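(* Write $\tau=\frac{1+i\sqrt7}{2}$. Every point $x\in\mathbf{H}^2_{\mathbb{C}}$ whose isotropy group in $\Gamma_7$ has $x$ as an isolated fixed point is in the $\Gamma_7$-orbit of exactly one of the following seven points $p$. Write $G$ for the isotropy group of $p$, $R_G$ for the subgroup of $G$ generated by complex reflections, and $(j_1,j_2)$ for the numbers of mirrors of complex reflections of $G$ that lie in the $\Gamma_7$-orbits of the mirrors polar to $(0,1,0)$, $(1,0,1)$ respectively. (1) $p=(1,0,-1)$: $G=R_G$ has order $4$, generated by the reflections with polar vectors $(0,1,0)$, $(1,0,1)$, with braid length $2$; $(j_1,j_2)=(1,1)$. (2) $p=(3+i\sqrt7,1,\bar\tau)$: $G=R_G$ has order $6$, generated by the reflections with polar vectors $(1,-\tau,0)$, $(1+i\sqrt7,0,1)$, with braid length $3$; $(j_1,j_2)=(0,3)$. (3) $p=(-1-\tau,-\bar\tau,\tau)$: $G=R_G$ has order $6$, generated by the reflections with polar vectors $(0,\tau,1)$, $(\tau,\bar\tau,0)$, with braid length $3$; $(j_1,j_2)=(0,3)$. (4) $p=(\bar\tau,0,-1)$: $G=R_G$ has order $8$, generated by the reflections with polar vectors $(0,1,0)$, $(\tau,1,1)$, with braid length $4$; $(j_1,j_2)=(2,2)$. (5) $p=(4,\bar\tau,-\tau)$: $G=R_G$ has order $8$, generated by the reflections with polar vectors $(1+i\sqrt7,0,1)$, $(\tau,\bar\tau,0)$, with braid length $4$; $(j_1,j_2)=(0,4)$. (6) $p$ is the fixed point in $\mathbf{H}^2_{\mathbb{C}}$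 of $M=\begin{pmatrix}-2&\tau-2&1+2i\sqrt7\\ \tau-1&\tau+1&3\\ \tau&1&3-\tau\end{pmatrix}$: $G$ is cyclic of order $6$, generated by $M$, and $R_G$ has order $2$, generated by the reflection with polar vector $(-\bar\tau,\tau,1)$; $(j_1,j_2)=(1,0)$. (7) $p$ is the fixed point in $\mathbf{H}^2_{\mathbb{C}}$ of $M=\begin{pmatrix}-2-\tau&\tau-3&3\tau-2\\-1&0&-\bar\tau\\-\bar\tau&\tau&2\end{pmatrix}$: $G$ is cyclic of order $7$, generated by $M$, and $R_G$ is trivial. In cases (6) and (7), $p$ has no representative with coordinates in $\mathbb{Q}(i\sqrt7)$.
   Context: On $\mathbb{C}^3$ let $\langle v,w\rangle=w^*Jv$ with $J=\begin{pmatrix}0&0&1\\0&1&0\\1&0&0\end{pmatrix}$, $U(J)=\{A\in GL_3(\mathbb{C}):A^*JA=J\}$, and let $\Gamma_d=PU(J,\mathcal{O}_d)$ be the image in $PU(J)$ of $U(J)\cap GL_3(\mathcal{O}_d)$, with $\mathcal{O}_d$ the ring of integers of $\mathbb{Q}(i\sqrt d)$ ($\mathcal{O}_7=\mathbb{Z}[\frac{1+i\sqrt7}{2}]$). It acts on $\mathbf{H}^2_{\mathbb{C}}=\{\mathbb{C}v:\langle v,v\rangle<0\}$; a vector $v$ stands for the point $\mathbb{C}v$, and matrices stand for their classes in $PU(J)$. For $\langle w,w\rangle>0$, the mirror polar to $w$ is $\{\mathbb{C}v\in\mathbf{H}^2_{\mathbb{C}}:\langle v,w\rangle=0\}$; a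 complex reflection is a nontrivial finite-order element fixing such a mirror pointwise. ''The reflection with polar vector $w$'' is the involution $v\mapsto v-2\frac{\langle v,w\rangle}{\langle w,w\rangle}w$. The braid length of a pair $A,B$ is the smallest $n\ge2$ such that the alternating products $ABA\cdots$ and $BAB\cdots$ with $n$ factors are equal. *)

(* Defs.v *)
From HB Require Import structures.
From mathcomp Require Import all_boot all_order all_algebra.
From mathcomp Require Import generic_quotient complex.
From mathcomp Require Import mathcomp_extra boolp classical_sets functions.
From mathcomp Require Import cardinality reals topology normedtype.
From mathcomp Require Import archimedean algC algnum ring.

Set Implicit Arguments.
Unset Strict Implicit.
Unset Printing Implicit Defensive.

Import Order.TTheory GRing.Theory Num.Theory.
Import numFieldNormedType.Exports.

Local Open Scope classical_set_scope.
Local Open Scope ring_scope.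
Local Open Scope complex_scope.
Local Open Scope sesquilinear_scope.
Local Open Scope quotient_scope.

(* The library's norm topology on an abstract numFieldType, made available on
   the concrete type R[i] so that 'cV[R[i]]_3 is a topological space. *)
HB.instance Definition _ (R : realType) := PseudoPointedMetric.copy R[i] (R[i])^o.

Definition vec3 (R : realType) (a b c : R[i]) : 'cV[R[i]]_3 :=
  \col_(i < 3) [:: a; b; c]`_i.

Definition mat3 (R : realType) (rows : seq (seq R[i])) : 'M[R[i]]_3 :=
  \matrix_(i < 3, j < 3) (nth [::] rows i)`_j.

Definition Jmx (R : realType) : 'M[R[i]]_3 :=
  mat3 [:: [:: 0; 0; 1]; [:: 0; 1; 0]; [:: 1; 0; 0]].

Definition herm (R : realType) (v w : 'cV[R[i]]_3) : R[i] :=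
  (w^t* *m Jmx R *m v) 0 0.

Definition isUJ (R : realType) : pred 'M[R[i]]_3 :=
  fun A => (A \in unitmx) && (A^t* *m Jmx R *m A == Jmx R).

Record UJ (R : realType) := MkUJ { UJval :> 'M[R[i]]_3; _ : isUJ UJval }.

HB.instance Definition _ (R : realType) := [isSub for @UJval R].
HB.instance Definition _ (R : realType) := [Choice of UJ R by <:].

Section UJGroup.
Variable R : realType.
Implicit Types A B C : UJ R.

Lemma UJ_unit A : val A \in unitmx.
Proof. by case: A => A /= /andP[]. Qed.

Lemma UJ_form A : (val A)^t* *m Jmx R *m val A = Jmx R.
Proof. by case: A => A /= /andP[_ /eqP]. Qed.

Lemma isUJ1 : isUJ (1%:M : 'M[R[i]]_3).
Proof. by rewrite /isUJ unitmx1 /= trmx1 map_mx1 mul1mx mulmx1. Qed.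

Lemma isUJM A B : isUJ (val A *m val B).
Proof.
rewrite /isUJ unitmx_mul !UJ_unit /= trmx_mul map_mxM.
by rewrite !mulmxA -(mulmxA _ _ (Jmx R)) -(mulmxA _ (_ *m Jmx R)) UJ_form UJ_form.
Qed.

Lemma isUJV A : isUJ (invmx (val A)).
Proof.
rewrite /isUJ unitmx_inv UJ_unit /=; apply/eqP.
rewrite -[in LHS](UJ_form A) trmx_inv map_invmx -!mulmxA mulmxV ?UJ_unit // mulmx1.
by rewrite mulKmx // map_unitmx unitmx_tr UJ_unit.
Qed.

Definition UJ1 : UJ R := MkUJ isUJ1.
Definition UJM A B : UJ R := MkUJ (isUJM A B).
Definition UJV A : UJ R := MkUJ (isUJV A).

Fact UJMA : associative UJM.
Proof. by move=> A B C; apply/val_inj; rewrite /= mulmxA. Qed.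
Fact UJ1M : left_id UJ1 UJM.
Proof. by move=> A; apply/val_inj; rewrite /= mul1mx. Qed.
Fact UJM1 : right_id UJ1 UJM.
Proof. by move=> A; apply/val_inj; rewrite /= mulmx1. Qed.
Fact UJVM : left_inverse UJ1 UJV UJM.
Proof. by move=> A; apply/val_inj; rewrite /= mulVmx ?UJ_unit. Qed.
Fact UJMV : right_inverse UJ1 UJV UJM.
Proof. by move=> A; apply/val_inj; rewrite /= mulmxV ?UJ_unit. Qed.

HB.instance Definition _ := isGroup.Build (UJ R) UJMA UJ1M UJM1 UJVM UJMV.

(* A scalar c relating two elements of U(J) has modulus 1, since J <> 0. *)
Definition scalar_equiv : rel (UJ R) :=
  fun A B => `[< exists2 c : R[i], c != 0 & val A = c *: val B >].

Fact scalar_equiv_refl : reflexive scalar_equiv.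
Proof. by move=> A; apply/asboolP; exists 1; rewrite ?oner_eq0 ?scale1r. Qed.
Fact scalar_equiv_sym : symmetric scalar_equiv.
Proof.
suff h A B : scalar_equiv A B -> scalar_equiv B A.
  by move=> A B; apply/idP/idP; apply: h.
move=> /asboolP[c c0 AB]; apply/asboolP; exists c^-1; rewrite ?invr_eq0 //.
by rewrite AB scalerA mulVf // scale1r.
Qed.
Fact scalar_equiv_trans : transitive scalar_equiv.
Proof.
move=> B A C /asboolP[c c0 AB] /asboolP[d d0 BC]; apply/asboolP.
by exists (c * d); rewrite ?mulf_neq0 // AB BC scalerA.
Qed.

Definition scalar_equiv_rel :=
  EquivRel scalar_equiv scalar_equiv_refl scalar_equiv_sym scalar_equiv_trans.

End UJGroup.

Definition PU (R : realType) : Type := {eq_quot (scalar_equiv_rel R)}.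
HB.instance Definition _ (R : realType) :=
  EqQuotient.copy (PU R) {eq_quot (scalar_equiv_rel R)}.
HB.instance Definition _ (R : realType) :=
  Choice.copy (PU R) {eq_quot (scalar_equiv_rel R)}.

Section PUGroup.
Variable R : realType.
Implicit Types (A B C : UJ R) (g h : PU R).

Lemma pi_PU_eq A B :
  \pi_(PU R) A = \pi_(PU R) B <-> exists2 c : R[i], c != 0 & val A = c *: val B.
Proof. by split=> [/eqmodP/asboolP//|AB]; apply/eqmodP/asboolP. Qed.

Lemma repr_PU A : exists2 c : R[i], c != 0 & val (repr (\pi_(PU R) A)) = c *: val A.
Proof. by apply/pi_PU_eq; rewrite reprK. Qed.

Definition PU1 : PU R := \pi_(PU R) 1%g.
Definition PUM g h : PU R := \pi_(PU R) (repr g * repr h)%g.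
Definition PUV g : PU R := \pi_(PU R) (repr g)^-1%g.

Lemma PUM_pi A B : PUM (\pi A) (\pi B) = \pi_(PU R) (A * B)%g.
Proof.
have [c c0 Ac] := repr_PU A; have [d d0 Bd] := repr_PU B.
apply/pi_PU_eq; exists (c * d); rewrite ?mulf_neq0 //=.
by rewrite Ac Bd -scalemxAl -scalemxAr scalerA.
Qed.

Lemma PUV_pi A : PUV (\pi A) = \pi_(PU R) A^-1%g.
Proof.
have [c c0 Ac] := repr_PU A.
apply/pi_PU_eq; exists c^-1; rewrite ?invr_eq0 //= Ac.
by rewrite invmxZ // -Ac UJ_unit.
Qed.

Fact PUMA : associative PUM.
Proof.
by move=> g h k; rewrite -[g]reprK -[h]reprK -[k]reprK !PUM_pi mulgA.
Qed.
Fact PU1M : left_id PU1 PUM.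
Proof. by move=> g; rewrite -[g]reprK PUM_pi mul1g. Qed.
Fact PUM1 : right_id PU1 PUM.
Proof. by move=> g; rewrite -[g]reprK PUM_pi mulg1. Qed.
Fact PUVM : left_inverse PU1 PUV PUM.
Proof. by move=> g; rewrite -[g]reprK PUV_pi PUM_pi mulVg. Qed.
Fact PUMV : right_inverse PU1 PUV PUM.
Proof. by move=> g; rewrite -[g]reprK PUV_pi PUM_pi mulgV. Qed.

HB.instance Definition _ := isGroup.Build (PU R) PUMA PU1M PUM1 PUVM PUMV.

Lemma pi_PU1 : \pi_(PU R) 1%g = 1%g. Proof. by []. Qed.
Lemma pi_PUM A B : \pi_(PU R) (A * B)%g = (\pi_(PU R) A * \pi_(PU R) B)%g.
Proof. by rewrite -PUM_pi. Qed.
Lemma pi_PUV A : \pi_(PU R) A^-1%g = (\pi_(PU R) A)^-1%g.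
Proof. by rewrite -PUV_pi. Qed.

End PUGroup.

Record negvec (R : realType) :=
  MkNegvec { negvecval :> 'cV[R[i]]_3; _ : herm negvecval negvecval < 0 }.

HB.instance Definition _ (R : realType) := [isSub for @negvecval R].
HB.instance Definition _ (R : realType) := [Choice of negvec R by <:].
HB.instance Definition _ (R : realType) := Topological.copy (negvec R)
  (initial_topology (val : negvec R -> 'cV[R[i]]_3)).

Section H2Quotient.
Variable R : realType.
Implicit Types v w : negvec R.

Definition same_line : rel (negvec R) :=
  fun v w => `[< exists2 c : R[i], c != 0 & val v = c *: val w >].

Fact same_line_refl : reflexive same_line.
Proof. by move=> v; apply/asboolP; exists 1; rewrite ?oner_eq0 ?scale1r. Qed.
Fact same_line_sym : symmetric same_line.
Proof.
suff h v w : same_line v w -> same_line w v.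
  by move=> v w; apply/idP/idP; apply: h.
move=> /asboolP[c c0 vw]; apply/asboolP; exists c^-1; rewrite ?invr_eq0 //.
by rewrite vw scalerA mulVf // scale1r.
Qed.
Fact same_line_trans : transitive same_line.
Proof.
move=> w v u /asboolP[c c0 vw] /asboolP[d d0 wu]; apply/asboolP.
by exists (c * d); rewrite ?mulf_neq0 // vw wu scalerA.
Qed.

Definition same_line_rel :=
  EquivRel same_line same_line_refl same_line_sym same_line_trans.

End H2Quotient.

Definition H2 (R : realType) : Type :=
  quotient_topology {eq_quot (same_line_rel R)}.
HB.instance Definition _ (R : realType) :=
  Quotient.copy (H2 R) {eq_quot (same_line_rel R)}.
HB.instance Definition _ (R : realType) :=
  Choice.copy (H2 R) {eq_quot (same_line_rel R)}.
HB.instance Definition _ (R : realType) := Topological.copy (H2 R)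
  (quotient_topology {eq_quot (same_line_rel R)}).

Section Geometry.
Variable R : realType.
Implicit Types (A B : UJ R) (g h : PU R) (v w : 'cV[R[i]]_3) (x y : H2 R).
Implicit Types (G H S : set (PU R)) (m : set (H2 R)).

Lemma pi_H2_eq (u v : negvec R) : \pi_(H2 R) u = \pi_(H2 R) v <->
  exists2 c : R[i], c != 0 & val u = c *: val v.
Proof.
by split=> [/(@eqmodP _ (same_line_rel R))/asboolP//|uv];
  apply/(@eqmodP _ (same_line_rel R))/asboolP.
Qed.

Lemma open_H2E (U : set (H2 R)) : open U <->
  exists2 V : set 'cV[R[i]]_3, open V & val @^-1` V = \pi_(H2 R) @^-1` U.
Proof. by []. Qed.

(* x = Cv; in particular <v,v> < 0. *)
Definition is_line_of x v : Prop := exists2 u : negvec R, val u = v & x = \pi_(H2 R) u.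

Lemma herm_UJ A v w : herm (val A *m v) (val A *m w) = herm v w.
Proof.
rewrite /herm trmx_mul map_mxM -[in RHS](UJ_form A).
by rewrite !mulmxA.
Qed.

Fact UJact_neg A (v : negvec R) : herm (val A *m val v) (val A *m val v) < 0.
Proof. by rewrite herm_UJ; case: v. Qed.

Definition UJact A (v : negvec R) : negvec R := MkNegvec (UJact_neg A v).

Definition act g x : H2 R := \pi_(H2 R) (UJact (repr g) (repr x)).

Lemma act_pi A (v : negvec R) :
  act (\pi_(PU R) A) (\pi_(H2 R) v) = \pi_(H2 R) (UJact A v).
Proof.
have [c c0 Ac] := repr_PU A.
have [d d0 vd] : exists2 d : R[i], d != 0 & val (repr (\pi_(H2 R) v)) = d *: val v.
  by apply/pi_H2_eq; rewrite reprK.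
apply/pi_H2_eq; exists (c * d); rewrite ?mulf_neq0 //=.
by rewrite Ac vd -scalemxAl -scalemxAr scalerA.
Qed.

Lemma act1 x : act 1%g x = x.
Proof.
rewrite -[x]reprK -pi_PU1 act_pi; apply/pi_H2_eq; exists 1; rewrite ?oner_eq0 //=.
by rewrite mul1mx scale1r.
Qed.

Lemma actM g h x : act (g * h)%g x = act g (act h x).
Proof.
rewrite -[x]reprK -[g]reprK -[h]reprK -pi_PUM (act_pi (_ * _)%g).
rewrite (act_pi (repr h)) (act_pi (repr g)); apply/pi_H2_eq; exists 1; rewrite ?oner_eq0 //=.
by rewrite scale1r mulmxA.
Qed.

Definition mirror w : set (H2 R) :=
  [set \pi_(H2 R) v | v in [set v : negvec R | herm (val v) w = 0]].

Definition is_mirror m : Prop :=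
  exists w, 0 < herm w w /\ m = mirror w.

Definition reflects_in g m : Prop :=
  [/\ g <> 1%g, exists2 n : nat, (0 < n)%N & (g ^+ n = 1)%g
    & forall x, m x -> act g x = x].

Definition creflection g : Prop := exists2 m, is_mirror m & reflects_in g m.

(* If <w,w> = 0 this is the identity matrix, because 2 / 0 = 0; so refl w is
   defined for every w, and it is the reflection when <w,w> <> 0 (refl_mxE). *)
Definition refl_mx w : 'M[R[i]]_3 :=
  1%:M - (2 / herm w w) *: (w *m (w^t* *m Jmx R)).

Lemma refl_mxE w v : refl_mx w *m v = v - (2 * herm v w / herm w w) *: w.
Proof.
rewrite mulmxBl mul1mx -scalemxAl -mulmxA (mx11_scalar (_ *m v)) mul_mx_scalar.
by rewrite scalerA mulrAC.
Qed.

Lemma Jmx_herm : (Jmx R)^t* = Jmx R.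
Proof.
apply/matrixP => i j; rewrite !mxE.
by case: i j => [[|[|[|i]]] Hi] [[|[|[|j]]] Hj] //=; rewrite ?rmorph0 ?rmorph1.
Qed.

Lemma herm_sym v w : herm w v = (herm v w)^*%R.
Proof.
have -> : (herm v w)^*%R = ((w^t* *m Jmx R *m v)^t*) 0 0.
  by rewrite [RHS]mxE [in RHS]mxE.
by rewrite !trmx_mul !map_mxM trmxCK Jmx_herm mulmxA.
Qed.

Lemma refl_mxK w : refl_mx w *m refl_mx w = 1%:M.
Proof.
set P := w *m (w^t* *m Jmx R); set k := 2 / herm w w.
have PP : P *m P = herm w w *: P.
  rewrite /P -mulmxA (mulmxA _ w) (mx11_scalar (_ *m w)) -/(herm w w).
  by rewrite mul_scalar_mx -scalemxAr.
have hk : k * k * herm w w = k + k.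
  rewrite /k; have [->|n0] := eqVneq (herm w w) 0; first by rewrite invr0 !mulr0 addr0.
  by rewrite -mulrA divfK // mulr_natr mulr2n.
have QQ : (k *: P) *m (k *: P) = k *: P + k *: P.
  by rewrite -scalemxAl -scalemxAr PP !scalerA hk scalerDl.
rewrite /refl_mx -/P -/k mulmxBl mul1mx mulmxBr mulmx1 QQ.
by rewrite (_ : k *: P - _ = - (k *: P)) ?opprK ?subrK // opprD addrA subrr add0r.
Qed.

Lemma refl_isUJ w : isUJ (refl_mx w).
Proof.
have /mulmx1_unit[u _] := refl_mxK w; rewrite /isUJ u /=.
suff -> : (refl_mx w)^t* *m Jmx R = Jmx R *m refl_mx w.
  by rewrite -mulmxA refl_mxK mulmx1.
rewrite /refl_mx mulmxBr mulmx1 linearB /= map_mxB trmx1 map_mx1 mulmxBl mul1mx.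
congr (_ - _); rewrite linearZ /= map_mxZ -scalemxAl -scalemxAr; congr (_ *: _).
  by rewrite rmorphM fmorphV /= (esym (herm_sym w w)) rmorph_nat.
by rewrite !trmx_mul !map_mxM trmxCK Jmx_herm !mulmxA.
Qed.

Definition refl w : PU R := \pi_(PU R) (MkUJ (refl_isUJ w)).

Definition is_subgroup H : Prop :=
  H 1%g /\ forall g h, H g -> H h -> H (g * h^-1)%g.

Definition generated S : set (PU R) := smallest is_subgroup S.

Fixpoint alternating (n : nat) g h : PU R :=
  if n is n'.+1 then (g * alternating n' h g)%g else 1%g.

Definition braid_length g h (n : nat) : Prop :=
  [/\ (2 <= n)%N, alternating n g h = alternating n h g
    & forall k, (2 <= k < n)%N -> alternating k g h <> alternating k h g].

Definition fixed_points G : set (H2 R) := [set x | forall g, G g -> act g x = x].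

Definition reflection_subgroup G : set (PU R) :=
  generated [set g | G g /\ creflection g].

Definition mirrors_of G : set (set (H2 R)) :=
  [set m | is_mirror m /\ exists2 g, G g & reflects_in g m].

Definition isqrt (d : nat) : R[i] := 0 +i* Num.sqrt (d%:R : R).

Definition Qisqrt (d : nat) : set R[i] :=
  [set z | exists a b : rat, z = ratr a + ratr b * isqrt d].

(* The ring of integers of Q(i sqrt d); ringO7P below gives Z[tau] for d = 7. *)
Definition ringO (d : nat) : set R[i] :=
  [set z | Qisqrt d z /\ integralOver (intr : int -> R[i]) z].

Definition GL3O (d : nat) : set 'M[R[i]]_3 :=
  [set A | [/\ A \in unitmx, forall i j, ringO d (A i j)
             & forall i j, ringO d (invmx A i j)]].

Definition Gamma (d : nat) : set (PU R) :=
  [set \pi_(PU R) A | A in [set A : UJ R | GL3O d (val A)]].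

Definition Gorbit (d : nat) x : set (H2 R) :=
  [set y | exists2 g, Gamma d g & y = act g x].

Definition mirror_orbit (d : nat) m : set (set (H2 R)) :=
  [set m' | exists2 g, Gamma d g & m' = act g @` m].

Definition isotropy (d : nat) x : set (PU R) :=
  [set g | Gamma d g /\ act g x = x].

(* j1 and j2 count mirrors, as sets of points, not reflections. *)
Definition mirror_numbers G (j1 j2 : nat) : Prop :=
  (mirrors_of G `&` mirror_orbit 7 (mirror (vec3 0 1 0)) #= `I_j1)%card /\
  (mirrors_of G `&` mirror_orbit 7 (mirror (vec3 1 0 1)) #= `I_j2)%card.

Definition two_reflection_isotropy
    (p : H2 R) (w1 w2 : 'cV[R[i]]_3) (order braid j1 j2 : nat) : Prop :=
  let G := isotropy 7 p in
  [/\ G = reflection_subgroup G, (G #= `I_order)%card,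
      G = generated [set refl w1; refl w2],
      braid_length (refl w1) (refl w2) braid & mirror_numbers G j1 j2].

End Geometry.

Lemma rat_integral (R : realType) (q : rat) :
  integralOver (intr : int -> R[i]) (ratr q) -> exists n : int, q = n%:~R.
Proof.
case=> p mp; rewrite /root.
have -> : map_poly (intr : int -> R[i]) p = map_poly (ratr : rat -> R[i]) (map_poly intr p).
  by rewrite -map_poly_comp; apply: eq_map_poly => x; rewrite /= ratr_int.
rewrite -/(root _ _) fmorph_root => rq.
have ai : (ratr q : algC) \in Aint.
  apply: (@algnum.root_monic_Aint (map_poly ratr (map_poly intr p))).
  - by rewrite fmorph_root.
  - by rewrite map_monic; apply: monic_map.
  - apply/polyOverP => i; rewrite !coef_map /= ratr_int; exact: intr_int.
have qr : (ratr q : algC) \in Crat by apply/CratP; exists q.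
have /intrP[n qn] := algnum.Cint_rat_Aint qr ai.
by exists n; apply: (fmorph_inj (ratr : rat -> algC)); rewrite /= qn ratr_int.
Qed.


Definition tau (R : realType) : R[i] := (1 + isqrt R 7) / 2.

Lemma sqr_isqrt7 (R : realType) : isqrt R 7 ^+ 2 = - 7%:R.
Proof.
rewrite expr2 /isqrt; simpc; rewrite -expr2 sqr_sqrtr ?ler0n //.
by congr Complex; ring.
Qed.

Lemma conj_isqrt7 (R : realType) : (isqrt R 7)^*%R = - isqrt R 7.
Proof. by rewrite /isqrt; apply/eqP; rewrite eq_complex /= oppr0 !eqxx. Qed.

Lemma conj_integral (R : realType) (z : R[i]) :
  integralOver (intr : int -> R[i]) z -> integralOver (intr : int -> R[i]) z^*%R.
Proof.
case=> p mp rp; exists p => //; rewrite -(fmorph_root Num.conj) in rp.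
move: rp; rewrite -map_poly_comp; congr (root _ _).
by apply: eq_map_poly => n /=; rewrite rmorph_int.
Qed.

Lemma tau_sqr (R : realType) : tau R ^+ 2 = tau R - 2.
Proof.
rewrite /tau expr_div_n sqrrD sqr_isqrt7; by field; rewrite ?pnatr_eq0.
Qed.

Lemma tau_integral (R : realType) : integralOver (intr : int -> R[i]) (tau R).
Proof.
exists ('X^2 - 'X + 2%:P).
  rewrite monicE -addrA lead_coefDl ?lead_coefXn // size_polyXn.
  rewrite (leq_ltn_trans (size_polyD _ _)) // gtn_max size_polyN size_polyX.
  by rewrite size_polyC.
rewrite /root rmorphD rmorphB /= map_polyXn map_polyX map_polyC /= !hornerE /=.
rewrite tau_sqr; apply/eqP; ring.
Qed.

Lemma ringO7P (R : realType) (z : R[i]) :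
  ringO 7 z <-> exists a b : int, z = a%:~R + b%:~R * tau R.
Proof.
split=> [[[a [b zE]] zi]|[a [b ->]]]; last first.
  split.
    exists (a%:~R + b%:~R / 2), (b%:~R / 2).
    rewrite rmorphD !rmorphM /= fmorphV !ratr_int rmorph_nat /tau; by field; rewrite ?pnatr_eq0.
  by apply: integral_add; [apply: integral_id|apply: integral_mul; [apply: integral_id|apply: tau_integral]].
have zci := conj_integral zi.
have zcE : z^*%R = ratr a - ratr b * isqrt R 7.
   rewrite zE rmorphD (rmorphM _ (ratr b)) !fmorph_rat -mulrN.
  by congr (_ + _ * _); exact: conj_isqrt7.
have [m mE] : exists m : int, 2 * a = m%:~R.
  apply: (@rat_integral R); rewrite rmorphM rmorph_nat /=.
  have -> : 2 * ratr a = z + z^*%R by rewrite zcE zE; ring.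
  exact: integral_add.
have [N NE] : exists N : int, a ^+ 2 + 7 * b ^+ 2 = N%:~R.
  apply: (@rat_integral R); rewrite rmorphD rmorphM rmorph_nat !rmorphXn /=.
  have -> : ratr a ^+ 2 + 7%:R * ratr b ^+ 2 = z * z^*%R.
    transitivity (ratr a ^+ 2 - ratr b ^+ 2 * isqrt R 7 ^+ 2).
      by rewrite sqr_isqrt7; ring.
    by rewrite zcE zE; ring.
  exact: integral_mul.
have [s sE] : exists s : int, 14 * b = s%:~R.
  apply: (@rat_integral R); exists ('X^2 - (7 * (4 * N - m ^+ 2))%:P).
    by rewrite monicE lead_coefDl ?lead_coefXn // size_polyXn size_polyN size_polyC; case: eqP.
  rewrite /root rmorphB /= map_polyXn map_polyC /= !hornerE /=.
  rewrite -ratr_int -rmorphXn -rmorphB /= fmorph_eq0 subr_eq0.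
  rewrite intrM intrB intrM rmorphXn /= -mE -NE; apply/eqP; ring.
have s2 : s ^+ 2 = 7 * (4 * N - m ^+ 2).
  apply: (@intr_inj rat); rewrite rmorphXn intrM intrB intrM rmorphXn /= -mE -NE -sE; ring.
have [n nE] : exists n, s = n * 7.
  apply/dvdzP.
  have : (7 %| s ^+ 2)%Z by rewrite s2 dvdz_mulr.
  by rewrite expr2 !dvdzE abszM /= Euclid_dvdM // orbb.
have bn : 2 * b = n%:~R.
  apply: (@mulfI _ (7 : rat)) => //; rewrite mulrA -[7 * 2]/(14 : rat) sE nE intrM; ring.
have n2 : 7 * n ^+ 2 = 4 * N - m ^+ 2.
  by apply: (@mulfI _ (7 : int)) => //; rewrite -s2 nE; ring.
have [k kE] : exists k, m - n = k * 2.
  apply/dvdzP.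
  have : (2 %| (m - n) ^+ 2)%Z.
    have -> : (m - n) ^+ 2 = (2 * N - 3 * n ^+ 2 - m * n) * 2 by (have : m^+2 = 4 * N - 7 * n^+2 by rewrite n2; ring); move=> e; rewrite sqrrB e; ring.
    exact: dvdz_mull.
  by rewrite expr2 !dvdzE abszM /= Euclid_dvdM // orbb.
exists k, n; rewrite zE /tau.
have -> : a = k%:~R + n%:~R / 2.
  have : (2 * a = 2 * k%:~R + n%:~R) by rewrite mE -(subrK n m) kE intrD intrM; ring.
  by move=> e; apply: (@mulfI _ (2 : rat)) => //; rewrite e; by field; rewrite ?pnatr_eq0.
have -> : b = n%:~R / 2 by rewrite -bn; by field; rewrite ?pnatr_eq0.
rewrite rmorphD !rmorphM /= fmorphV !ratr_int rmorph_nat; by field; rewrite ?pnatr_eq0.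
Qed.

(* Main.v *)
(** By Cayley-Hamilton and the sign of the discriminant of the characteristic
    polynomial, the trace of an elliptic matrix of SU(J) with entries in Z[tau] is
    one of 3, -1, 0, 1, 2, -tau, -conj tau.  When x is isolated among the fixed
    points of its isotropy group, some element A of this group has a simple
    eigenvalue at x.  For each trace this yields an integral vector of small norm:
    orthogonal to x, or a primitive vector on the line x of norm -1, -2 or -3, or a
    short vector for the positive form -<(A + A^-1) v, v> when A has order 7.
    Reduction theory over the norm-Euclidean ring Z[tau] completes it to a basis of
    the lattice whose Gram matrix belongs to a short list, and two bases with the
    same Gram matrix differ by an element of Gamma_7; hence the seven orbits.

    An isometry fixing one of the five rational points is determined by the images
    of a reduced basis of the orthogonal lattice, which leaves finitely many
    candidates, enumerated by computation.  The coordinates of the two other points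
    are irrational, so the integral vectors orthogonal to x span a lattice of rank
    1 or 0; an element of the isotropy group is then recovered from its eigenvalue
    at x, a root of unity of order dividing 6 or 7, and is a power of M. *)

From HB Require Import structures.
From mathcomp Require Import all_boot all_order all_algebra.
From mathcomp Require Import generic_quotient complex.
From mathcomp Require Import mathcomp_extra boolp classical_sets functions.
From mathcomp Require Import cardinality reals topology normedtype.
From mathcomp Require Import archimedean perm ring lra zify ssrZ.
Require Import Defs.

Set Implicit Arguments.
Unset Strict Implicit.
Unset Printing Implicit Defensive.

Import Order.TTheory GRing.Theory Num.Theory.
Import numFieldNormedType.Exports.

Local Open Scope classical_set_scope.
Local Open Scope ring_scope.
Local Open Scope sesquilinear_scope.
Local Open Scope quotient_scope.

(** * The ring Z[tau] *)

Section Arith.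
Variable R : realType.
Local Notation C := R[i].
Implicit Types (z w k : C).

(** The units of Z[tau] are 1 and -1 and the dimension is odd, so every class in Gamma_7 has exactly
    one integral representative of determinant 1, and its trace is an invariant in Z[tau]. Since J
    is unimodular, a primitive x with <x,x> = -N has an orthogonal lattice of determinant N; the
    squared covering radius 4/7 of Z[tau] provides in it a vector of norm m with 3 m^2 <= 7 N. The
    obstacle is an element A whose eigenvalue at x is irrational: the line x then carries no
    integral vector, and the Hermitian form is indefinite on the lattices at hand. The form is
    therefore twisted by A: into <(A - A^-1) u, w> / sqrt(-7) on the orthogonal of the fixed vector
    of A in orders 3 and 4, and with A + A^-1 in order 7. The twisted forms are integral and
    definite, their determinants come from the eigenvalues, and the same reduction theory applies. A
    short vector and its images under A (with the fixed vector in order 3) form a basis whose Gram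
    matrix determines A up to conjugacy. An eigenvalue i or -i at x is excluded by parity. *)

Definition isO : {pred C} := fun z => `[< exists a b : int, z = a%:~R + b%:~R * tau R >].

Lemma isOP z : reflect (exists a b : int, z = a%:~R + b%:~R * tau R) (z \in isO).
Proof. exact: asboolP. Qed.

Lemma isO_subring : subring_closed isO.
Proof.
split=> [|x y /isOP[a [b ->]] /isOP[c [d ->]]|x y /isOP[a [b ->]] /isOP[c [d ->]]]; apply/isOP.
- by exists 1, 0; rewrite mul0r addr0.
- by exists (a - c), (b - d); rewrite !intrB; ring.
- exists (a * c - 2 * b * d), (a * d + b * c + b * d).
  rewrite !(intrB, intrD, intrM).
  transitivity ((a%:~R * c%:~R + b%:~R * d%:~R * tau R ^+ 2) + (a%:~R * d%:~R + b%:~R * c%:~R) * tau R : C); first by ring.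
  by rewrite tau_sqr; ring.
Qed.
HB.instance Definition _ := GRing.isSubringClosed.Build C isO isO_subring.

Lemma isO_tau : tau R \in isO.
Proof. by apply/isOP; exists 0, 1; rewrite mul1r add0r. Qed.

Lemma conj_tau : (tau R)^*%R = 1 - tau R.
Proof.
rewrite /tau rmorphM rmorphD /= fmorphV rmorph_nat rmorph1.
have -> : (isqrt R 7)^* = - isqrt R 7 :> C by exact: conj_isqrt7.
by field; rewrite ?pnatr_eq0.
Qed.

Lemma isO_conj z : z \in isO -> z^*%R \in isO.
Proof.
move=> /isOP[a [b ->]]; rewrite rmorphD rmorphM /= !rmorph_int.
rewrite (_ : (tau R)^* = 1 - tau R); last exact: conj_tau.
by rewrite rpredD ?rpredM ?rpredB ?rpred_int ?rpred1 ?isO_tau.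
Qed.

Lemma ringO_isO z : ringO 7 z <-> z \in isO.
Proof. by rewrite ringO7P; split=> [h|/isOP//]; apply/isOP. Qed.

(** The squared modulus takes its values in [R] rather than in [R[i]], so that [lra] and [nra] apply
    to it. *)
Definition nsq (z : C) : R := complex.Re z ^+ 2 + complex.Im z ^+ 2.

Lemma nsqE z : (nsq z)%:C%C = z * z^*%R.
Proof. by case: z => a b; apply/eqP; rewrite eq_complex /nsq /=; apply/andP; split; apply/eqP; ring. Qed.

Lemma nsq_ge0 z : 0 <= nsq z.
Proof. by rewrite addr_ge0 // sqr_ge0. Qed.

Lemma nsqM z w : nsq (z * w) = nsq z * nsq w.
Proof. by case: z w => [a b] [c d]; rewrite /nsq /=; ring. Qed.

Lemma nsq_eq0 z : (nsq z == 0) = (z == 0).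
Proof. by case: z => a b; rewrite eq_complex /nsq /= paddr_eq0 ?sqr_ge0 // !sqrf_eq0. Qed.

Lemma nsqN z : nsq (- z) = nsq z.
Proof. by case: z => a b; rewrite /nsq /=; ring. Qed.

Lemma nsqC z : nsq z^*%R = nsq z.
Proof. by case: z => a b; rewrite /nsq /=; ring. Qed.

Lemma nsq1 : nsq 1 = 1.
Proof. by rewrite /nsq /=; ring. Qed.

Lemma nsq0 : nsq 0 = 0.
Proof. by rewrite /nsq /=; ring. Qed.

Lemma tauE : tau R = (1 / 2 +i* (Num.sqrt 7 / 2))%C.
Proof.
rewrite /tau /isqrt; have -> : 2 = (2 : R)%:C%C :> C by rewrite rmorph_nat.
rewrite -fmorphV /=; apply/eqP; rewrite eq_complex /=; apply/andP; split; apply/eqP; ring.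
Qed.

Lemma sqr_sqrt7 : Num.sqrt (7 : R) ^+ 2 = 7.
Proof. by rewrite sqr_sqrtr ?ler0n. Qed.

Lemma Ocoord (a b : int) : a%:~R + b%:~R * tau R =
  ((a%:~R + b%:~R / 2) +i* (b%:~R * Num.sqrt 7 / 2))%C :> C.
Proof.
have iE (n : int) : n%:~R = (n%:~R : R)%:C%C by rewrite rmorph_int.
by rewrite tauE !(iE a, iE b); apply/eqP; rewrite eq_complex /=; apply/andP; split; apply/eqP; ring.
Qed.

Lemma nsqO (a b : int) : nsq (a%:~R + b%:~R * tau R) = (a ^+ 2 + a * b + 2 * b ^+ 2)%:~R.
Proof.
rewrite Ocoord /nsq /= !(intrD, intrM, rmorphXn) /=.
transitivity (a%:~R ^+ 2 + a%:~R * b%:~R + b%:~R ^+ 2 / 4 + b%:~R ^+ 2 * Num.sqrt 7 ^+ 2 / 4 : R); first by field; rewrite ?pnatr_eq0.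
by rewrite sqr_sqrt7; field; rewrite ?pnatr_eq0.
Qed.

Lemma O_inj (a b c d : int) : a%:~R + b%:~R * tau R = c%:~R + d%:~R * tau R -> a = c /\ b = d.
Proof.
rewrite !Ocoord => -[e1 e2].
have s7 : Num.sqrt (7 : R) != 0 by rewrite sqrtr_eq0 -ltNge ltr0n.
have e : (b%:~R : R) = d%:~R.
  apply: (mulIf s7); apply: (@mulIf _ (2^-1)); first by rewrite invr_eq0 pnatr_eq0.
  exact: e2.
split; last exact: (intr_inj e).
by move: e1; rewrite e => /addIr/intr_inj.
Qed.

Lemma nsqO_nat z : z \in isO -> exists n : nat, nsq z = n%:R.
Proof.
move=> /isOP[a [b ->]]; rewrite nsqO; set N := (X in X%:~R).
by exists (absz N); rewrite -[RHS]/(((absz N : int))%:~R) gez0_abs // /N; nia.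
Qed.

Lemma nsqO_ge1 z : z \in isO -> z != 0 -> 1 <= nsq z.
Proof.
move=> zO z0; have [n nE] := nsqO_nat zO; rewrite nE ler1n lt0n.
by apply/eqP => n0; move: z0; rewrite -nsq_eq0 nE n0 eqxx.
Qed.

(* A point of the plane is at squared distance at most 4/7 from Z[tau]: the
   hexagonal Voronoi cell has circumradius 2/sqrt 7. *)
Lemma nearestO z : exists2 k, k \in isO & nsq (z - k) <= 4 / 7.
Proof.
have s7 : 0 < Num.sqrt (7 : R) by rewrite sqrtr_gt0 ltr0n.
have rnd (x : R) : exists n : int, `|x - n%:~R| <= 1 / 2.
  exists (Num.floor (x + 1 / 2)); have := real_floor_itv (num_real (x + 1/2)).
  rewrite intrD => /andP[h1 h2]; rewrite ler_norml; apply/andP; split; lra.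
case: z => x0 y0.
have [b hb] := rnd (y0 / (Num.sqrt 7 / 2)).
have [a ha] := rnd (x0 - b%:~R / 2).
pose x := x0 - b%:~R / 2 - a%:~R; pose e := (y0 / (Num.sqrt 7 / 2) - b%:~R) / 2.
have he : `|e| <= 1 / 4.
  rewrite /e normrM [`|2^-1|]ger0_norm ?invr_ge0 ?ler0n //; lra.
have key (c d : int) : nsq ((x0 +i* y0)%C - (a%:~R + b%:~R * tau R + (c%:~R + d%:~R * tau R))) =
   (x - c%:~R - d%:~R / 2) ^+ 2 + 7 * (e - d%:~R / 2) ^+ 2.
  rewrite !Ocoord /nsq /= /x.
  have -> : y0 - (b%:~R * Num.sqrt 7 / 2 + d%:~R * Num.sqrt 7 / 2) = Num.sqrt 7 * (e - d%:~R / 2).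
    by rewrite /e; field; rewrite ?pnatr_eq0 ?gt_eqF.
  rewrite exprMn sqr_sqrt7; congr (_ + _); congr (_ ^+ 2); ring.
have inO (c d : int) : a%:~R + b%:~R * tau R + (c%:~R + d%:~R * tau R) \in isO.
  by apply/isOP; exists (a + c), (b + d); rewrite !intrD; ring.
have hx : `|x| <= 1 / 2 by [].
suff [c [d h]] : exists c d : int, (x - c%:~R - d%:~R / 2) ^+ 2 + 7 * (e - d%:~R / 2) ^+ 2 <= 4 / 7.
  by exists (a%:~R + b%:~R * tau R + (c%:~R + d%:~R * tau R)); rewrite ?inO // key.
clearbody x e; move: hx he; rewrite !ler_norml => /andP[x1 x2] /andP[e1 e2].
(* After rounding, the point is x + e sqrt(-7) with |x| <= 1/2 and |e| <= 1/4. The line u + 7 v = 2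
   is the perpendicular bisector of 0 and tau: [aux] treats the side nearer to 0, [aux2] the side
   nearer to tau. The bound 4/7 is attained at the vertex u = 1/2, v = 3/14. The other quadrants
   follow by symmetry. *)
have aux (u v : R) : 0 <= u <= 1 / 2 -> 0 <= v <= 1 / 4 -> u + 7 * v <= 2 -> u ^+ 2 + 7 * v ^+ 2 <= 4 / 7.
  by move=> /andP[? ?] /andP[? ?] ?; nra.
have aux2 (u v : R) : 0 <= u <= 1 / 2 -> 0 <= v <= 1 / 4 -> 2 <= u + 7 * v -> (1 / 2 - u) ^+ 2 + 7 * (1 / 2 - v) ^+ 2 <= 4 / 7.
  by move=> /andP[? ?] /andP[? ?] ?; nra.
have [x0'|x0'] := lerP 0 x; have [e0'|e0'] := lerP 0 e.
- have [h|/ltW h] := lerP (x + 7 * e) 2.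
    by exists 0, 0; have := aux x e; rewrite x0' x2 e0' e2 => /(_ isT isT h); rewrite !mulr0z; nra.
  by exists 0, 1; have := aux2 x e; rewrite x0' x2 e0' e2 => /(_ isT isT h); nra.
- have [h|/ltW h] := lerP (x + 7 * - e) 2.
    by exists 0, 0; have := aux x (- e); rewrite x0' x2 => /(_ isT _ h); rewrite !mulr0z; nra.
  by exists 1, (-1); have := aux2 x (- e); rewrite x0' x2 => /(_ isT _ h); nra.
- have [h|/ltW h] := lerP (- x + 7 * e) 2.
    by exists 0, 0; have := aux (- x) e; rewrite e0' e2 => /(_ _ isT h); rewrite !mulr0z; nra.
  by exists (-1), 1; have := aux2 (- x) e; rewrite e0' e2 => /(_ _ isT h); nra.
- have [h|/ltW h] := lerP (- x + 7 * - e) 2.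
    by exists 0, 0; have := aux (- x) (- e); move=> /(_ _ _ h); rewrite !mulr0z; nra.
  by exists 0, (-1); have := aux2 (- x) (- e); move=> /(_ _ _ h); nra.
Qed.

End Arith.

Arguments isO : clear implicits.

(* The pair (a, b) stands for a + b tau; seq models of vectors and matrices let
   vm_compute decide identities over Z[tau]. *)
Definition ZO : Type := (BinNums.Z * BinNums.Z)%type.
Definition z0 : ZO := (BinNums.Z0, BinNums.Z0).
Definition zi (n : BinNums.Z) : ZO := (n, BinNums.Z0).
Definition zadd (p q : ZO) : ZO := (BinInt.Z.add p.1 q.1, BinInt.Z.add p.2 q.2).
Definition zopp (p : ZO) : ZO := (BinInt.Z.opp p.1, BinInt.Z.opp p.2).
Definition zmul (p q : ZO) : ZO :=
  (BinInt.Z.sub (BinInt.Z.mul p.1 q.1) (BinInt.Z.mul 2 (BinInt.Z.mul p.2 q.2)),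
   BinInt.Z.add (BinInt.Z.add (BinInt.Z.mul p.1 q.2) (BinInt.Z.mul p.2 q.1)) (BinInt.Z.mul p.2 q.2)).
Definition zconj (p : ZO) : ZO := (BinInt.Z.add p.1 p.2, BinInt.Z.opp p.2).
Definition zeq (p q : ZO) : bool := BinInt.Z.eqb p.1 q.1 && BinInt.Z.eqb p.2 q.2.

Lemma zeqP (p q : ZO) : reflect (p = q) (zeq p q).
Proof.
case: p q => [a b] [c d]; apply: (iffP andP) => /= [[/BinInt.Z.eqb_eq -> /BinInt.Z.eqb_eq ->]//|[-> ->]].
by rewrite !BinInt.Z.eqb_refl.
Qed.

Definition zmat : Type := seq (seq ZO).
Definition zvec : Type := seq ZO.
Definition vget (v : zvec) (i : nat) : ZO := nth z0 v i.
Definition mget (X : zmat) (i j : nat) : ZO := nth z0 (nth [::] X i) j.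
Definition vmk (f : nat -> ZO) : zvec := [:: f 0; f 1; f 2]%N.
Definition mmk (f : nat -> nat -> ZO) : zmat :=
  [:: [:: f 0 0; f 0 1; f 0 2]; [:: f 1 0; f 1 1; f 1 2]; [:: f 2 0; f 2 1; f 2 2]]%N.
Definition zsum3 (f : nat -> ZO) : ZO := zadd (f 0%N) (zadd (f 1%N) (f 2%N)).
Definition mmul (X Y : zmat) : zmat := mmk (fun i j => zsum3 (fun k => zmul (mget X i k) (mget Y k j))).
Definition mvec (X : zmat) (v : zvec) : zvec := vmk (fun i => zsum3 (fun k => zmul (mget X i k) (vget v k))).
Definition madj (X : zmat) : zmat := mmk (fun i j => zconj (mget X j i)).
Definition mscale (c : ZO) (X : zmat) : zmat := mmk (fun i j => zmul c (mget X i j)).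
Definition vscale (c : ZO) (v : zvec) : zvec := vmk (fun i => zmul c (vget v i)).
Definition vadd (v w : zvec) : zvec := vmk (fun i => zadd (vget v i) (vget w i)).
Definition mone : zmat := mmk (fun i j => if i == j then zi 1 else z0).
Definition mJ : zmat := mmk (fun i j => if (i + j == 2)%N then zi 1 else z0).
Definition mcols (u v w : zvec) : zmat :=
  mmk (fun i j => match j with 0%N => vget u i | 1%N => vget v i | _ => vget w i end).
Definition zherm (v w : zvec) : ZO :=
  zadd (zmul (vget v 0) (zconj (vget w 2)))
    (zadd (zmul (vget v 1) (zconj (vget w 1))) (zmul (vget v 2) (zconj (vget w 0)))).
Definition ztr (X : zmat) : ZO := zsum3 (fun i => mget X i i).
Definition meq (X Y : zmat) : bool :=
  all (fun i => all (fun j => zeq (mget X i j) (mget Y i j)) [:: 0; 1; 2]%N) [:: 0; 1; 2]%N.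
Definition veq (v w : zvec) : bool := all (fun i => zeq (vget v i) (vget w i)) [:: 0; 1; 2]%N.
Fixpoint mpow (X : zmat) (n : nat) : zmat := if n is n'.+1 then mmul X (mpow X n') else mone.
Definition zsub (p q : ZO) : ZO := zadd p (zopp q).
Definition mdet (X : zmat) : ZO :=
  let m i j := mget X i j in
  zadd (zmul (m 0 0) (zsub (zmul (m 1 1) (m 2 2)) (zmul (m 1 2) (m 2 1))))%N
 (zadd (zmul (m 0 1) (zsub (zmul (m 1 2) (m 2 0)) (zmul (m 1 0) (m 2 2))))%N
       (zmul (m 0 2) (zsub (zmul (m 1 0) (m 2 1)) (zmul (m 1 1) (m 2 0)))))%N.
(** The adjugate. The determinant times the adjugate is an inverse exactly when the determinant
    squares to 1; this is how unimodularity of an explicit basis is tested. *)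
Definition madjg (X : zmat) : zmat :=
  let m i j := mget X i j in
  let c a b c' d := zsub (zmul (m a b) (m c' d)) (zmul (m a d) (m c' b)) in
  [:: [:: c 1 1 2 2; c 0 2 2 1; c 0 1 1 2];
      [:: c 1 2 2 0; c 0 0 2 2; c 0 2 1 0];
      [:: c 1 0 2 1; c 0 1 2 0; c 0 0 1 1]]%N.

Section Embed.
Variable R : realType.
Local Notation C := R[i].

Definition zc (p : ZO) : C := (int_of_Z p.1)%:~R + (int_of_Z p.2)%:~R * tau R.
Definition eV (v : zvec) : 'cV[C]_3 := \col_i zc (vget v i).
Definition eM (X : zmat) : 'M[C]_3 := \matrix_(i, j) zc (mget X i j).

Lemma zcE p : zc p = (int_of_Z p.1)%:~R + (int_of_Z p.2)%:~R * tau R.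
Proof. by []. Qed.

Lemma zcD p q : zc (zadd p q) = zc p + zc q.
Proof. by rewrite /zc /= (rmorphD int_of_Z) (rmorphD int_of_Z p.2) !intrD; ring. Qed.
Lemma zcN p : zc (zopp p) = - zc p.
Proof. by rewrite /zc /= (rmorphN int_of_Z) (rmorphN int_of_Z p.2) !intrN; ring. Qed.
Lemma zcB p q : zc (zsub p q) = zc p - zc q.
Proof. by rewrite zcD zcN. Qed.
Lemma zcM p q : zc (zmul p q) = zc p * zc q.
Proof.
case: p q => [a b] [c d]; rewrite /zc /=.
have -> : BinInt.Z.sub (BinInt.Z.mul a c) (BinInt.Z.mul 2 (BinInt.Z.mul b d)) = a * c - 2 * (b * d) :> BinNums.Z by [].
have -> : BinInt.Z.add (BinInt.Z.add (BinInt.Z.mul a d) (BinInt.Z.mul b c)) (BinInt.Z.mul b d) = a * d + b * c + b * d :> BinNums.Z by [].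
rewrite !(rmorphD, rmorphB, rmorphM) /=.
transitivity ((int_of_Z a)%:~R * (int_of_Z c)%:~R + ((int_of_Z a)%:~R * (int_of_Z d)%:~R + (int_of_Z b)%:~R * (int_of_Z c)%:~R) * tau R + (int_of_Z b)%:~R * (int_of_Z d)%:~R * tau R ^+ 2 : C); last by ring.
rewrite tau_sqr; ring.
Qed.
Lemma zc0 : zc z0 = 0. Proof. by rewrite /zc /= mul0r addr0. Qed.
Lemma zc1 : zc (zi 1) = 1. Proof. by rewrite /zc /= mul0r addr0. Qed.
Lemma zc_conj p : zc (zconj p) = (zc p)^*%R.
Proof.
case: p => a b; rewrite /zc /= (rmorphD int_of_Z) (rmorphN int_of_Z b) intrD intrN.
have := conj_tau R; move: (tau R) => t tE.
by rewrite rmorphD rmorphM /= !rmorph_int tE; ring.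
Qed.
Lemma zc_inj : injective zc.
Proof.
move=> [a b] [c d] /O_inj /= [/(can_inj int_of_ZK) -> e].
by rewrite (can_inj int_of_ZK e).
Qed.
Lemma zc_isO p : zc p \in isO R.
Proof. by apply/isOP; exists (int_of_Z p.1), (int_of_Z p.2). Qed.
Lemma isO_zc z : z \in isO R -> exists p, z = zc p.
Proof. by move=> /isOP[a [b ->]]; exists (Z_of_int a, Z_of_int b); rewrite /zc /= !Z_of_intK. Qed.

Lemma zc_int (n : BinNums.Z) : zc (zi n) = (int_of_Z n)%:~R.
Proof. by rewrite /zc /= mul0r addr0. Qed.

Lemma sum3 (F : 'I_3 -> C) : \sum_i F i = F 0 + (F 1 + F 2%:R).
Proof.
rewrite !big_ord_recl big_ord0 addr0; congr (_ + (_ + _)); congr F; exact/val_inj.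
Qed.

Lemma vget_mk f (i : 'I_3) : vget (vmk f) i = f i.
Proof. by case: i => [[|[|[|i]]] Hi]. Qed.
Lemma mget_mk f (i j : 'I_3) : mget (mmk f) i j = f i j.
Proof. by case: i j => [[|[|[|i]]] Hi] [[|[|[|j]]] Hj]. Qed.

Lemma eM_mul X Y : eM (mmul X Y) = eM X *m eM Y.
Proof.
by apply/matrixP => i j; rewrite !mxE mget_mk sum3 !mxE /zsum3 !zcD !zcM.
Qed.
Lemma eM_vec X v : eV (mvec X v) = eM X *m eV v.
Proof.
by apply/matrixP => i j; rewrite !mxE vget_mk sum3 !mxE /zsum3 !zcD !zcM.
Qed.
Lemma eM_adj X : eM (madj X) = (eM X)^t*.
Proof. by apply/matrixP => i j; rewrite !mxE mget_mk zc_conj. Qed.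
Lemma eM_scale c X : eM (mscale c X) = zc c *: eM X.
Proof. by apply/matrixP => i j; rewrite !mxE mget_mk zcM. Qed.
Lemma eV_scale c v : eV (vscale c v) = zc c *: eV v.
Proof. by apply/matrixP => i j; rewrite !mxE vget_mk zcM. Qed.
Lemma eV_add v w : eV (vadd v w) = eV v + eV w.
Proof. by apply/matrixP => i j; rewrite !mxE vget_mk zcD. Qed.
Lemma eM_one : eM mone = 1%:M.
Proof.
apply/matrixP => i j; rewrite !mxE mget_mk (fun_if zc) zc1 zc0.
by have -> : (nat_of_ord i == j) = (i == j) by []; case: eqP.
Qed.
Lemma eM_J : eM mJ = Jmx R.
Proof.
by apply/matrixP => i j; rewrite !mxE mget_mk; case: i j => [[|[|[|i]]] Hi] [[|[|[|j]]] Hj] //=; rewrite ?zc0 ?zc1.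
Qed.
Lemma eM_pow X n : eM (mpow X n) = (eM X) ^+ n.
Proof. by elim: n => [|n IH]; rewrite ?expr0 ?exprS /= ?eM_one // eM_mul IH. Qed.

Lemma meqP X Y : reflect (eM X = eM Y) (meq X Y).
Proof.
apply: (iffP allP) => [h|h i].
  apply/matrixP => i j; rewrite !mxE; congr zc.
  have /h/allP/(_ j) : (i : nat) \in [:: 0; 1; 2]%N by case: i => [[|[|[|i]]] Hi].
  move=> e; apply/zeqP/e; by case: j {e} => [[|[|[|j]]] Hj].
move=> iI; apply/allP => j jI; apply/zeqP/zc_inj.
have li : (i < 3)%N by move: iI; rewrite !inE => /or3P[] /eqP ->.
have lj : (j < 3)%N by move: jI; rewrite !inE => /or3P[] /eqP ->.
by move/matrixP/(_ (Ordinal li) (Ordinal lj)): h; rewrite !mxE.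
Qed.
Lemma veqP v w : reflect (eV v = eV w) (veq v w).
Proof.
apply: (iffP allP) => [h|h i].
  apply/matrixP => i j; rewrite !mxE; congr zc; apply/zeqP/h.
  by case: i => [[|[|[|i]]] Hi].
move=> iI; apply/zeqP/zc_inj.
have li : (i < 3)%N by move: iI; rewrite !inE => /or3P[] /eqP ->.
by move/matrixP/(_ (Ordinal li) 0): h; rewrite !mxE.
Qed.

Lemma hermE (v w : 'cV[C]_3) : herm v w = v 0 0 * (w 2%:R 0)^*%R + (v 1 0 * (w 1 0)^*%R + v 2%:R 0 * (w 0 0)^*%R).
Proof. by rewrite /herm !(mxE, sum3) /=; ring. Qed.

Lemma herm_eV v w : herm (eV v) (eV w) = zc (zherm v w).
Proof. by rewrite hermE /zherm !zcD !zcM !zc_conj !mxE. Qed.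

Lemma Jmx_sq : Jmx R *m Jmx R = 1%:M.
Proof. by rewrite -eM_J -eM_one -eM_mul; apply/meqP; vm_compute. Qed.

Lemma isUJ_of (A : 'M[C]_3) : A^t* *m Jmx R *m A = Jmx R -> isUJ A.
Proof.
move=> h; rewrite /isUJ h eqxx andbT.
have e : (Jmx R *m A^t* *m Jmx R) *m A = 1%:M by rewrite -!mulmxA (mulmxA _ _ A) h Jmx_sq.
by have /mulmx1_unit[] := e.
Qed.

Definition uZ X : bool := meq (mmul (mmul (madj X) mJ) X) mJ.
Lemma uZ_isUJ X : uZ X -> isUJ (eM X).
Proof. by move=> /meqP h; apply: isUJ_of; rewrite -eM_adj -eM_J -!eM_mul. Qed.

Lemma eM_O X i j : eM X i j \in isO R.
Proof. by rewrite mxE zc_isO. Qed.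

Lemma eV_O v i j : eV v i j \in isO R.
Proof. by rewrite mxE zc_isO. Qed.

End Embed.

(** * Hermitian lattices over Z[tau] *)

Lemma ltn_add_descent (a b c k : nat) : (a < b -> c + b < k.+1 -> c + a < k)%N.
Proof. lia. Qed.

Section Reduction.
Variable R : realType.
Local Notation C := R[i].
Local Notation O := (isO R).
Local Notation Re := complex.Re.

Lemma nat_above (x : R) : exists n : nat, x < n%:R.
Proof. by exists (Num.bound `|x|); apply: le_lt_trans (ler_norm x) _; apply: archi_boundP. Qed.

Section Form.
Variables (V : lmodType C) (h : V -> V -> C).
Hypothesis hD : forall u v w, h (u + v) w = h u w + h v w.
Hypothesis hZ : forall c u w, h (c *: u) w = c * h u w.
Hypothesis hC : forall u v, h v u = (h u v)^*%R.

Lemma form_Dr u v w : h u (v + w) = h u v + h u w.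
Proof. by rewrite hC hD rmorphD /= -!hC. Qed.
Lemma form_Zr c u w : h u (c *: w) = c^*%R * h u w.
Proof. by rewrite hC hZ rmorphM /= -hC. Qed.
Lemma form_real u : h u u = (Re (h u u))%:C%C.
Proof. by have := hC u u; case: (h u u) => a b /= [e]; congr Complex; lra. Qed.

(** Completing the square in [k]: the best shift is by the element of Z[tau] nearest to
    [h r2 r1 / m]. *)
Lemma form_shift r1 r2 k : let m := Re (h r1 r1) in m != 0 ->
  m * Re (h (r2 - k *: r1) (r2 - k *: r1)) =
  m * Re (h r2 r2) - nsq (h r2 r1) + nsq (h r2 r1 - k * m%:C%C).
Proof.
move=> m m0; have mE : h r1 r1 = m%:C%C by exact: form_real.
rewrite -scaleNr !(hD, form_Dr, hZ, form_Zr) mE (hC r2 r1).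
case: (h r2 r2) => a a'; case: (h r2 r1) => b b'; case: k => c c'.
rewrite /nsq /=; ring.
Qed.

Lemma form_gram r1 r2 (a b c d : C) :
  let s1 := a *: r1 + b *: r2 in let s2 := c *: r1 + d *: r2 in
  Re (h s1 s1) * Re (h s2 s2) - nsq (h s2 s1) =
  nsq (a * d - b * c) * (Re (h r1 r1) * Re (h r2 r2) - nsq (h r2 r1)).
Proof.
move=> s1 s2; apply: complexI.
rewrite rmorphB !rmorphM [in RHS]rmorphB [in RHS]rmorphM /= !nsqE -!form_real -!hC.
rewrite /s1 /s2 !(hD, form_Dr, hZ, form_Zr) !(rmorphB, rmorphD, rmorphM) /=; ring.
Qed.

Variables r1 r2 : V.
Hypothesis pos : forall a b : C, a \in O -> b \in O -> (a != 0) || (b != 0) ->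
  exists2 k : nat, (0 < k)%N & Re (h (a *: r1 + b *: r2) (a *: r1 + b *: r2)) = k%:R.

(** Gauss reduction, with the nearest element of Z[tau] in place of the nearest integer. [V] and [h]
    are abstract because the lemma serves three forms: the Hermitian form on the orthogonal of a
    rational point, the twisted form of an element of order 3 or 4, and the projected form of the
    ternary reduction. *)
Lemma rank2_reduction : exists a b c d : C,
  let s1 := a *: r1 + b *: r2 in let s2 := c *: r1 + d *: r2 in
  [/\ [/\ a \in O, b \in O, c \in O & d \in O], nsq (a * d - b * c) = 1,
    nsq (h s2 s1) <= 4 / 7 * Re (h s1 s1) ^+ 2 & Re (h s1 s1) <= Re (h s2 s2)].
Proof.
suff key (k : nat) : forall a b c d : C, let s1 := a *: r1 + b *: r2 in let s2 := c *: r1 + d *: r2 in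
    a \in O -> b \in O -> c \in O -> d \in O -> nsq (a * d - b * c) = 1 ->
    Re (h s1 s1) + Re (h s2 s2) < k%:R -> exists a b c d : C,
  let s1 := a *: r1 + b *: r2 in let s2 := c *: r1 + d *: r2 in
  [/\ [/\ a \in O, b \in O, c \in O & d \in O], nsq (a * d - b * c) = 1,
    nsq (h s2 s1) <= 4 / 7 * Re (h s1 s1) ^+ 2 & Re (h s1 s1) <= Re (h s2 s2)].
  have := key _ 1 0 0 1; rewrite mul0r subr0 mulr1 nsq1.
  move=> h1; have [n hn] := nat_above (Re (h (1 *: r1 + 0 *: r2) (1 *: r1 + 0 *: r2)) + Re (h (0 *: r1 + 1 *: r2) (0 *: r1 + 1 *: r2))).
  by apply: (h1 n); rewrite ?rpred0 ?rpred1.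
elim: k => [|k IH] a b c d s1 s2 aO bO cO dO det lt_k.
  have nn x y : x \in O -> y \in O -> 0 <= Re (h (x *: r1 + y *: r2) (x *: r1 + y *: r2)).
    move=> xO yO; have [/orP h0|] := boolP ((x != 0) || (y != 0)).
      by have [n _ ->] := pos xO yO (introT orP h0); rewrite ler0n.
    rewrite negb_or !negbK => /andP[/eqP -> /eqP ->].
    by rewrite !scale0r addr0 -[X in h X _](scale0r 0) hZ mul0r.
  by move: lt_k; rewrite ltNge addr_ge0 // nn.
wlog le12 : a b c d @s1 @s2 aO bO cO dO det lt_k / Re (h s1 s1) <= Re (h s2 s2) => [hw|].
  have [le|/ltW le] := lerP (Re (h s1 s1)) (Re (h s2 s2)); first exact: (hw a b c d).
  apply: (hw c d a b) => //; last by rewrite addrC.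
  by rewrite -det -nsqN; congr nsq; ring.
have ne1 : (a != 0) || (b != 0).
  rewrite -negb_and; apply/negP => /andP[/eqP a0 /eqP b0].
  by move: det; rewrite a0 b0 !mul0r subr0 nsq0 => /eqP; rewrite eq_sym oner_eq0.
have [m m_gt0 mE] := pos aO bO ne1; rewrite -/s1 in mE.
have M0 : 0 < Re (h s1 s1) by rewrite mE ltr0n.
have [le|lt] := lerP (nsq (h s2 s1)) (4 / 7 * Re (h s1 s1) ^+ 2).
  by exists a, b, c, d.
set M := Re (h s1 s1) in M0 le12 lt lt_k *.
have MC0 : M%:C%C != 0 by rewrite (inj_eq (@complexI _)) gt_eqF.
have [q qO qle] := nearestO (h s2 s1 / M%:C%C).
have s2' : (c - q * a) *: r1 + (d - q * b) *: r2 = s2 - q *: s1.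
  by rewrite /s2 /s1 scalerDr !scalerA !scalerBl opprD addrACA.
have sh := form_shift (r1 := s1) s2 q (lt0r_neq0 M0); rewrite -/M in sh.
have bd : nsq (h s2 s1 - q * M%:C%C) <= 4 / 7 * M ^+ 2.
  have -> : h s2 s1 - q * M%:C%C = (h s2 s1 / M%:C%C - q) * M%:C%C by rewrite mulrBl divfK.
  by rewrite nsqM [nsq M%:C%C](_ : _ = M ^+ 2) ?ler_pM2r ?exprn_gt0 // /nsq /=; ring.
(* A pair that is not reduced has nsq (h s2 s1) above 4/7 M^2, while the shifted product is at most
   that, so the second vector becomes strictly shorter. The norms are natural numbers, whence the
   descent on their sum. *)
have dec : Re (h (s2 - q *: s1) (s2 - q *: s1)) < Re (h s2 s2).
  by rewrite -(ltr_pM2l M0) sh; lra.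
have det' : a * (d - q * b) - b * (c - q * a) = a * d - b * c by ring.
have c'O : c - q * a \in O by rewrite rpredB ?rpredM.
have d'O : d - q * b \in O by rewrite rpredB ?rpredM.
have ne2 : (c - q * a != 0) || (d - q * b != 0).
  rewrite -negb_and; apply/negP => /andP[/eqP a0 /eqP b0].
  by move: det; rewrite -det' a0 b0 !mulr0 subr0 nsq0 => /eqP; rewrite eq_sym oner_eq0.
have ne3 : (c != 0) || (d != 0).
  rewrite -negb_and; apply/negP => /andP[/eqP a0 /eqP b0].
  by move: det; rewrite a0 b0 !mulr0 subr0 nsq0 => /eqP; rewrite eq_sym oner_eq0.
have [n _ nE] := pos cO dO ne3; have [n' _ nE'] := pos c'O d'O ne2.
apply: (IH a b (c - q * a) (d - q * b)); rewrite ?det' // -/s1 -/M.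
rewrite s2' in nE' *; rewrite -/s2 in nE; move: dec lt_k.
by rewrite nE' nE (mE : M = _) -!natrD !ltr_nat; apply: ltn_add_descent.
Qed.

(** Hermite's bound: for a reduced pair with norms m <= n and product b, the determinant m n - |b|^2
    is at least m^2 - 4/7 m^2. *)
Lemma rank2_short : exists a b c d : C,
  let s1 := a *: r1 + b *: r2 in let s2 := c *: r1 + d *: r2 in
  let D := Re (h r1 r1) * Re (h r2 r2) - nsq (h r2 r1) in
  [/\ [/\ a \in O, b \in O, c \in O & d \in O], nsq (a * d - b * c) = 1,
    [/\ nsq (h s2 s1) <= 4 / 7 * Re (h s1 s1) ^+ 2, Re (h s1 s1) <= Re (h s2 s2),
     Re (h s1 s1) * Re (h s2 s2) - nsq (h s2 s1) = D & 3 / 7 * Re (h s1 s1) ^+ 2 <= D] &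
    exists2 k : nat, (0 < k)%N & Re (h s1 s1) = k%:R].
Proof.
have [a [b [c [d /= [[aO bO cO dO] det l1 l2]]]]] := rank2_reduction.
exists a, b, c, d => /=.
have ne1 : (a != 0) || (b != 0).
  rewrite -negb_and; apply/negP => /andP[/eqP a0 /eqP b0].
  by move: det; rewrite a0 b0 !mul0r subr0 nsq0 => /eqP; rewrite eq_sym oner_eq0.
have [m m_gt0 mE] := pos aO bO ne1.
have g := form_gram r1 r2 a b c d; rewrite det mul1r /= in g.
split=> //; last by exists m.
split=> //; rewrite -g.
have : Re (h (a *: r1 + b *: r2) (a *: r1 + b *: r2)) ^+ 2 <= Re (h (a *: r1 + b *: r2) (a *: r1 + b *: r2)) * Re (h (c *: r1 + d *: r2) (c *: r1 + d *: r2)).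
  by rewrite expr2 ler_pM2l // mE ltr0n.
by move: l1; lra.
Qed.

End Form.

Definition Omx m n (A : 'M[C]_(m, n)) : Prop := forall i j, A i j \in O.

Lemma Omx_mul m n p (A : 'M[C]_(m, n)) (B : 'M[C]_(n, p)) : Omx A -> Omx B -> Omx (A *m B).
Proof. by move=> hA hB i j; rewrite mxE rpred_sum // => k _; rewrite rpredM. Qed.
Lemma Omx_add m n (A B : 'M[C]_(m, n)) : Omx A -> Omx B -> Omx (A + B).
Proof. by move=> hA hB i j; rewrite mxE rpredD. Qed.
Lemma Omx_opp m n (A : 'M[C]_(m, n)) : Omx A -> Omx (- A).
Proof. by move=> hA i j; rewrite mxE rpredN. Qed.
Lemma Omx_scale m n c (A : 'M[C]_(m, n)) : c \in O -> Omx A -> Omx (c *: A).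
Proof. by move=> hc hA i j; rewrite mxE rpredM. Qed.
Lemma Omx_one n : Omx (1%:M : 'M[C]_n).
Proof. by move=> i j; rewrite mxE rpred_nat. Qed.
Lemma Omx_delta m n i j : Omx (delta_mx i j : 'M[C]_(m, n)).
Proof. by move=> k l; rewrite mxE rpred_nat. Qed.
Lemma Omx_tr m n (A : 'M[C]_(m, n)) : Omx A -> Omx (A^t*).
Proof. by move=> hA i j; rewrite !mxE isO_conj. Qed.
Lemma Omx_J : Omx (Jmx R).
Proof. by rewrite -eM_J => i j; exact: eM_O. Qed.
Lemma Omx_eM X : Omx (eM R X). Proof. exact: eM_O. Qed.
Lemma Omx_exp n (A : 'M[C]_n.+1) k : Omx A -> Omx (A ^+ k).
Proof. by move=> hA; elim: k => [|k IH]; rewrite ?expr0 ?exprS; [exact: Omx_one|exact: Omx_mul]. Qed.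

Lemma elementaryK n (i j : 'I_n) (k : C) : i != j ->
  (1%:M + k *: delta_mx i j) *m (1%:M - k *: delta_mx i j) = 1%:M.
Proof.
move=> ij; rewrite mulmxDl mul1mx mulmxBr mulmx1 -scalemxAl -scalemxAr mul_delta_mx_0 1?eq_sym //.
by rewrite !scaler0 subr0 subrK.
Qed.

(* The Euclidean algorithm in Z[tau]. *)
Lemma primitive_completion (w : 'cV[C]_3) : Omx w -> w != 0 ->
  exists Q Q' : 'M[C]_3, exists d : C,
  [/\ Omx Q, Omx Q', Q *m Q' = 1%:M, d \in O & w = d *: col 0 Q].
Proof.
suff key (N : nat) : forall w : 'cV[C]_3, Omx w -> w != 0 -> \sum_i nsq (w i 0) < N%:R ->
  exists Q Q' : 'M[C]_3, exists d : C,
  [/\ Omx Q, Omx Q', Q *m Q' = 1%:M, d \in O & w = d *: col 0 Q].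
  by move=> wO w0; have [n hn] := nat_above (\sum_i nsq (w i 0)); apply: (key n).
elim: N => [|N IH] {}w wO w0.
  by rewrite ltNge sumr_ge0 // => i _; exact: nsq_ge0.
move=> lt_N.
have [[i [j [ij wi0 wj0 le_ji]]]|none] := pselect (exists i j, [/\ i != j, w i 0 != 0, w j 0 != 0 & nsq (w j 0) <= nsq (w i 0)]).
  have [k kO kle] := nearestO (w i 0 / w j 0).
  pose E := 1%:M - k *: delta_mx i j : 'M[C]_3; pose E' := 1%:M + k *: delta_mx i j : 'M[C]_3.
  have EE' : E' *m E = 1%:M by exact: elementaryK.
  have E'E : E *m E' = 1%:M by exact: mulmx1C.
  have OE : Omx E by apply/Omx_add/Omx_opp/Omx_scale/Omx_delta => //; exact: Omx_one.
  have OE' : Omx E' by apply/Omx_add/Omx_scale/Omx_delta => //; exact: Omx_one.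
  have Ew l : (E *m w) l 0 = w l 0 - (l == i)%:R * (k * w j 0).
    rewrite mulmxBl mul1mx -scalemxAl !mxE; congr (_ - _).
    rewrite (bigD1 j) //= big1 ?addr0; last by move=> l' /negPf nl; rewrite !mxE nl andbF mul0r.
    by rewrite !mxE eqxx andbT; case: eqP => _; rewrite ?mul0r ?mulr0 ?mul1r.
  (* The remainder of the division has squared modulus at most 4/7 of that of entry j, which is at
     most that of entry i. *)
  have lt_i : nsq ((E *m w) i 0) < nsq (w i 0).
    rewrite Ew eqxx mul1r; have -> : w i 0 - k * w j 0 = (w i 0 / w j 0 - k) * w j 0 by rewrite mulrBl divfK.
    rewrite nsqM; have : 0 < nsq (w j 0) by rewrite lt_def nsq_ge0 nsq_eq0 wj0.
    by move: kle le_ji; nra.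
  have Ew0 : E *m w != 0.
    by apply: contraNneq w0 => e; rewrite -[w]mul1mx -EE' -mulmxA e mulmx0.
  have OEw : Omx (E *m w) by exact: Omx_mul.
  have lt_s : \sum_l nsq ((E *m w) l 0) < \sum_l nsq (w l 0).
    rewrite (bigD1 i) // [ltRHS](bigD1 i) //=.
    have -> : \sum_(l | l != i) nsq ((E *m w) l 0) = \sum_(l | l != i) nsq (w l 0).
      by apply: eq_bigr => l /negPf li; rewrite Ew li mul0r subr0.
    by rewrite ltrD2r.
  have nat_s (u : 'cV[C]_3) : Omx u -> exists n : nat, \sum_l nsq (u l 0) = n%:R.
    move=> uO; have /choice[f fE] : forall l, exists n : nat, nsq (u l 0) = n%:R by move=> l; apply: nsqO_nat.
    by exists (\sum_l f l)%N; rewrite natr_sum; apply: eq_bigr.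
  have [n1 n1E] := nat_s _ wO; have [n2 n2E] := nat_s _ OEw.
  have lt_N' : \sum_l nsq ((E *m w) l 0) < N%:R.
    by move: lt_s lt_N; rewrite n1E n2E !ltr_nat; lia.
  have [Q [Q' [d [OQ OQ' QQ' dO e]]]] := IH _ OEw Ew0 lt_N'.
  exists (E' *m Q), (Q' *m E), d; split; try exact: Omx_mul; try done.
    by rewrite mulmxA -(mulmxA E') QQ' mulmx1.
  by rewrite -(mul1mx w) -EE' -mulmxA e -scalemxAr !colE mulmxA.
(* No two nonzero entries are left, so [w] has exactly one, and a transposition moves it to place
   0. *)
have [i wi0] : exists i, w i 0 != 0.
  apply/existsP; rewrite -negb_forall; apply: contra w0 => /forallP h.
  by apply/eqP/matrixP => a b; rewrite ord1 mxE; apply/eqP/h.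
exists (tperm_mx i 0), (tperm_mx i 0), (w i 0); split=> //.
- by move=> a b; rewrite !mxE rpred_nat.
- by move=> a b; rewrite !mxE rpred_nat.
- by rewrite /tperm_mx -perm_mxM perm.tperm2 perm_mx1.
- apply/matrixP => a b; rewrite ord1 !mxE.
  have [->|ai] := eqVneq a i; first by rewrite tpermL eqxx mulr1.
  have -> : w a 0 = 0.
    apply/eqP/negPn/negP => wa0; apply: none.
    have [le|/ltW le] := lerP (nsq (w a 0)) (nsq (w i 0)).
      by exists i, a; rewrite eq_sym.
    by exists a, i.
  case: tpermP => [ai'|a0|_ /eqP/negPf ->]; rewrite ?mulr0 //; first by rewrite ai' eqxx in ai.
  by case: eqP => [i0|_]; rewrite ?mulr0 //; move: ai; rewrite a0 i0 eqxx.
Qed.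

End Reduction.

(** * The Hermitian form and its unitary group *)

Lemma det2E (K : comNzRingType) (A : 'M[K]_2) : \det A = A 0 0 * A 1 1 - A 0 1 * A 1 0.
Proof.
rewrite (expand_det_row _ 0) !big_ord_recl big_ord0 addr0 /cofactor !det_mx11 !mxE.
rewrite (_ : lift 0 0 = 1 :> 'I_2); last exact/val_inj.
rewrite (_ : lift 1 0 = 0 :> 'I_2); last exact/val_inj.
by rewrite /= addn0 expr0 mul1r add0n expr1 mulN1r mulrN.
Qed.

Lemma det3E (K : comNzRingType) (A : 'M[K]_3) : \det A = A 0 0 * (A 1 1 * A 2%:R 2%:R - A 1 2%:R * A 2%:R 1)
  + (A 0 1 * (A 1 2%:R * A 2%:R 0 - A 1 0 * A 2%:R 2%:R)
  + A 0 2%:R * (A 1 0 * A 2%:R 1 - A 1 1 * A 2%:R 0)).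
Proof.
rewrite (expand_det_row _ 0) !big_ord_recl big_ord0 addr0 /cofactor !det2E !mxE.
rewrite (_ : lift 0 (0 : 'I_2) = 1 :> 'I_3); last exact/val_inj.
rewrite (_ : lift 0 (1 : 'I_2) = 2%:R :> 'I_3); last exact/val_inj.
rewrite (_ : lift (1 : 'I_3) (0 : 'I_2) = 0 :> 'I_3); last exact/val_inj.
rewrite (_ : lift (1 : 'I_3) (1 : 'I_2) = 2%:R :> 'I_3); last exact/val_inj.
rewrite (_ : lift 0 (lift 0 (0 : 'I_1)) = 2%:R :> 'I_3); last exact/val_inj.
rewrite (_ : lift (2%:R : 'I_3) (0 : 'I_2) = 0 :> 'I_3); last exact/val_inj.
rewrite (_ : lift (2%:R : 'I_3) (1 : 'I_2) = 1 :> 'I_3); last exact/val_inj.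
rewrite !add0n (_ : (-1) ^+ (nat_of_ord (@ord0 2)) = 1 :> K) // (_ : (-1) ^+ (nat_of_ord (1%R : 'I_3)) = -1 :> K) //.
rewrite (_ : (-1) ^+ (nat_of_ord (2%:R : 'I_3)) = 1 :> K); last by rewrite -signr_odd.
by rewrite (_ : ord0 = 0) //; ring.
Qed.

Section Geo.
Variable R : realType.
Local Notation C := R[i].
Local Notation O := (isO R).
Local Notation Re := complex.Re.
Implicit Types (A : 'M[C]_3) (u v w : 'cV[C]_3).

Lemma herm_def v w : herm v w = (w^t* *m Jmx R *m v) 0 0.
Proof. by []. Qed.

Lemma hermDl u v w : herm (u + v) w = herm u w + herm v w.
Proof. by rewrite !hermE !mxE; ring. Qed.
Lemma hermZl c u w : herm (c *: u) w = c * herm u w.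
Proof. by rewrite !hermE !mxE; ring. Qed.
Lemma hermCC u v : herm v u = (herm u v)^*%R.
Proof. exact: herm_sym. Qed.
Lemma hermDr u v w : herm u (v + w) = herm u v + herm u w.
Proof. exact: (form_Dr hermDl hermCC). Qed.
Lemma hermZr c u w : herm u (c *: w) = c^*%R * herm u w.
Proof. exact: (form_Zr hermZl hermCC). Qed.
Lemma hermNl u w : herm (- u) w = - herm u w.
Proof. by rewrite -scaleN1r hermZl mulN1r. Qed.
Lemma hermBl u v w : herm (u - v) w = herm u w - herm v w.
Proof. by rewrite hermDl hermNl. Qed.
Lemma herm0l w : herm 0 w = 0.
Proof. by rewrite -[X in herm X _](scale0r 0) hermZl mul0r. Qed.
Lemma herm0r w : herm w 0 = 0.
Proof. by rewrite hermCC herm0l rmorph0. Qed.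
Lemma herm_real u : herm u u = (Re (herm u u))%:C%C.
Proof. exact: (form_real hermCC). Qed.
Lemma herm_perpC u v : herm u v = 0 -> herm v u = 0.
Proof. by move=> h; rewrite hermCC h rmorph0. Qed.

Lemma herm_lt0 u : (herm u u < 0) = (Re (herm u u) < 0).
Proof. by rewrite {1}herm_real ltcR. Qed.
Lemma herm_gt0 u : (0 < herm u u) = (0 < Re (herm u u)).
Proof. by rewrite {1}herm_real ltcR. Qed.

Lemma herm_neg_neq0 v : herm v v < 0 -> v != 0.
Proof. by apply: contraTneq => ->; rewrite herm0l ltxx. Qed.

(* Reversed Cauchy-Schwarz: the form is definite on the orthogonal of a negative vector. *)
Lemma perp_neg_ge0 v u : herm v v < 0 -> herm u v = 0 ->
  0 <= Re (herm u u) /\ (Re (herm u u) = 0 -> u = 0).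
Proof.
move=> vneg uv; have E := uv; rewrite hermE in E.
have E' : (u 0 0)^*%R * v 2%:R 0 + ((u 1 0)^*%R * v 1 0 + (u 2%:R 0)^*%R * v 0 0) = 0.
  by apply: (can_inj (@conjCK _)); rewrite !(rmorphD, rmorphM, rmorph0) /= !conjCK -[RHS]E; ring.
(* [u 0 0] is eliminated by means of the orthogonality relation [E] and its conjugate [E']. The
   factor |v_2|^2 is nonzero for negative v, since otherwise <v,v> = |v_1|^2. *)
have key : nsq (v 2%:R 0) * Re (herm u u) = nsq (u 1 0 * v 2%:R 0 - u 2%:R 0 * v 1 0) - nsq (u 2%:R 0) * Re (herm v v).
  apply: complexI; rewrite rmorphB !rmorphM /= !nsqE -!herm_real !hermE.
  rewrite !(rmorphB, rmorphD, rmorphM) /=.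
  apply/eqP; rewrite -subr_eq0; apply/eqP.
  transitivity (v 2%:R 0 * (u 2%:R 0)^* * (u 0 0 * (v 2%:R 0)^* + (u 1 0 * (v 1 0)^* + u 2%:R 0 * (v 0 0)^*))
   + (v 2%:R 0)^* * u 2%:R 0 * ((u 0 0)^* * v 2%:R 0 + ((u 1 0)^* * v 1 0 + (u 2%:R 0)^* * v 0 0))); first ring.
  by rewrite E E' !mulr0 addr0.
have v20 : v 2%:R 0 != 0.
  apply: contraTneq vneg => v2; rewrite herm_lt0 -leNgt.
  have -> : herm v v = (nsq (v 1 0))%:C%C by rewrite hermE v2 conjC0 mulr0 mul0r addr0 add0r nsqE.
  exact: nsq_ge0.
have n2 : 0 < nsq (v 2%:R 0) by rewrite lt_def nsq_eq0 v20 nsq_ge0.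
rewrite herm_lt0 in vneg.
have h1 := nsq_ge0 (u 1 0 * v 2%:R 0 - u 2%:R 0 * v 1 0).
have h2 := nsq_ge0 (u 2%:R 0).
split; first by rewrite -(pmulr_rge0 _ n2) key subr_ge0 (le_trans _ h1) // mulr_ge0_le0 // ltW.
move=> q0; rewrite q0 mulr0 in key.
have n0 : nsq (u 2%:R 0) = 0.
  by apply/eqP; rewrite eq_le h2 andbT -(nmulr_lge0 _ vneg); lra.
have u2 : u 2%:R 0 = 0 by apply/eqP; rewrite -nsq_eq0 n0.
have u1 : u 1 0 = 0.
  move: key; rewrite u2 !mul0r subr0 nsq0 mul0r subr0 => /esym/eqP.
  by rewrite nsq_eq0 mulf_eq0 (negPf v20) orbF => /eqP.
have u0 : u 0 0 = 0.
  move: E; rewrite u1 u2 !mul0r !addr0 => /eqP.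
  by rewrite mulf_eq0 conjC_eq0 (negPf v20) orbF => /eqP.
apply/matrixP => i j; rewrite ord1 mxE; case: i => [[|[|[|i]]] Hi] //.
- by rewrite -[RHS]u0; congr (u _ _); apply/val_inj.
- by rewrite -[RHS]u1; congr (u _ _); apply/val_inj.
- by rewrite -[RHS]u2; congr (u _ _); apply/val_inj.
Qed.

Lemma perp_neg_gt0 v u : herm v v < 0 -> herm u v = 0 -> u != 0 -> 0 < Re (herm u u).
Proof.
move=> vneg uv u0; have [h1 h2] := perp_neg_ge0 vneg uv.
by rewrite lt_def h1 andbT; apply: contra u0 => /eqP/h2 ->.
Qed.

Lemma neg_not_perp v w : herm v v < 0 -> herm w w < 0 -> herm v w != 0.
Proof.
move=> vneg wneg; apply/negP => /eqP vw; have [] := perp_neg_ge0 wneg vw.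
by rewrite leNgt -herm_lt0 vneg.
Qed.

Lemma perp_decomp v u : herm v v != 0 -> herm (u - (herm u v / herm v v) *: v) v = 0.
Proof. by move=> v0; rewrite hermBl hermZl divfK // subrr. Qed.

Definition cols (a b c : 'cV[C]_3) : 'M[C]_3 := \matrix_(i, j) nth 0 [:: a i 0; b i 0; c i 0] j.

Lemma ord3P (P : 'I_3 -> Prop) : P 0 -> P 1 -> P 2%:R -> forall i, P i.
Proof.
move=> h0 h1 h2 [[|[|[|i]]] Hi] //.
- by rewrite (_ : Ordinal Hi = 0) //; apply/val_inj.
- by rewrite (_ : Ordinal Hi = 1) //; apply/val_inj.
- by rewrite (_ : Ordinal Hi = 2%:R) //; apply/val_inj.
Qed.

Lemma cols_mul a b c (x : 'cV[C]_3) : cols a b c *m x = x 0 0 *: a + (x 1 0 *: b + x 2%:R 0 *: c).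
Proof. by apply/matrixP => i j; rewrite ord1 !mxE sum3 !mxE /=; ring. Qed.

Lemma mul_cols A a b c : A *m cols a b c = cols (A *m a) (A *m b) (A *m c).
Proof.
by apply/matrixP => i; apply: ord3P; rewrite !mxE; apply: eq_bigr => k _; rewrite !mxE.
Qed.

Lemma cols_inj a b c a' b' c' : cols a b c = cols a' b' c' -> [/\ a = a', b = b' & c = c'].
Proof.
move=> /matrixP e; split; apply/matrixP => i j; rewrite ord1.
- by have := e i 0; rewrite !mxE.
- by have := e i 1; rewrite !mxE.
- by have := e i 2%:R; rewrite !mxE.
Qed.

Lemma cols_col A : A = cols (col 0 A) (col 1 A) (col 2%:R A).
Proof. by apply/matrixP => i; apply: ord3P; rewrite !mxE. Qed.

Lemma cols_eM (u v w : zvec) : cols (eV R u) (eV R v) (eV R w) = eM R (mcols u v w).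
Proof. by apply/matrixP; apply: ord3P; apply: ord3P; rewrite !mxE. Qed.

Lemma gram_mx A i j : (A^t* *m Jmx R *m A) i j = herm (col j A) (col i A).
Proof.
rewrite /herm -[in RHS]mulmxA -[LHS]/((A^t* *m Jmx R *m A) i j) -!mulmxA !mxE.
by apply: eq_bigr => k _; rewrite !mxE; congr (_ * _); apply: eq_bigr => l _; rewrite !mxE.
Qed.

End Geo.

(** * Characteristic polynomials and traces of elliptic isometries *)

Section Trace.
Variable R : realType.
Local Notation C := R[i].
Local Notation O := (isO R).
Local Notation Re := complex.Re.

Lemma tr3E (K : comNzRingType) (A : 'M[K]_3) : \tr A = A 0 0 + (A 1 1 + A 2%:R 2%:R).
Proof.
rewrite /mxtrace !big_ord_recl big_ord0 addr0; congr (_ + (_ + _)); congr (A _ _); exact/val_inj.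
Qed.

Lemma mulmx3E (K : comNzRingType) n m (A : 'M[K]_(m, 3)) (B : 'M[K]_(3, n)) i j :
  (A *m B) i j = A i 0 * B 0 j + (A i 1 * B 1 j + A i 2%:R * B 2%:R j).
Proof.
rewrite !mxE !big_ord_recl big_ord0 addr0; congr (_ + (_ * _ + _ * _)); congr (_ _ _); exact/val_inj.
Qed.

Definition minor_sum (K : comNzRingType) (A : 'M[K]_3) : K :=
  (A 0 0 * A 1 1 - A 0 1 * A 1 0) + ((A 0 0 * A 2%:R 2%:R - A 0 2%:R * A 2%:R 0)
  + (A 1 1 * A 2%:R 2%:R - A 1 2%:R * A 2%:R 1)).

Lemma Cayley_Hamilton3 (K : comNzRingType) (A : 'M[K]_3) :
  A *m A *m A = \tr A *: (A *m A) - minor_sum A *: A + (\det A)%:M.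
Proof.
have PE i j := mulmx3E A A i j; move: (A *m A) PE => P PE.
apply/matrixP; apply: ord3P; apply: ord3P; rewrite mulmx3E !mxE !PE tr3E det3E /minor_sum /= ?mulr0n ?mulr1n; ring.
Qed.

Lemma det_shift3 (K : comNzRingType) (A : 'M[K]_3) (x : K) :
  \det (A - x%:M) = \det A - minor_sum A * x + \tr A * x ^+ 2 - x ^+ 3.
Proof. rewrite !det3E !mxE /= ?mulr0n ?mulr1n tr3E /minor_sum; ring. Qed.

(** Cayley-Hamilton gives the inverse as A^2 - (tr A) A + e_2, where e_2 is the sum of the principal
    minors; take traces and use tr(A^2) = (tr A)^2 - 2 e_2. *)
Lemma minor_sum_inv (K : comNzRingType) (A B : 'M[K]_3) : A *m B = 1%:M -> \det A = 1 -> minor_sum A = \tr B.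
Proof.
move=> AB dA.
have : (A *m A *m A) *m B = (\tr A *: (A *m A) - minor_sum A *: A + (\det A)%:M) *m B by rewrite Cayley_Hamilton3.
rewrite mulmxDl mulmxBl -!scalemxAl -!(mulmxA _ A B) AB !mulmx1 mul_scalar_mx dA scale1r => e.
have /(congr1 mxtrace) : B = A *m A - \tr A *: A + (minor_sum A)%:M.
  by rewrite e -scalemx1; apply/matrixP => i j; rewrite !mxE; ring.
rewrite linearD linearB /= linearZ /= mxtrace_scalar => ->.
rewrite !tr3E !mulmx3E /minor_sum; ring.
Qed.

(** The matrix determinant lemma, with the adjugate of [A] written as a polynomial in [A]; it is
    applied below to the singular matrix A - l. *)
Lemma det_rank1_update (K : comNzRingType) (A : 'M[K]_3) (x : 'cV[K]_3) (y : 'rV[K]_3) :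
  \det (A + x *m y) = \det A + (y *m (A *m A - \tr A *: A + (minor_sum A)%:M) *m x) 0 0.
Proof.
have e1 i j : (x *m y) i j = x i 0 * y 0 j by rewrite mxE big_ord1.
have PE i j := mulmx3E A A i j; move: (A *m A) PE (x *m y) e1 => P PE M e1.
rewrite !det3E !mulmx3E !mxE !e1 !PE !tr3E /minor_sum /= ?mulr0n ?mulr1n; ring.
Qed.

Implicit Types (A : 'M[C]_3) (u v w : 'cV[C]_3).

Definition uni A := A^t* *m Jmx R *m A = Jmx R.

Lemma uni_herm A v w : uni A -> herm (A *m v) (A *m w) = herm v w.
Proof. by move=> h; rewrite /herm trmx_mul map_mxM -[in RHS]h !mulmxA. Qed.

(** The inverse of an isometry, written without division so that integrality is visible. *)
Definition uinv A := Jmx R *m A^t* *m Jmx R.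

Lemma uinvK A : uni A -> uinv A *m A = 1%:M.
Proof. by move=> h; rewrite /uinv -!mulmxA (mulmxA _ _ A) h Jmx_sq. Qed.
Lemma uinvKr A : uni A -> A *m uinv A = 1%:M.
Proof. by move=> /uinvK/mulmx1C. Qed.

Lemma uni_mul A B : uni A -> uni B -> uni (A *m B).
Proof.
move=> hA hB; rewrite /uni trmx_mul map_mxM !mulmxA -(mulmxA _ _ (Jmx R)) -(mulmxA _ (_ *m Jmx R)).
by rewrite hA.
Qed.
Lemma uni_one : uni 1%:M.
Proof. by rewrite /uni trmx1 map_mx1 mul1mx mulmx1. Qed.
Lemma uni_inv A : uni A -> uni (uinv A).
Proof.
move=> h; have e := uinvK h; have e' := uinvKr h.
have : (A *m uinv A)^t* *m Jmx R *m (A *m uinv A) = Jmx R.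
  by rewrite e' trmx1 map_mx1 mul1mx mulmx1.
have -> : (A *m uinv A)^t* *m Jmx R *m (A *m uinv A) = (uinv A)^t* *m (A^t* *m Jmx R *m A) *m uinv A.
  by rewrite trmx_mul map_mxM !mulmxA.
by rewrite h.
Qed.
Lemma Omx_uinv A : Omx A -> Omx (uinv A).
Proof. by move=> h; apply/Omx_mul/Omx_J/Omx_mul/Omx_tr => //; apply: Omx_J. Qed.
Lemma uni_opp A : uni A -> uni (- A).
Proof. by rewrite /uni => h; rewrite mulmxN linearN /= map_mxN !mulNmx opprK. Qed.
Lemma uni_adj A v w : uni A -> herm (A *m v) w = herm v (uinv A *m w).
Proof. by move=> h; rewrite -{1}(mul1mx w) -(uinvKr h) -mulmxA uni_herm. Qed.

Lemma tr_uinv A : \tr (uinv A) = (\tr A)^*%R.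
Proof.
rewrite /uinv mxtrace_mulC mulmxA Jmx_sq mul1mx.
by rewrite -map_trmx mxtrace_tr trace_map_mx.
Qed.

Lemma det_J : \det (Jmx R) = -1.
Proof. by rewrite det3E !mxE /=; ring. Qed.

Lemma uni_det A : uni A -> nsq (\det A) = 1.
Proof.
move=> h; have /(congr1 determinant) := h; rewrite !det_mulmx det_J det_map_mx det_tr.
by rewrite mulrN1 mulNr => /oppr_inj; rewrite mulrC -nsqE => /complexI.
Qed.

Section Unitary.
Variable A : 'M[C]_3.
Hypotheses (Au : uni A) (Ad : \det A = 1).
Local Notation a := (\tr A).

Lemma minor_uni : minor_sum A = a^*%R.
Proof. by rewrite (minor_sum_inv (uinvKr Au) Ad) tr_uinv. Qed.

Lemma CH_uni : A *m A *m A = a *: (A *m A) - a^*%R *: A + 1%:M.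
Proof. by rewrite Cayley_Hamilton3 minor_uni Ad. Qed.

Lemma eig_char (u : 'cV[C]_3) (x : C) : A *m u = x *: u -> u != 0 -> x ^+ 3 - a * x ^+ 2 + a^*%R * x - 1 = 0.
Proof.
move=> e u0; have := congr1 (fun M => M *m u) CH_uni.
rewrite mulmxDl mulmxBl -!scalemxAl -!mulmxA !(e, =^~ scalemxAr) mul1mx !scalerA => h.
have : (x ^+ 3 - a * x ^+ 2 + a^* * x - 1) *: u = 0.
  rewrite -[X in _ + X]scale1r -scalerBl -scalerDl in h.
  rewrite (_ : _ - 1 = x * x * x - (a * x * x - a^* * x + 1)); last by ring.
  by rewrite scalerBl h subrr.
by move/eqP; rewrite scaler_eq0 (negPf u0) orbF => /eqP.
Qed.

Lemma char_eig (x : C) : x ^+ 3 - a * x ^+ 2 + a^*%R * x - 1 = 0 -> exists2 u : 'cV[C]_3, u != 0 & A *m u = x *: u.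
Proof.
move=> h; have : \det (A - x%:M) == 0.
  by rewrite det_shift3 Ad minor_uni -oppr_eq0 -h; apply/eqP; ring.
rewrite -det_tr => /det0P[r r0]; rewrite linearB /= tr_scalar_mx mulmxBr mul_mx_scalar => /eqP.
rewrite subr_eq0 => /eqP e; exists r^T; first by rewrite trmx_eq0.
by rewrite -[A]trmxK -trmx_mul e linearZ.
Qed.

Variable v : 'cV[C]_3.
Variable l : C.
Hypotheses (vneg : herm v v < 0) (Av : A *m v = l *: v).

Let v0 : v != 0. Proof. exact: herm_neg_neq0. Qed.

Lemma eig_neg_unit : nsq l = 1.
Proof.
have := uni_herm v v Au; rewrite Av hermZl hermZr mulrA -nsqE => e.
by apply: complexI; apply: (mulIf (ltr0_neq0 vneg)); rewrite e mul1r.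
Qed.

Lemma eig_perp u : (herm (A *m u) v = l * herm u v).
Proof.
have lu := eig_neg_unit.
have l1 : l * l^*%R = 1 by rewrite -nsqE lu.
have -> : herm (A *m u) v = l * (herm (A *m u) (A *m v)).
  by rewrite Av hermZr mulrA l1 mul1r.
by rewrite uni_herm.
Qed.

(** An eigenvector not orthogonal to [v] has the eigenvalue of [v]; one orthogonal to [v] lies where
    the form is definite, hence has nonzero norm. *)
Lemma eig_unit u x : A *m u = x *: u -> u != 0 -> nsq x = 1.
Proof.
move=> Aux u0; have [uv|uv] := eqVneq (herm u v) 0; last first.
  have := eig_perp u; rewrite Aux hermZl => /(mulIf uv) ->; exact: eig_neg_unit.
have := uni_herm u u Au; rewrite Aux hermZl hermZr mulrA -nsqE => e.
have uu : herm u u != 0.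
  by rewrite gt_eqF // herm_gt0 (perp_neg_gt0 vneg).
by apply: complexI; apply: (mulIf uu); rewrite e mul1r.
Qed.

Lemma lam_char : l ^+ 3 - a * l ^+ 2 + a^*%R * l - 1 = 0.
Proof. exact: eig_char Av v0. Qed.

(** The derivative at [x] of the characteristic polynomial X^3 - a X^2 + conj(a) X - 1; it does not
    vanish at a root exactly when this eigenvalue is simple. *)
Definition disc_char (x : C) : C := 3%:R * x ^+ 2 - 2%:R * a * x + a^*%R.

(* The rank-one perturbation A - l + v v* J acts as <v,v> on v and as A - l on
   the orthogonal of v, so its determinant is <v,v> times chi'(l). *)
Lemma simple_eigP : (exists u, [/\ u != 0, herm u v = 0 & A *m u = l *: u]) <-> disc_char l = 0.
Proof.
pose B := A - l%:M + v *m (v^t* *m Jmx R).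
have Bu u : B *m u = A *m u - l *: u + herm u v *: v.
  rewrite mulmxDl mulmxBl mul_scalar_mx; congr (_ + _).
  by rewrite -mulmxA (mx11_scalar (_ *m u)) mul_mx_scalar.
have detB : \det B = herm v v * disc_char l.
  rewrite det_rank1_update; set A' := A - l%:M.
  have A'v : A' *m v = 0 by rewrite mulmxBl Av mul_scalar_mx subrr.
  have -> : \det A' = 0.
    by rewrite det_shift3 Ad minor_uni -[RHS]oppr0 -lam_char; ring.
  rewrite add0r -mulmxA.
  have -> : (A' *m A' - \tr A' *: A' + (minor_sum A')%:M) *m v = minor_sum A' *: v.
    by rewrite mulmxDl mulmxBl -mulmxA A'v mulmx0 -scalemxAl A'v scaler0 subr0 add0r mul_scalar_mx.
  rewrite -scalemxAr mxE mulrC; congr (_ * _).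
  have trA : a = A 0 0 + (A 1 1 + A 2%:R 2%:R) by exact: tr3E.
  have mA := minor_uni; rewrite /disc_char -mA trA /minor_sum !mxE /= ?mulr1n ?mulr0n; ring.
split=> [[u [u0 uv Aul]]|d0].
  have /eqP : \det B = 0.
    apply/eqP; rewrite -det_tr; apply/det0P; exists u^T; first by rewrite trmx_eq0.
    by rewrite -trmx_mul Bu Aul subrr uv scale0r addr0 trmx0.
  by rewrite detB mulf_eq0 (negPf (ltr0_neq0 vneg)) /= => /eqP.
have : \det B == 0 by rewrite detB d0 mulr0.
rewrite -det_tr => /det0P[r r0] e.
have {e} : B *m r^T = 0 by rewrite -[B]trmxK -trmx_mul e trmx0.
(* A - l maps into the orthogonal of v, so pairing B r = 0 with v leaves <r,v> <v,v> = 0. *)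
rewrite Bu => e; have uv : herm r^T v = 0.
  have := congr1 (fun z => herm z v) e.
  rewrite herm0l hermDl hermBl hermZl hermZl eig_perp subrr add0r => /eqP.
  by rewrite mulf_eq0 (negPf (ltr0_neq0 vneg)) orbF => /eqP.
exists r^T; split; rewrite ?trmx_eq0 //; apply/eqP; rewrite -subr_eq0.
by rewrite uv scale0r addr0 in e; rewrite e.
Qed.

End Unitary.
End Trace.

Definition znorm (p : ZO) : BinNums.Z :=
  BinInt.Z.add (BinInt.Z.add (BinInt.Z.mul p.1 p.1) (BinInt.Z.mul p.1 p.2)) (BinInt.Z.mul 2 (BinInt.Z.mul p.2 p.2)).
Definition ztrace (p : ZO) : BinNums.Z := BinInt.Z.add (BinInt.Z.mul 2 p.1) p.2.

Local Open Scope Z_scope.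
Definition elliptic_traces : seq ZO := [:: (3, 0); (-1, 0); (0, 0); (1, 0); (2, 0); (0, -1); (-1, 1)].

(** With N the norm and T the trace of a = x + y tau, the second inequality is N^2 - 8 Re(a^3) + 18
    N - 27 <= 0, because 2 Re(a^3) = T^3 - 3 N T. The first confines a to a finite box. *)
Lemma elliptic_traces_enum (x y : BinNums.Z) :
  x * x + x * y + 2 * (y * y) <= 9 ->
  (x * x + x * y + 2 * (y * y)) * (x * x + x * y + 2 * (y * y))
  - 4 * ((2 * x + y) * (2 * x + y) * (2 * x + y)) + 12 * (x * x + x * y + 2 * (y * y)) * (2 * x + y)
  + 18 * (x * x + x * y + 2 * (y * y)) - 27 <= 0 -> (x, y) \in elliptic_traces.
Proof.
move=> hN hf; have /andP[y1 y2] : -2 <= y <= 2 by nia.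
have /andP[x1 x2] : -4 <= x <= 4 by nia.
have hy : y = -2 \/ y = -1 \/ y = 0 \/ y = 1 \/ y = 2 by lia.
have hx : x = -4 \/ x = -3 \/ x = -2 \/ x = -1 \/ x = 0 \/ x = 1 \/ x = 2 \/ x = 3 \/ x = 4 by lia.
clear y1 y2 x1 x2; move: hN hf.
by case: hy => [|[|[|[|]]]] ->; case: hx => [|[|[|[|[|[|[|[|]]]]]]]] ->; vm_compute.
Qed.
Local Close Scope Z_scope.

Section TraceList.
Variable R : realType.
Local Notation C := R[i].
Local Notation O := (isO R).
Local Notation Re := complex.Re.

Lemma nsq_zc p : nsq (zc R p) = (int_of_Z (znorm p))%:~R.
Proof.
by rewrite /zc nsqO; congr (_%:~R); rewrite /znorm !expr2; lia.
Qed.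

Lemma Re_zc p : Re (zc R p) * 2 = (int_of_Z (ztrace p))%:~R.
Proof.
rewrite /zc Ocoord /= /ztrace.
have -> : int_of_Z (BinInt.Z.add (BinInt.Z.mul 2 p.1) p.2) = 2 * int_of_Z p.1 + int_of_Z p.2 by lia.
by rewrite intrD intrM; field; rewrite ?pnatr_eq0.
Qed.

Lemma nsq_parallelogram (x y : C) : nsq (x + y) + nsq (x - y) = 2 * nsq x + 2 * nsq y.
Proof. by case: x y => [a b] [c d]; rewrite /nsq /=; ring. Qed.

Lemma nsq_unit_inv (l : C) : nsq l = 1 -> l != 0 /\ l^*%R = l^-1.
Proof.
move=> n1; have l0 : l != 0 by rewrite -nsq_eq0 n1 oner_eq0.
by split=> //; apply: (mulfI l0); rewrite -nsqE n1 mulfV.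
Qed.

(** The left side is the discriminant of (X - l) q(X), where q = X^2 - s X + conj(l); it equals
    disc(q) q(l)^2. The relation conj(s) = s l gives disc(q) = conj(l) (|s|^2 - 4) and q(l)^2 = l
    |q(l)|^2. *)
Lemma deltoid_identity (a s l : C) : l != 0 -> l^*%R = l^-1 -> s^*%R = s * l -> a = s + l ->
  nsq a ^+ 2 - 8 * Re (a ^+ 3) + 18 * nsq a - 27 = - ((4 - nsq s) * nsq (l ^+ 2 - s * l + l^*%R)).
Proof.
move=> l0 lc h aE; have acE : a^*%R = s * l + l^-1 by rewrite {1}aE rmorphD /= h lc.
have ReE (z : C) : (Re z)%:C%C = (z + z^*%R) / 2.
  by case: z => x y; apply/eqP; rewrite eq_complex /=; apply/andP; split; apply/eqP; field; rewrite ?pnatr_eq0.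
have e1 := nsqE a; have e2 := nsqE s; have e3 := nsqE (l ^+ 2 - s * l + l^*%R); have e4 := ReE (a ^+ 3).
apply: complexI; move: (nsq a) (nsq s) (nsq (l ^+ 2 - s * l + l^*%R)) (Re (a ^+ 3)) e1 e2 e3 e4 => N1 N2 N3 N4 e1 e2 e3 e4.
rewrite !(rmorphB, rmorphD, rmorphM, rmorphXn) /= ?conjCK ?acE ?h lc in e1 e2 e3 e4.
rewrite !(rmorphB, rmorphD, rmorphM, rmorphN, rmorphXn, rmorph_nat) /= e1 e2 e3 e4 aE.
by field; rewrite ?l0 ?pnatr_eq0.
Qed.

Variable A : 'M[C]_3.
Hypotheses (Au : uni A) (Ad : \det A = 1).
Variables (v : 'cV[C]_3) (l : C).
Hypotheses (vneg : herm v v < 0) (Av : A *m v = l *: v).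
Local Notation a := (\tr A).
Let s := a - l.

Lemma conj_s : s^*%R = s * l.
Proof.
have [l0 lc] := nsq_unit_inv (eig_neg_unit Au vneg Av).
have := lam_char Au Ad vneg Av; rewrite rmorphB /= lc => h.
apply: (mulfI l0); rewrite mulrBr mulfV //.
by apply/eqP; rewrite -subr_eq0 -h /s; apply/eqP; ring.
Qed.

Lemma char_factor (x : C) : x ^+ 3 - a * x ^+ 2 + a^*%R * x - 1 = (x - l) * (x ^+ 2 - s * x + l^*%R).
Proof.
have [l0 lc] := nsq_unit_inv (eig_neg_unit Au vneg Av).
have h := conj_s; have aE : a = s + l by rewrite /s subrK.
have acE : a^*%R = s * l + l^-1 by rewrite {1}aE rmorphD /= h lc.
by rewrite acE aE lc; field.
Qed.

Lemma other_eigs : exists m1 m2 : C, [/\ m1 + m2 = s, m1 * m2 = l^*%R, nsq m1 = 1 & nsq m2 = 1].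
Proof.
pose r : C := sqrtC (s ^+ 2 - 4 * l^*%R).
have rr : r ^+ 2 = s ^+ 2 - 4 * l^*%R by rewrite sqrtCK.
have two0 : (2 : C) != 0 by rewrite pnatr_eq0.
pose m1 := (s + r) / 2; pose m2 := (s - r) / 2.
have e1 : m1 + m2 = s by rewrite /m1 /m2; field.
have e2 : m1 * m2 = l^*%R.
  transitivity ((s ^+ 2 - r ^+ 2) / 4); first by rewrite /m1 /m2; field; rewrite ?pnatr_eq0.
  by rewrite rr; field; rewrite ?pnatr_eq0.
have root m : m = m1 \/ m = m2 -> nsq m = 1.
  move=> hm; have : m ^+ 3 - a * m ^+ 2 + a^*%R * m - 1 = 0.
    rewrite char_factor -e1 -e2; case: hm => ->; ring.
  case/(char_eig Au Ad) => u u0 e; exact: (eig_unit Au vneg Av e u0).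
by exists m1, m2; split=> //; apply: root; [left|right].
Qed.

Lemma nsq_s : nsq s <= 4.
Proof.
have [m1 [m2 [<- _ n1 n2]]] := other_eigs.
have := nsq_parallelogram m1 m2; rewrite n1 n2; have := nsq_ge0 (m1 - m2); lra.
Qed.

Lemma nsq_tr : nsq a <= 9.
Proof.
have h1 := nsq_s; have n1 := eig_neg_unit Au vneg Av.
have h2 : nsq a = nsq l + nsq s + (nsq l * 4 + nsq s - nsq (2 * l - s)) / 2.
  have -> : a = s + l by rewrite /s subrK.
  by case: l s => [x y] [z t]; rewrite /nsq /=; field; rewrite ?pnatr_eq0.
by rewrite h2 n1; have := nsq_ge0 (2 * l - s); lra.
Qed.

(* The discriminant of the characteristic polynomial has constant sign on
   elliptic elements; this is Goldman's deltoid inequality. *)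
Lemma deltoid : nsq a ^+ 2 - 8 * Re (a ^+ 3) + 18 * nsq a - 27 <= 0.
Proof.
have [l0 lc] := nsq_unit_inv (eig_neg_unit Au vneg Av).
rewrite (deltoid_identity l0 lc conj_s) ?subrK //.
by rewrite oppr_le0 mulr_ge0 ?nsq_ge0 // subr_ge0 nsq_s.
Qed.

Hypothesis AO : Omx A.

Lemma elliptic_trace : exists2 p : ZO, p \in elliptic_traces & a = zc R p.
Proof.
have /isO_zc[p pE] : a \in O by rewrite rpred_sum.
exists p => //; have h1 := nsq_tr; have h2 := deltoid.
have Re3 (z : C) : Re (z ^+ 3) * 2 = (Re z * 2) ^+ 3 - 3 * nsq z * (Re z * 2).
  by case: z => x y; rewrite /nsq 2!exprS expr1 /=; ring.
have h3 : 8 * Re (a ^+ 3) = 4 * ((Re a * 2) ^+ 3 - 3 * nsq a * (Re a * 2)) by rewrite -Re3; ring.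
rewrite h3 pE nsq_zc Re_zc in h2; rewrite pE nsq_zc in h1.
rewrite (_ : 9 = 9%:~R) // ler_int in h1.
have {}h2 : (int_of_Z (znorm p)) ^+ 2 - 4 * ((int_of_Z (ztrace p)) ^+ 3 - 3 * int_of_Z (znorm p) * int_of_Z (ztrace p)) + 18 * int_of_Z (znorm p) - 27 <= 0.
  by rewrite -(ler_int R) !(intrB, intrD, intrM, rmorphXn) /=.
case: p {pE h3} => x y in h1 h2 *; apply: elliptic_traces_enum; rewrite /znorm /ztrace !exprS !expr0 in h1 h2 *; cbn [fst snd] in h1, h2 |- *; lia.
Qed.

End TraceList.

(** * The action on the ball *)

Section Bridge.
Variable R : realType.
Local Notation C := R[i].
Local Notation O := (isO R).
Local Notation Re := complex.Re.
Implicit Types (A B : 'M[C]_3) (u v w : 'cV[C]_3) (x y : H2 R) (g : PU R).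

Lemma nsqO_unit z : z \in O -> nsq z = 1 -> z = 1 \/ z = -1.
Proof.
move=> /isO_zc[[a b] ->]; rewrite nsq_zc => /eqP; rewrite (_ : 1 = 1%:~R) // eqr_int => /eqP.
rewrite /znorm; cbn [fst snd] => h.
have b0 : b = 0 by nia.
have [a1|a1] : a = 1 \/ a = -1 by nia.
  by left; rewrite a1 b0 zc1.
by right; rewrite a1 b0 -zc1 -zcN.
Qed.

Lemma uni_isUJ A : uni A -> isUJ A. Proof. exact: isUJ_of. Qed.
Lemma UJ_uni (A : UJ R) : uni (val A). Proof. exact: UJ_form. Qed.
Lemma uni_unit A : uni A -> A \in unitmx. Proof. by move/uni_isUJ/andP => []. Qed.

(** The class of a matrix. Outside U(J) it takes the default value 1, so the facts about it assume
    [uni]. *)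
Definition piU A : PU R := \pi_(PU R) (insubd (UJ1 R) A).

Lemma val_insubU A : uni A -> val (insubd (UJ1 R) A) = A.
Proof. by move=> h; rewrite insubdK //; apply: uni_isUJ. Qed.
Lemma piU_val (A : UJ R) : piU (val A) = \pi_(PU R) A.
Proof. by rewrite /piU valKd. Qed.
Lemma piU_mul A B : uni A -> uni B -> piU (A *m B) = (piU A * piU B)%g.
Proof.
move=> hA hB; rewrite /piU -pi_PUM; congr (\pi _); apply/val_inj.
transitivity (A *m B); first exact: val_insubU (uni_mul hA hB).
by rewrite -{1}(val_insubU hA) -{1}(val_insubU hB).
Qed.
Lemma piU_one : piU 1%:M = 1%g.
Proof. by rewrite -[1%:M]/(val (UJ1 R)) piU_val. Qed.
Lemma piU_inv A : uni A -> piU (uinv A) = (piU A)^-1%g.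
Proof.
move=> h; apply: (mulgI (piU A)); rewrite -(piU_mul h (uni_inv h)) uinvKr //.
by rewrite piU_one mulgV.
Qed.
Lemma piU_eq A B : uni A -> uni B -> piU A = piU B <-> exists2 c : C, c != 0 & A = c *: B.
Proof. by move=> hA hB; rewrite /piU pi_PU_eq !val_insubU. Qed.
Lemma piU_exp A k : uni A -> piU (A ^+ k) = (piU A ^+ k)%g.
Proof.
move=> h; have hk n : uni (A ^+ n).
  by elim: n => [|n IH]; [exact: uni_one|rewrite exprS; apply: uni_mul].
elim: k => [|k IH]; first by rewrite expr0 expg0 -piU_one.
by rewrite exprS expgS -IH -piU_mul.
Qed.
Lemma uni_exp A k : uni A -> uni (A ^+ k).
Proof. by move=> h; elim: k => [|n IH]; [exact: uni_one|rewrite exprS; apply: uni_mul]. Qed.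

Lemma uniN A : uni A -> piU (- A) = piU A.
Proof.
move=> h; apply/(piU_eq (uni_opp h) h).
by exists (-1); rewrite ?oppr_eq0 ?oner_eq0 ?scaleN1r.
Qed.

Lemma scale_unit_entry A c : uni A -> Omx A -> Omx (c *: A) -> c \in O.
Proof.
move=> hA AO cO; have : Omx (c *: A *m uinv A) by apply: Omx_mul => //; exact: Omx_uinv.
by rewrite -scalemxAl uinvKr // scalemx1 => /(_ 0 0); rewrite mxE eqxx.
Qed.

Lemma uni_scale_unit A c : uni A -> uni (c *: A) -> nsq c = 1.
Proof.
rewrite /uni => hA.
have -> : (c *: A)^t* = c^*%R *: A^t* by apply/matrixP => i j; rewrite !mxE rmorphM.
rewrite -!scalemxAl -scalemxAr scalerA hA => /matrixP/(_ 1 1).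
by rewrite !mxE /= mulr1 mulrC -nsqE => /complexI.
Qed.

Lemma piU_eqO A B : uni A -> uni B -> Omx A -> Omx B -> piU A = piU B <-> A = B \/ A = - B.
Proof.
move=> hA hB AO BO; split=> [/(piU_eq hA hB)[c c0 e]|[->//|->]]; last exact: uniN.
rewrite e in hA AO *.
have [->|->] := nsqO_unit (scale_unit_entry hB BO AO) (uni_scale_unit hB hA).
  by left; rewrite scale1r.
by right; rewrite scaleN1r.
Qed.

Lemma GammaP g : Gamma 7 g <-> exists A, [/\ uni A, Omx A & g = piU A].
Proof.
split=> [[A [_ hA _] <-]|[A [hA AO ->]]].
  by exists (val A); split; [exact: UJ_uni|move=> i j; apply/ringO_isO/hA|rewrite piU_val].
exists (insubd (UJ1 R) A) => //; split; rewrite val_insubU //.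
- exact: uni_unit.
- by move=> i j; apply/ringO_isO/AO.
- move=> i j; apply/ringO_isO; suff -> : invmx A = uinv A by apply: Omx_uinv.
  by rewrite -[LHS]mul1mx -(uinvK hA) mulmxK // uni_unit.
Qed.

Lemma Omx_det A : Omx A -> \det A \in O.
Proof. by move=> h; rewrite det3E !(rpredD, rpredN, rpredM, h). Qed.

(** The determinant is a unit of Z[tau] of modulus 1, hence 1 or -1, and -A has the opposite
    determinant in dimension 3. *)
Lemma GammaP1 g : Gamma 7 g <-> exists A, [/\ uni A, Omx A, \det A = 1 & g = piU A].
Proof.
split=> [/GammaP[A [hA AO ->]]|[A [hA AO _ ->]]]; last by apply/GammaP; exists A.
have [d|d] := nsqO_unit (Omx_det AO) (uni_det hA); first by exists A.
exists (- A); split; rewrite ?uniN //; [exact: uni_opp|exact: Omx_opp|].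
by rewrite -scaleN1r detZ d; ring.
Qed.

Lemma line_exists v : herm v v < 0 -> exists x, is_line_of x v.
Proof. by move=> h; exists (\pi_(H2 R) (MkNegvec h)), (MkNegvec h). Qed.
Lemma line_of x : exists v, is_line_of x v.
Proof. by exists (val (repr x)); exists (repr x); rewrite ?reprK. Qed.
Lemma line_neg x v : is_line_of x v -> herm v v < 0.
Proof. by move=> [u <- _]; case: u. Qed.
Lemma line_eq x y v w : is_line_of x v -> is_line_of y w -> x = y <-> exists2 c : C, c != 0 & v = c *: w.
Proof. by move=> [u <- ->] [u' <- ->]; rewrite pi_H2_eq. Qed.
Lemma act_line x v A : is_line_of x v -> uni A -> is_line_of (act (piU A) x) (A *m v).
Proof.
move=> [u <- ->] hA; exists (UJact (insubd (UJ1 R) A) u); rewrite ?act_pi //=.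
by rewrite val_insubU.
Qed.
Lemma act_fix x v A : is_line_of x v -> uni A -> act (piU A) x = x <-> exists c : C, A *m v = c *: v.
Proof.
move=> xv hA; rewrite (line_eq (act_line xv hA) xv); split=> [[c _ e]|[c e]]; exists c => //.
apply: contraTneq (line_neg (act_line xv hA)) => c0.
by rewrite e c0 scale0r herm0l ltxx.
Qed.

Lemma isotropyP x v g : is_line_of x v ->
  isotropy 7 x g <-> exists A c, [/\ uni A, Omx A, \det A = 1, A *m v = c *: v & g = piU A].
Proof.
move=> xv; split=> [[/GammaP1[A [hA AO dA ->]]]|[A [c [hA AO dA e ->]]]].
  by case/(act_fix xv hA) => c e; exists A, c.
by split; [apply/GammaP1; exists A|apply/(act_fix xv hA); exists c].
Qed.

Lemma gt0_complex (e : C) : 0 < e -> exists2 r : R, 0 < r & e = r%:C%C.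
Proof. by case: e => a b; rewrite ltcE /= => /andP[/eqP -> a0]; exists a. Qed.

Lemma open_line (W : set 'cV[C]_3) v u : open W -> W v ->
  exists2 e : R, 0 < e & forall c : R, `|c| < e -> W (v + c%:C%C *: u).
Proof.
move=> oW Wv; have /nbhs_ballP[e e0 h] : nbhs v W by apply: open_nbhs_nbhs.
have [r r0 eE] := gt0_complex e0.
pose N := \sum_i Num.sqrt (nsq (u i 0)) + 1.
have N0 : 0 < N by rewrite ltr_wpDl // sumr_ge0 // => i _; exact: sqrtr_ge0.
exists (r / N); first by rewrite divr_gt0.
move=> c cle; apply: h; split; first exact: e0.
move=> i j; rewrite ord1 !mxE; change (`|v i 0 - (v i 0 + c%:C%C * u i 0)| < e).
rewrite opprD addrA subrr add0r normrN normrM eE !normc_def /= expr0n addr0 sqrtr_sqr -rmorphM ltcR.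
have le : Num.sqrt (nsq (u i 0)) <= N.
  rewrite /N (bigD1 i) //= -addrA lerDl addr_ge0 // sumr_ge0 // => k _; exact: sqrtr_ge0.
apply: le_lt_trans (_ : `|c| * N < r); first by rewrite ler_wpM2l.
by rewrite -ltr_pdivlMr.
Qed.

(** Each element of [S] acts by a scalar on the span of v and u, hence fixes all points v + c u; for
    small real c > 0 these are negative, close to x, and different from x. *)
Lemma not_isolated (S : set (PU R)) x v u : is_line_of x v -> u != 0 -> herm u v = 0 ->
  (forall g, S g -> exists A l, [/\ uni A, g = piU A, A *m v = l *: v & A *m u = l *: u]) ->
  ~ isolated (fixed_points S) x.
Proof.
move=> xv u0 uv hS [_ [V Vx VS]].
have [U [oU Ux] UV] : exists2 U : set (H2 R), open U /\ U x & U `<=` V.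
  by move: Vx; rewrite nbhsE => -[U [oU Ux] UV]; exists U.
have [W oW WU] := (open_H2E U).1 oU.
have [v' v'E x'E] := xv.
have Wv : W v.
  by rewrite -v'E; have : (val @^-1` W) v' by rewrite WU /preimage /= -x'E.
have [e e0 eW] := open_line u oW Wv.
have vneg := line_neg xv.
have up : 0 < Re (herm u u) by apply: perp_neg_gt0 vneg uv u0.
pose q := - Re (herm v v); have q0 : 0 < q by rewrite oppr_gt0 -herm_lt0.
(* The first bound keeps the point in the neighbourhood. The other two give c^2 <u,u> <= c <u,u> <=
   q/2, so that the perturbed vector stays negative. *)
pose c := Num.min (e / 2) (Num.min 1 (q / (2 * Re (herm u u)))).
have c0 : 0 < c by rewrite !lt_min !divr_gt0 // ?mulr_gt0 // ?ltr0n // ltr01.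
have ce : `|c| < e.
  rewrite gtr0_norm // /c gt_min; apply/orP; left; lra.
have cneg : herm (v + c%:C%C *: u) (v + c%:C%C *: u) < 0.
  have vu := herm_perpC uv.
  rewrite hermDl !hermDr !hermZl !hermZr uv vu !mulr0 addr0 add0r.
  rewrite [herm v v]herm_real [herm u u]herm_real.
  have -> : (c%:C%C)^*%R = c%:C%C by apply/eqP; rewrite eq_complex /= oppr0 !eqxx.
  rewrite -!rmorphM -rmorphD ltcR.
  have c1 : c <= 1 by rewrite /c !ge_min lexx orbT.
  have c2 : c * (2 * Re (herm u u)) <= q.
    by rewrite -ler_pdivlMr ?mulr_gt0 // /c !ge_min lexx !orbT.
  move: c1 c2 q0 up c0; rewrite /q; move: (Re (herm v v)) (Re (herm u u)) => a b; nra.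
have [y yv] := line_exists cneg.
have Uy : U y.
  have [v2 v2E y2E] := yv.
  have : (val @^-1` W) v2 by rewrite /preimage /= v2E; apply: eW.
  by rewrite WU /preimage /= -y2E.
have Fy : fixed_points S y.
  move=> g /hS[A [l [hA -> Av Aul]]]; apply/(act_fix yv hA); exists l.
  by rewrite mulmxDr -scalemxAr Av Aul scalerDr !scalerA mulrC.
have : y = x.
  have : (V `&` fixed_points S) y by split=> //; apply: UV.
  by rewrite VS.
case/(line_eq yv xv) => d d0 e1.
have : (d - 1) *: v = c%:C%C *: u.
  by rewrite scalerBl scale1r -e1 addrC addKr.
move/(congr1 (fun z => herm z u)); rewrite !hermZl (herm_perpC uv) mulr0 => /esym/eqP.
rewrite mulf_eq0 (inj_eq (@complexI _) _ 0) (gt_eqF c0) /=.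
by rewrite gt_eqF // herm_gt0.
Qed.

Lemma det_cols0 (a b c : 'cV[C]_3) : \det (cols a b c) = 0 ->
  exists x : 'cV[C]_3, x != 0 /\ x 0 0 *: a + (x 1 0 *: b + x 2%:R 0 *: c) = 0.
Proof.
move=> /eqP; rewrite -det_tr => /det0P[r r0 e]; exists r^T; rewrite trmx_eq0; split=> //.
by rewrite -cols_mul -[cols _ _ _]trmxK -trmx_mul e trmx0.
Qed.

Lemma perp_dep v u1 u2 : herm v v < 0 -> herm u1 v = 0 -> herm u2 v = 0 -> u1 != 0 ->
  \det (cols v u1 u2) = 0 -> exists c : C, u2 = c *: u1.
Proof.
move=> vneg h1 h2 u10 /det_cols0[x [x0 e]].
have x00 : x 0 0 = 0.
  have := congr1 (fun z => herm z v) e.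
  rewrite herm0l !hermDl !hermZl h1 h2 !mulr0 !addr0 => /eqP.
  by rewrite mulf_eq0 (negPf (ltr0_neq0 vneg)) orbF => /eqP.
rewrite x00 scale0r add0r in e.
have x20 : x 2%:R 0 != 0.
  apply: contra x0 => /eqP x2; move: e; rewrite x2 scale0r addr0 => /eqP.
  rewrite scaler_eq0 (negPf u10) orbF => /eqP x1; apply/eqP/matrixP => i j; rewrite ord1 [RHS]mxE.
  by move: i; apply: ord3P.
exists (- (x 1 0 / x 2%:R 0)); apply: (scalerI x20).
rewrite scalerA mulrN mulrCA mulfV // mulr1 scaleNr; apply/eqP.
by rewrite -addr_eq0 addrC e.
Qed.

Lemma perp_span v u1 u2 w : \det (cols v u1 u2) != 0 -> exists a b c : C, w = a *: v + (b *: u1 + c *: u2).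
Proof.
move=> d; pose x := invmx (cols v u1 u2) *m w.
exists (x 0 0), (x 1 0), (x 2%:R 0); rewrite -cols_mul mulKVmx // unitmxE unitfE //.
Qed.

(** After division by the eigenvalue at v, the stabiliser acts on the orthogonal of v as a subgroup
    of U(2). If every element has eigenvalue 1 there, all share a fixed vector, contradicting
    [not_isolated]: suppose A fixes u, B fixes another line uB and AB fixes w; then B w - w is
    orthogonal to u and to uB, hence zero, so A and B both fix w. Either w is on the line of u, and
    B fixes u, or A is the identity. *)
Lemma isolated_regular x v : is_line_of x v -> isolated (fixed_points (isotropy 7 x)) x ->
  exists A l, [/\ uni A, Omx A, \det A = 1, A *m v = l *: v & disc_char A l != 0].
Proof.
move=> xv iso; apply: contrapT => none.
have vneg := line_neg xv; have v0 := herm_neg_neq0 vneg.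
pose G (A : 'M[C]_3) (l : C) := [/\ uni A, Omx A, \det A = 1 & A *m v = l *: v].
have GM A l B m : G A l -> G B m -> G (A *m B) (l * m).
  move=> [a1 a2 a3 a4] [b1 b2 b3 b4]; split; rewrite ?det_mulmx ?a3 ?b3 ?mulr1 //.
  - exact: uni_mul.
  - exact: Omx_mul.
  - by rewrite -mulmxA b4 -scalemxAr a4 scalerA mulrC.
have ev A l : G A l -> exists u, [/\ u != 0, herm u v = 0 & A *m u = l *: u].
  move=> [a1 a2 a3 a4]; apply/(simple_eigP a1 a3 vneg a4)/eqP/negPn/negP => h.
  by apply: none; exists A, l.
suff [u [u0 uv hu]] : exists u, [/\ u != 0, herm u v = 0 & forall A l, G A l -> A *m u = l *: u].
  apply: (not_isolated xv u0 uv _ iso) => g /(isotropyP _ xv)[A [l [a1 a2 a3 a4 ->]]].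
  by exists A, l; split=> //; apply: hu.
have [triv|] := pselect (forall A l, G A l -> A = l%:M).
  (* When all elements are scalar, any vector orthogonal to v serves; applying [ev] to the identity
     provides one. *)
  have [u [u0 uv _]] : exists u, [/\ u != 0, herm u v = 0 & 1%:M *m u = 1 *: u].
    apply: ev; split; rewrite ?det1 ?mul1mx ?scale1r //; [exact: uni_one|exact: Omx_one].
  by exists u; split=> // A l /triv ->; rewrite mul_scalar_mx.
move=> /existsNP[A /existsNP[l /not_implyP[GA nA]]].
have [u [u0 uv Aul]] := ev A l GA; exists u; split=> // B m GB; apply: contrapT => nB.
have [a1 a2 a3 a4] := GA; have [b1 b2 b3 b4] := GB.
have nl := eig_neg_unit a1 vneg a4; have nm := eig_neg_unit b1 vneg b4.
have [l0 lc] := nsq_unit_inv nl; have [m0 mc] := nsq_unit_inv nm.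
have [w [w0 wv ABw]] := ev _ _ (GM _ _ _ _ GA GB).
have [uB [uB0 uBv BuB]] := ev B m GB.
have indep : \det (cols v u uB) != 0.
  apply/negP => /eqP d; have [c cE] := perp_dep vneg uv uBv u0 d.
  have c0 : c != 0 by apply: contraNneq uB0 => c0; rewrite cE c0 scale0r.
  apply: nB; apply: (scalerI c0); rewrite scalemxAr -cE BuB cE !scalerA mulrC //.
pose z := B *m w - m *: w.
have zv : herm z v = 0 by rewrite hermBl hermZl (eig_perp b1 vneg b4) wv !mulr0 subrr.
have zuB : herm z uB = 0.
  rewrite hermBl hermZl; apply/eqP; rewrite subr_eq0; apply/eqP.
  have := uni_herm w uB b1; rewrite BuB hermZr mc => h.
  by rewrite -h mulrA mulfV // mul1r.
have zu : herm z u = 0.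
  rewrite hermBl hermZl; apply/eqP; rewrite subr_eq0; apply/eqP.
  have := uni_herm (B *m w) u a1; rewrite mulmxA ABw Aul hermZl hermZr lc => <-.
  by rewrite mulrACA mulfV // mul1r.
have z0 : z = 0.
  apply/eqP/negPn/negP => z0; have := perp_neg_gt0 vneg zv z0.
  have [a [b [c e]]] := perp_span z indep.
  by rewrite {2}e !hermDr !hermZr zv zu zuB !mulr0 !addr0 ltxx.
have Bw : B *m w = m *: w by apply/eqP; rewrite -subr_eq0 -/z z0.
have Aw : A *m w = l *: w.
  by apply: (scalerI m0); rewrite scalemxAr -Bw mulmxA ABw scalerA mulrC.
have [d|d] := eqVneq (\det (cols v u w)) 0.
  have [c cE] := perp_dep vneg uv wv u0 d.
  have c0 : c != 0 by apply: contraNneq w0 => c0; rewrite cE c0 scale0r.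
  by apply: nB; apply: (scalerI c0); rewrite scalemxAr -cE Bw cE !scalerA mulrC.
apply: nA; have e : A *m cols v u w = l%:M *m cols v u w.
  by rewrite !mul_cols !mul_scalar_mx a4 Aul Aw.
by rewrite -[A](mulmxK (_ : cols v u w \in unitmx)) ?e ?mulmxK // unitmxE unitfE.
Qed.

End Bridge.

Local Opaque herm.

(** * Orbits of points of finite order *)

Section Lattice.
Variable R : realType.
Local Notation C := R[i].
Local Notation O := (isO R).
Local Notation Re := complex.Re.
Implicit Types (A B : 'M[C]_3) (u v w x y r : 'cV[C]_3).

Lemma O_real_int z : z \in O -> z = (Re z)%:C%C -> exists n : int, z = n%:~R.
Proof.
move=> /isOP[a [b zE]]; rewrite zE Ocoord => -[e]; exists a.
have b0 : (b%:~R : R) = 0.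
  apply: (@mulIf _ (Num.sqrt 7 / 2)); first by rewrite mulf_neq0 ?invr_eq0 ?pnatr_eq0 // gt_eqF // sqrtr_gt0 ltr0n.
  by rewrite mulrA e mul0r.
by rewrite b0 !mul0r addr0 -(rmorph_int (real_complex R)).
Qed.

Lemma intC_Re (n : int) : Re (n%:~R : C) = n%:~R.
Proof. by rewrite -(rmorph_int (real_complex R)). Qed.

Lemma herm_O u w : Omx u -> Omx w -> herm u w \in O.
Proof. by move=> hu hw; rewrite hermE !(rpredD, rpredM) ?isO_conj ?hu ?hw. Qed.

Lemma herm_int u : Omx u -> exists n : int, herm u u = n%:~R.
Proof. by move=> hu; apply: O_real_int (herm_real u); exact: herm_O. Qed.

Lemma herm_posnat u : Omx u -> 0 < Re (herm u u) -> exists2 k : nat, (0 < k)%N & Re (herm u u) = k%:R.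
Proof.
move=> /herm_int[n ->]; rewrite intC_Re ltr0z; case: n => // n n0; by exists n.
Qed.

Lemma col_cols (a b c : 'cV[C]_3) : [/\ col 0 (cols a b c) = a, col 1 (cols a b c) = b & col 2%:R (cols a b c) = c].
Proof. by split; apply/matrixP => i j; rewrite ord1 !mxE. Qed.

Lemma gram_det (a b c : 'cV[C]_3) : - (nsq (\det (cols a b c)))%:C%C =
  herm a a * (herm b b * herm c c - herm c b * herm b c) +
  (herm b a * (herm c b * herm a c - herm a b * herm c c) +
   herm c a * (herm a b * herm b c - herm b b * herm a c)).
Proof.
set B := cols a b c; transitivity (\det (B^t* *m Jmx R *m B)).
  rewrite !det_mulmx det_J det_map_mx det_tr nsqE; ring.
by rewrite det3E !gram_mx; have [-> -> ->] := col_cols a b c.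
Qed.

Lemma det_cols_lin y r1 r2 (a b c : C) :
  \det (cols (a *: y + (b *: r1 + c *: r2)) r1 r2) = a * \det (cols y r1 r2).
Proof. rewrite !det3E !mxE /=; ring. Qed.

Lemma det_cols_lin2 y r1 r2 (a b c d : C) :
  \det (cols y (a *: r1 + b *: r2) (c *: r1 + d *: r2)) = (a * d - b * c) * \det (cols y r1 r2).
Proof. rewrite !det3E !mxE /=; ring. Qed.

(** Dividing [w] by its content gives the first column x of a unimodular [Q]. Since J is unimodular,
    the columns of J Q'^* form the basis of Z[tau]^3 dual to the columns of [Q]: one vector pairs to
    1 with x, two are orthogonal to it. *)
Lemma dual_basis w : Omx w -> w != 0 -> exists x y r1 r2, exists d : C,
  [/\ [/\ Omx x, Omx y, Omx r1 & Omx r2], d \in O, w = d *: x,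
   [/\ herm y x = 1, herm r1 x = 0 & herm r2 x = 0] & nsq (\det (cols y r1 r2)) = 1].
Proof.
move=> wO w0; have [Q [Q' [d [OQ OQ' QQ' dO e]]]] := primitive_completion wO w0.
pose S := Jmx R *m Q'^t*.
have OS : Omx S by apply/Omx_mul/Omx_tr => //; exact: Omx_J.
have QS : Q^t* *m Jmx R *m S = 1%:M.
  by rewrite /S mulmxA -(mulmxA _ (Jmx R) (Jmx R)) Jmx_sq mulmx1 -map_mxM -trmx_mul (mulmx1C QQ') trmx1 map_mx1.
have hQS i j : herm (col j S) (col i Q) = (i == j)%:R.
  have := congr1 (fun M : 'M[C]_3 => M i j) QS; rewrite [X in _ = X -> _]mxE => <-.
  rewrite herm_def -!mulmxA !mxE; apply: eq_bigr => k _; rewrite !mxE; congr (_ * _).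
  by apply: eq_bigr => l _; rewrite !mxE.
have Ocol (M : 'M[C]_3) j : Omx M -> Omx (col j M) by move=> OM i k; rewrite mxE.
exists (col 0 Q), (col 0 S), (col 1 S), (col 2%:R S), d; split=> //; first by split; apply: Ocol.
rewrite -cols_col /S det_mulmx det_J det_map_mx det_tr mulN1r nsqN nsqC.
have := congr1 determinant QQ'; rewrite det_mulmx det1 => /(congr1 (@nsq R)).
rewrite nsqM nsq1; have [n1 E1] := nsqO_nat (Omx_det OQ); have [n2 E2] := nsqO_nat (Omx_det OQ').
rewrite E1 E2 -natrM => /eqP; rewrite (_ : 1 = 1%:R) // eqr_nat muln_eq1 => /andP[_ /eqP ->] //.
Qed.

(** Replacing y by x in the basis multiplies its determinant by <x,x>, and the Gram matrix of (x,
    r1, r2) is block diagonal; comparing the two expressions of its determinant cancels one factor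
    <x,x>. *)
Lemma perp_gram x y r1 r2 : herm y x = 1 -> herm r1 x = 0 -> herm r2 x = 0 ->
  nsq (\det (cols y r1 r2)) = 1 -> herm x x != 0 ->
  Re (herm r1 r1) * Re (herm r2 r2) - nsq (herm r2 r1) = - Re (herm x x).
Proof.
move=> yx r1x r2x d xx.
have d0 : \det (cols y r1 r2) != 0 by rewrite -nsq_eq0 d oner_eq0.
have [a [b [c e]]] := perp_span x d0.
have aE : a = herm x x by rewrite [X in herm X _]e !hermDl !hermZl yx r1x r2x !mulr0 !addr0 mulr1.
have := gram_det x r1 r2; rewrite {1}e det_cols_lin aE nsqM d mulr1 r1x r2x !mul0r !addr0.
have xxr : herm x x = (Re (herm x x))%:C%C := herm_real x.
have -> : nsq (herm x x) = Re (herm x x) * Re (herm x x) by rewrite {1}xxr /nsq /=; ring.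
rewrite [herm r1 r2]hermCC -nsqE [herm r1 r1]herm_real [herm r2 r2]herm_real xxr -!(rmorphM, rmorphB, rmorphN) /=.
move/complexI; rewrite -mulrN => /mulfI -> //.
by rewrite xxr in xx; rewrite (inj_eq (@complexI _) _ 0) in xx.
Qed.

Lemma perp_all (a b c z : 'cV[C]_3) : \det (cols a b c) != 0 ->
  herm z a = 0 -> herm z b = 0 -> herm z c = 0 -> z = 0.
Proof.
move=> d za zb zc; have u : cols a b c \in unitmx by rewrite unitmxE unitfE.
have u' : (cols a b c)^t* *m Jmx R \in unitmx.
  rewrite unitmxE unitfE det_mulmx det_J det_map_mx det_tr mulrN1 oppr_eq0 conjC_eq0 //.
have e : (cols a b c)^t* *m Jmx R *m z = 0.
  move: (col_cols a b c); move: (cols a b c) => B [ca cb cc].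
  have hh i : (B^t* *m Jmx R *m z) i 0 = herm z (col i B).
    by rewrite herm_def -!mulmxA !mxE; apply: eq_bigr => k _; rewrite !mxE.
  have E (w w' : 'cV[C]_3) : w = w' -> herm z w' = 0 -> herm z w = 0 by move=> ->.
  apply/matrixP => i j; rewrite ord1 hh [RHS]mxE; move: i; apply: ord3P.
  - exact: (E _ _ ca za).
  - exact: (E _ _ cb zb).
  - exact: (E _ _ cc zc).
by rewrite -(mulKmx u' z) e mulmx0.
Qed.

Lemma reduced_perp x : Omx x -> herm x x < 0 -> forall y r1 r2,
  Omx y -> Omx r1 -> Omx r2 -> herm y x = 1 -> herm r1 x = 0 -> herm r2 x = 0 ->
  nsq (\det (cols y r1 r2)) = 1 -> exists N m n k : nat, exists s1 s2,
  [/\ [/\ Omx s1, Omx s2, herm s1 x = 0 & herm s2 x = 0], nsq (\det (cols y s1 s2)) = 1,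
   [/\ herm x x = - N%:R, herm s1 s1 = m%:R, herm s2 s2 = n%:R & nsq (herm s2 s1) = k%:R] &
   [/\ (0 < m)%N, (m <= n)%N, (7 * k <= 4 * m ^ 2)%N, (m * n = N + k)%N & (3 * m ^ 2 <= 7 * N)%N]].
Proof.
move=> xO xneg y r1 r2 yO r1O r2O yx r1x r2x d.
have pg := perp_gram yx r1x r2x d (ltr0_neq0 xneg).
have d0 : \det (cols y r1 r2) != 0 by rewrite -nsq_eq0 d oner_eq0.
have pos (a b : C) : a \in O -> b \in O -> (a != 0) || (b != 0) ->
    exists2 k : nat, (0 < k)%N & Re (herm (a *: r1 + b *: r2) (a *: r1 + b *: r2)) = k%:R.
  move=> aO bO ab; apply: herm_posnat; first by apply/Omx_add/Omx_scale => //; apply: Omx_scale.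
  apply: (perp_neg_gt0 xneg); first by rewrite hermDl !hermZl r1x r2x !mulr0 addr0.
  apply: contraTneq ab => e; rewrite negb_or !negbK.
  have /det0P : \det (cols y r1 r2)^T != 0 by rewrite det_tr.
  pose z : 'cV[C]_3 := \col_i nth 0 [:: 0; a; b] i.
  have z0 : z = 0.
    have ez : cols y r1 r2 *m z = 0 by rewrite cols_mul !mxE /= scale0r add0r.
    by rewrite -(mulKmx (_ : cols y r1 r2 \in unitmx) z) ?ez ?mulmx0 // unitmxE unitfE.
  move=> _; apply/andP; split; apply/eqP.
    by have := congr1 (fun z : 'cV[C]_3 => z 1 0) z0; rewrite !mxE.
  by have := congr1 (fun z : 'cV[C]_3 => z 2%:R 0) z0; rewrite !mxE.
have [a [b [c [e /= [[aO bO cO eO] det [h1 h2 h3 h4] [m m0 mE]]]]]] := rank2_short (@hermDl R) (@hermZl R) (@hermCC R) pos.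
set s1 := a *: r1 + b *: r2 in h1 h2 h3 h4 mE; set s2 := c *: r1 + e *: r2 in h1 h2 h3.
have s1O : Omx s1 by apply/Omx_add/Omx_scale => //; apply: Omx_scale.
have s2O : Omx s2 by apply/Omx_add/Omx_scale => //; apply: Omx_scale.
have [k kE] := nsqO_nat (herm_O s2O s1O).
have s2pos : 0 < Re (herm s2 s2) by apply: lt_le_trans h2; rewrite mE ltr0n.
have [n n0 nE] := herm_posnat s2O s2pos.
have [N0 N0E] := herm_int xO.
have [N NE] : exists N : nat, herm x x = - N%:R.
  move: xneg; rewrite N0E; case: N0 {N0E} => N; first by rewrite ltrz0.
  by exists N.+1; rewrite NegzE rmorphN.
have ReN : Re (herm x x) = - N%:R by rewrite NE -(rmorph_nat (real_complex R)).
rewrite pg ReN opprK in h3 h4; rewrite mE nE kE in h1 h2 h3 h4.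
exists N, m, n, k, s1, s2; split.
- by split=> //; rewrite hermDl !hermZl r1x r2x !mulr0 addr0.
- by rewrite det_cols_lin2 nsqM det d mulr1.
- split=> //; first by rewrite herm_real mE rmorph_nat.
  by rewrite herm_real nE rmorph_nat.
split=> //.
- by rewrite -(ler_nat R).
- by rewrite -(ler_nat R) !natrM; lra.
- by apply/eqP; rewrite -(eqr_nat R) natrM natrD; apply/eqP; lra.
- by rewrite -(ler_nat R) !natrM; lra.
Qed.

Definition conj_gram (a b c a0 b0 c0 : 'cV[C]_3) : Prop :=
  [/\ herm a a = herm a0 a0, herm b b = herm b0 b0, herm c c = herm c0 c0 &
   [/\ herm b a = herm b0 a0, herm c a = herm c0 a0 & herm c b = herm c0 b0]].

(** The linear map between the two triples is integral because the reference basis has an integral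
    inverse, and it is an isometry because the Gram matrices agree. *)
Lemma gram_transfer (a b c a0 b0 c0 : 'cV[C]_3) (B0' : 'M[C]_3) :
  Omx a -> Omx b -> Omx c -> Omx B0' -> cols a0 b0 c0 *m B0' = 1%:M ->
  conj_gram a b c a0 b0 c0 ->
  exists A, [/\ uni A, Omx A, A *m a0 = a, A *m b0 = b & A *m c0 = c].
Proof.
move=> aO bO cO BO BB [h1 h2 h3 [h4 h5 h6]].
exists (cols a b c *m B0'); have e : cols a b c *m B0' *m cols a0 b0 c0 = cols a b c.
  by rewrite -mulmxA (mulmx1C BB) mulmx1.
have [e1 e2 e3] : [/\ cols a b c *m B0' *m a0 = a, cols a b c *m B0' *m b0 = b & cols a b c *m B0' *m c0 = c].
  by rewrite mul_cols in e; apply: cols_inj e.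
split=> //; last first.
  by apply: Omx_mul => // i; apply: ord3P; rewrite !mxE /=; [apply: aO|apply: bO|apply: cO].
rewrite /uni; have u : cols a0 b0 c0 \in unitmx by case/mulmx1_unit: BB.
have g : (cols a b c)^t* *m Jmx R *m cols a b c = (cols a0 b0 c0)^t* *m Jmx R *m cols a0 b0 c0.
  move: (col_cols a b c) (col_cols a0 b0 c0); move: (cols a b c) (cols a0 b0 c0) => B B0 [c1 c2 c3] [d1 d2 d3].
  have k4 : herm a b = herm a0 b0 by rewrite [LHS]hermCC h4 [RHS]hermCC.
  have k5 : herm a c = herm a0 c0 by rewrite [LHS]hermCC h5 [RHS]hermCC.
  have k6 : herm b c = herm b0 c0 by rewrite [LHS]hermCC h6 [RHS]hermCC.
  have E (u1 w1 u2 w2 u3 w3 u4 w4 : 'cV[C]_3) : u1 = u3 -> w1 = w3 -> u2 = u4 -> w2 = w4 ->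
    herm u3 w3 = herm u4 w4 -> herm u1 w1 = herm u2 w2 by move=> -> -> -> ->.
  apply/matrixP => i j; rewrite !gram_mx; move: i j; apply: ord3P; apply: ord3P.
  - exact: (E _ _ _ _ _ _ _ _ c1 c1 d1 d1 h1).
  - exact: (E _ _ _ _ _ _ _ _ c2 c1 d2 d1 h4).
  - exact: (E _ _ _ _ _ _ _ _ c3 c1 d3 d1 h5).
  - exact: (E _ _ _ _ _ _ _ _ c1 c2 d1 d2 k4).
  - exact: (E _ _ _ _ _ _ _ _ c2 c2 d2 d2 h2).
  - exact: (E _ _ _ _ _ _ _ _ c3 c2 d3 d2 h6).
  - exact: (E _ _ _ _ _ _ _ _ c1 c3 d1 d3 k5).
  - exact: (E _ _ _ _ _ _ _ _ c2 c3 d2 d3 k6).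
  - exact: (E _ _ _ _ _ _ _ _ c3 c3 d3 d3 h3).
rewrite trmx_mul map_mxM.
have -> : (B0'^t* *m (cols a b c)^t*) *m Jmx R *m (cols a b c *m B0') =
  B0'^t* *m ((cols a b c)^t* *m Jmx R *m cols a b c) *m B0' by rewrite !mulmxA.
rewrite g !mulmxA -map_mxM -trmx_mul BB trmx1 map_mx1 mul1mx -mulmxA BB mulmx1 //.
Qed.

End Lattice.

(** * Primitive vectors of norm -1, -2, -3 and the five rational points *)

Local Open Scope Z_scope.
Definition small_norms : seq ZO := [:: (0, 0); (1, 0); (-1, 0); (0, 1); (0, -1); (1, -1); (-1, 1)].

Lemma small_norms_enum (x y : BinNums.Z) : x * x + x * y + 2 * (y * y) <= 2 -> (x, y) \in small_norms.
Proof.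
move=> h; have /andP[y1 y2] : -1 <= y <= 1 by nia.
have /andP[x1 x2] : -2 <= x <= 2 by nia.
have hy : y = -1 \/ y = 0 \/ y = 1 by lia.
have hx : x = -2 \/ x = -1 \/ x = 0 \/ x = 1 \/ x = 2 by lia.
clear y1 y2 x1 x2; move: h.
by case: hy => [|[|]] ->; case: hx => [|[|[|[|]]]] ->; vm_compute.
Qed.
Local Close Scope Z_scope.

Local Open Scope Z_scope.
Definition vp1 : zvec := [:: (1, 0); (0, 0); (-1, 0)].
Definition vp2 : zvec := [:: (2, 2); (1, 0); (1, -1)].
Definition vp3 : zvec := [:: (-1, -1); (-1, 1); (0, 1)].
Definition vp4 : zvec := [:: (1, -1); (0, 0); (-1, 0)].
Definition vp5 : zvec := [:: (4, 0); (1, -1); (0, -1)].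
Definition ztau : ZO := (0, 1).
Definition zm1 : ZO := (-1, 0).
Definition ztaub : ZO := (1, -1).
Definition zmtaub : ZO := (-1, 1).
(** For each rational point, a triple (y, r1, r2): y pairs to 1 with the point, and r1, r2 span its
    orthogonal lattice with a reduced Gram matrix. The vector y is normalised as in the orbit lemma
    for that Gram matrix. *)
Definition ref4 : zvec * zvec * zvec := ([:: (-1, 1); (0, 0); (1, 0)], [:: (0, 0); (1, 0); (0, 0)], [:: (0, 1); (0, 0); (1, 0)]).
Definition ref1 : zvec * zvec * zvec := ([:: (0, 0); (0, 0); (1, 0)], [:: (0, 0); (1, 0); (0, 0)], [:: (1, 0); (0, 0); (1, 0)]).
Definition ref5 : zvec * zvec * zvec := ([:: (-1, 2); (1, 0); (1, 0)], [:: (0, 2); (0, 0); (1, 0)], [:: (0, 1); (1, -1); (0, 0)]).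
Definition ref2 : zvec * zvec * zvec := ([:: (-3, -1); (-1, 0); (-1, 1)], [:: (1, 0); (0, -1); (0, 0)], [:: (0, 2); (0, 0); (1, 0)]).
Definition ref3 : zvec * zvec * zvec := ([:: (-1, 1); (1, 0); (0, 0)], [:: (0, 0); (0, 1); (1, 0)], [:: (0, -1); (-1, 1); (0, 0)]).
Local Close Scope Z_scope.

Definition ref_basis (y r1 r2 x : zvec) : bool :=
  let M := mcols y r1 r2 in
  [&& meq (mmul M (mscale (mdet M) (madjg M))) mone, zeq (zherm y x) (zi 1),
      zeq (zherm r1 x) z0 & zeq (zherm r2 x) z0].

Section Rational.
Variable R : realType.
Local Notation C := R[i].
Local Notation O := (isO R).
Local Notation Re := complex.Re.
Local Notation eV := (eV R).
Local Notation zc := (zc R).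
Implicit Types (A B : 'M[C]_3) (u v w x y r s : 'cV[C]_3).

Lemma hermNr u w : herm u (- w) = - herm u w.
Proof. by rewrite [LHS]hermCC hermNl rmorphN /= [in RHS]hermCC. Qed.
Lemma hermNN u w : herm (- u) (- w) = herm u w.
Proof. by rewrite hermNl hermNr opprK. Qed.

Lemma nsq_le2 (z : C) : z \in O -> nsq z <= 2 -> exists2 p, p \in small_norms & z = zc p.
Proof.
move=> /isO_zc[[a b] ->]; rewrite nsq_zc (_ : 2 = 2%:~R) // ler_int => h.
exists (a, b) => //; apply: small_norms_enum.
rewrite /znorm in h; cbn [fst snd] in h; lia.
Qed.

Definition perp_basis x y s1 s2 : Prop :=
  [/\ [/\ Omx y, Omx s1 & Omx s2], herm y x = 1, herm s1 x = 0, herm s2 x = 0 & nsq (\det (cols y s1 s2)) = 1].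

Lemma perp_basis_shift x y s1 s2 a b : a \in O -> b \in O -> perp_basis x y s1 s2 ->
  perp_basis x (y + (a *: s1 + b *: s2)) s1 s2.
Proof.
move=> aO bO [[yO s1O s2O] yx s1x s2x d]; split=> //.
- by split=> //; do 2![apply: Omx_add => //]; apply: Omx_scale.
- by rewrite !hermDl !hermZl yx s1x s2x !mulr0 !addr0.
- by rewrite -[X in X + _]scale1r det_cols_lin mul1r.
Qed.

Lemma perp_basis_lin x y s1 s2 a b c d : a \in O -> b \in O -> c \in O -> d \in O -> nsq (a * d - b * c) = 1 ->
  perp_basis x y s1 s2 -> perp_basis x y (a *: s1 + b *: s2) (c *: s1 + d *: s2).
Proof.
move=> aO bO cO dO det [[yO s1O s2O] yx s1x s2x dd]; split=> //.
- by split=> //; apply: Omx_add => //; apply: Omx_scale.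
- by rewrite !hermDl !hermZl s1x s2x !mulr0 !addr0.
- by rewrite !hermDl !hermZl s1x s2x !mulr0 !addr0.
- by rewrite det_cols_lin2 nsqM det dd mulr1.
Qed.

Lemma perp_basis_swap x y s1 s2 : perp_basis x y s1 s2 -> perp_basis x y s2 s1.
Proof.
move=> h; have := @perp_basis_lin x y s1 s2 0 1 1 0 (rpred0 _) (rpred1 _) (rpred1 _) (rpred0 _) _ h.
by rewrite !scale0r !scale1r addr0 add0r; apply; rewrite mul0r mulr1 sub0r nsqN nsq1.
Qed.

Lemma perp_basis_negr x y s1 s2 : perp_basis x y s1 s2 -> perp_basis x y s1 (- s2).
Proof.
move=> h; have := @perp_basis_lin x y s1 s2 1 0 0 (-1) (rpred1 _) (rpred0 _) (rpred0 _) _ _ h.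
rewrite !scale0r !scale1r addr0 add0r scaleN1r; apply; first by rewrite rpredN rpred1.
by rewrite mul0r mul1r subr0 nsqN nsq1.
Qed.

(** The Gram determinant of a unimodular basis is -1. Once the other products are normalised, this
    equation determines <y,y> and restricts the products of y with s1, s2. *)
Lemma perp_basis_norm x y s1 s2 : perp_basis x y s1 s2 ->
  -1 = herm y y * (herm s1 s1 * herm s2 s2 - herm s2 s1 * (herm s2 s1)^*%R) +
   ((herm y s1)^*%R * (herm s2 s1 * herm y s2 - herm y s1 * herm s2 s2) +
    (herm y s2)^*%R * (herm y s1 * (herm s2 s1)^*%R - herm s1 s1 * herm y s2)) :> C.
Proof.
move=> [_ _ _ _ d]; have := gram_det y s1 s2; rewrite d rmorph1 => ->.
by rewrite [herm s1 s2]hermCC [herm s1 y]hermCC [herm s2 y]hermCC.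
Qed.

(** The isometry between the bases carries x0 to x because each of the two vectors is determined by
    its products 1, 0, 0 with its basis. *)
Lemma ref_transfer x y s1 s2 (B0 : zvec * zvec * zvec) (x0 : zvec) (g g1 g2 g21 h1 h2 : ZO) :
  let: (y0, r1, r2) := B0 in
  ref_basis y0 r1 r2 x0 && all2 zeq [:: zherm y0 y0; zherm r1 r1; zherm r2 r2; zherm r2 r1; zherm y0 r1; zherm y0 r2]
    [:: g; g1; g2; g21; h1; h2] -> perp_basis x y s1 s2 ->
  [/\ herm y y = zc g, herm s1 s1 = zc g1, herm s2 s2 = zc g2 &
    [/\ herm s2 s1 = zc g21, herm y s1 = zc h1 & herm y s2 = zc h2]] ->
  exists A, [/\ uni A, Omx A & A *m eV x0 = x].
Proof.
case: B0 => [[y0 r1] r2] /andP[/and4P[/meqP M /zeqP k1 /zeqP k2 /zeqP k3] /and5P[/zeqP <- /zeqP <- /zeqP <- /zeqP <- /and3P[/zeqP <- /zeqP <- _]]].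
move=> [[yO s1O s2O] yx s1x s2x d] [e1 e2 e3 [e4 e5 e6]].
have [A [Au AO A1 A2 A3]] : exists A, [/\ uni A, Omx A, A *m eV y0 = y, A *m eV r1 = s1 & A *m eV r2 = s2].
  apply: (gram_transfer yO s1O s2O (@Omx_eM R (mscale (mdet (mcols y0 r1 r2)) (madjg (mcols y0 r1 r2))))).
    by rewrite cols_eM -eM_mul (M R) eM_one.
  split; rewrite ?herm_eV //; split; rewrite ?herm_eV //.
  - by rewrite [LHS]hermCC e5 -herm_eV -hermCC herm_eV.
  - by rewrite [LHS]hermCC e6 -herm_eV -hermCC herm_eV.
exists A; split=> //; apply/eqP; rewrite -subr_eq0; apply/eqP.
apply: (@perp_all _ y s1 s2); first by rewrite -nsq_eq0 d oner_eq0.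
- rewrite hermBl -{1}A1 uni_herm // [herm x y]hermCC yx [herm (eV x0) _]hermCC herm_eV k1 zc1 conjC1 subrr //.
- rewrite hermBl -{1}A2 uni_herm // [herm x s1]hermCC s1x [herm (eV x0) _]hermCC herm_eV k2 zc0 conjC0 subrr //.
- rewrite hermBl -{1}A3 uni_herm // [herm x s2]hermCC s2x [herm (eV x0) _]hermCC herm_eV k3 zc0 conjC0 subrr //.
Qed.

Lemma O_mod2 (z : C) : z \in O -> exists2 q, q \in O & exists2 p, p \in [:: z0; zi 1; ztau; zadd (zi 1) ztau] & z + 2 * q = zc p.
Proof.
move=> /isOP[a [b ->]].
pose a' := (a %/ 2)%Z; pose b' := (b %/ 2)%Z.
exists (- (a'%:~R + b'%:~R * tau R)).
  by rewrite rpredN; apply/isOP; exists a', b'.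
have ha := divz_eq a 2; have hb := divz_eq b 2; rewrite -/a' in ha; rewrite -/b' in hb.
have e : a%:~R + b%:~R * tau R + 2 * - (a'%:~R + b'%:~R * tau R) = (a %% 2)%Z%:~R + (b %% 2)%Z%:~R * tau R.
  by rewrite {1}ha {1}hb !intrD !intrM; ring.
rewrite e.
have [->|->] : ((a %% 2)%Z = 0 \/ (a %% 2)%Z = 1) by lia.
  have [->|->] : ((b %% 2)%Z = 0 \/ (b %% 2)%Z = 1) by lia.
    by exists z0; rewrite ?inE ?eqxx // /zc.
  by exists ztau; rewrite ?inE ?eqxx ?orbT // /zc.
have [->|->] : ((b %% 2)%Z = 0 \/ (b %% 2)%Z = 1) by lia.
  by exists (zi 1); rewrite ?inE ?eqxx ?orbT // /zc.
by exists (zadd (zi 1) ztau); rewrite ?inE ?eqxx ?orbT // /zc.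
Qed.

Lemma perp_basis_int x y s1 s2 : perp_basis x y s1 s2 -> exists n : int, herm y y = n%:~R.
Proof. by move=> [[yO _ _] _ _ _ _]; exact: herm_int. Qed.

Lemma intC (n : int) : n%:~R = (n%:~R : R)%:C%C :> C.
Proof. by rewrite rmorph_int. Qed.

Lemma zc_nsq p : zc p * (zc p)^*%R = (int_of_Z (znorm p))%:~R.
Proof. by rewrite -nsqE nsq_zc rmorph_int. Qed.

(** The orthogonal lattice is unimodular, hence splits off: y can be shifted to be orthogonal to
    it. *)
Lemma orbit_norm1 x y s1 s2 : perp_basis x y s1 s2 -> herm s1 s1 = 1 -> herm s2 s2 = 1 -> herm s2 s1 = 0 ->
  exists A, [/\ uni A, Omx A & A *m eV vp4 = x].
Proof.
move=> Bas h1 h2 h3; have h3' : herm s1 s2 = 0 by rewrite hermCC h3 rmorph0.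
have [[yO s1O s2O] _ _ _ _] := Bas.
have c1O : - herm y s1 \in O by rewrite rpredN herm_O.
have c2O : - herm y s2 \in O by rewrite rpredN herm_O.
have Bas' := perp_basis_shift c1O c2O Bas; move: Bas'.
set y' := y + _ => Bas'.
have k1 : herm y' s1 = 0 by rewrite /y' !hermDl !hermZl h1 h3; ring.
have k2 : herm y' s2 = 0 by rewrite /y' !hermDl !hermZl h2 h3'; ring.
have e := perp_basis_norm Bas'; rewrite k1 k2 h1 h2 h3 !(rmorph0, mul0r, mulr0, subr0, addr0, mulr1) in e.
have W : zc zm1 = -1 by rewrite /zc /= mul0r addr0.
apply: (@ref_transfer x y' s1 s2 ref4 vp4 zm1 (zi 1) (zi 1) z0 z0 z0); [by vm_compute|exact: Bas'|].
by split; [rewrite W -e|rewrite zc1|rewrite zc1|rewrite zc0; split].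
Qed.

(** Only <y,s2> modulo 2 survives the shifts. The determinant equation 2 n - |p|^2 = -1 asks for an
    odd norm, and among the residues 0, 1, tau, 1 + tau only 1 has one. *)
Lemma orbit_norm2_odd x y s1 s2 : perp_basis x y s1 s2 -> herm s1 s1 = 1 -> herm s2 s2 = 2 -> herm s2 s1 = 0 ->
  exists A, [/\ uni A, Omx A & A *m eV vp1 = x].
Proof.
move=> Bas h1 h2 h3; have h3' : herm s1 s2 = 0 by rewrite hermCC h3 rmorph0.
have [[yO s1O s2O] _ _ _ _] := Bas.
have c1O : - herm y s1 \in O by rewrite rpredN herm_O.
have [q qO [p pI pE]] := O_mod2 (herm_O yO s2O).
have Bas' := perp_basis_shift c1O qO Bas; move: Bas'.
set y' := y + _ => Bas'.
have k1 : herm y' s1 = 0 by rewrite /y' !hermDl !hermZl h1 h3; ring.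
have k2 : herm y' s2 = zc p by rewrite /y' !hermDl !hermZl h2 h3' -pE; ring.
have e := perp_basis_norm Bas'; rewrite k1 k2 h1 h2 h3 in e.
have [n nE] := perp_basis_int Bas'.
have e' : 2 * n - int_of_Z (znorm p) = -1.
  apply: (@intr_inj C); rewrite intrB intrM -zc_nsq -nE.
  have -> : (-1)%:~R = -1 :> C by rewrite rmorphN.
  by rewrite e rmorph0 (_ : 2%:~R = 2 :> C) //; ring.
have [pE1 n0] : p = zi 1 /\ n = 0.
  move: pI; rewrite !inE => /or4P[] /eqP p1; rewrite p1 in e' *; rewrite /znorm /= in e'; try lia.
  by split=> //; lia.
apply: (@ref_transfer x y' s1 s2 ref1 vp1 z0 (zi 1) (zi 2) z0 z0 (zi 1)); [by vm_compute|exact: Bas'|].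
by split; [rewrite zc0 nE n0|rewrite zc1|rewrite zc_int|rewrite zc0; split => //; rewrite k2 pE1].
Qed.

(** Both products of y are reduced to i, j in {0, 1}; the determinant equation 2 n + i j - 2 i^2 - 2
    j^2 = -1 then forces i j to be odd. *)
Lemma orbit_norm2_even x y s1 s2 : perp_basis x y s1 s2 -> herm s1 s1 = 2 -> herm s2 s2 = 2 -> herm s2 s1 = tau R ->
  exists A, [/\ uni A, Omx A & A *m eV vp5 = x].
Proof.
move=> Bas h1 h2 h3; have h3' : herm s1 s2 = 1 - tau R by rewrite hermCC h3 conj_tau.
have t2 := tau_sqr R; set t := tau R in h3 h3' t2 *.
have tO : t \in O := isO_tau R.
(* Shifts along s1 and s2 move <y,s1> by 2 and by tau, which generate the ideal of tau, of index
   2. *)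
have wlog1 : exists y' i, [/\ perp_basis x y' s1 s2, herm y' s1 = i%:R & (i <= 1)%N].
  have [[yO s1O s2O] _ _ _ _] := Bas.
  have /isOP[a [b abE]] := herm_O yO s1O.
  have aE := divz_eq a 2.
  have a'O : (- (a %/ 2)%Z)%:~R \in O by exact: rpred_int.
  have bO : (- b)%:~R \in O by exact: rpred_int.
  have B := perp_basis_shift a'O bO Bas.
  exists (y + ((- (a %/ 2)%Z)%:~R *: s1 + (- b)%:~R *: s2)), (absz (a %% 2)%Z).
  split; [exact: B| |by lia].
  rewrite !hermDl !hermZl h1 h3 abE {1}aE.
  have -> : (absz (a %% 2)%Z)%:R = (a %% 2)%Z%:~R :> C by rewrite -[in RHS](@gez0_abs (a %% 2)%Z) //; lia.
  by rewrite !(intrD, intrN, intrM) -/t; ring.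
have {Bas}[y1 [i [Bas k1 i1]]] := wlog1.
(* Shifts by c s1 - (1 - tau) c s2 preserve <y,s1>, because tau (1 - tau) = 2, and move <y,s2> by
   -(1 - tau) c; the residue ring modulo 1 - tau has two elements. *)
have wlog2 : exists y' j, [/\ perp_basis x y' s1 s2, herm y' s1 = i%:R, herm y' s2 = j%:R & (j <= 1)%N].
  have [[yO s1O s2O] _ _ _ _] := Bas.
  have /isOP[a [b abE]] := herm_O yO s2O.
  have aE := divz_eq (a + b) 2; set h := ((a + b) %/ 2)%Z in aE.
  have aO : h%:~R * t - b%:~R \in O by apply: rpredB; [apply: rpredM => //; exact: rpred_int|exact: rpred_int].
  have bO : - ((1 - t) * (h%:~R * t - b%:~R)) \in O by rewrite rpredN; apply: rpredM => //; apply: rpredB => //; exact: rpred1.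
  have B := perp_basis_shift aO bO Bas.
  exists (y1 + ((h%:~R * t - b%:~R) *: s1 + (- ((1 - t) * (h%:~R * t - b%:~R))) *: s2)), (absz ((a + b) %% 2)%Z).
  split; [exact: B| | |by lia].
    rewrite !hermDl !hermZl h1 h3 k1.
    transitivity (i%:R + (h%:~R * t - b%:~R) * (t ^+ 2 - t + 2)); first by ring.
    by rewrite t2; ring.
  rewrite !hermDl !hermZl h2 h3' abE -/t.
  have -> : (absz ((a + b) %% 2)%Z)%:R = (a%:~R + b%:~R) - h%:~R * 2 :> C.
    have -> : (absz ((a + b) %% 2)%Z)%:R = ((a + b) %% 2)%Z%:~R :> C by rewrite -[in RHS](@gez0_abs ((a + b) %% 2)%Z) //; lia.
    have := congr1 (intr : int -> C) aE; rewrite intrD (intrD _ (h * 2)) intrM => ->.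
    by rewrite (_ : 2%:~R = 2 :> C) //; ring.
  transitivity (a%:~R + b%:~R * t - (1 - t) * (h%:~R * t - b%:~R)); first by ring.
  transitivity (a%:~R + b%:~R + h%:~R * (t ^+ 2 - t)); first by ring.
  by rewrite t2; ring.
have {Bas k1}[y2 [j [Bas k1 k2 j1]]] := wlog2.
have e := perp_basis_norm Bas; rewrite k1 k2 h1 h2 h3 conj_tau -/t !rmorph_nat in e.
have [n nE] := perp_basis_int Bas; rewrite nE in e.
clear wlog2.
have e' : 2 * n + (i%:Z * j%:Z - 2 * i%:Z * i%:Z - 2 * j%:Z * j%:Z) = -1.
  apply: (@intr_inj C); rewrite !(intrB, intrD, intrM).
  have -> : (-1)%:~R = -1 :> C by rewrite rmorphN.
  have iC (m : nat) : (m%:Z)%:~R = m%:R :> C by [].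
  rewrite !iC e.
  have -> : t * (1 - t) = 2 by rewrite mulrBr mulr1 -expr2 t2; ring.
  by ring.
have [[i1E j1E] n1] : [/\ i = 1%N & j = 1%N] /\ n = 1.
  case: i i1 e' {k1 e} => [|[|i]] // _; case: j j1 {k2} => [|[|j]] // _ e'; try lia.
apply: (@ref_transfer x y2 s1 s2 ref5 vp5 (zi 1) (zi 2) (zi 2) ztau (zi 1) (zi 1)); [by vm_compute|exact: Bas|].
split; [by rewrite zc1 nE n1|by rewrite zc_int|by rewrite zc_int|].
by split; [rewrite h3 /zc /= mul1r add0r|rewrite zc1 k1 i1E|rewrite zc1 k2 j1E].
Qed.

Lemma O_mod3 (z : C) : z \in O -> exists2 q, q \in O & exists a b : int, [/\ z - 3 * q = a%:~R + b%:~R * tau R, -1 <= a <= 1 & -1 <= b <= 1].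
Proof.
move=> /isOP[a [b ->]].
pose a' := ((a + 1) %/ 3)%Z; pose b' := ((b + 1) %/ 3)%Z.
exists (a'%:~R + b'%:~R * tau R); first by apply/isOP; exists a', b'.
exists (a - 3 * a'), (b - 3 * b'); split; [|lia|lia].
by rewrite !intrB !intrM; ring.
Qed.

(** With <y,s1> = 0, only p = <y,s2> modulo 3 is left. Among the small residues, the determinant
    equation 3 n - 2 |p|^2 = -1 selects the norm 2, that is tau or conj tau up to sign; these two
    classes are the points [vp3] and [vp2]. *)
Lemma orbit_norm3 x y s1 s2 : perp_basis x y s1 s2 -> herm s1 s1 = 2 -> herm s2 s2 = 2 -> herm s2 s1 = 1 ->
  (exists A, [/\ uni A, Omx A & A *m eV vp2 = x]) \/ (exists A, [/\ uni A, Omx A & A *m eV vp3 = x]).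
Proof.
move=> Bas h1 h2 h3; have h3' : herm s1 s2 = 1 by rewrite hermCC h3 conjC1.
have [[yO s1O s2O] _ _ _ _] := Bas.
have cO : herm y s2 - 2 * herm y s1 \in O by rewrite rpredB ?rpredM ?herm_O ?rpred_nat.
have [q qO [a [b [abE ha hb]]]] := O_mod3 cO.
have bO : - herm y s1 - 2 * q \in O by rewrite rpredB ?rpredN ?rpredM ?herm_O ?rpred_nat.
have Bas' := perp_basis_shift qO bO Bas; move: Bas'.
set y' := y + _ => Bas'.
have k1 : herm y' s1 = 0 by rewrite /y' !hermDl !hermZl h1 h3; ring.
have k2 : herm y' s2 = a%:~R + b%:~R * tau R by rewrite /y' !hermDl !hermZl h2 h3' -abE; move: (herm y s1) (herm y s2) => u1 u2; ring.
have e := perp_basis_norm Bas'; rewrite k1 h1 h2 h3 in e.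
have [n nE] := perp_basis_int Bas'.
have e' : 3 * n - 2 * (a ^+ 2 + a * b + 2 * b ^+ 2) = -1.
  apply: (@intr_inj C); rewrite intrB 2!intrM -nE (intC (a ^+ 2 + a * b + 2 * b ^+ 2)) -nsqO nsqE -k2.
  have -> : (-1)%:~R = -1 :> C by rewrite rmorphN.
  rewrite e rmorph0 conjC1 -[2%:~R]/(2 : C) -[3%:~R]/(3 : C); move: ((herm y' s2)^*%R) (herm y' s2) (herm y' y') => u1 u2 u3; ring.
have /andP[a1 a2] := ha; have /andP[b1 b2] := hb.
have ac : a = -1 \/ a = 0 \/ a = 1 by lia.
have bc : b = -1 \/ b = 0 \/ b = 1 by lia.
have {ac bc}[n1 ab] : n = 1 /\ [\/ a = 0 /\ b = 1, a = 0 /\ b = -1, a = 1 /\ b = -1 | a = -1 /\ b = 1].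
  clear -e' ac bc; rewrite !expr2 in e'.
  case: ac => [|[|]] aE; case: bc => [|[|]] bE; rewrite aE bE in e' *; try lia; split; try lia.
  - by constructor 4.
  - by constructor 2.
  - by constructor 1.
  - by constructor 3.
have key (B1 : zvec * zvec * zvec) (x0 : zvec) (s1' s2' : 'cV[C]_3) (p : ZO) : (let: (y0, r1, r2) := B1 in
   ref_basis y0 r1 r2 x0 && all2 zeq [:: zherm y0 y0; zherm r1 r1; zherm r2 r2; zherm r2 r1; zherm y0 r1; zherm y0 r2]
    [:: zi 1; zi 2; zi 2; zi 1; z0; p]) -> perp_basis x y' s1' s2' -> herm s1' s1' = 2 -> herm s2' s2' = 2 -> herm s2' s1' = 1 ->
    herm y' s1' = 0 -> herm y' s2' = zc p -> exists A, [/\ uni A, Omx A & A *m eV x0 = x].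
  case: B1 => [[y0 r1] r2] hB hp g1 g2 g3 g4 g5.
  apply: (@ref_transfer x y' s1' s2' (y0, r1, r2) x0 (zi 1) (zi 2) (zi 2) (zi 1) z0 p hB hp).
  have z2 : zc (zi 2) = 2 by rewrite zc_int.
  split; rewrite ?z2; [by rewrite zc1 nE n1|exact: g1|exact: g2|].
  by split; [rewrite zc1; exact: g3|rewrite zc0; exact: g4|exact: g5].
(* Negating both s1 and s2 preserves their Gram matrix and changes the sign of <y,s2>. *)
have BN := perp_basis_swap (perp_basis_negr (perp_basis_swap (perp_basis_negr Bas'))).
have g1 : herm (- s1) (- s1) = 2 by rewrite hermNN h1.
have g2 : herm (- s2) (- s2) = 2 by rewrite hermNN h2.
have g3 : herm (- s2) (- s1) = 1 by rewrite hermNN h3.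
have g4 : herm y' (- s1) = 0 by rewrite hermNr k1 oppr0.
have g5 : herm y' (- s2) = - (a%:~R + b%:~R * tau R) by rewrite hermNr k2.
case: ab => -[aE bE]; rewrite aE bE in k2 g5.
- right; apply: (key ref3 vp3 _ _ (zopp ztau) _ BN) => //.
  by rewrite g5 zcN.
- right; apply: (key ref3 vp3 _ _ (zopp ztau) _ Bas') => //.
- left; apply: (key ref2 vp2 _ _ zmtaub _ BN) => //.
  by rewrite g5 (_ : zmtaub = zopp ztaub) // zcN.
- left; apply: (key ref2 vp2 _ _ zmtaub _ Bas') => //.
Qed.

(** The reduced Gram matrix of the orthogonal lattice runs over a short list, one orbit lemma for
    each entry. The last hypothesis discards the diagonal form 1, 3; [order3_orbit] establishes it,
    and in order 2 the norm is never 3. *)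
Lemma rational_orbit x y r1 r2 (N : nat) : Omx x -> perp_basis x y r1 r2 -> herm x x = - N%:R -> (0 < N <= 3)%N ->
  (N = 3%N -> forall s, Omx s -> herm s x = 0 -> herm s s <> 1) ->
  exists2 p, p \in [:: vp1; vp2; vp3; vp4; vp5] & exists A, [/\ uni A, Omx A & A *m eV p = x].
Proof.
move=> xO [[yO r1O r2O] yx r1x r2x d] xx /andP[N0 N3] no1.
have xneg : herm x x < 0 by rewrite xx oppr_lt0 ltr0n.
have [N' [m [n [k [s1 [s2 [[s1O s2O s1x s2x] d' [xx' ss1 ss2 bk] [m0 mn k4 mnN m3]]]]]]]] :=
  reduced_perp xO xneg yO r1O r2O yx r1x r2x d.
have NN : N' = N.
  by move: xx'; rewrite xx => /oppr_inj/eqP; rewrite eqr_nat => /eqP ->.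
subst N'; clear xx'.
have Bas : perp_basis x y s1 s2 by split.
have bO := herm_O s2O s1O.
(* 3 m^2 <= 7 N <= 21 gives m <= 2; then m n = N + k and 7 k <= 4 m^2 leave five possibilities. *)
have cases : [\/ [/\ N = 1, m = 1, n = 1 & k = 0], [/\ N = 2, m = 1, n = 2 & k = 0], [/\ N = 2, m = 2, n = 2 & k = 2]
   | [/\ N = 3, m = 1, n = 3 & k = 0] \/ [/\ N = 3, m = 2, n = 2 & k = 1]]%N.
  have m2 : (m <= 2)%N by clear -m3 N3; nia.
  have e22 : (2 ^ 2 = 4)%N by [].
  have e12 : (1 ^ 2 = 1)%N by [].
  case: m m0 m2 mn k4 mnN m3 {ss1} => [|[|[|m]]] // _ _ mn k4 mnN m3; rewrite ?e22 ?e12 in k4 m3.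
    have k0 : k = 0%N by lia.
    case: N N0 N3 mnN m3 {xx no1 xneg} => [|[|[|[|N]]]] // _ _ mnN m3.
    - by constructor 1; split; lia.
    - by constructor 2; split; lia.
    - by constructor 4; left; split; lia.
  case: N N0 N3 mnN m3 {xx no1 xneg} => [|[|[|[|N]]]] // _ _ mnN m3.
    by constructor 3; split; lia.
  by constructor 4; right; split; lia.
have hb0 : k = 0%N -> herm s2 s1 = 0 by move=> k0; apply/eqP; rewrite -nsq_eq0 bk k0.
case: cases => [[NE mE nE kE]|[NE mE nE kE]|[NE mE nE kE]|[[NE mE nE kE]|[NE mE nE kE]]]; rewrite mE in ss1; rewrite nE in ss2; rewrite kE in bk.
- by exists vp4; rewrite ?inE ?eqxx ?orbT //; apply: (orbit_norm1 Bas ss1 ss2 (hb0 kE)).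
- by exists vp1; rewrite ?inE ?eqxx ?orbT //; apply: (orbit_norm2_odd Bas ss1 ss2 (hb0 kE)).
- exists vp5; first by rewrite !inE eqxx !orbT.
  have [p pI pE] := nsq_le2 bO (eq_ind_r (fun z => z <= 2) (lexx _) bk).
  have nC : herm (- s2) (- s2) = 2 by rewrite hermNN ss2.
  have nC1 : herm (- s2) s1 = - herm s2 s1 by rewrite hermNl.
  have nC2 : herm s1 (- s2) = - (herm s2 s1)^*%R by rewrite hermNr [herm s1 s2]hermCC.
  have tE : zc ztau = tau R by rewrite /zc /= mul1r add0r.
  have znE q : zc q = herm s2 s1 -> znorm q = (zi 2).1.
    move=> qE; move: bk; rewrite -qE nsq_zc (_ : 2%:R = 2%:~R :> R) // => /intr_inj; rewrite /zi /=; lia.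
  have zp := znE _ (esym pE).
  (* The four elements of norm 2. Negating s2 changes the sign of the product and exchanging s1 with
     s2 conjugates it, so all reduce to tau. *)
  have pI' : p \in [:: ztau; zopp ztau; ztaub; zmtaub].
    have -> : [:: ztau; zopp ztau; ztaub; zmtaub] = [seq q <- small_norms | BinInt.Z.eqb (znorm q) (zi 2).1] by vm_compute.
    by rewrite mem_filter zp pI.
  move: pI'; rewrite !inE => /or4P[] /eqP p1; rewrite p1 in pE zp.
  + by apply: (orbit_norm2_even Bas ss1 ss2); rewrite pE -tE.
  + apply: (orbit_norm2_even (perp_basis_negr Bas) ss1 nC); rewrite nC1 pE -zcN -tE; congr zc.
  + apply: (orbit_norm2_even (perp_basis_swap Bas) ss2 ss1); rewrite hermCC pE -zc_conj -tE; congr zc.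
  + apply: (orbit_norm2_even (perp_basis_swap (perp_basis_negr Bas)) nC ss1); rewrite nC2 pE -zc_conj -zcN -tE; congr zc.
- by case: (no1 NE s1 s1O s1x ss1).
have [b1|b1] := nsqO_unit bO bk.
  by have [h|h] := orbit_norm3 Bas ss1 ss2 b1; [exists vp2|exists vp3]; rewrite ?inE ?eqxx ?orbT.
have nC : herm (- s2) (- s2) = 2 by rewrite hermNN ss2.
have nC1 : herm (- s2) s1 = 1 by rewrite hermNl b1 opprK.
by have [h|h] := orbit_norm3 (perp_basis_negr Bas) ss1 nC nC1; [exists vp2|exists vp3]; rewrite ?inE ?eqxx ?orbT.
Qed.

End Rational.

Local Open Scope Z_scope.
Definition zM6 : zmat := [:: [:: (-2, 0); (-2, 1); (-1, 4)]; [:: (-1, 1); (1, 1); (3, 0)]; [:: (0, 1); (1, 0); (3, -1)]].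
Definition zw6 : zvec := [:: (-1, 1); (0, 1); (1, 0)].
(** Vectors of norm -1 and 1 orthogonal to [zw6]. Together with [zw6] and their image under the
    square of [zM6] they give bases with the two Gram matrices that arise in [order3_neg]. *)
Definition zs6m : zvec := [:: (-3, 0); (-1, 1); (0, 1)].
Definition zs6p : zvec := [:: (-1, 1); (1, 0); (0, 0)].
(** The prime 3 is inert in Z[tau]; this excludes a primitive fixed vector of norm 3 in
    [order3_neg]. *)
Lemma znorm_neq3 (x y : BinNums.Z) : x * x + x * y + 2 * (y * y) <> 3.
Proof.
move=> h; have /andP[y1 y2] : -1 <= y <= 1 by nia.
have /andP[x1 x2] : -3 <= x <= 3 by nia.
have hy : y = -1 \/ y = 0 \/ y = 1 by lia.
have hx : x = -3 \/ x = -2 \/ x = -1 \/ x = 0 \/ x = 1 \/ x = 2 \/ x = 3 by lia.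
clear y1 y2 x1 x2; move: h.
by case: hy => [|[|]] ->; case: hx => [|[|[|[|[|[|]]]]]] ->; vm_compute.
Qed.
Local Close Scope Z_scope.

(** * Elements of order 2 and 3 fixing a rational point *)

Section Regular.
Variable R : realType.
Local Notation C := R[i].
Local Notation O := (isO R).
Local Notation Re := complex.Re.
Local Notation eV := (eV R).
Local Notation eM := (eM R).
Local Notation zc := (zc R).
Implicit Types (A B : 'M[C]_3) (u v w x y r s : 'cV[C]_3).

Definition regular_at A v l := [/\ uni A, Omx A, \det A = 1, A *m v = l *: v & disc_char A l != 0].

Lemma reg_uniq A v l u : herm v v < 0 -> regular_at A v l -> herm u v = 0 -> A *m u = l *: u -> u = 0.
Proof.
move=> vneg [Au AO Ad Av reg] uv Aul; apply/eqP/negPn/negP => u0.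
by case/eqP: reg; apply/(simple_eigP Au Ad vneg Av); exists u.
Qed.

(** A second negative eigenvector is not orthogonal to v, hence has the same eigenvalue, and this
    eigenvalue is simple. *)
Lemma reg_line A v l v2 m : herm v v < 0 -> regular_at A v l -> herm v2 v2 < 0 -> A *m v2 = m *: v2 ->
  exists2 c : C, c != 0 & v2 = c *: v.
Proof.
move=> vneg reg v2neg Av2; have [Au AO Ad Av _] := reg.
have ml : m = l.
  have h := eig_perp Au vneg Av v2; rewrite Av2 hermZl in h.
  by apply: (mulIf _ h); apply: neg_not_perp.
have vv : herm v v != 0 by rewrite ltr0_neq0.
have := reg_uniq vneg reg (perp_decomp v2 vv) _; rewrite mulmxBr -scalemxAr Av2 Av ml.
rewrite scalerBr !scalerA mulrC => /(_ erefl)/eqP; rewrite subr_eq0 => /eqP e.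
exists (herm v2 v / herm v v) => //.
by rewrite mulf_neq0 ?invr_eq0 // neg_not_perp.
Qed.

Lemma regular_inv A v l : herm v v < 0 -> regular_at A v l -> regular_at (uinv A) v l^-1.
Proof.
move=> vneg [Au AO Ad Av reg]; have [l0 lc] := nsq_unit_inv (eig_neg_unit Au vneg Av).
have vl : uinv A *m v = l^-1 *: v.
  by apply: (scalerI l0); rewrite scalemxAr -Av mulmxA uinvK // mul1mx scalerA mulfV // scale1r.
split=> //; [exact: uni_inv|exact: Omx_uinv| |].
  by have := congr1 determinant (uinvK Au); rewrite det_mulmx Ad mulr1 det1.
apply: contra reg => /eqP h; apply/eqP/(simple_eigP Au Ad vneg Av).
have Ad' : \det (uinv A) = 1 by have := congr1 determinant (uinvK Au); rewrite det_mulmx Ad mulr1 det1.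
have [u [u0 uv e]] := (simple_eigP (uni_inv Au) Ad' vneg vl).2 h.
exists u; split=> //; apply: (scalerI (_ : l^-1 != 0)); first by rewrite invr_eq0.
by rewrite scalemxAr -e mulmxA uinvKr // mul1mx scalerA mulVf // scale1r.
Qed.

Lemma tr_sqr A : uni A -> \det A = 1 -> \tr (A *m A) = \tr A ^+ 2 - 2 * (\tr A)^*%R.
Proof. by move=> Au Ad; rewrite -(minor_uni Au Ad) !tr3E !mulmx3E /minor_sum; ring. Qed.

(** [W] is k times the orthogonal projection onto v, so a nonzero column is an integral vector on
    the line of v. For the primitive x on that line and y with <y,x> = 1, the number <W y, y> = -k/N
    is rational and lies in Z[tau]; therefore N divides k. *)
Lemma rational_from_proj (W : 'M[C]_3) (k : nat) v : (0 < k)%N -> Omx W -> herm v v < 0 ->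
  (forall u, herm u v = 0 -> W *m u = 0) -> W *m v = k%:R *: v ->
  exists x y r1 r2 c, exists N j : nat, [/\ c != 0, v = c *: x, Omx x /\ perp_basis x y r1 r2,
    herm x x = - N%:R & k = (j * N)%N].
Proof.
move=> k0 WO vneg Wp Wv; have v0 := herm_neg_neq0 vneg; have vv : herm v v != 0 by rewrite ltr0_neq0.
have kC : (k%:R : C) != 0 by rewrite pnatr_eq0 -lt0n.
have WE u : W *m u = (k%:R * (herm u v / herm v v)) *: v.
  have := Wp _ (perp_decomp u vv); rewrite mulmxBr -scalemxAr Wv => /eqP.
  by rewrite subr_eq0 => /eqP ->; rewrite scalerA mulrC.
have [j j0] : exists j, col j W != 0.
  apply/existsP; rewrite -negb_forall; apply/negP => /forallP h.
  have W0 : W = 0.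
    by apply/matrixP => i j; have /eqP/matrixP/(_ i 0) := h j; rewrite !mxE.
  by move: Wv; rewrite W0 mul0mx => /esym/eqP; rewrite scaler_eq0 (negPf kC) (negPf v0).
have colO : Omx (col j W) by move=> i i'; rewrite mxE.
have [x [y [r1 [r2 [d [[xO yO r1O r2O] dO e [yx r1x r2x] D]]]]]] := dual_basis colO j0.
have d0 : d != 0 by apply: contraNneq j0 => d0; rewrite e d0 scale0r.
have e' := e; rewrite colE WE in e'; set t := k%:R * _ in e'.
have t0 : t != 0 by apply: contraNneq j0 => t0; rewrite colE WE -/t t0 scale0r.
have vE : v = (t^-1 * d) *: x by rewrite -scalerA -e' scalerA mulVf // scale1r.
set c := t^-1 * d in vE; have c0 : c != 0 by rewrite mulf_neq0 ?invr_eq0.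
have xneg : herm x x < 0.
  move: vneg; rewrite vE hermZl hermZr mulrA -nsqE pmulr_rlt0 // (@ltcR _ 0) lt_def nsq_eq0 c0; exact: nsq_ge0.
have [m mE] := herm_int xO.
have [N NE] : exists N : nat, herm x x = - N%:R.
  move: xneg; rewrite mE; case: m {mE} => m; first by rewrite ltrz0.
  by exists m.+1; rewrite NegzE rmorphN.
have N0 : (N%:R : C) != 0 by move: xneg; rewrite NE; apply: contraTneq => ->; rewrite oppr0 ltxx.
have WyO : herm (W *m y) y \in O by apply: herm_O => //; apply: Omx_mul.
have Wyy : herm (W *m y) y = - (k%:R / N%:R).
  rewrite WE vE !hermZl !hermZr NE yx [herm x y]hermCC yx conjC1.
  have cc0 : c^*%R != 0 by rewrite conjC_eq0.
  by field; rewrite ?c0 ?cc0 ?N0.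
have [n nE] : exists n : int, herm (W *m y) y = n%:~R.
  apply: O_real_int => //; rewrite Wyy -(rmorph_nat (real_complex R) k) -(rmorph_nat (real_complex R) N) -fmorphV -rmorphM -rmorphN //.
have kn : - (k%:Z) = n * N%:Z.
  apply: (@intr_inj C); rewrite intrM -nE Wyy intrN.
  by rewrite mulNr divfK.
exists x, y, r1, r2, c, N, (absz n); split=> //.
  by rewrite -[LHS](abszN k%:Z) kn abszM.
Qed.

Section Cases.
Variables (A : 'M[C]_3) (v : 'cV[C]_3) (l : C).
Hypotheses (vneg : herm v v < 0) (reg : regular_at A v l).

Let Au : uni A. Proof. by case: reg. Qed.
Let AO : Omx A. Proof. by case: reg. Qed.
Let Ad : \det A = 1. Proof. by case: reg. Qed.
Let Av : A *m v = l *: v. Proof. by case: reg. Qed.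
Let dl : disc_char A l != 0. Proof. by case: reg. Qed.
Let ch : l ^+ 3 - \tr A * l ^+ 2 + (\tr A)^*%R * l - 1 = 0. Proof. exact: (lam_char Au Ad vneg Av). Qed.
Let l0 : l != 0. Proof. by have [] := nsq_unit_inv (eig_neg_unit Au vneg Av). Qed.
Let lc : l^*%R = l^-1. Proof. by have [] := nsq_unit_inv (eig_neg_unit Au vneg Av). Qed.

Lemma trace_neq3 : \tr A <> 3%:R.
Proof.
move=> a; have ac : (\tr A)^*%R = 3%:R by rewrite a rmorph_nat.
have : (l - 1) ^+ 3 = 0 by rewrite -[RHS]ch ac a; ring.
move/eqP; rewrite expf_eq0 subr_eq0 /= => /eqP l1.
by case/eqP: dl; rewrite /disc_char l1 ac a; ring.
Qed.

Definition in_rational_orbit := exists2 p, p \in [:: vp1; vp2; vp3; vp4; vp5] &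
  exists P c, [/\ uni P, Omx P, c != 0 & v = c *: (P *m eV p)].

Lemma perp_fix u : herm u v = 0 -> herm (A *m u) v = 0.
Proof. by move=> h; rewrite (eig_perp Au vneg Av) h mulr0. Qed.

(** The eigenvalues are 1, -1, -1 with 1 at v, and A + 1 is twice the projection onto v, so the
    primitive vector has norm -1 or -2. *)
Lemma order2_orbit : \tr A = -1 -> in_rational_orbit.
Proof.
move=> a; have ac : (\tr A)^*%R = -1 by rewrite a rmorphN1.
have l1 : l = 1.
  have : (l - 1) * (l + 1) ^+ 2 = 0 by rewrite -[RHS]ch ac a; ring.
  move/eqP; rewrite mulf_eq0 subr_eq0 => /orP[/eqP //|].
  rewrite expf_eq0 addr_eq0 /= => /eqP l1.
  by case/eqP: dl; rewrite /disc_char l1 ac a; ring.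
have WO : Omx (A + 1%:M) by apply: Omx_add => //; exact: Omx_one.
have Wv : (A + 1%:M) *m v = 2%:R *: v by rewrite mulmxDl Av mul1mx l1 scale1r -mulr2n scaler_nat.
have Wp u : herm u v = 0 -> (A + 1%:M) *m u = 0.
  move=> uv; rewrite mulmxDl mul1mx; set z := A *m u + u.
  have zv : herm z v = 0 by rewrite hermDl perp_fix // uv addr0.
  (* Cayley-Hamilton makes (A + 1)^2 u a fixed vector orthogonal to v, hence zero. A nontrivial
     Jordan block for -1 is then excluded because z has norm 0 where the form is definite. *)
  have Az : A *m z = - z.
    have zv' : herm (A *m z + z) v = 0 by rewrite hermDl perp_fix // zv addr0.
    have := reg_uniq vneg reg zv' _; rewrite l1 scale1r => h.
    apply/eqP; rewrite -addr_eq0; apply/eqP/h.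
    have := congr1 (fun M => M *m u) (CH_uni Au Ad); rewrite ac a => e.
    rewrite /z !mulmxDr !mulmxA -/mulmx; move: e.
    rewrite mulmxDl mulmxBl -!scalemxAl mul1mx scaleN1r scaleN1r opprK => ->.
    by apply/matrixP => i j; rewrite !mxE; ring.
  have [_ h] := perp_neg_ge0 vneg zv; apply: h.
  have := uni_herm u z Au; rewrite Az hermNr => e.
  by rewrite {1}/z hermDl -e subrr.
have [x [y [r1 [r2 [c [N [j [c0 vE [xO Bas] xx kE]]]]]]]] := rational_from_proj (isT : (0 < 2)%N) WO vneg Wp Wv.
have N1 : (0 < N <= 3)%N.
  have : (N %| 2)%N by rewrite kE dvdn_mull.
  by move=> /dvdn_leq h; have := h isT; case: N {h xx} kE => [|[|[|[|N]]]] //; rewrite muln0.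
have N3 : N = 3%N -> forall s, Omx s -> herm s x = 0 -> herm s s <> 1.
  by move=> N3; move: kE; rewrite N3; lia.
have [p pI [P [Pu PO Px]]] := rational_orbit xO Bas xx N1 N3.
by exists p => //; exists P, c; split=> //; rewrite Px.
Qed.

Lemma cube_tr0 : \tr A = 0 -> A *m A *m A = 1%:M.
Proof. by move=> a; rewrite (CH_uni Au Ad) a rmorph0 !scale0r subr0 add0r. Qed.

Lemma order3_orbit : \tr A = 0 -> l = 1 -> in_rational_orbit.
Proof.
move=> a l1; have A3 := cube_tr0 a.
pose W := A *m A + A + 1%:M.
have AW : A *m W = W by rewrite /W !mulmxDr mulmx1 mulmxA A3 -addrA addrC.
have WO : Omx W by apply: Omx_add; [apply: Omx_add => //; exact: Omx_mul|exact: Omx_one].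
have Av1 : A *m v = v by rewrite Av l1 scale1r.
have Wv : W *m v = 3%:R *: v.
  by rewrite /W !mulmxDl -mulmxA !Av1 mul1mx; apply/matrixP => i j; rewrite !mxE; ring.
have Wp u : herm u v = 0 -> W *m u = 0.
  move=> uv; apply: (reg_uniq vneg reg); last by rewrite l1 scale1r mulmxA AW.
  by rewrite /W !mulmxDl -mulmxA mul1mx !hermDl !perp_fix // uv !addr0.
have [x [y [r1 [r2 [c [N [j [c0 vE [xO Bas] xx kE]]]]]]]] := rational_from_proj (isT : (0 < 3)%N) WO vneg Wp Wv.
have N1 : (0 < N <= 3)%N.
  have : (N %| 3)%N by rewrite kE dvdn_mull.
  by move=> /dvdn_leq h; have := h isT; case: N {h xx} kE => [|[|[|[|N]]]] //; rewrite muln0.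
(* With g = <A s, s>, the relation W s = 0 gives 1 + g + conj(g) = 0. So g = a + b tau with b = -1 -
   2 a has norm 7 a (a + 1) + 2 >= 2, whereas Cauchy-Schwarz in the orthogonal of v gives |g|^2 <=
   1. *)
have no1 : N = 3%N -> forall s, Omx s -> herm s x = 0 -> herm s s <> 1.
  move=> _ s sO sx s1; have sv : herm s v = 0 by rewrite vE hermZr sx mulr0.
  have := Wp s sv; rewrite /W !mulmxDl mul1mx -mulmxA => /(congr1 (fun z => herm z s)).
  rewrite !hermDl herm0l s1; set g := herm (A *m s) s.
  have gO : g \in O by apply: herm_O => //; exact: Omx_mul.
  have -> : herm (A *m (A *m s)) s = g^*%R.
    have <- : herm (A *m (A *m (A *m s))) (A *m s) = herm (A *m (A *m s)) s by exact: uni_herm.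
    by rewrite !mulmxA A3 mul1mx hermCC.
  move=> e.
  have zs : herm (A *m s - g *: s) v = 0 by rewrite hermBl hermZl perp_fix // sv mulr0 subr0.
  have [ge0 _] := perp_neg_ge0 vneg zs.
  have qE : herm (A *m s - g *: s) (A *m s - g *: s) = 1 - g * g^*%R.
    rewrite hermBl hermZl -scaleNr !hermDr !hermZr uni_herm // s1 -/g [herm s (A *m s)]hermCC -/g rmorphN; ring.
  rewrite qE -nsqE -(rmorph1 (real_complex R)) -rmorphB /= subr_ge0 in ge0.
  have [[p q] pE] := isO_zc gO.
  have e' : Re g * 2 = -1.
    by move: e; case: (g) => g1 g2 /(congr1 (fun z : C => complex.Re z)) /=; lra.
  rewrite pE nsq_zc (_ : 1 = 1%:~R) // ler_int /znorm in ge0.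
  rewrite pE Re_zc /ztrace (_ : -1 = (-1)%:~R) // in e'; move/intr_inj: e' => e'.
  by cbn [fst snd] in ge0, e'; clear -ge0 e'; nia.
have [p pI [P [Pu PO Px]]] := rational_orbit xO Bas xx N1 no1.
by exists p => //; exists P, c; split=> //; rewrite Px.
Qed.

Lemma regular_sqr : disc_char (A *m A) (l * l) != 0 -> regular_at (A *m A) v (l * l).
Proof.
move=> h; split=> //; [exact: uni_mul|exact: Omx_mul|by rewrite det_mulmx Ad mulr1|].
by rewrite -mulmxA Av -scalemxAr Av scalerA.
Qed.

End Cases.

End Regular.

Lemma short_bound_arith (F : realFieldType) (q n K : F) : 3 / 7 * q <= K * n -> 3 * q <= 7 * K * n.
Proof. move: (K * n) (mulrA 7 K n) => z <-; lra. Qed.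

(** * The twisted form of an element with eigenvalues 1, l, conj l *)

Section Irrational.
Variable R : realType.
Local Notation C := R[i].
Local Notation O := (isO R).
Local Notation Re := complex.Re.
Local Notation Im := complex.Im.
Local Notation eV := (eV R).
Local Notation eM := (eM R).
Local Notation zc := (zc R).
Implicit Types (B : 'M[C]_3) (u w x y r s : 'cV[C]_3).

Lemma orth_det (a b c : 'cV[C]_3) : herm a a != 0 -> herm b b != 0 -> herm c c != 0 ->
  herm b a = 0 -> herm c a = 0 -> herm c b = 0 -> \det (cols a b c) != 0.
Proof.
move=> a0 b0 c0 ba ca cb; have := gram_det a b c; rewrite ba ca cb !mul0r !addr0 subr0.
apply: contra_eqN => /eqP ->; rewrite nsq0 oppr0 eq_sym.
by rewrite !mulf_neq0.
Qed.

Lemma O_antisym (g : C) : g \in O -> exists a b : int, [/\ g = a%:~R + b%:~R * tau R,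
  g - g^*%R = b%:~R * isqrt R 7 & g + g^*%R = (2 * a + b)%:~R].
Proof.
move=> /isOP[a [b gE]]; exists a, b; rewrite gE.
have := conj_tau R; have : isqrt R 7 = tau R - (1 - tau R) by rewrite /tau; field; rewrite ?pnatr_eq0.
move: (tau R) (isqrt R 7) => t s -> tc; split=> //.
  by rewrite rmorphD rmorphM /= !rmorph_int tc; ring.
by rewrite rmorphD rmorphM /= !rmorph_int tc intrD intrM; ring.
Qed.

Lemma isqrt7_neq0 : isqrt R 7 != 0.
Proof. by apply/eqP => e; have := sqr_isqrt7 R; rewrite e expr0n /= => /esym/eqP; rewrite oppr_eq0 pnatr_eq0. Qed.

Variables (A : 'M[C]_3) (v : 'cV[C]_3) (l : C).
Hypotheses (vneg : herm v v < 0) (reg : regular_at A v l).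

Let Au : uni A. Proof. by case: reg. Qed.
Let AO : Omx A. Proof. by case: reg. Qed.
Let Ad : \det A = 1. Proof. by case: reg. Qed.
Let Av : A *m v = l *: v. Proof. by case: reg. Qed.
Let l0 : l != 0. Proof. by have [] := nsq_unit_inv (eig_neg_unit Au vneg Av). Qed.
Let lc : l^*%R = l^-1. Proof. by have [] := nsq_unit_inv (eig_neg_unit Au vneg Av). Qed.

(* The Hermitian form <(A - A^-1) u, w> / sqrt(-7), definite on the orthogonal of
   the fixed vector when A has eigenvalues 1, l and conj l. *)
Definition skew_form (u w : 'cV[C]_3) : C := (isqrt R 7)^-1 * (herm (A *m u) w - herm (uinv A *m u) w).

Lemma skewD u u' w : skew_form (u + u') w = skew_form u w + skew_form u' w.
Proof. by rewrite /skew_form !mulmxDr !hermDl opprD addrACA mulrDr. Qed.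
Lemma skewZ c u w : skew_form (c *: u) w = c * skew_form u w.
Proof. by rewrite /skew_form -!scalemxAr !hermZl; ring. Qed.
Lemma uinv_adj u w : herm (uinv A *m u) w = herm u (A *m w).
Proof. by rewrite -(uni_herm _ w Au) mulmxA uinvKr // mul1mx. Qed.
Lemma skewC u w : skew_form w u = (skew_form u w)^*%R.
Proof.
have sc : ((isqrt R 7)^-1)^*%R = - (isqrt R 7)^-1.
  rewrite fmorphV -invrN; congr (_^-1); exact: conj_isqrt7.
rewrite /skew_form rmorphM rmorphB /= sc.
rewrite -hermCC -(hermCC (uinv A *m u)) uinv_adj (uni_adj _ _ Au).
by rewrite mulNr -mulrN opprB.
Qed.

(** The difference of <A u, u> and its conjugate is b sqrt(-7), so the twisted form reads off the
    coordinate of tau and is integral. *)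
Lemma skew_int u : Omx u -> exists a b : int, [/\ herm (A *m u) u = a%:~R + b%:~R * tau R,
  skew_form u u = b%:~R & herm (A *m u) u + herm (uinv A *m u) u = (2 * a + b)%:~R].
Proof.
move=> uO; have gO : herm (A *m u) u \in O by apply: herm_O => //; exact: Omx_mul.
have [a [b [e1 e2 e3]]] := O_antisym gO; exists a, b.
have e4 : herm (uinv A *m u) u = (herm (A *m u) u)^*%R by rewrite uinv_adj hermCC.
split=> //; last by rewrite e4.
by rewrite /skew_form e4 e2 mulrC mulfK ?isqrt7_neq0.
Qed.

Variables (k : nat) (P : 'M[C]_3).
Hypotheses (k0 : (0 < k)%N) (PO : Omx P) (AP : A *m P = P) (trP : \tr P = k%:R).
Hypothesis Padj : forall u f : 'cV[C]_3, A *m f = f -> herm (P *m u) f = k%:R * herm u f.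
Hypothesis Pfix : forall f : 'cV[C]_3, A *m f = f -> P *m f = k%:R *: f.
Hypotheses (l1 : l != 1) (Iml : Im l < 0).
Hypothesis ch' : (l^*%R) ^+ 3 - \tr A * (l^*%R) ^+ 2 + (\tr A)^*%R * l^*%R - 1 = 0.

Let fix_perp f : A *m f = f -> herm f v = 0.
Proof.
move=> Af; have := eig_perp Au vneg Av f; rewrite Af => /eqP.
rewrite -[X in X == _]mul1r -subr_eq0 -mulrBl mulf_eq0 subr_eq0 eq_sym (negPf l1) /=.
by move/eqP.
Qed.

Let llc : l^*%R != l.
Proof. by move: Iml; case: (l) => a b /=; rewrite eq_complex /= eqxx /=; lra. Qed.

(** [P] is k times the projection onto the line fixed by A, which v does not span since l is not 1.
    As for a rational point, the integer <P y, y> = k/N shows that the norm N of the primitive fixed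
    vector w divides k. *)
Lemma irr_basis : exists w y r1 r2 v', exists N j : nat,
  [/\ [/\ Omx w, A *m w = w, perp_basis w y r1 r2, herm w w = N%:R & k = (j * N)%N],
      (0 < N)%N,
      [/\ A *m v' = l^*%R *: v', v' != 0, herm v' v = 0, herm v' w = 0 & herm w v = 0] &
      \det (cols v w v') != 0].
Proof.
have kC : (k%:R : C) != 0 by rewrite pnatr_eq0 -lt0n.
have [j j0] : exists j, col j P != 0.
  apply/existsP; rewrite -negb_forall; apply/negP => /forallP h.
  have P0 : P = 0 by apply/matrixP => i j; have /eqP/matrixP/(_ i 0) := h j; rewrite !mxE.
  by move: kC; rewrite -trP P0 mxtrace0 eqxx.
have colO : Omx (col j P) by move=> i i'; rewrite mxE.
have [w [y [r1 [r2 [d [[wO yO r1O r2O] dO e [yw r1w r2w] D]]]]]] := dual_basis colO j0.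
have d0 : d != 0 by apply: contraNneq j0 => d0; rewrite e d0 scale0r.
have Aw : A *m w = w.
  by apply: (scalerI d0); rewrite scalemxAr -e colE mulmxA AP.
have w0 : w != 0 by apply: contraNneq j0 => w0; rewrite e w0 scaler0.
have wv := fix_perp Aw.
have wpos := perp_neg_gt0 vneg wv w0.
have [N N0 NE] := herm_posnat wO wpos.
have wwN : herm w w = N%:R by rewrite herm_real NE rmorph_nat.
have NC : (N%:R : C) != 0 by rewrite pnatr_eq0 -lt0n.
have [v' v'0 Av'] := char_eig Au Ad ch'.
have v'v : herm v' v = 0.
  have := eig_perp Au vneg Av v'; rewrite Av' hermZl => /eqP.
  by rewrite -subr_eq0 -mulrBl mulf_eq0 subr_eq0 (negPf llc) /= => /eqP.
have l1' : l^*%R != 1 by rewrite -(inj_eq (can_inj (@conjCK _))) conjCK conjC1.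
have v'f f : A *m f = f -> herm v' f = 0.
  move=> Af; have := uni_herm v' f Au; rewrite Av' Af hermZl => /eqP.
  by rewrite -[X in _ == X]mul1r -subr_eq0 -mulrBl mulf_eq0 subr_eq0 (negPf l1') /= => /eqP.
have v'pos := perp_neg_gt0 vneg v'v v'0.
have det0 : \det (cols v w v') != 0.
  apply: orth_det; [by rewrite ltr0_neq0| | |exact: wv|exact: v'v|exact: v'f].
    by rewrite gt_eqF // herm_gt0.
  by rewrite gt_eqF // herm_gt0.
have Pperp u : herm u w = 0 -> P *m u = 0.
  move=> uw; have Af : A *m (P *m u) = P *m u by rewrite mulmxA AP.
  apply: (perp_all det0); first exact: fix_perp.
    by rewrite Padj // uw mulr0.
  by rewrite hermCC v'f // conjC0.
have ww : herm w w != 0 by rewrite gt_eqF // herm_gt0.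
have Pyy : herm (P *m y) y = k%:R / N%:R.
  have := Pperp _ (perp_decomp y ww); rewrite mulmxBr -scalemxAr (Pfix Aw) => /eqP.
  by rewrite subr_eq0 => /eqP ->; rewrite !hermZl yw [herm w y]hermCC yw conjC1 wwN; field.
have WyO : herm (P *m y) y \in O by apply: herm_O => //; apply: Omx_mul.
have [n nE] : exists n : int, herm (P *m y) y = n%:~R.
  apply: O_real_int => //; rewrite Pyy -(rmorph_nat (real_complex R) k) -(rmorph_nat (real_complex R) N) -fmorphV -rmorphM //.
have kn : k%:Z = n * N%:Z.
  by apply: (@intr_inj C); rewrite intrM -nE Pyy divfK.
exists w, y, r1, r2, v', N, (absz n); split=> //; first split=> //.
  by rewrite -[LHS]/(absz k%:Z) kn abszM.
by split; [exact: Av'|exact: v'0|exact: v'v|exact: v'f|exact: wv].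
Qed.

(** On the orthogonal of w, spanned by v and v', the twisted form multiplies <v,v> by K and <v',v'>
    by -K, where K = 2 Im(l) / sqrt 7. The normalisation Im(l) < 0 makes K negative, hence the form
    positive. Its determinant on the orthogonal lattice is K^2 N, and [rank2_short] yields the
    bound, since 7 K^2 = - Re((l - conj l)^2). *)
Lemma irr_short : exists w s (a b : int), exists N j : nat,
  [/\ [/\ Omx w, A *m w = w, herm w w = N%:R & k = (j * N)%N], (0 < N)%N, Omx s /\ herm s w = 0,
     [/\ herm (A *m s) s = a%:~R + b%:~R * tau R, herm (A *m s) s + herm (uinv A *m s) s = (2 * a + b)%:~R, 0 < b &
       3 * (b%:~R : R) ^+ 2 <= - Re ((l - l^*%R) ^+ 2) * N%:R] &
     forall u, herm u w = 0 -> exists a b v', [/\ u = a *: v + b *: v', A *m v = l *: v & A *m v' = l^*%R *: v']].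
Proof.
have [w [y [r1 [r2 [v' [N [j [[wO Aw Bas wwN kE] N0 [Av' v'0 v'v v'w wv] det0]]]]]]]] := irr_basis.
have [[yO r1O r2O] yw r1w r2w D] := Bas.
have ww : herm w w != 0 by rewrite wwN pnatr_eq0 -lt0n.
have dec u : herm u w = 0 -> exists a b, u = a *: v + b *: v'.
  move=> uw; have [a [b [c e]]] := perp_span u det0; exists a, c.
  have b0 : b = 0.
    have := uw; rewrite e !hermDl !hermZl [herm v w]hermCC wv conjC0 v'w !mulr0 add0r addr0 => /eqP.
    by rewrite mulf_eq0 (negPf ww) orbF => /eqP.
  by rewrite {1}e b0 scale0r add0r.
pose K : R := 2 * Im l / Num.sqrt 7.
have s7 : 0 < Num.sqrt (7 : R) by rewrite sqrtr_gt0 ltr0n.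
have Kneg : K < 0 by rewrite /K pmulr_llt0 ?invr_gt0 // pmulr_rlt0.
have KE : (isqrt R 7)^-1 * (l - l^*%R) = K%:C%C.
  apply: (mulfI isqrt7_neq0); rewrite mulrA mulfV ?isqrt7_neq0 // mul1r /K /isqrt.
  have sc : 2 * Im l = Num.sqrt 7 * (2 * Im l / Num.sqrt 7) by field; rewrite gt_eqF.
  by case: (l) sc => p q sc; apply/eqP; rewrite eq_complex /=; apply/andP; split; apply/eqP; move: sc => /=; lra.
have K2 : 7 * K ^+ 2 = - Re ((l - l^*%R) ^+ 2).
  have -> : K ^+ 2 = (2 * Im l) ^+ 2 / 7 by rewrite /K expr_div_n sqr_sqrt7.
  by case: (l) => x1 y1; rewrite expr2 /=; field; rewrite ?pnatr_eq0.
clearbody K.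
have uAv : uinv A *m v = l^*%R *: v.
  by apply: (scalerI l0); rewrite scalemxAr -Av mulmxA uinvK // mul1mx scalerA lc mulfV // scale1r.
have uAv' : uinv A *m v' = l *: v'.
  have lc0 : l^*%R != 0 by rewrite conjC_eq0.
  by apply: (scalerI lc0); rewrite scalemxAr -Av' mulmxA uinvK // mul1mx scalerA lc mulVf // scale1r.
have hv u : skew_form v u = K%:C%C * herm v u.
  by rewrite /skew_form Av uAv !hermZl -KE; ring.
have hv' u : skew_form v' u = - K%:C%C * herm v' u.
  by rewrite /skew_form Av' uAv' !hermZl -KE; ring.
have vv' : herm v v' = 0 by rewrite hermCC v'v conjC0.
have v'pos := perp_neg_gt0 vneg v'v v'0.
have ReK (z : C) : Re (K%:C%C * z) = K * Re z by case: z => p q /=; ring.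
have pos (a b : C) : a \in O -> b \in O -> (a != 0) || (b != 0) ->
    exists2 k : nat, (0 < k)%N & Re (skew_form (a *: r1 + b *: r2) (a *: r1 + b *: r2)) = k%:R.
  move=> aO bO ab; set u := a *: r1 + b *: r2.
  have uO : Omx u by apply: Omx_add; apply: Omx_scale.
  have uw : herm u w = 0 by rewrite hermDl !hermZl r1w r2w !mulr0 addr0.
  have u0 : u != 0.
    apply: contraTneq ab => e; rewrite negb_or !negbK.
    pose z : 'cV[C]_3 := \col_i nth 0 [:: 0; a; b] i.
    have z0 : z = 0.
      have ez : cols y r1 r2 *m z = 0 by rewrite cols_mul !mxE /= scale0r add0r.
      have U : cols y r1 r2 \in unitmx by rewrite unitmxE unitfE -nsq_eq0 D oner_eq0.
      by rewrite -[LHS](mulKmx U) ez mulmx0.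
    apply/andP; split; apply/eqP.
      by have := congr1 (fun z : 'cV[C]_3 => z 1 0) z0; rewrite !mxE.
    by have := congr1 (fun z : 'cV[C]_3 => z 2%:R 0) z0; rewrite !mxE.
  have [p [q [_ qE _]]] := skew_int uO.
  have [c [d e]] := dec u uw.
  have cd : Re (skew_form u u) = - K * (nsq c * - Re (herm v v) + nsq d * Re (herm v' v')).
    rewrite e skewD !skewZ hv hv' !hermDr !hermZr vv' v'v !mulr0 addr0 add0r.
    have -> : c * (K%:C%C * (c^*%R * herm v v)) + d * (- K%:C%C * (d^*%R * herm v' v')) =
      (K * (nsq c * Re (herm v v) - nsq d * Re (herm v' v')))%:C%C.
      by rewrite rmorphM rmorphB !rmorphM /= !nsqE -!herm_real; ring.
    by rewrite /=; ring.
  have h0 : 0 < Re (skew_form u u).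
    rewrite cd mulr_gt0 ?oppr_gt0 //.
    have vn : 0 < - Re (herm v v) by rewrite oppr_gt0 -herm_lt0.
    have [c0|c0] := eqVneq c 0.
      rewrite c0 nsq0 mul0r add0r mulr_gt0 // lt_def nsq_ge0 nsq_eq0 andbT.
      by apply: contra u0 => /eqP d0; rewrite e c0 d0 !scale0r addr0.
    rewrite ltr_pwDl // ?mulr_ge0 ?nsq_ge0 ?(ltW v'pos) //.
    by rewrite mulr_gt0 // lt_def nsq_ge0 nsq_eq0 c0.
  move: h0; rewrite qE intC_Re ltr0z; case: (q) => // n n0; by exists n.
have [a [b [c [d /= [[aO bO cO dO] _ [_ _ _ sh] [m m0 mE]]]]]] := rank2_short skewD skewZ skewC pos.
set s := a *: r1 + b *: r2 in sh mE.
have sO : Omx s by apply: Omx_add; apply: Omx_scale.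
have sw : herm s w = 0 by rewrite hermDl !hermZl r1w r2w !mulr0 addr0.
have [p [q [gE qE tE]]] := skew_int sO.
exists w, s, p, q, N, j; split=> //; last first.
  by move=> u uw; have [c1 [d1 e]] := dec u uw; exists c1, d1, v'.
have qm : (q%:~R : R) = m%:R by rewrite -mE qE intC_Re.
split=> //; first by rewrite -(ltr0z R) qm ltr0n.
have [c1 [d1 e1]] := dec r1 r1w; have [c2 [d2 e2]] := dec r2 r2w.
have G1 := form_gram skewD skewZ skewC v v' c1 d1 c2 d2.
have G2 := form_gram (@hermDl R) (@hermZl R) (@hermCC R) v v' c1 d1 c2 d2.
rewrite /= -e1 -e2 in G1 G2.
have pg := perp_gram yw r1w r2w D ww.
have key : Re (skew_form r1 r1) * Re (skew_form r2 r2) - nsq (skew_form r2 r1) = K ^+ 2 * N%:R.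
  rewrite G1 hv !hv' v'v mulr0 nsq0 subr0.
  have -> : N%:R = Re (herm w w) by rewrite wwN -(rmorph_nat (real_complex R)).
  rewrite -[Re (herm w w)]opprK -pg G2 v'v nsq0 subr0 ReK mulNr.
  have -> : Re (- (K%:C%C * herm v' v')) = - (K * Re (herm v' v')) by rewrite -ReK; case: (_ * _) => ? ?.
  by ring.
rewrite key mE -qm in sh.
by rewrite -K2; exact: short_bound_arith sh.
Qed.

End Irrational.

Definition zinvertible (a b c : zvec) : bool :=
  let M := mcols a b c in meq (mmul M (mscale (mdet M) (madjg M))) mone.

(** * Elements of order 3 and 4 with irrational eigenvalue at the point *)

Section Order34.
Variable R : realType.
Local Notation C := R[i].
Local Notation O := (isO R).
Local Notation Re := complex.Re.
Local Notation Im := complex.Im.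
Local Notation eV := (eV R).
Local Notation eM := (eM R).
Local Notation zc := (zc R).
Implicit Types (A B P : 'M[C]_3) (u v w x y r s : 'cV[C]_3).

Lemma comm_on_basis A P g (a b c : 'cV[C]_3) B : cols a b c *m B = 1%:M ->
  A *m (P *m a) = P *m (g *m a) -> A *m (P *m b) = P *m (g *m b) -> A *m (P *m c) = P *m (g *m c) ->
  A *m P = P *m g.
Proof.
move=> BB ha hb hc; rewrite -[LHS]mulmx1 -[RHS]mulmx1 -BB !mulmxA; congr (_ *m B).
by rewrite -!mulmxA !mul_cols ha hb hc.
Qed.

Lemma Omx_cols (a b c : 'cV[C]_3) : Omx a -> Omx b -> Omx c -> Omx (cols a b c).
Proof. by move=> aO bO cO i k; rewrite mxE; case: k => [[|[|[|k]]] hk] /=. Qed.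

Lemma zinvertibleP a b c : zinvertible a b c ->
  cols (eV a) (eV b) (eV c) *m eM (mscale (mdet (mcols a b c)) (madjg (mcols a b c))) = 1%:M.
Proof. by move/meqP => h; rewrite cols_eM -eM_mul (h R) eM_one. Qed.

Lemma gram_transferZ (a b c : 'cV[C]_3) (a0 b0 c0 : zvec) : Omx a -> Omx b -> Omx c -> zinvertible a0 b0 c0 ->
  conj_gram a b c (eV a0) (eV b0) (eV c0) ->
  exists P, [/\ uni P, Omx P, P *m eV a0 = a, P *m eV b0 = b & P *m eV c0 = c].
Proof. by move=> aO bO cO /zinvertibleP; apply: gram_transfer => //; exact: Omx_eM. Qed.

(** [P] carries the negative eigenvector x of [g] to a negative eigenvector of [A], and [A] has a
    single line of those. *)
Lemma conj_orbit A P g v l x m : uni P -> Omx P -> herm v v < 0 -> regular_at A v l ->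
  A *m P = P *m g -> herm x x < 0 -> g *m x = m *: x ->
  exists c : C, c != 0 /\ v = c *: (P *m x).
Proof.
move=> Pu PO vneg reg AP xneg gx.
have xneg' : herm (P *m x) (P *m x) < 0 by rewrite uni_herm.
have e : A *m (P *m x) = m *: (P *m x) by rewrite mulmxA AP -mulmxA gx scalemxAr.
have [c c0 cE] := reg_line vneg reg xneg' e.
by exists c^-1; rewrite invr_eq0 c0 cE scalerA mulVf // scale1r.
Qed.

Section Cases.
Variables (A : 'M[C]_3) (v : 'cV[C]_3) (l : C).
Hypotheses (vneg : herm v v < 0) (reg : regular_at A v l).

Let Au : uni A. Proof. by case: reg. Qed.
Let AO : Omx A. Proof. by case: reg. Qed.
Let Ad : \det A = 1. Proof. by case: reg. Qed.
Let Av : A *m v = l *: v. Proof. by case: reg. Qed.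
Let l0 : l != 0. Proof. by have [] := nsq_unit_inv (eig_neg_unit Au vneg Av). Qed.
Let lc : l^*%R = l^-1. Proof. by have [] := nsq_unit_inv (eig_neg_unit Au vneg Av). Qed.
Let ch : l ^+ 3 - \tr A * l ^+ 2 + (\tr A)^*%R * l - 1 = 0. Proof. exact: (lam_char Au Ad vneg Av). Qed.

Let ch' (n : int) : \tr A = n%:~R -> (l^*%R) ^+ 3 - \tr A * (l^*%R) ^+ 2 + (\tr A)^*%R * l^*%R - 1 = 0.
Proof.
move=> a; have ac : (\tr A)^*%R = n%:~R by rewrite a rmorph_int.
have := congr1 (fun z : C => z^*%R) ch; rewrite ac a.
by rewrite !exprS !expr0 !mulr1 !(rmorphB, rmorphD, rmorphM) /= rmorph_int rmorph1 rmorph0.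
Qed.

(** Here l^2 = -1 and N divides 2, so 3 q^2 <= 4 N <= 8 forces q = 1. But A^2 = -1 on the orthogonal
    of w, so A^-1 s = - A s and 2 p + q = 0: q would be even. *)
Lemma order4_neg : \tr A = 1 -> l != 1 -> Im l < 0 -> False.
Proof.
move=> a l1 Il; have ac : (\tr A)^*%R = 1 by rewrite a rmorph1.
have A3 : A *m A *m A = A *m A - A + 1%:M by rewrite (CH_uni Au Ad) ac a !scale1r.
have ll : l ^+ 2 = -1.
  have : (l - 1) * (l ^+ 2 + 1) = 0 by rewrite -[RHS]ch ac a; ring.
  by move/eqP; rewrite mulf_eq0 subr_eq0 (negPf l1) /= addr_eq0 => /eqP.
have lcN : l^*%R = - l.
  by rewrite lc; apply: (mulfI l0); rewrite mulfV // mulrN -expr2 ll opprK.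
pose P := A *m A + 1%:M.
have PO : Omx P by apply: Omx_add; [exact: Omx_mul|exact: Omx_one].
have AP : A *m P = P by rewrite /P mulmxDr mulmx1 mulmxA A3 addrAC subrK.
have trP : \tr P = 2%:R.
  by rewrite /P mxtraceD (tr_sqr Au Ad) ac a mxtrace1; ring.
have Padj u f : A *m f = f -> herm (P *m u) f = 2%:R * herm u f.
  move=> Af; rewrite /P mulmxDl mul1mx hermDl -{1}Af -mulmxA uni_herm // -{1}Af uni_herm //.
  by ring.
have Pfix (f : 'cV[C]_3) : A *m f = f -> P *m f = 2%:R *: f.
  by move=> Af; rewrite /P mulmxDl mul1mx -mulmxA !Af scaler_nat mulr2n.
have [w [s [p [q [N [j [[wO Aw wN kE] N0 [sO sw] [gE tE q0 qb] dec]]]]]]] :=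
  irr_short vneg reg (isT : (0 < 2)%N) PO AP trP Padj Pfix l1 Il (ch' (n := 1) a).
have N2 : (N <= 2)%N by apply: dvdn_leq => //; rewrite kE dvdn_mull.
have [c [d [v' [sE _ Av']]]] := dec s sw.
have AAs : A *m (A *m s) = - s.
  rewrite sE !mulmxDr -!scalemxAr Av Av' -!scalemxAr Av Av' lcN !scalerA.
  by rewrite -!mulrA mulrNN -!expr2 ll !mulrN1 !scaleNr opprD.
have Ais : uinv A *m s = - (A *m s).
  by apply/eqP; rewrite -subr_eq0 opprK -[A *m s]mul1mx -{1}(uinvK Au) -mulmxA AAs mulmxN subrr.
move: tE; rewrite Ais hermNl subrr => /esym/eqP; rewrite intr_eq0 => /eqP tE.
have : (3 * (q * q) <= 4 * N%:Z).
  rewrite -(ler_int R) !intrM; rewrite expr2 in qb; apply: le_trans qb _.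
  rewrite lcN opprK (_ : (l + l) ^+ 2 = - 4%:R); last by transitivity (4 * l ^+ 2); [ring|rewrite ll; ring].
  rewrite -(rmorph_nat (real_complex R)) -rmorphN /= opprK.
  by [].
by clear -tE q0 N2; nia.
Qed.

(** The fixed vector w and a short vector s of the twisted form yield a basis w, s, A s. Its Gram
    matrix is one of two, both realised by the square of [zM6], and A acts on it by the same
    formulas; so A is conjugate to that square. *)
Lemma order3_neg x6 m : herm x6 x6 < 0 -> eM (mmul zM6 zM6) *m x6 = m *: x6 ->
  \tr A = 0 -> l != 1 -> Im l < 0 -> exists P c, [/\ uni P, Omx P, c != 0 & v = c *: (P *m x6)].
Proof.
move=> x6neg gx6 a l1 Il; have ac : (\tr A)^*%R = 0 by rewrite a rmorph0.
have A3 := cube_tr0 reg a.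
have ll : l ^+ 2 + l + 1 = 0.
  have : (l - 1) * (l ^+ 2 + l + 1) = 0 by rewrite -[RHS]ch ac a; ring.
  by move/eqP; rewrite mulf_eq0 subr_eq0 (negPf l1) /= => /eqP.
have lcE : l^*%R = l ^+ 2.
  rewrite lc; apply: (mulfI l0); rewrite mulfV //.
  by apply/eqP; rewrite eq_sym -subr_eq0; apply/eqP; rewrite -[RHS](mulr0 (l - 1)) -ll; ring.
pose P := A *m A + A + 1%:M.
have PO : Omx P by apply: Omx_add; [apply: Omx_add => //; exact: Omx_mul|exact: Omx_one].
have AP : A *m P = P by rewrite /P !mulmxDr mulmx1 mulmxA A3 -addrA addrC.
have trP : \tr P = 3%:R.
  by rewrite /P !mxtraceD (tr_sqr Au Ad) ac a mxtrace1; ring.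
have Padj u f : A *m f = f -> herm (P *m u) f = 3%:R * herm u f.
  move=> Af; rewrite /P !mulmxDl mul1mx !hermDl -{1}Af -mulmxA uni_herm // -{1 2}Af !uni_herm //.
  by ring.
have Pfix (f : 'cV[C]_3) : A *m f = f -> P *m f = 3%:R *: f.
  by move=> Af; rewrite /P !mulmxDl mul1mx -mulmxA !Af scaler_nat mulrSr mulr2n.
have [w [s [p [q [N [j [[wO Aw wN kE] N0 [sO sw] [gE tE q0 qb] dec]]]]]]] :=
  irr_short vneg reg (isT : (0 < 3)%N) PO AP trP Padj Pfix l1 Il (ch' (n := 0) a).
have N3 : (N <= 3)%N by apply: dvdn_leq => //; rewrite kE dvdn_mull.
have [c [d [v' [sE _ Av']]]] := dec s sw.
have lc3 : (l^*%R) ^+ 2 + l^*%R + 1 = 0 by rewrite lcE -[RHS](mulr0 (l ^+ 2 - l + 1)) -ll; ring.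
have AAs : A *m (A *m s) = - s - A *m s.
  apply/eqP; rewrite -subr_eq0 opprB opprK.
  rewrite sE !mulmxDr -!scalemxAr Av Av' -!scalemxAr Av Av' !scalerA.
  apply/eqP; transitivity ((l ^+ 2 + l + 1) *: (c *: v) + ((l^*%R) ^+ 2 + l^*%R + 1) *: (d *: v')); last by rewrite ll lc3 !scale0r addr0.
  by apply/matrixP => i1 i2; rewrite !mxE; ring.
have Ais : uinv A *m s = - s - A *m s.
  by rewrite -AAs -[in LHS](mul1mx s) -A3 !mulmxA uinvK // mul1mx.
(* (l - conj l)^2 = -3 turns the bound into q^2 <= N <= 3. *)
have b1 : q = 1.
  have : (3 * (q * q) <= 3 * N%:Z).
    rewrite -(ler_int R) !intrM; rewrite expr2 in qb; apply: le_trans qb _.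
    rewrite lcE (_ : (l - l ^+ 2) ^+ 2 = - 3%:R); last first.
      transitivity ((l ^+ 2 + l + 1) * (l ^+ 2 - 3 * l + 3) - 3); first by ring.
      by rewrite ll mul0r sub0r.
    by rewrite -(rmorph_nat (real_complex R)) -rmorphN /= opprK.
  by clear -q0 N3; nia.
have ssE : herm s s = - (2 * p + 1)%:~R.
  by move: tE; rewrite b1 Ais => <-; rewrite hermBl hermNl; ring.
have Asw : herm (A *m s) w = 0 by rewrite -Aw uni_herm.
have AsAs : herm (A *m s) (A *m s) = herm s s by rewrite uni_herm.
have := gram_det w s (A *m s); rewrite sw Asw !mul0r !addr0 wN AsAs [herm s (A *m s)]hermCC gE ssE b1 -nsqE nsqO.
have dO : \det (cols w s (A *m s)) \in O by apply/Omx_det/Omx_cols => //; exact: Omx_mul.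
have [dz dE] := isO_zc dO; rewrite dE nsq_zc => e.
have {}e : - int_of_Z (znorm dz) = N%:Z * ((2 * p + 1) * (2 * p + 1) - (p * p + p + 2)).
  apply: (@intr_inj C); rewrite intrN intrM intrB intrM.
  move: e; rewrite !(rmorph_int (real_complex R)) => ->.
  by rewrite !expr2 mulrNN !mulr1.
have zn0 : 0 <= int_of_Z (znorm dz) by rewrite -(ler_int R) -nsq_zc nsq_ge0.
(* The Gram determinant of w, s, A s gives |det|^2 = N (1 - 3 p (p + 1)), which is nonnegative only
   for p = 0 or -1 and is then N. *)
have pE : p = 0 \/ p = -1.
  by clear -e zn0 N0; nia.
have zN : int_of_Z (znorm dz) = N%:Z by case: pE e => ->; clear; lia.
have N1 : N = 1%N.
  have N13 : N = 1%N \/ N = 3%N by move: kE N0 N3; clear; case: N => [|[|[|[|N]]]] //; lia.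
  case: N13 => // N13; case: (@znorm_neq3 dz.1 dz.2); move: zN; rewrite N13 /znorm; clear; lia.
pose s0 := if p == 0 then zs6m else zs6p.
pose t0 := mvec (mmul zM6 zM6) s0.
have [c1 c2] : zinvertible zw6 s0 t0 /\ [&& zeq (zherm zw6 zw6) (zi 1), veq (mvec (mmul zM6 zM6) zw6) zw6,
   veq (mvec (mmul zM6 zM6) t0) (vadd (vscale (zi (-1)) s0) (vscale (zi (-1)) t0)),
   zeq (zherm s0 s0) (if p == 0 then zi (-1) else zi 1), zeq (zherm t0 t0) (zherm s0 s0) & [&& zeq (zherm s0 zw6) z0, zeq (zherm t0 zw6) z0 &
   zeq (zherm t0 s0) (if p == 0 then ztau else zmtaub)]].
  by rewrite /t0 /s0; case: pE => ->; vm_compute.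
case/and5P: c2 => /zeqP k1 /veqP k2 /veqP k3 /zeqP k4 /andP[/zeqP k5 /and3P[/zeqP k6 /zeqP k7 /zeqP k8]].
have ht0 : eV t0 = eM (mmul zM6 zM6) *m eV s0 by rewrite -eM_vec.
have [Q [Qu QO Qw Qs Qt]] : exists Q, [/\ uni Q, Omx Q, Q *m eV zw6 = w, Q *m eV s0 = s & Q *m eV t0 = A *m s].
  apply: (gram_transferZ wO sO _ c1); first exact: Omx_mul.
  have ss0 : herm s s = zc (zherm s0 s0)
    by rewrite k4 ssE -intrN; case: pE => -> /=; rewrite zc_int; congr (_%:~R); vm_compute.
  split; rewrite ?herm_eV.
  - by rewrite wN N1 k1 zc1.
  - exact: ss0.
  - by rewrite k5 AsAs.
  split; rewrite ?herm_eV.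
  - by rewrite k6 zc0.
  - by rewrite k7 zc0.
  by rewrite gE k8 b1; case: pE => ->.
exists Q; suff AQ : A *m Q = Q *m eM (mmul zM6 zM6).
  by have [e1 [e10 e1E]] := conj_orbit Qu QO vneg reg AQ x6neg gx6; exists e1.
apply: (comm_on_basis (zinvertibleP c1)).
- by rewrite Qw Aw -eM_vec k2.
- by rewrite Qs -ht0 Qt.
- rewrite Qt AAs -eM_vec k3 eV_add !eV_scale mulmxDr -!scalemxAr Qs Qt zc_int.
  by rewrite !scaleN1r.
Qed.

Lemma eig_Im_neq0 : l ^+ 2 != 1 -> ~~ (Im l < 0) -> Im l^-1 < 0.
Proof.
move=> l2; rewrite -lc -leNgt le_eqVlt => /orP[/eqP e|]; last by case: (l) => a b /=; rewrite oppr_lt0.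
case/negP: l2; rewrite expr2; apply/eqP.
suff {1}-> : l = l^-1 by rewrite mulVf.
by rewrite -lc; move: e; case: (l) => a b /= e; apply/eqP; rewrite eq_complex /= eqxx -e oppr0 eqxx.
Qed.

End Cases.

Section Dispatch.
Variables (x6 : 'cV[C]_3) (m : C).
Hypotheses (x6neg : herm x6 x6 < 0) (gx6 : eM (mmul zM6 zM6) *m x6 = m *: x6).

Definition in_orbit x v := exists P c, [/\ uni P, Omx P, c != 0 & v = c *: (P *m x)].

Lemma order3_irr A v l : herm v v < 0 -> regular_at A v l -> \tr A = 0 -> l != 1 -> in_orbit x6 v.
Proof.
move=> vneg reg a l1; case Il : (Im l < 0); first exact: order3_neg vneg reg _ _ x6neg gx6 a l1 Il.
have [Au AO Ad Av _] := reg.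
have ch := lam_char Au Ad vneg Av; rewrite a rmorph0 in ch.
have reg' := regular_inv vneg reg; apply: (order3_neg vneg reg' x6neg gx6).
- by rewrite tr_uinv a rmorph0.
- by rewrite invr_eq1.
apply: (eig_Im_neq0 vneg reg); last by rewrite Il.
apply: contra l1 => /eqP l2; apply/eqP; move: ch.
rewrite exprS l2 mul0r mul0r subr0 addr0 mulr1 => /eqP.
by rewrite subr_eq0 => /eqP.
Qed.

Lemma order4_false A v l : herm v v < 0 -> regular_at A v l -> \tr A = 1 -> l != 1 -> False.
Proof.
move=> vneg reg a l1; case Il : (Im l < 0); first exact: order4_neg vneg reg a l1 Il.
have [Au AO Ad Av _] := reg.
have ch := lam_char Au Ad vneg Av; rewrite a rmorph1 in ch.
have reg' := regular_inv vneg reg; apply: (order4_neg vneg reg').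
- by rewrite tr_uinv a rmorph1.
- by rewrite invr_eq1.
apply: (eig_Im_neq0 vneg reg); last by rewrite Il.
apply: contra l1 => /eqP l2; apply/eqP; move: ch.
rewrite exprS l2 !mul1r !mulr1 => /eqP.
rewrite (_ : l - 1 + l - 1 = 2 * (l - 1)); last by ring.
by rewrite mulf_eq0 pnatr_eq0 /= subr_eq0 => /eqP.
Qed.

(** Squaring reduces trace 1 with l = 1 to order 2 and trace 2 to order 3, the eigenvalue at v
    staying simple; inversion turns the trace - conj tau into - tau. *)
Lemma regular_cases A v l : herm v v < 0 -> regular_at A v l ->
  [\/ in_rational_orbit v, in_orbit x6 v |
    exists B k, regular_at B v k /\ \tr B = - tau R].
Proof.
move=> vneg reg; have [Au AO Ad Av dl] := reg.
have ch := lam_char Au Ad vneg Av.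
have reg2 := @regular_sqr _ A v l reg.
have t2 := tr_sqr Au Ad.
have [p pI a] := elliptic_trace Au Ad vneg Av AO.
have ra : forall n : BinNums.Z, p = zi n -> \tr A = (int_of_Z n)%:~R by move=> n pE; rewrite a pE zc_int.
have rac : forall n : BinNums.Z, p = zi n -> (\tr A)^*%R = (int_of_Z n)%:~R by move=> n pE; rewrite (ra n pE) rmorph_int.
move: pI; rewrite !inE.
case/orP => [/eqP pE|/orP[/eqP pE|/orP[/eqP pE|/orP[/eqP pE|/orP[/eqP pE|/orP[/eqP pE|/eqP pE]]]]]].
- by case: (trace_neq3 vneg reg (ra _ pE)).
- by constructor 1; apply: (order2_orbit vneg reg); rewrite (ra _ pE).
- have a0 := ra _ pE; have [l1|l1] := eqVneq l 1.
    by constructor 1; exact: order3_orbit vneg reg a0 l1.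
  by constructor 2; exact: order3_irr vneg reg a0 l1.
- have a1 := ra _ pE; have ac1 := rac _ pE; have [l1|l1] := eqVneq l 1; last by case: (order4_false vneg reg a1 l1).
  have a2 : \tr (A *m A) = -1 by rewrite t2 ac1 a1; ring.
  constructor 1; apply: (order2_orbit vneg (reg2 _) a2).
  by rewrite /disc_char a2 l1 rmorphN1 (_ : _ - 1 = 4%:R) ?pnatr_eq0 //; ring.
- have a1 := ra _ pE; have ac1 := rac _ pE.
  have a2 : \tr (A *m A) = 0 by rewrite t2 ac1 a1; ring.
  have d2 : disc_char (A *m A) (l * l) != 0.
    by rewrite /disc_char a2 rmorph0 addr0 mulr0 mul0r subr0 mulf_neq0 ?pnatr_eq0 // expf_neq0 // mulf_neq0 //;
       have [] := nsq_unit_inv (eig_neg_unit Au vneg Av).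
  have reg' := reg2 d2; have [l1|l1] := eqVneq (l * l) 1.
    by constructor 1; exact: order3_orbit vneg reg' a2 l1.
  by constructor 2; exact: order3_irr vneg reg' a2 l1.
- constructor 3; exists A, l; split=> //; rewrite a pE /zc /=; ring.
constructor 3; exists (uinv A), l^-1; split; first exact: regular_inv.
rewrite tr_uinv a pE -zc_conj /zc /=; ring.
Qed.

End Dispatch.

End Order34.

(** * Short vectors of positive unimodular ternary forms *)

Section Rank3.
Variable R : realType.
Local Notation C := R[i].
Local Notation O := (isO R).
Local Notation Re := complex.Re.
Implicit Types (u v w : 'cV[C]_3).

Lemma hermite3_arith (m k : nat) : (0 < m)%N -> (3 * (m * m) <= 7 * k)%N -> (3 * (k * k) <= 7 * m)%N -> (m <= 2)%N.
Proof.
move=> m0 h1 h2; case: (leqP m 2) => // m3.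
have h3 : (9 * m <= 7 * k)%N by nia.
have h4 : (27 * k <= 49)%N by nia.
lia.
Qed.

Lemma hermite3_arith1 (m n z : R) : z <= 4 / 7 * m ^+ 2 -> m * m <= n + z -> 3 * (m * m) <= 7 * n.
Proof. rewrite expr2; move: (m * m) => w; lra. Qed.

Lemma hermite3_arith2 (x y : R) : 3 / 7 * y ^+ 2 <= x -> 3 * (y * y) <= 7 * x.
Proof. rewrite expr2; move: (y * y) => z; lra. Qed.

Variable h : 'cV[C]_3 -> 'cV[C]_3 -> C.
Hypothesis hD : forall u v w, h (u + v) w = h u w + h v w.
Hypothesis hZ : forall c u w, h (c *: u) w = c * h u w.
Hypothesis hC : forall u v, h v u = (h u v)^*%R.
Hypothesis hO : forall u v, Omx u -> Omx v -> h u v \in O.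
Hypothesis pos : forall u, Omx u -> u != 0 -> exists2 k : nat, (0 < k)%N & Re (h u u) = k%:R.
Hypothesis unimodular : forall a b c, nsq (\det (cols a b c)) = 1 ->
  h a a * (h b b * h c c - h c b * h b c) +
  (h b a * (h c b * h a c - h a b * h c c) + h c a * (h a b * h b c - h b b * h a c)) = 1.

Lemma rank3_min : exists m : nat, (0 < m)%N /\ (exists w, [/\ Omx w, w != 0 & Re (h w w) = m%:R]) /\
  forall u, Omx u -> u != 0 -> m%:R <= Re (h u u).
Proof.
pose p := [pred m : nat | `[< exists w, [/\ Omx w, w != 0 & Re (h w w) = m%:R] >]].
have ex : exists m, p m.
  have wO : Omx (delta_mx 0 0 : 'cV[C]_3) by exact: Omx_delta.
  have w0 : (delta_mx 0 0 : 'cV[C]_3) != 0.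
    by apply/eqP => /matrixP/(_ 0 0); rewrite !mxE /= => /eqP; rewrite oner_eq0.
  have [m _ mE] := pos wO w0; exists m; apply/asboolP; by exists (delta_mx 0 0).
case: (ex_minnP ex) => m /asboolP[w [wO w0 wE]] mmin.
exists m; split; last split; last first.
- move=> u uO u0; have [k _ kE] := pos uO u0; rewrite kE ler_nat; apply: mmin.
  by apply/asboolP; exists u.
- by exists w.
by have [k k0 kE] := pos wO w0; move/eqP: kE; rewrite wE eqr_nat => /eqP ->.
Qed.

(** Hermite's induction. Let m be the minimum, attained at q, and k the value of the projected form
    [H] at a reduced vector. As [H] has determinant m, 3 k^2 <= 7 m; lifting that vector with a
    nearest multiple of q gives m^2 <= k + 4/7 m^2. Both together force m <= 2. *)
Lemma rank3_short : exists w m, [/\ Omx w, Re (h w w) = m%:R & (0 < m <= 2)%N].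
Proof.
have [m [m0 [[w [wO w0 wE]] mmin]]] := rank3_min.
have [Q [Q' [d [QO QO' QQ' dO e]]]] := primitive_completion wO w0.
have QQ : Q' *m Q = 1%:M by apply: mulmx1C.
set q := col 0 Q in e.
have d0 : d != 0 by apply: contraNneq w0 => d0; rewrite e d0 scale0r.
have q0 : q != 0 by apply: contraNneq w0 => q0; rewrite e q0 scaler0.
have qO : Omx q by move=> i j; rewrite mxE.
(* w = d q with |d|^2 >= 1, so by minimality the primitive vector q has the same norm. *)
have qm : Re (h q q) = m%:R.
  apply/eqP; rewrite eq_le mmin // andbT -wE e hZ (form_Zr hZ hC) mulrA -nsqE (form_real hC) /= mul0r subr0.
  by rewrite ler_peMl ?nsqO_ge1 // (le_trans (ler0n _ m)) // mmin.
have hq : h q q = m%:R%:C%C by rewrite (form_real hC) qm.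
pose r1 := col 1 Q; pose r2 := col 2%:R Q.
have QE : Q = cols q r1 r2.
  by apply/matrixP => i; apply: ord3P; rewrite !mxE.
have dQ : nsq (\det (cols q r1 r2)) = 1.
  have := congr1 determinant QQ'; rewrite det_mulmx det1 -QE => dd.
  have a1 : 1 <= nsq (\det Q).
    by rewrite nsqO_ge1 ?Omx_det //; apply/eqP => z; move/eqP: dd; rewrite z mul0r eq_sym oner_eq0.
  have a2 : 1 <= nsq (\det Q').
    by rewrite nsqO_ge1 ?Omx_det //; apply/eqP => z; move/eqP: dd; rewrite z mulr0 eq_sym oner_eq0.
  have a3 : nsq (\det Q) * nsq (\det Q') = 1 by rewrite -nsqM dd nsq1.
  by apply/eqP; rewrite eq_le a1 andbT -a3 ler_peMr // nsq_ge0.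
have indep a b c : a *: q + (b *: r1 + c *: r2) = 0 -> [/\ a = 0, b = 0 & c = 0].
  pose z : 'cV[C]_3 := \col_i nth 0 [:: a; b; c] i.
  have <- : Q *m z = a *: q + (b *: r1 + c *: r2) by rewrite QE cols_mul !mxE.
  move=> Qz; have z0 : z = 0 by rewrite -[z]mul1mx -QQ -mulmxA Qz mulmx0.
  by split; [have := congr1 (fun z : 'cV[C]_3 => z 0 0) z0|have := congr1 (fun z : 'cV[C]_3 => z 1 0) z0|
    have := congr1 (fun z : 'cV[C]_3 => z 2%:R 0) z0]; rewrite !mxE.
have mC : (m%:R%:C%C : C) != 0 by rewrite (inj_eq (@complexI _)) pnatr_eq0 -lt0n.
(* The form induced on the quotient by q, multiplied by m to clear the denominator. *)
pose H u v := m%:R%:C%C * h u v - h u q * h q v.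
have HD u v w' : H (u + v) w' = H u w' + H v w' by rewrite /H !hD; ring.
have HZ c u w' : H (c *: u) w' = c * H u w' by rewrite /H !hZ; ring.
have mc : (m%:R%:C%C : C)^*%R = m%:R%:C%C by apply/eqP; rewrite eq_complex /= oppr0 !eqxx.
have HC u v : H v u = (H u v)^*%R by rewrite /H rmorphB !rmorphM /= mc -!hC mulrC [h v q * _]mulrC; ring.
have r1O : Omx r1 by move=> i j; rewrite mxE.
have r2O : Omx r2 by move=> i j; rewrite mxE.
have HE u : H u u = (m%:R * Re (h u u) - nsq (h u q))%:C%C.
  by rewrite rmorphB rmorphM /= -(form_real hC) nsqE -hC.
have zE' u : h (m%:R%:C%C *: u + (- h u q) *: q) (m%:R%:C%C *: u + (- h u q) *: q) = (m%:R * Re (H u u))%:C%C.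
  rewrite rmorphM /= -(form_real HC) /H !hD !hZ !(form_Dr hD hC) !(form_Zr hZ hC) (hC u q) mc hq.
  by rewrite rmorphN /=; ring.
have Hpos a b : a \in O -> b \in O -> (a != 0) || (b != 0) ->
    exists2 k : nat, (0 < k)%N & Re (H (a *: r1 + b *: r2) (a *: r1 + b *: r2)) = k%:R.
  move=> aO bO ab; set u := a *: r1 + b *: r2.
  have uO : Omx u by apply: Omx_add; apply: Omx_scale.
  pose z := m%:R%:C%C *: u + (- h u q) *: q.
  have mO : (m%:R%:C%C : C) \in O by rewrite (rmorph_nat (real_complex R)) rpred_nat.
  have zO : Omx z by apply: Omx_add; apply: Omx_scale => //; rewrite rpredN hO.
  have z0 : z != 0.
    apply/eqP => z0; have := indep (- h u q) (m%:R%:C%C * a) (m%:R%:C%C * b).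
    rewrite -!scalerA -scalerDr addrC -/u -/z z0 => /(_ erefl)[_ /eqP + /eqP].
    by rewrite !mulf_eq0 (negPf mC) /= => a0 b0; move: ab; rewrite a0 b0.
  have [k k0 kE] := pos zO z0.
  have zE : h z z = (m%:R * (m%:R * Re (h u u) - nsq (h u q)))%:C%C by rewrite zE' HE.
  rewrite HE /=; have [n nE] := nsqO_nat (hO uO qO).
  have [k2 _ k2E] : exists2 k : nat, (0 <= k)%N & Re (h u u) = k%:R.
    have [-> |u0] := eqVneq u 0; first by exists 0%N => //; rewrite -[X in h X _](scale0r 0) hZ mul0r.
    by have [k' k'0 ->] := pos uO u0; exists k'.
  have : 0 < m%:R * (m%:R * Re (h u u) - nsq (h u q)) by move: kE; rewrite zE /= => ->; rewrite ltr0n.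
  rewrite pmulr_rgt0 ?ltr0n // k2E nE -natrM subr_gt0 ltr_nat => lt.
  by exists (m * k2 - n)%N; rewrite ?subn_gt0 // natrB // ltnW.
have [a [b [c [d' /= [[aO bO cO d'O] dd [_ _ _ sh] [k k0 kE]]]]]] := rank2_short HD HZ HC Hpos.
set s := a *: r1 + b *: r2 in kE sh.
(* The determinant of this Schur complement is m times the ternary determinant, which is 1. *)
have DE : Re (H r1 r1) * Re (H r2 r2) - nsq (H r2 r1) = m%:R.
  apply: complexI; rewrite rmorphB rmorphM /= -!(form_real HC) nsqE -HC.
  have := unimodular dQ; rewrite /H hq; move: (h r1 r1) (h r2 r2) (h r1 r2) (h r2 r1) (h r1 q) (h q r1) (h r2 q) (h q r2) => x1 x2 x3 x4 x5 x6 x7 x8 ue.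
  by rewrite -[RHS]mulr1 -ue; ring.
rewrite DE kE in sh.
have sO : Omx s by apply: Omx_add; apply: Omx_scale.
have [t tO tle] := nearestO (h s q / m%:R%:C%C).
have mR : (0 : R) < m%:R by rewrite ltr0n.
have shift := form_shift hD hZ hC (r1 := q) s t; rewrite /= qm in shift.
have {}shift := shift (lt0r_neq0 mR).
have HsE : m%:R * Re (h s s) - nsq (h s q) = k%:R by rewrite -kE HE.
have bd : nsq (h s q - t * m%:R%:C%C) <= 4 / 7 * m%:R ^+ 2.
  have -> : h s q - t * m%:R%:C%C = (h s q / m%:R%:C%C - t) * m%:R%:C%C by rewrite mulrBl divfK.
  by rewrite nsqM [nsq m%:R%:C%C](_ : _ = m%:R ^+ 2) ?ler_pM2r ?exprn_gt0 // /nsq /=; ring.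
have stO : Omx (s - t *: q) by apply: Omx_add => //; apply/Omx_opp/Omx_scale.
have st0 : s - t *: q != 0.
  apply/eqP => z; have := indep (- t) a b; rewrite addrC scaleNr -/s z => /(_ erefl)[_ a0 b0].
  by move: dd; rewrite a0 b0 !mul0r subr0 nsq0 => /eqP; rewrite eq_sym oner_eq0.
have mle := mmin _ stO st0.
have mk : (3 * (m * m) <= 7 * k)%N.
  rewrite -(ler_nat R) !natrM -HsE.
  have := ler_wpM2l (ltW mR) mle; rewrite [X in _ <= X]shift.
  exact: hermite3_arith1 bd.
have kk : (3 * (k * k) <= 7 * m)%N.
  rewrite -(ler_nat R) !natrM; exact: hermite3_arith2.
by exists w, m; split=> //; rewrite m0 (hermite3_arith m0 mk kk).
Qed.
End Rank3.

(** * Elements of order 7 *)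

Section Order7.
Variable R : realType.
Local Notation C := R[i].
Local Notation O := (isO R).
Local Notation Re := complex.Re.
Local Notation Im := complex.Im.
Local Notation t := (tau R).
Implicit Types (A B N : 'M[C]_3) (v w : 'cV[C]_3).

(** The characteristic polynomial of an element of trace - tau. It is a factor of the seventh
    cyclotomic polynomial over Z[tau], and its roots are permuted by squaring. *)
Definition p7 (x : C) : C := x ^+ 3 + t * x ^+ 2 - (1 - t) * x - 1.

Let tt : t ^+ 2 - t + 2 = 0. Proof. by rewrite tau_sqr; ring. Qed.

Lemma p7_sqr x : p7 x = 0 -> p7 (x ^+ 2) = 0.
Proof.
move=> h; have -> : p7 (x ^+ 2) = p7 x * (x ^+ 3 - t * x ^+ 2 - (1 - t) * x + 1) + (t ^+ 2 - t + 2) * (x ^+ 4 - x ^+ 2).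
  by rewrite /p7; ring.
by rewrite h tt !mul0r addr0.
Qed.

(** The cofactor is [p7] with tau replaced by its conjugate 1 - tau. *)
Lemma p7_cyclotomic x : p7 x = 0 -> x ^+ 6 + x ^+ 5 + x ^+ 4 + x ^+ 3 + x ^+ 2 + x + 1 = 0.
Proof.
move=> h; transitivity (p7 x * (x ^+ 3 + (1 - t) * x ^+ 2 - t * x - 1) + (t ^+ 2 - t + 2) * (x ^+ 4 + 2 * x ^+ 3 + x ^+ 2)).
  by rewrite /p7; ring.
by rewrite h tt !mul0r addr0.
Qed.

(** A common root of [p7] and its derivative would satisfy 2 (2 tau - 1) x = 7, whose sides have
    squared moduli 28 and 49. *)
Lemma p7_simple x : p7 x = 0 -> nsq x = 1 -> 3%:R * x ^+ 2 - 2%:R * - t * x + - (1 - t) != 0.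
Proof.
move=> px n1; apply/eqP => d.
have e : 2 * (2 * t - 1) * x = 7.
  have : (2 * (2 * t - 1) * x - 7) = 9 * p7 x - (3 * x + t) * (3%:R * x ^+ 2 - 2 * - t * x + - (1 - t)) + 2 * (t ^+ 2 - t + 2) * x + (t ^+ 2 - t + 2).
    by rewrite /p7; ring.
  by rewrite px d tt !(mulr0, mul0r, addr0, subr0) => /eqP; rewrite subr_eq0 => /eqP.
have := congr1 (@nsq R) e; rewrite !nsqM n1 mulr1.
have -> : 2 * t - 1 = (-1)%:~R + 2%:~R * t by ring.
rewrite nsqO.
have -> : nsq (2 : C) = 4 by rewrite /nsq /=; ring.
have -> : nsq (7 : C) = 49 by rewrite /nsq /=; ring.
by move/eqP; rewrite -[4]/(4%:~R) -[49]/(49%:~R) -intrM eqr_int.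
Qed.

(** The minimal polynomial of 2 cos(2 pi / 7); the map u -> u^2 - 2 doubles the angle and permutes
    the roots. *)
Definition cubic7 (u : R) := u ^+ 3 + u ^+ 2 - 2 * u - 1.

Lemma twoRe (x : C) : (2 * Re x)%:C%C = x + x^*%R.
Proof. by case: x => a b; apply/eqP; rewrite eq_complex /=; apply/andP; split; apply/eqP; ring. Qed.

Lemma p7_cubic x : nsq x = 1 -> p7 x = 0 -> cubic7 (2 * Re x) = 0.
Proof.
move=> n1 h; have [x0 xc] := nsq_unit_inv n1; apply: complexI.
have e := p7_cyclotomic h.
have e2 : (2 * (2 * Re x))%:C%C = 2 * (x + x^*%R) by rewrite -twoRe rmorphM rmorph_nat.
apply: (mulfI (expf_neq0 3 x0)); rewrite rmorph0 mulr0 -[RHS]e /cubic7.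
rewrite !(rmorphB, rmorphD, rmorphXn) /= e2 !twoRe xc rmorph1.
by field.
Qed.

Lemma twoRe_sqr (x : C) : nsq x = 1 -> 2 * Re (x ^+ 2) = (2 * Re x) ^+ 2 - 2.
Proof. by case: x => a b; rewrite /nsq /= => n1; rewrite expr2 /=; rewrite expr2 in n1 *; lra. Qed.

Lemma cubic7_prod u : cubic7 u = 0 -> u * (u ^+ 2 - 2) * ((u ^+ 2 - 2) ^+ 2 - 2) = 1.
Proof.
move=> h; transitivity (1 + cubic7 u * (u ^+ 4 - u ^+ 3 - 3 * u ^+ 2 + 2 * u + 1)); first by rewrite /cubic7; ring.
by rewrite h mul0r addr0.
Qed.

(** The three conjugates have product 1, so they are not all nonpositive. *)
Lemma cubic7_pos u : cubic7 u = 0 -> [\/ 0 < u, 0 < u ^+ 2 - 2 | 0 < (u ^+ 2 - 2) ^+ 2 - 2].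
Proof.
move=> h.
have e := cubic7_prod h.
case: (ltrP 0 u) => h1; first by constructor 1.
case: (ltrP 0 (u ^+ 2 - 2)) => h2; first by constructor 2.
case: (ltrP 0 ((u ^+ 2 - 2) ^+ 2 - 2)) => h3; first by constructor 3.
have := mulr_le0_ge0 h3 (mulr_le0 h1 h2); rewrite mulrC e.
by rewrite leNgt ltr01.
Qed.

Lemma cubic7_bounds u : cubic7 u = 0 -> 0 < u ->
  [/\ 31 / 25 <= u <= 5 / 4, - (1 / 2) < u ^+ 2 - 2 < - (7 / 16) & - (181 / 100) <= (u ^+ 2 - 2) ^+ 2 - 2 < - 1].
Proof.
move=> h u0; have e : u * (u - 1) * (u + 2) = 1.
  transitivity (1 + cubic7 u); [rewrite /cubic7; ring|by rewrite h addr0].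
have u1 : 1 < u by rewrite ltNge; apply/negP => h1; nra.
have lo : 31 / 25 < u.
  rewrite ltNge; apply/negP => h1.
  have a1 : u * (u - 1) <= 31 / 25 * (6 / 25) by nra.
  by nra.
have hi : u < 5 / 4.
  rewrite ltNge; apply/negP => h1.
  have a1 : 5 / 4 * (1 / 4) <= u * (u - 1) by nra.
  by nra.
have s1 : 31 / 25 * (31 / 25) < u ^+ 2 by nra.
have s2 : u ^+ 2 < 5 / 4 * (5 / 4) by nra.
move: (u ^+ 2) s1 s2 => s s1 s2.
split; apply/andP; split; try lra; nra.
Qed.

Lemma cubic7_lt u : cubic7 u = 0 -> 0 < u -> let u2 := u ^+ 2 - 2 in (u2 < u) /\ (u2 ^+ 2 - 2 < u2).
Proof. by move=> h u0 /=; have [/andP[b1 b2] /andP[b3 b4] /andP[b5 b6]] := cubic7_bounds h u0; split; lra. Qed.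

(** The conclusion is the sum of the values of the quadratic polynomial with roots p, q at x, y, z,
    with weights -X, Y, Z. Choosing p, q so that this polynomial has one sign at x and the other at
    y, z bounds the moments of orders 0, 1, 2 without knowing the weights. *)
Lemma weights_ge0 (X Y Z x y z p q : R) : 0 <= X -> 0 <= Y -> 0 <= Z ->
  (x - p) * (x - q) <= 0 -> 0 <= (y - p) * (y - q) -> 0 <= (z - p) * (z - q) ->
  0 <= (- X * x ^+ 2 + Y * y ^+ 2 + Z * z ^+ 2) - (p + q) * (- X * x + Y * y + Z * z) + p * q * (- X + Y + Z).
Proof.
move=> X0 Y0 Z0 hx hy hz; have := mulr_ge0 Y0 hy; have := mulr_ge0 Z0 hz; have := mulr_ge0_le0 X0 hx.
move=> h1 h2 h3; apply: (le_trans (addr_ge0 (addr_ge0 h3 h2) (_ : 0 <= - (X * ((x - p) * (x - q)))))).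
  by rewrite oppr_ge0.
by rewrite le_eqVlt; apply/orP; left; apply/eqP; ring.
Qed.

Lemma weights_le0 (X Y Z x y z p q : R) : 0 <= X -> 0 <= Y -> 0 <= Z ->
  0 <= (x - p) * (x - q) -> (y - p) * (y - q) <= 0 -> (z - p) * (z - q) <= 0 ->
  (- X * x ^+ 2 + Y * y ^+ 2 + Z * z ^+ 2) - (p + q) * (- X * x + Y * y + Z * z) + p * q * (- X + Y + Z) <= 0.
Proof.
move=> X0 Y0 Z0 hx hy hz; have := mulr_ge0_le0 Y0 hy; have := mulr_ge0_le0 Z0 hz; have := mulr_ge0 X0 hx.
move=> h1 h2 h3; rewrite -oppr_ge0.
apply: (le_trans (addr_ge0 (addr_ge0 h1 (_ : 0 <= - (Y * ((y - p) * (y - q))))) (_ : 0 <= - (Z * ((z - p) * (z - q)))))); rewrite ?oppr_ge0 //.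
by rewrite le_eqVlt; apply/orP; left; apply/eqP; ring.
Qed.

Lemma weights_int (e0 e1 e2 : int) : let E0 : R := e0%:~R in let E1 : R := e1%:~R in let E2 : R := e2%:~R in
  E2 - (- (1 / 3) + - 2) * E1 + - (1 / 3) * - 2 * E0 <= 0 ->
  E2 - (1 + - 2) * E1 + 1 * - 2 * E0 <= 0 ->
  0 <= E2 - (3 / 2 + - (1 / 3)) * E1 + 3 / 2 * - (1 / 3) * E0 ->
  [/\ 3 * e2 + 7 * e1 + 2 * e0 <= 0, e2 + e1 - 2 * e0 <= 0 & 0 <= 6 * e2 - 7 * e1 - 3 * e0].
Proof.
move=> E0 E1 E2 h1 h2 h3.
have iM (k : nat) (x : int) : ((k%:R * x)%:~R : R) = k%:R * x%:~R by rewrite rmorphM /= rmorph_nat.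
split; rewrite -(ler_int R) !(rmorphD, rmorphN) /= !iM -/E0 -/E1 -/E2; move: h1 h2 h3; clearbody E0 E1 E2; lra.
Qed.

(** The root pairs (-1/3, -2), (1, -2) and (3/2, -1/3) separate u from u2 and u4; each supplies one
    linear inequality in [order7_short]. *)
Lemma cubic7_signs u : cubic7 u = 0 -> 0 < u -> let u2 := u ^+ 2 - 2 in let u4 := u2 ^+ 2 - 2 in
  [/\ [/\ 0 <= (u - - (1 / 3)) * (u - - 2), (u2 - - (1 / 3)) * (u2 - - 2) <= 0 & (u4 - - (1 / 3)) * (u4 - - 2) <= 0],
   [/\ 0 <= (u - 1) * (u - - 2), (u2 - 1) * (u2 - - 2) <= 0 & (u4 - 1) * (u4 - - 2) <= 0] &
   [/\ (u - 3 / 2) * (u - - (1 / 3)) <= 0, 0 <= (u2 - 3 / 2) * (u2 - - (1 / 3)) & 0 <= (u4 - 3 / 2) * (u4 - - (1 / 3))]].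
Proof.
move=> c u0 u2 u4; have [/andP[b1 b2] /andP[b3 b4] /andP[b5 b6]] := cubic7_bounds c u0.
rewrite -/u2 in b3 b4 b5 b6; rewrite -/u4 in b5 b6; clearbody u4 u2; clear c u0.
split; split; first [by apply: mulr_ge0; lra|by apply: mulr_le0_ge0; lra|by apply: mulr_le0; lra].
Qed.

Lemma weights_gt0 (X Y Z x y z : R) : 0 <= X -> 0 <= Y -> 0 <= Z -> 0 < X + Y + Z ->
  7 / 16 <= x -> y <= - (7 / 16) -> z <= - (7 / 16) -> 0 < X * x + Y * - y + Z * - z.
Proof.
move=> X0 Y0 Z0 p; rewrite -subr_ge0 => hx; rewrite -subr_ge0 => hy; rewrite -subr_ge0 => hz.
have := mulr_ge0 X0 hx; have := mulr_ge0 Y0 hy; have := mulr_ge0 Z0 hz => h1 h2 h3.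
apply: (@lt_le_trans _ _ (7 / 16 * (X + Y + Z))); first by rewrite mulr_gt0 // divr_gt0 ?ltr0n.
rewrite -subr_ge0; apply: (le_trans (addr_ge0 (addr_ge0 h1 h2) h3)).
by rewrite le_eqVlt; apply/orP; left; apply/eqP; field; rewrite ?pnatr_eq0.
Qed.

Lemma scale_nsq (c : C) (x : R) : c * x%:C%C * c^*%R = (x * nsq c)%:C%C.
Proof. by rewrite rmorphM /= nsqE; ring. Qed.
Lemma scale2_nsq (c : C) (x : R) : c * x%:C%C * (c^*%R * x%:C%C) = (x ^+ 2 * nsq c)%:C%C.
Proof. by rewrite rmorphM /= nsqE rmorphXn /=; ring. Qed.

Lemma gram_detN N (a b c : 'cV[C]_3) : - (\det N * (nsq (\det (cols a b c)))%:C%C) =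
  herm (N *m a) a * (herm (N *m b) b * herm (N *m c) c - herm (N *m c) b * herm (N *m b) c) +
  (herm (N *m b) a * (herm (N *m c) b * herm (N *m a) c - herm (N *m a) b * herm (N *m c) c) +
   herm (N *m c) a * (herm (N *m a) b * herm (N *m b) c - herm (N *m b) b * herm (N *m a) c)).
Proof.
set B := cols a b c; transitivity (\det (B^t* *m Jmx R *m (N *m B))).
  rewrite !det_mulmx det_J det_map_mx det_tr nsqE; ring.
have e i j : (B^t* *m Jmx R *m (N *m B)) i j = herm (N *m col j B) (col i B).
  rewrite [in RHS]colE mulmxA -colE herm_def -!mulmxA !mxE.
  by apply: eq_bigr => k _; rewrite !mxE; congr (_ * _); apply: eq_bigr => l _; rewrite !mxE.
by rewrite det3E !e; have [-> -> ->] := col_cols a b c.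
Qed.

Section Element.
Variables (A : 'M[C]_3) (v : 'cV[C]_3) (l : C).
Hypotheses (vneg : herm v v < 0) (reg : regular_at A v l) (trA : \tr A = - t).

Let Au : uni A. Proof. by case: reg. Qed.
Let AO : Omx A. Proof. by case: reg. Qed.
Let Ad : \det A = 1. Proof. by case: reg. Qed.
Let Av : A *m v = l *: v. Proof. by case: reg. Qed.
Let l1 : nsq l = 1. Proof. exact: (eig_neg_unit Au vneg Av). Qed.
Let l0 : l != 0. Proof. by have [] := nsq_unit_inv l1. Qed.
Let lc : l^*%R = l^-1. Proof. by have [] := nsq_unit_inv l1. Qed.
Let trAc : (\tr A)^*%R = - (1 - t).
Proof. by rewrite trA rmorphN /= -[1 - t]conj_tau. Qed.

Lemma char_p7 x : x ^+ 3 - \tr A * x ^+ 2 + (\tr A)^*%R * x - 1 = p7 x.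
Proof. by rewrite trAc trA /p7; ring. Qed.

Let pl : p7 l = 0. Proof. by rewrite -char_p7; exact: (lam_char Au Ad vneg Av). Qed.

Lemma order7_sqr : regular_at (A *m A) v (l ^+ 2) /\ \tr (A *m A) = - t.
Proof.
have trA2 : \tr (A *m A) = - t.
  rewrite tr_sqr // trAc trA; apply/eqP; rewrite -subr_eq0; apply/eqP; rewrite -[RHS]tt; ring.
split=> //; rewrite expr2; apply: (regular_sqr reg).
rewrite /disc_char trA2 rmorphN /= -[(tau R)^*%R]/((tau R)^*%R) conj_tau -expr2.
by apply: p7_simple; [exact: p7_sqr|rewrite expr2 nsqM l1 mulr1].
Qed.

Hypothesis lpos : 0 < Re l.

Let u1 := 2 * Re l.
Let u2 := u1 ^+ 2 - 2.
Let u4 := u2 ^+ 2 - 2.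

Let upos : 0 < u1. Proof. by rewrite /u1 mulr_gt0. Qed.
Let c1 : cubic7 u1 = 0. Proof. exact: p7_cubic. Qed.
Let n2 : nsq (l ^+ 2) = 1. Proof. by rewrite expr2 nsqM l1 mulr1. Qed.
Let u2E : 2 * Re (l ^+ 2) = u2. Proof. exact: twoRe_sqr. Qed.
Let n4 : nsq (l ^+ 2 ^+ 2) = 1. Proof. by rewrite expr2 nsqM n2 mulr1. Qed.
Let u4E : 2 * Re (l ^+ 2 ^+ 2) = u4. Proof. by rewrite twoRe_sqr // u2E. Qed.
Let bounds : [/\ 31 / 25 <= u1 <= 5 / 4, - (1 / 2) < u2 < - (7 / 16) & - (181 / 100) <= u4 < - 1].
Proof. by apply: cubic7_bounds => //; rewrite /u1 mulr_gt0. Qed.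

Lemma order7_basis : exists v1 v2, [/\ A *m v1 = l ^+ 2 *: v1, A *m v2 = l ^+ 2 ^+ 2 *: v2,
  [/\ herm v1 v = 0, herm v2 v = 0 & herm v2 v1 = 0], 0 < Re (herm v1 v1) /\ 0 < Re (herm v2 v2) & \det (cols v v1 v2) != 0].
Proof.
have [v1 v10 Av1] : exists2 x : 'cV[C]_3, x != 0 & A *m x = l ^+ 2 *: x.
  by apply: (char_eig Au Ad); rewrite char_p7 p7_sqr.
have [v2 v20 Av2] : exists2 x : 'cV[C]_3, x != 0 & A *m x = l ^+ 2 ^+ 2 *: x.
  by apply: (char_eig Au Ad); rewrite char_p7 !p7_sqr.
have [lt21 lt42] := cubic7_lt c1 upos; rewrite -/u2 -/u4 in lt21 lt42.
have d12 : l ^+ 2 != l.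
  by apply: contraTneq lt21 => e; rewrite -u2E e ltxx.
have d14 : l ^+ 2 ^+ 2 != l.
  by apply: contraTneq (lt_trans lt42 lt21) => e; rewrite -/u4 -u4E e ltxx.
have d24 : l ^+ 2 ^+ 2 != l ^+ 2.
  by apply: contraTneq lt42 => e; rewrite -/u4 -u4E e u2E ltxx.
have perp x k : A *m x = k *: x -> k != l -> herm x v = 0.
  move=> Ax kl; have := eig_perp Au vneg Av x; rewrite Ax hermZl => /eqP.
  by rewrite -subr_eq0 -mulrBl mulf_eq0 subr_eq0 (negPf kl) /= => /eqP.
have v1v := perp _ _ Av1 d12; have v2v := perp _ _ Av2 d14.
have v21 : herm v2 v1 = 0.
  have := uni_herm v2 v1 Au; rewrite Av1 Av2 hermZl hermZr => /eqP.
  have [z0 ->] := nsq_unit_inv n2; rewrite mulrA -[X in _ == X]mul1r -subr_eq0 -mulrBl mulf_eq0 => /orP[|/eqP //].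
  rewrite subr_eq0 => /eqP h; have e : l ^+ 2 ^+ 2 = l ^+ 2 by rewrite -[LHS](mulfVK z0) h mul1r.
  by case/eqP: d24.
have p1 := perp_neg_gt0 vneg v1v v10; have p2 := perp_neg_gt0 vneg v2v v20.
exists v1, v2; split=> //; apply: orth_det => //.
- exact: ltr0_neq0.
- by rewrite gt_eqF // herm_gt0.
- by rewrite gt_eqF // herm_gt0.
Qed.

Lemma herm_orth v0 v1 v2 (a0 a1 a2 b0 b1 b2 : C) : herm v1 v0 = 0 -> herm v2 v0 = 0 -> herm v2 v1 = 0 ->
  herm (a0 *: v0 + (a1 *: v1 + a2 *: v2)) (b0 *: v0 + (b1 *: v1 + b2 *: v2)) =
  a0 * b0^*%R * herm v0 v0 + (a1 * b1^*%R * herm v1 v1 + a2 * b2^*%R * herm v2 v2).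
Proof.
move=> h1 h2 h3; rewrite !(hermDl, hermDr, hermZl, hermZr) h1 h2 h3 [herm v0 v1]hermCC [herm v0 v2]hermCC [herm v1 v2]hermCC h1 h2 h3 conjC0; ring.
Qed.

Let S w := A *m w + uinv A *m w.

Lemma eig_trace x k : nsq k = 1 -> A *m x = k *: x -> S x = (2 * Re k)%:C%C *: x.
Proof.
move=> k1 Ax; have [k0 kc] := nsq_unit_inv k1.
have Aix : uinv A *m x = k^*%R *: x.
  by rewrite kc; apply: (scalerI k0); rewrite scalemxAr -Ax mulmxA uinvK // mul1mx scalerA mulfV // scale1r.
by rewrite /S Ax Aix -scalerDl twoRe.
Qed.

(** -X, Y, Z are the contributions to <w,w> of the components of w along the eigenvectors with
    eigenvalues l, l^2, l^4. *)
Lemma order7_weights w : exists X Y Z : R, [/\ [/\ 0 <= X, 0 <= Y & 0 <= Z],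
  herm w w = (- X + Y + Z)%:C%C, herm (S w) w = (- X * u1 + Y * u2 + Z * u4)%:C%C,
  herm (S w) (S w) = (- X * u1 ^+ 2 + Y * u2 ^+ 2 + Z * u4 ^+ 2)%:C%C &
  w != 0 -> 0 < X + Y + Z].
Proof.
have [v1 [v2 [Av1 Av2 [h1 h2 h3] [p1 p2] det0]]] := order7_basis.
have [c0 [c1' [c2 e]]] := perp_span w det0.
have Sw : S w = (c0 * u1%:C%C) *: v + ((c1' * u2%:C%C) *: v1 + (c2 * u4%:C%C) *: v2).
  rewrite /S {1 2}e !mulmxDr -!scalemxAr addrACA -scalerDr -/(S v) (eig_trace l1 Av) scalerA.
  rewrite addrACA -!scalerDr -/(S v1) -/(S v2) (eig_trace n2 Av1) (eig_trace n4 Av2) u2E u4E !scalerA.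
  by [].
have vn : 0 < - Re (herm v v) by rewrite oppr_gt0 -herm_lt0.
exists (nsq c0 * - Re (herm v v)), (nsq c1' * Re (herm v1 v1)), (nsq c2 * Re (herm v2 v2)).
have cm (x y : C) : (x * y)^*%R = x^*%R * y^*%R by rewrite rmorphM.
have cr (r : R) : (r%:C%C : C)^*%R = r%:C%C by apply/eqP; rewrite eq_complex /= oppr0 !eqxx.
split.
- by split; apply: mulr_ge0; rewrite ?nsq_ge0 // ltW.
- rewrite {1 2}e herm_orth // [in LHS](herm_real v) [in LHS](herm_real v1) [in LHS](herm_real v2) -!nsqE; apply/eqP; rewrite eq_complex /=; apply/andP; split; apply/eqP; ring.
- rewrite Sw {1}e herm_orth // !scale_nsq.
  rewrite [in LHS](herm_real v) [in LHS](herm_real v1) [in LHS](herm_real v2).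
  move: (Re _) (Re _) (Re _) (nsq _) (nsq _) (nsq _) u1 u2 u4 => r1 r2 r3 r4 r5 r6 r7 r8 r9.
  apply/eqP; rewrite eq_complex /=; apply/andP; split; apply/eqP; ring.
- rewrite Sw herm_orth // !cm !cr.
  rewrite !scale2_nsq.
  rewrite [in LHS](herm_real v) [in LHS](herm_real v1) [in LHS](herm_real v2).
  move: (Re _) (Re _) (Re _) (nsq _) (nsq _) (nsq _) u1 u2 u4 => r1 r2 r3 r4 r5 r6 r7 r8 r9.
  apply/eqP; rewrite eq_complex /=; apply/andP; split; apply/eqP; ring.
move=> w0; rewrite lt_def; apply/andP; split; last by rewrite !addr_ge0 ?mulr_ge0 ?nsq_ge0 // ltW.
apply: contra w0; rewrite !paddr_eq0 ?addr_ge0 ?mulr_ge0 ?nsq_ge0 ?(ltW vn) ?(ltW p1) ?(ltW p2) //.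
rewrite !mulf_eq0 !nsq_eq0 (gt_eqF vn) (gt_eqF p1) (gt_eqF p2) !orbF => /andP[/andP[/eqP z0 /eqP z1] /eqP z2].
by rewrite e z0 z1 z2 !scale0r !addr0.
Qed.

Lemma det_cols_scale (a b c : 'cV[C]_3) (x y z : C) : \det (cols (x *: a) (y *: b) (z *: c)) = x * y * z * \det (cols a b c).
Proof. by rewrite !det3E !mxE /=; ring. Qed.

Lemma det_trace_form : \det (A + uinv A) = 1.
Proof.
have [v1 [v2 [Av1 Av2 _ _ det0]]] := order7_basis.
apply: (mulIf det0); rewrite mul1r -det_mulmx mul_cols.
have SE x : (A + uinv A) *m x = S x by rewrite mulmxDl.
rewrite !SE (eig_trace l1 Av) (eig_trace n2 Av1) (eig_trace n4 Av2) det_cols_scale u2E u4E -!rmorphM /= cubic7_prod //.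
by rewrite mul1r.
Qed.

Let h x y := - herm (S x) y.

Let SD x y : S (x + y) = S x + S y. Proof. by rewrite /S !mulmxDr addrACA. Qed.
Let SZ k x : S (k *: x) = k *: S x. Proof. by rewrite /S -!scalemxAr scalerDr. Qed.
Let hD x y z : h (x + y) z = h x z + h y z. Proof. by rewrite /h SD hermDl opprD. Qed.
Let hZ k x z : h (k *: x) z = k * h x z. Proof. by rewrite /h SZ hermZl mulrN. Qed.
Let uinv_adj' x y : herm (uinv A *m x) y = herm x (A *m y).
Proof. by rewrite -(uni_herm _ y Au) mulmxA uinvKr // mul1mx. Qed.
Let hC x y : h y x = (h x y)^*%R.
Proof.
rewrite /h rmorphN /= -[in RHS]hermCC /S hermDl hermDr; congr (- _).
by rewrite uinv_adj' (uni_adj _ _ Au) addrC.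
Qed.
Let hO x y : Omx x -> Omx y -> h x y \in O.
Proof.
move=> xO yO; rewrite rpredN herm_O //; apply: Omx_add; apply: Omx_mul => //; exact: Omx_uinv.
Qed.
(** The positive number u1 = 2 Re l is attached to the negative vector v, while u2 and u4 are
    negative and attached to positive vectors; hence -<(A + A^-1) x, x> is a sum of nonnegative
    terms. *)
Let hpos x : Omx x -> x != 0 -> exists2 k : nat, (0 < k)%N & Re (h x x) = k%:R.
Proof.
move=> xO x0; have [X [Y [Z [[X0 Y0 Z0] _ e1 _ /(_ x0) p]]]] := order7_weights x.
have hE : h x x = (X * u1 + Y * - u2 + Z * - u4)%:C%C by rewrite /h e1 -rmorphN; congr (_%:C)%C; ring.
have [n nE] : exists n : int, h x x = n%:~R by apply: O_real_int; [exact: hO|rewrite hE].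
have h0 : 0 < Re (h x x).
  rewrite hE /=; case: bounds => /andP[b1 b2] /andP[b3 b4] /andP[b5 b6].
  apply: weights_gt0 => //; last by apply: ltW; apply: lt_trans b6 _; rewrite ltrN2; lra.
    by apply: le_trans b1; lra.
  exact: ltW.
move: h0; rewrite nE intC_Re ltr0z; case: (n) => // k k0; by exists k.
Qed.
Let hdet a b c : nsq (\det (cols a b c)) = 1 ->
  h a a * (h b b * h c c - h c b * h b c) +
  (h b a * (h c b * h a c - h a b * h c c) + h c a * (h a b * h b c - h b b * h a c)) = 1.
Proof.
move=> d; have := gram_detN (A + uinv A) a b c; rewrite d det_trace_form !mulmxDl -/(S a) -/(S b) -/(S c) /h !mul1r.
move: (herm _ _) (herm (S a) b) (herm (S a) c) (herm (S b) a) (herm (S b) b) (herm (S b) c) (herm (S c) a) (herm (S c) b) (herm (S c) c).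
move=> x1 x2 x3 x4 x5 x6 x7 x8 x9 e; apply: oppr_inj; rewrite -[- 1]/(- (1%:C)%C) e; ring.
Qed.

(** The trace form is integral, positive and of determinant 1, so it has a vector w of norm m = -(2
    b + c) in {1, 2}. The moments <w,w>, <S w, w>, <S w, S w>, where S = A + A^-1, are integer
    combinations of a, b, c; the three moment inequalities leave three triples. *)
Lemma order7_short : exists w (a b c : int), [/\ Omx w, herm w w = a%:~R, herm (A *m w) w = b%:~R + c%:~R * t &
  (a, b, c) \in [:: (0, -1, 0); (1, -1, 0); (3, 0, -2)]].
Proof.
have [w [m [wO hE m12]]] := rank3_short hD hZ hC hO hpos hdet.
have [a aE] := herm_int wO.
have /O_antisym[b [c [bE _ bT]]] : herm (A *m w) w \in O by apply: herm_O => //; exact: Omx_mul.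
exists w, a, b, c; split=> //.
have iE : herm (uinv A *m w) w = (herm (A *m w) w)^*%R by rewrite uinv_adj' hermCC.
have mE : (m%:Z = - (2 * b + c)).
  apply: (@intr_inj R); rewrite -[LHS]/(m%:R) -hE /h /S hermDl iE bT -intrN intC_Re //.
(* Cayley-Hamilton divided by A; it expresses the second moment through a, b and c. *)
have AA : A *m A = \tr A *: A - (\tr A)^*%R *: 1%:M + uinv A.
  have := congr1 (fun M => M *m uinv A) (CH_uni Au Ad).
  by rewrite mulmxDl mulmxBl -!scalemxAl -!mulmxA uinvKr // !mulmx1 mul1mx.
have e2 : herm (A *m (A *m w)) w = - t * herm (A *m w) w + (1 - t) * a%:~R + (herm (A *m w) w)^*%R.
  rewrite mulmxA AA trAc trA mulmxDl mulmxBl -!scalemxAl mul1mx !hermDl -scaleNr !hermZl iE aE; ring.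
have SS : herm (S w) (S w) = (3 * a + (2 * b + c) - b + 3 * c)%:~R.
  have -> : herm (S w) (S w) = 2 * herm w w + herm (A *m (A *m w)) w + (herm (A *m (A *m w)) w)^*%R.
    rewrite /S hermDl !hermDr (uni_herm _ _ Au) (uni_herm _ _ (uni_inv Au)) uinv_adj'.
    rewrite [herm (A *m w) (uinv A *m w)]hermCC uinv_adj' [herm w (A *m (A *m w))]hermCC conjCK; ring.
  rewrite e2 aE bE; have tc := conj_tau R; move: (tt) tc; move: (tau R) => z zz zc.
  have cm (x y : C) : (x * y)^*%R = x^*%R * y^*%R by rewrite rmorphM.
  have cd (x y : C) : (x + y)^*%R = x^*%R + y^*%R by rewrite rmorphD.
  have cn (x : C) : (- x)^*%R = - x^*%R by rewrite rmorphN.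
  rewrite !(cd, cm, cn, zc, rmorph_int, rmorph1) /= !(intrD, intrM, intrN).
  apply/eqP; rewrite -subr_eq0; apply/eqP.
  by transitivity (- 2 * c%:~R * (z ^+ 2 - z + 2)); [ring|rewrite zz mulr0].
have [X [Y [Z [[X0 Y0 Z0] E0 E1 E2 _]]]] := order7_weights w.
have {}E0 : - X + Y + Z = a%:~R by apply: complexI; rewrite -E0 aE (rmorph_int (real_complex R)).
have {}E1 : - X * u1 + Y * u2 + Z * u4 = (2 * b + c)%:~R.
  by apply: complexI; rewrite -E1 /S hermDl iE bT (rmorph_int (real_complex R)).
have {}E2 : - X * u1 ^+ 2 + Y * u2 ^+ 2 + Z * u4 ^+ 2 = (3 * a + (2 * b + c) - b + 3 * c)%:~R.
  by apply: complexI; rewrite -E2 SS (rmorph_int (real_complex R)).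
have V := weights_le0 X0 Y0 Z0 (x := u1) (y := u2) (z := u4).
have W := weights_ge0 X0 Y0 Z0 (x := u1) (y := u2) (z := u4).
rewrite E0 E1 E2 in V W.
have [k1 k2 k3] : [/\ 3 * (3 * a + (2 * b + c) - b + 3 * c) + 7 * (2 * b + c) + 2 * a <= 0,
   (3 * a + (2 * b + c) - b + 3 * c) + (2 * b + c) - 2 * a <= 0 &
   0 <= 6 * (3 * a + (2 * b + c) - b + 3 * c) - 7 * (2 * b + c) - 3 * a].
  have [[s1 s2 s3] [s4 s5 s6] [s7 s8 s9]] := cubic7_signs c1 upos.
  by apply: weights_int; [exact: V|exact: V|exact: W].
have : a = 0 /\ b = -1 /\ c = 0 \/ a = 1 /\ b = -1 /\ c = 0 \/ a = 3 /\ b = 0 /\ c = -2.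
  by clear -k1 k2 k3 mE m12; lia.
by case=> [[-> [-> ->]]|[[-> [-> ->]]|[-> [-> ->]]]].
Qed.

End Element.
End Order7.

Local Open Scope Z_scope.
Definition zM7 : zmat := [:: [:: (-2, -1); (-3, 1); (-2, 3)]; [:: (-1, 0); (0, 0); (-1, 1)]; [:: (-1, 1); (0, 1); (2, 0)]].
(** The power of [zM7] to which the normalised elements of order 7 are conjugate. The vectors
    [zr7a], [zr7b], [zr7c] realise the three triples of [order7_short] for it. *)
Definition zM7_4 : zmat := mpow zM7 4.
Definition zr7a : zvec := [:: (-2, -1); (-1, 0); (-1, 1)].
Definition zr7b : zvec := [:: (-2, -1); (-1, 1); (-1, 1)].
Definition zr7c : zvec := [:: (-2, -2); (-1, 0); (-2, 1)].
Local Close Scope Z_scope.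

Section Order7Orbit.
Variable R : realType.
Local Notation C := R[i].
Local Notation O := (isO R).
Local Notation Re := complex.Re.
Local Notation t := (tau R).
Local Notation eV := (eV R).
Local Notation eM := (eM R).
Local Notation zc := (zc R).

(** A, A^2 and A^4 all have trace - tau, and their eigenvalues at v have real parts whose doubles
    are conjugate roots of [cubic7]; one of these is positive. *)
Lemma order7_pos (A : 'M[C]_3) (v : 'cV[C]_3) (l : C) : herm v v < 0 -> regular_at A v l -> \tr A = - t ->
  exists B k, [/\ regular_at B v k, \tr B = - t & 0 < Re k].
Proof.
move=> vneg reg trA; have [Au AO Ad Av _] := reg.
have l1 : nsq l = 1 by exact: (eig_neg_unit Au vneg Av).
have pl : p7 l = 0 by rewrite -(char_p7 trA); exact: (lam_char Au Ad vneg Av).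
have l2 : nsq (l ^+ 2) = 1 by rewrite expr2 nsqM l1 mulr1.
have [reg2 tr2] := order7_sqr vneg reg trA.
have [reg4 tr4] := order7_sqr vneg reg2 tr2.
have half (x : R) : 0 < 2 * x -> 0 < x by lra.
case: (cubic7_pos (p7_cubic l1 pl)) => h.
- by exists A, l; split=> //; exact: half.
- by exists (A *m A), (l ^+ 2); split=> //; apply: half; rewrite twoRe_sqr.
by exists (A *m A *m (A *m A)), (l ^+ 2 ^+ 2); split=> //; apply: half; rewrite !twoRe_sqr.
Qed.

Lemma zc_tau : zc ztau = t.
Proof. by rewrite zcE /= add0r mul1r. Qed.
Lemma zc_taub : zc ztaub = 1 - t.
Proof. by rewrite -[ztaub]/(zconj ztau) zc_conj zc_tau conj_tau. Qed.

Lemma uni_sqr (A : 'M[C]_3) : uni A -> \det A = 1 -> A *m A = \tr A *: A - (\tr A)^*%R *: 1%:M + uinv A.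
Proof.
move=> Au Ad; have := congr1 (fun M => M *m uinv A) (CH_uni Au Ad).
by rewrite mulmxDl mulmxBl -!scalemxAl -!mulmxA uinvKr // !mulmx1 mul1mx.
Qed.

Lemma herm_sqr7 (A : 'M[C]_3) (w : 'cV[C]_3) : uni A -> \det A = 1 -> \tr A = - t ->
  herm (A *m (A *m w)) w = - t * herm (A *m w) w + (1 - t) * herm w w + (herm (A *m w) w)^*%R.
Proof.
move=> Au Ad trA; have trAc : (\tr A)^*%R = - (1 - t) by rewrite trA rmorphN /= -[1 - t]conj_tau.
have iE : herm (uinv A *m w) w = (herm (A *m w) w)^*%R.
  by rewrite -(uni_herm _ w Au) mulmxA uinvKr // mul1mx hermCC.
rewrite mulmxA (uni_sqr Au Ad) trAc trA mulmxDl mulmxBl -!scalemxAl mul1mx !hermDl -scaleNr !hermZl iE; ring.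
Qed.

Lemma zc_zi (n : int) : zc (zi (Z_of_int n)) = n%:~R.
Proof. by rewrite zc_int Z_of_intK. Qed.

Lemma order7_reference (a b c : int) : (a, b, c) \in [:: (0, -1, 0); (1, -1, 0); (3, 0, -2)] ->
  exists w0 w1 w2 : zvec, let g := eM zM7_4 in let y : C := b%:~R + c%:~R * t in [/\ zinvertible w0 w1 w2,
   [/\ herm (eV w0) (eV w0) = a%:~R, herm (eV w1) (eV w1) = a%:~R & herm (eV w2) (eV w2) = a%:~R],
   [/\ herm (eV w1) (eV w0) = y, herm (eV w2) (eV w1) = y & herm (eV w2) (eV w0) = - t * y + (1 - t) * a%:~R + y^*%R] &
   [/\ g *m eV w0 = eV w1, g *m eV w1 = eV w2 & g *m eV w2 = - t *: eV w2 + (1 - t) *: eV w1 + eV w0]].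
Proof.
rewrite !inE => abc.
pose w0 := if a == 0 then zr7a else if a == 1 then zr7b else zr7c.
pose w1 := mvec zM7_4 w0; pose w2 := mvec zM7_4 w1.
have [c1 c2] : zinvertible w0 w1 w2 /\ [&& zeq (zherm w0 w0) (zi (Z_of_int a)), zeq (zherm w1 w1) (zi (Z_of_int a)), zeq (zherm w2 w2) (zi (Z_of_int a)),
   zeq (zherm w1 w0) (Z_of_int b, Z_of_int c), zeq (zherm w2 w1) (Z_of_int b, Z_of_int c) &
   zeq (zherm w2 w0) (zadd (zadd (zmul (zopp ztau) (Z_of_int b, Z_of_int c)) (zmul ztaub (zi (Z_of_int a)))) (zconj (Z_of_int b, Z_of_int c)))]
   /\ veq (mvec zM7_4 w2) (vadd (vadd (vscale (zopp ztau) w2) (vscale ztaub w1)) w0).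
  by rewrite /w2 /w1 /w0; case/or3P: abc => /eqP[-> -> ->]; vm_compute.
case: c2 => /and5P[/zeqP k1 /zeqP k2 /zeqP k3 /zeqP k4 /andP[/zeqP k5 /zeqP k6]] /veqP CH.
have e1 : eM zM7_4 *m eV w0 = eV w1 by rewrite -eM_vec.
have e2 : eM zM7_4 *m eV w1 = eV w2 by rewrite -eM_vec.
have {}CH := CH R; rewrite eM_vec in CH.
exists w0, w1, w2 => /=; clearbody w2; clearbody w1; clearbody w0.
have zcb : b%:~R + c%:~R * t = zc (Z_of_int b, Z_of_int c) by rewrite zcE /= !Z_of_intK.
split; [exact: c1|by split; rewrite herm_eV ?k1 ?k2 ?k3 zc_zi|split; rewrite herm_eV ?k4 ?k5 ?k6 ?zcb|split].
- by [].
- by [].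
- by rewrite !zcD !zcM zc_conj zcN zc_zi zc_taub zc_tau.
- exact: e1.
- exact: e2.
by rewrite CH !eV_add !eV_scale zcN zc_taub zc_tau.
Qed.

(** By [herm_sqr7] the Gram matrix of w, B w, B^2 w depends only on the triple of [order7_short]. It
    is also the Gram matrix of a basis made of a reference vector and its images under [zM7_4], and
    both operators have the same characteristic polynomial, so they are conjugate. *)
Lemma order7_orbit (A : 'M[C]_3) (v x7 : 'cV[C]_3) (l m : C) : herm v v < 0 -> regular_at A v l -> \tr A = - t ->
  herm x7 x7 < 0 -> eM zM7_4 *m x7 = m *: x7 -> in_orbit x7 v.
Proof.
move=> vneg reg0 trA0 x7neg gx7.
have [B [k [reg trB kpos]]] := order7_pos vneg reg0 trA0.
have [Bu BO Bd Bv _] := reg.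
have [w [a [b [c [wO wa wb abc]]]]] := order7_short vneg reg trB kpos.
have [w0 [w1 [w2 [c1 [k1 k2 k3] [k4 k5 k6] [g0 g1 g2]]]]] := order7_reference abc.
have e2 := herm_sqr7 w Bu Bd trB; rewrite wa wb in e2.
have BwO : Omx (B *m w) by exact: Omx_mul.
have BBwO : Omx (B *m (B *m w)) by exact: Omx_mul.
have [Q [Qu QO Qw Q1 Q2]] : exists Q, [/\ uni Q, Omx Q, Q *m eV w0 = w, Q *m eV w1 = B *m w & Q *m eV w2 = B *m (B *m w)].
  apply: (gram_transferZ wO BwO BBwO c1).
  split; last split; rewrite ?k1 ?k2 ?k3 ?k4 ?k5 ?k6 ?(uni_herm _ _ Bu) //.
exists Q; suff BQ : B *m Q = Q *m eM zM7_4.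
  by have [e1 [e10 e1E]] := conj_orbit Qu QO vneg reg BQ x7neg gx7; exists e1.
apply: (comm_on_basis (zinvertibleP R c1)).
- by rewrite Qw g0 Q1.
- by rewrite Q1 g1 Q2.
rewrite Q2 g2 !mulmxDr -!scalemxAr Q2 Q1 Qw.
have -> : B *m (B *m (B *m w)) = (B *m B *m B) *m w by rewrite !mulmxA.
have trBc : (\tr B)^*%R = - (1 - t) by rewrite trB rmorphN /= -[1 - t]conj_tau.
rewrite (CH_uni Bu Bd) trBc trB !mulmxDl mulNmx -!scalemxAl mul1mx -!mulmxA.
by rewrite !scaleNr opprK.
Qed.
End Order7Orbit.

(** * The two irrational points and the integral vectors orthogonal to them *)

Section Irrational67.
Variable R : realType.
Local Notation C := R[i].
Local Notation O := (isO R).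
Local Notation Re := complex.Re.
Local Notation t := (tau R).
Local Notation eV := (eV R).
Local Notation eM := (eM R).
Local Notation zc := (zc R).
Implicit Types (A B M : 'M[C]_3) (u v w y z : 'cV[C]_3).

Lemma eig_orth A u w (a b : C) : uni A -> A *m u = a *: u -> A *m w = b *: w -> nsq b = 1 -> a != b -> herm u w = 0.
Proof.
move=> Au e1 e2 b1 ab; have [b0 bc] := nsq_unit_inv b1.
have := uni_herm u w Au; rewrite e1 e2 hermZl hermZr bc mulrA => /eqP.
rewrite -[X in _ == X]mul1r -subr_eq0 -mulrBl mulf_eq0 => /orP[|/eqP //].
rewrite subr_eq0 => /eqP/(congr1 (fun z : C => z * b)); rewrite mulfVK // mul1r => e.
by rewrite e eqxx in ab.
Qed.

(** Eigenvectors for distinct eigenvalues of modulus 1 are mutually orthogonal and form a basis;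
    three nonnegative norms would make the form nonnegative, contradicted by [vp1]. *)
Lemma neg_eigenvector A u1 u2 u3 (k1 k2 k3 : C) : uni A -> u1 != 0 -> u2 != 0 -> u3 != 0 ->
  A *m u1 = k1 *: u1 -> A *m u2 = k2 *: u2 -> A *m u3 = k3 *: u3 -> nsq k1 = 1 -> nsq k2 = 1 -> nsq k3 = 1 ->
  k1 != k2 -> k1 != k3 -> k2 != k3 -> [\/ herm u1 u1 < 0, herm u2 u2 < 0 | herm u3 u3 < 0].
Proof.
move=> Au u10 u20 u30 e1 e2 e3 n1 n2 n3 d12 d13 d23.
have h1 : herm u2 u1 = 0 by apply: (eig_orth Au e2 e1 n1); rewrite eq_sym.
have h2 : herm u3 u1 = 0 by apply: (eig_orth Au e3 e1 n1); rewrite eq_sym.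
have h3 : herm u3 u2 = 0 by apply: (eig_orth Au e3 e2 n2); rewrite eq_sym.
have ind (a b c : C) : a *: u1 + (b *: u2 + c *: u3) = 0 -> [/\ a = 0, b = 0 & c = 0].
  move=> e; have eA : (a * k1) *: u1 + ((b * k2) *: u2 + (c * k3) *: u3) = 0.
    have := congr1 (mulmx A) e; rewrite mulmx0 !mulmxDr -!scalemxAr e1 e2 e3 !scalerA //.
  have eB : (a * k1 * k1) *: u1 + ((b * k2 * k2) *: u2 + (c * k3 * k3) *: u3) = 0.
    have := congr1 (mulmx A) eA; rewrite mulmx0 !mulmxDr -!scalemxAr e1 e2 e3 !scalerA //.
  have c1 : (a * (k1 - k2) * (k1 - k3)) *: u1 = 0.
    transitivity ((a * k1 * k1) *: u1 + ((b * k2 * k2) *: u2 + (c * k3 * k3) *: u3) - (k2 + k3) *: ((a * k1) *: u1 + ((b * k2) *: u2 + (c * k3) *: u3)) + (k2 * k3) *: (a *: u1 + (b *: u2 + c *: u3))).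
      by apply/matrixP => i j; rewrite !mxE; ring.
    by rewrite e eA eB !scaler0 subr0 addr0.
  have c2 : (b * (k1 - k2) * (k2 - k3)) *: u2 = 0.
    transitivity (- ((a * k1 * k1) *: u1 + ((b * k2 * k2) *: u2 + (c * k3 * k3) *: u3) - (k1 + k3) *: ((a * k1) *: u1 + ((b * k2) *: u2 + (c * k3) *: u3)) + (k1 * k3) *: (a *: u1 + (b *: u2 + c *: u3)))).
      by apply/matrixP => i j; rewrite !mxE; ring.
    by rewrite e eA eB !scaler0 subr0 addr0 oppr0.
  have a0 : a = 0.
    move/eqP: c1; rewrite scaler_eq0 (negPf u10) orbF !mulf_eq0 !subr_eq0 (negPf d12) (negPf d13) !orbF; exact/eqP.
  have b0 : b = 0.
    move/eqP: c2; rewrite scaler_eq0 (negPf u20) orbF !mulf_eq0 !subr_eq0 (negPf d12) (negPf d23) !orbF; exact/eqP.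
  split=> //; move: e; rewrite a0 b0 !scale0r !add0r => /eqP.
  by rewrite scaler_eq0 (negPf u30) orbF => /eqP.
have det0 : \det (cols u1 u2 u3) != 0.
  apply/eqP => /det_cols0[x [x0 e]]; have [a0 b0 c0] := ind _ _ _ e.
  case/eqP: x0; apply/matrixP => i j; rewrite ord1 mxE; move: i; exact: ord3P.
have [a [b [c e]]] := perp_span (eV vp1) det0.
have neg : herm (eV vp1) (eV vp1) < 0.
  by rewrite herm_eV (_ : zherm vp1 vp1 = zi (-2)) // zc_int ltrz0.
move: neg; rewrite e herm_orth // -!nsqE [in X in X -> _](herm_real u1) [in X in X -> _](herm_real u2) [in X in X -> _](herm_real u3).
rewrite -!rmorphM -!rmorphD /= (@ltcR _ _ 0) => neg.
case: (boolP (herm u1 u1 < 0)) => p1; first by constructor 1.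
case: (boolP (herm u2 u2 < 0)) => p2; first by constructor 2.
case: (boolP (herm u3 u3 < 0)) => p3; first by constructor 3.
move: p1 p2 p3; rewrite !herm_lt0 -!leNgt => p1 p2 p3; exfalso.
by move: neg; rewrite ltNge !addr_ge0 ?mulr_ge0 ?nsq_ge0.
Qed.

(** In a basis of Z[tau]^3 that starts with the primitive vector on the line of u, the eigenvalue is
    a matrix entry of A. *)
Lemma int_eig A u k : Omx A -> Omx u -> u != 0 -> A *m u = k *: u -> k \in O.
Proof.
move=> AO uO u0 e; have [Q [Q' [d [OQ OQ' QQ' dO uE]]]] := primitive_completion uO u0.
have QQ : Q' *m Q = 1%:M by apply: mulmx1C.
have d0 : d != 0 by apply: contraNneq u0 => d0; rewrite uE d0 scale0r.
have e' : A *m col 0 Q = k *: col 0 Q.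
  by apply: (scalerI d0); rewrite scalemxAr -uE e uE !scalerA mulrC.
have h (N : 'M[C]_3) : (N *m Q) 0 0 = (N *m col 0 Q) 0 0 by rewrite !mxE; apply: eq_bigr => i _; rewrite !mxE.
have -> : k = (Q' *m A *m Q) 0 0 by rewrite h -mulmxA e' -scalemxAr mxE -h QQ mxE mulr1.
by apply: Omx_mul => //; apply: Omx_mul.
Qed.

Lemma unit_O (k : C) : k \in O -> nsq k = 1 -> k = 1 \/ k = -1.
Proof. by move=> kO k1; apply/nsqO_unit. Qed.

(** The Hermitian cross product for J: integral when u and w are, and orthogonal to both. *)
Definition cross u w : 'cV[C]_3 :=
  \col_i nth 0 [:: (u 0 0 * w 1 0 - u 1 0 * w 0 0)^*%R; - (u 0 0 * w 2%:R 0 - u 2%:R 0 * w 0 0)^*%R; (u 1 0 * w 2%:R 0 - u 2%:R 0 * w 1 0)^*%R] i.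

Lemma herm_cross z u w : herm z (cross u w) = \det (cols z u w).
Proof. by rewrite hermE det3E !mxE /= rmorphN /= !conjCK; ring. Qed.

Lemma Omx_cross u w : Omx u -> Omx w -> Omx (cross u w).
Proof.
move=> uO wO i j; rewrite mxE; move: i.
have h (a b c d : C) : a \in O -> b \in O -> c \in O -> d \in O -> (a * b - c * d)^*%R \in O.
  by move=> aO bO cO dO; rewrite isO_conj // rpredB ?rpredM.
by apply: ord3P => /=; rewrite ?rpredN; apply: h.
Qed.

(** If u and M u are independent, their cross product is an integral vector on the line x, which has
    none. Otherwise u is an integral eigenvector, and its eigenvalue is a unit of Z[tau]. *)
Lemma int_perp M x k u : uni M -> Omx M -> herm x x < 0 -> M *m x = k *: x ->
  (forall y, Omx y -> y != 0 -> forall c, y <> c *: x) ->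
  Omx u -> u != 0 -> herm u x = 0 -> M *m u = u \/ M *m u = - u.
Proof.
move=> Mu MO xneg Mx irr uO u0 ux.
have bx : herm (M *m u) x = 0 by rewrite (eig_perp Mu xneg Mx) ux mulr0.
have bO : Omx (M *m u) by exact: Omx_mul.
have [d|d] := eqVneq (\det (cols x u (M *m u))) 0.
  have [c e] := perp_dep xneg ux bx u0 d.
  have cO := int_eig MO uO u0 e.
  have c1 : nsq c = 1.
    have := uni_herm u u Mu; rewrite e hermZl hermZr mulrA -nsqE => h; apply: complexI.
    have uu : herm u u != 0 by rewrite gt_eqF // herm_gt0 (perp_neg_gt0 xneg ux u0).
    by apply: (mulIf uu); rewrite h mul1r.
  by case: (unit_O cO c1) e => ->; rewrite ?scale1r ?scaleN1r; [left|right].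
exfalso; pose y := cross u (M *m u).
have y0 : y != 0 by apply: contra d => /eqP y0; rewrite -herm_cross -/y y0 herm0r.
have xx : herm x x != 0 by rewrite ltr0_neq0.
apply: (irr y (Omx_cross uO bO) y0 (herm y x / herm x x)).
apply/eqP; rewrite -subr_eq0; apply/eqP; apply: (perp_all d).
- exact: perp_decomp.
- rewrite hermBl hermZl [herm y u]hermCC herm_cross [herm x u]hermCC ux conjC0 mulr0 subr0.
  by rewrite det3E !mxE /= (_ : _ + _ = 0) ?conjC0 //; ring.
rewrite hermBl hermZl [herm y (M *m u)]hermCC herm_cross [herm x (M *m u)]hermCC bx conjC0 mulr0 subr0.
by rewrite det3E !mxE /= (_ : _ + _ = 0) ?conjC0 //; ring.
Qed.

Lemma herm_row x B w : herm x (Jmx R *m B^t* *m w) = (w^t* *m B *m x) 0 0.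
Proof. by rewrite herm_def !trmx_mul !map_mxM trmxCK Jmx_herm -!mulmxA (mulmxA (Jmx R)) Jmx_sq mul1mx. Qed.

Lemma Qisqrt_scale (z : C) : Qisqrt 7 z -> exists2 n : nat, (0 < n)%N & n%:R * z \in O.
Proof.
case=> a [b ->]; exists (absz (denq a * denq b)); first by rewrite absz_gt0 mulf_neq0 ?denq_neq0.
have -> : ((absz (denq a * denq b))%:R : C) = (denq a)%:~R * (denq b)%:~R.
  by rewrite -intrM -[LHS]/((absz (denq a * denq b) : int)%:~R) gez0_abs // mulr_ge0 // ltW.
have -> : isqrt R 7 = 2 * t - 1 by rewrite /tau; field; rewrite ?pnatr_eq0.
have rE (q : rat) : (denq q)%:~R * ratr q = (numq q)%:~R :> C.
  by rewrite /ratr mulrC divfK // intr_eq0 denq_neq0.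
have -> : (denq a)%:~R * (denq b)%:~R * (ratr a + ratr b * (2 * t - 1)) =
   (denq b)%:~R * (numq a)%:~R + (denq a)%:~R * (numq b)%:~R * (2 * t - 1) :> C.
  by rewrite -!rE; ring.
have iO (n : int) : (n%:~R : C) \in O by rewrite rpred_int.
have a1 : (denq b)%:~R * (numq a)%:~R \in O by rewrite rpredM ?iO.
have a2 : 2 * t - 1 \in O by rewrite rpredB ?rpred1 // rpredM ?rpred_nat ?isO_tau.
have a3 : (denq a)%:~R * (numq b)%:~R * (2 * t - 1) \in O by rewrite rpredM // rpredM ?iO.
exact: rpredD.
Qed.

Lemma Qisqrt_int v : (forall i, Qisqrt 7 (v i 0)) -> exists2 c : C, c != 0 & Omx (c *: v).
Proof.
move=> vQ; have [n0 p0 h0] := Qisqrt_scale (vQ 0); have [n1 p1 h1] := Qisqrt_scale (vQ 1); have [n2 p2 h2] := Qisqrt_scale (vQ 2%:R).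
exists (n0 * n1 * n2)%:R; first by rewrite pnatr_eq0 -lt0n !muln_gt0 p0 p1.
move=> i j; rewrite ord1 mxE !natrM; move: i; apply: ord3P.
- have -> : n0%:R * n1%:R * n2%:R * v 0 0 = n1%:R * n2%:R * (n0%:R * v 0 0) by ring.
  by rewrite rpredM // rpredM ?rpred_nat.
- have -> : n0%:R * n1%:R * n2%:R * v 1 0 = n0%:R * n2%:R * (n1%:R * v 1 0) by ring.
  by rewrite rpredM // rpredM ?rpred_nat.
by rewrite -mulrA rpredM // rpredM ?rpred_nat.
Qed.

End Irrational67.

Section Points67.
Variable R : realType.
Local Notation C := R[i].
Local Notation O := (isO R).
Local Notation Re := complex.Re.
Local Notation t := (tau R).
Local Notation eV := (eV R).
Local Notation eM := (eM R).
Local Notation zc := (zc R).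
Implicit Types (A B M : 'M[C]_3) (u v w y z : 'cV[C]_3).

Lemma p7_root7 (x : C) : p7 x = 0 -> x ^+ 7 = 1.
Proof.
move=> /p7_cyclotomic h; apply/eqP; rewrite -subr_eq0; apply/eqP.
by transitivity ((x - 1) * (x ^+ 6 + x ^+ 5 + x ^+ 4 + x ^+ 3 + x ^+ 2 + x + 1)); [ring|rewrite h mulr0].
Qed.

Lemma p7bar_root7 (x : C) : x ^+ 3 + (1 - t) * x ^+ 2 - t * x - 1 = 0 -> x ^+ 7 = 1.
Proof.
move=> h; have tt : t ^+ 2 - t + 2 = 0 by rewrite tau_sqr; ring.
apply/eqP; rewrite -subr_eq0; apply/eqP.
transitivity ((x - 1) * (p7 x * (x ^+ 3 + (1 - t) * x ^+ 2 - t * x - 1) + (t ^+ 2 - t + 2) * (x ^+ 4 + 2 * x ^+ 3 + x ^+ 2))).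
  by rewrite /p7; ring.
by rewrite h tt mulr0 mul0r addr0 mulr0.
Qed.

Lemma elliptic_eig A v (l : C) : uni A -> Omx A -> \det A = 1 -> herm v v < 0 -> A *m v = l *: v ->
  [\/ l ^+ 6 = 1, l ^+ 2 = -1 | l ^+ 7 = 1].
Proof.
move=> Au AO Ad vneg Av; have ch := lam_char Au Ad vneg Av.
have [p pI a] := elliptic_trace Au Ad vneg Av AO.
have ra : forall n : BinNums.Z, p = zi n -> \tr A = (int_of_Z n)%:~R by move=> n pE; rewrite a pE zc_int.
have rac : forall n : BinNums.Z, p = zi n -> (\tr A)^*%R = (int_of_Z n)%:~R by move=> n pE; rewrite (ra n pE) rmorph_int.
have sub (x y : C) : x - y = 0 -> x = y by move/eqP; rewrite subr_eq0 => /eqP.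
move: pI; rewrite !inE.
case/orP => [/eqP pE|/orP[/eqP pE|/orP[/eqP pE|/orP[/eqP pE|/orP[/eqP pE|/orP[/eqP pE|/eqP pE]]]]]].
- have a1 := ra _ pE; have ac1 := rac _ pE; rewrite ac1 a1 in ch; constructor 1.
  have /eqP : (l - 1) ^+ 3 = 0 by rewrite -[RHS]ch; ring.
  by rewrite expf_eq0 subr_eq0 /= => /eqP ->; rewrite expr1n.
- have a1 := ra _ pE; have ac1 := rac _ pE; rewrite ac1 a1 in ch; constructor 1.
  have /eqP : (l - 1) * (l + 1) ^+ 2 = 0 by rewrite -[RHS]ch; ring.
  rewrite mulf_eq0 expf_eq0 subr_eq0 addr_eq0 /= => /orP[]/eqP ->; first by rewrite expr1n.
  by rewrite (exprM _ 2 3) sqrrN !expr1n.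
- have a1 := ra _ pE; have ac1 := rac _ pE; rewrite ac1 a1 in ch; constructor 1.
  have e : l ^+ 3 = 1 by apply: sub; rewrite -[RHS]ch; ring.
  by rewrite (exprM _ 3 2) e expr1n.
- have a1 := ra _ pE; have ac1 := rac _ pE; rewrite ac1 a1 in ch.
  have /eqP : (l - 1) * (l ^+ 2 + 1) = 0 by rewrite -[RHS]ch; ring.
  rewrite mulf_eq0 subr_eq0 addr_eq0 => /orP[/eqP ->|/eqP e]; first by constructor 1; rewrite expr1n.
  by constructor 2.
- have a1 := ra _ pE; have ac1 := rac _ pE; rewrite ac1 a1 in ch; constructor 1.
  have /eqP : (l - 1) * (l ^+ 2 - l + 1) = 0 by rewrite -[RHS]ch; ring.
  rewrite mulf_eq0 subr_eq0 => /orP[/eqP ->|/eqP e]; first by rewrite expr1n.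
  by apply: sub; transitivity ((l ^+ 2 - l + 1) * ((l + 1) * (l ^+ 3 - 1))); [ring|rewrite e mul0r].
- constructor 3; apply: p7_root7; rewrite -[RHS]ch -(char_p7 (A := A)) // a pE zcE /=; ring.
have zE : \tr A = - (1 - t) by rewrite a pE -zc_taub -zcN.
have zEc : (\tr A)^*%R = - (1 - (1 - t)) by rewrite zE rmorphN rmorphB /= rmorph1 conj_tau.
constructor 3; apply: p7bar_root7; rewrite -[RHS]ch zEc zE; ring.
Qed.

Lemma root6_prim (k : C) : k ^+ 2 - k + 1 = 0 -> 6.-primitive_root k.
Proof.
move=> h; have k3 : k ^+ 3 = -1.
  apply/eqP; rewrite -subr_eq0 opprK; apply/eqP.
  by transitivity ((k ^+ 2 - k + 1) * (k + 1)); [ring|rewrite h mul0r].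
have k6 : k ^+ 6 = 1 by rewrite (exprM _ 3 2) k3 sqrrN expr1n.
have [m pm] := prim_order_exists (isT : (0 < 6)%N) k6.
have two0 : (2 : C) != 0 by rewrite pnatr_eq0.
have m3 : ~~ (m %| 3)%N.
  apply/negP => d; have := prim_order_dvd pm 3; rewrite d => /esym/eqP; rewrite k3 => /eqP.
  by rewrite eq_sym -subr_eq0 opprK (negPf two0).
have m2 : ~~ (m %| 2)%N.
  apply/negP => d; have := prim_order_dvd pm 2; rewrite d => /esym/eqP k2.
  have := k3; rewrite exprS k2 mulr1 => k1; move: h; rewrite k2 k1 opprK => /eqP.
  by rewrite (_ : 1 + 1 + 1 = 3%:R) ?pnatr_eq0 //; ring.
by move=> m6; move: pm m3 m2; have := dvdn_leq _ m6; case: m m6 => [|[|[|[|[|[|[|m]]]]]]] // _ /(_ isT).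
Qed.

Lemma root7_prim (k : C) : p7 k = 0 -> 7.-primitive_root k.
Proof.
move=> h; have k7 := p7_root7 h.
have [m pm m7] := prim_order_exists (isT : (0 < 7)%N) k7.
have m1 : m != 1%N.
  apply: contraTneq isT => m1; rewrite m1 in pm; have := prim_expr_order pm; rewrite expr1 => k1.
  have := p7_cyclotomic h; rewrite k1 !expr1n => /eqP.
  by rewrite (_ : _ + 1 = 7%:R) ?pnatr_eq0 //; ring.
by move: m1 pm; have := dvdn_leq _ m7; case: m m7 => [|[|[|[|[|[|[|[|m]]]]]]]] // _ /(_ isT).
Qed.

Lemma prim_expr_neq1 n (k : C) m : n.-primitive_root k -> ~~ (n %| m)%N -> k ^+ m != 1.
Proof. by move=> pk; rewrite (prim_order_dvd pk). Qed.

Lemma nsq_root n (k : C) : (0 < n)%N -> k ^+ n = 1 -> nsq k = 1.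
Proof.
move=> n0 h; have nX m : nsq (k ^+ m) = nsq k ^+ m.
  by elim: m => [|m IH]; rewrite ?expr0 ?nsq1 // !exprS nsqM IH.
have : nsq k ^+ n = 1 by rewrite -nX h nsq1.
by move/eqP; rewrite pexpr_eq1 ?nsq_ge0 // => /eqP.
Qed.

Lemma uZ_uni X : uZ X -> uni (eM X).
Proof. by move/meqP => h; rewrite /uni -eM_adj -eM_J -!eM_mul; exact: h. Qed.

Lemma eM_det X : \det (eM X) = zc (mdet X).
Proof. by rewrite det3E !mxE /mdet !(zcD, zcB, zcM) /=; ring. Qed.

Lemma eM_tr X : \tr (eM X) = zc (ztr X).
Proof. by rewrite tr3E !mxE /ztr /zsum3 !zcD. Qed.

Lemma exists_neg7 : exists x k, [/\ herm x x < 0, eM zM7 *m x = k *: x & p7 k = 0].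
Proof.
have Mu : uni (eM zM7) by apply: uZ_uni; vm_compute.
have Md : \det (eM zM7) = 1 by rewrite eM_det (_ : mdet zM7 = zi 1) ?zc1 //; vm_compute.
have trM : \tr (eM zM7) = - t by rewrite eM_tr (_ : ztr zM7 = zopp ztau) ?zcN ?zc_tau //; vm_compute.
have [k kE] := @solve_monicpoly C 3 (fun i => nth 0 [:: 1; 1 - t; - t] i) isT.
have pk : p7 k = 0 by rewrite /p7 kE !big_ord_recl big_ord0 /=; ring.
have pk2 := p7_sqr pk; have pk4 := p7_sqr pk2.
have n1 (x : C) : p7 x = 0 -> nsq x = 1 by move=> /p7_root7; exact: nsq_root.
have pr := root7_prim pk; have k0 : k != 0 by have [] := nsq_unit_inv (n1 _ pk).
have d12 : k != k ^+ 2.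
  apply/eqP => e; have := prim_expr_neq1 pr (isT : ~~ (7 %| 1)%N); apply/negP/negPn/eqP/(mulfI k0).
  by rewrite expr1 mulr1 {3}e expr2.
have d13 : k != k ^+ 2 ^+ 2.
  apply/eqP => e; have := prim_expr_neq1 pr (isT : ~~ (7 %| 3)%N); apply/negP/negPn/eqP/(mulfI k0).
  by rewrite -exprS mulr1 {2}e -exprM.
have d23 : k ^+ 2 != k ^+ 2 ^+ 2.
  apply/eqP => e; have := prim_expr_neq1 pr (isT : ~~ (7 %| 2)%N); apply/negP/negPn/eqP/(mulfI (expf_neq0 2 k0)).
  by rewrite mulr1 {3}e -expr2.
have ex (x : C) : p7 x = 0 -> exists2 u : 'cV[C]_3, u != 0 & eM zM7 *m u = x *: u.
  by move=> h; apply: (char_eig Mu Md); rewrite (char_p7 trM).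
have [u1 u10 e1] := ex _ pk; have [u2 u20 e2] := ex _ pk2; have [u3 u30 e3] := ex _ pk4.
case: (neg_eigenvector Mu u10 u20 u30 e1 e2 e3 (n1 _ pk) (n1 _ pk2) (n1 _ pk4) d12 d13 d23) => h.
- by exists u1, k.
- by exists u2, (k ^+ 2).
by exists u3, (k ^+ 2 ^+ 2).
Qed.

Lemma exists_neg6 : exists x k, [/\ herm x x < 0, eM zM6 *m x = k *: x & k ^+ 2 - k + 1 = 0].
Proof.
have Mu : uni (eM zM6) by apply: uZ_uni; vm_compute.
have Md : \det (eM zM6) = 1 by rewrite eM_det (_ : mdet zM6 = zi 1) ?zc1 //; vm_compute.
have trM : \tr (eM zM6) = 2 by rewrite eM_tr (_ : ztr zM6 = zi 2) ?zc_int //; vm_compute.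
have [k kE] := @solve_monicpoly C 2 (fun i => nth 0 [:: -1; 1] i) isT.
have pk : k ^+ 2 - k + 1 = 0 by rewrite kE !big_ord_recl big_ord0 /=; ring.
have pk' : (1 - k) ^+ 2 - (1 - k) + 1 = 0 by rewrite -[RHS]pk; ring.
have n1 (x : C) : x ^+ 2 - x + 1 = 0 -> nsq x = 1.
  by move=> /root6_prim/prim_expr_order; exact: nsq_root.
have ch (x : C) : x ^+ 3 - \tr (eM zM6) * x ^+ 2 + (\tr (eM zM6))^*%R * x - 1 = (x - 1) * (x ^+ 2 - x + 1).
  by rewrite trM rmorph_nat; ring.
have ex (x : C) : x ^+ 2 - x + 1 = 0 -> exists2 u : 'cV[C]_3, u != 0 & eM zM6 *m u = x *: u.
  by move=> h; apply: (char_eig Mu Md); rewrite ch h mulr0.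
have e3 : eM zM6 *m eV zw6 = 1 *: eV zw6 by rewrite scale1r -eM_vec; apply/veqP; vm_compute.
have w1 : herm (eV zw6) (eV zw6) = 1 by rewrite herm_eV (_ : zherm zw6 zw6 = zi 1) ?zc1 //; vm_compute.
have u30 : eV zw6 != 0 by apply/eqP => z; move/eqP: w1; rewrite z herm0l eq_sym oner_eq0.
have [u1 u10 e1] := ex _ pk; have [u2 u20 e2] := ex _ pk'.
have k1 (x : C) : x ^+ 2 - x + 1 = 0 -> x != 1.
  move=> h; apply/eqP => x1; move/eqP: h; rewrite x1 expr1n subrr add0r; exact/negP/oner_neq0.
have d12 : k != 1 - k.
  apply/eqP => e; have : 4 * (k ^+ 2 - k + 1) = 3.
    by transitivity ((k - (1 - k)) ^+ 2 + 3); [ring|rewrite -e subrr expr0n add0r].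
  by rewrite pk mulr0 => /esym/eqP; rewrite pnatr_eq0.
case: (neg_eigenvector Mu u10 u20 u30 e1 e2 e3 (n1 _ pk) (n1 _ pk') (nsq1 R) d12 (k1 _ pk) (k1 _ pk')) => h.
- by exists u1, k.
- by exists u2, (1 - k).
by move: h; rewrite w1 ltr10.
Qed.
End Points67.

Section Isotropy67.
Variable R : realType.
Local Notation C := R[i].
Local Notation O := (isO R).
Local Notation Re := complex.Re.
Local Notation t := (tau R).
Local Notation eV := (eV R).
Local Notation eM := (eM R).
Local Notation zc := (zc R).
Implicit Types (A B M : 'M[C]_3) (u v w y z : 'cV[C]_3).

Lemma prim_root_notO n (k : C) : n.-primitive_root k -> ~~ (n %| 2)%N -> k \notin O.
Proof.
move=> pk n2; apply/negP => kO; have := prim_expr_neq1 pk n2.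
have k1 := nsq_root (prim_order_gt0 pk) (prim_expr_order pk).
by case: (unit_O kO k1) => ->; rewrite ?sqrrN expr1n eqxx.
Qed.

(** An integral vector on an eigenline would put the eigenvalue into Z[tau], whose only roots of
    unity are 1 and -1. *)
Lemma irrational_line n (k : C) M x : Omx M -> M *m x = k *: x -> n.-primitive_root k -> ~~ (n %| 2)%N ->
  forall y, Omx y -> y != 0 -> forall c : C, y <> c *: x.
Proof.
move=> MO Mx pk n2 y yO y0 c e; case/negP: (prim_root_notO pk n2).
by apply: (int_eig MO yO y0); rewrite e -scalemxAr Mx !scalerA mulrC.
Qed.

Lemma irrational_coord n (k : C) M x v (c : C) : Omx M -> M *m x = k *: x -> n.-primitive_root k -> ~~ (n %| 2)%N ->
  v != 0 -> v = c *: x -> ~ forall i, Qisqrt 7 (v i 0).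
Proof.
move=> MO Mx pk n2 v0 vx /Qisqrt_int[d d0 dO].
apply: (irrational_line MO Mx pk n2 dO _ (c := d * c)); first by rewrite scaler_eq0 negb_or d0.
by rewrite vx scalerA.
Qed.

Lemma expmx_eig M (x : 'cV[C]_3) (k : C) j : M *m x = k *: x -> M ^+ j *m x = k ^+ j *: x.
Proof.
move=> Mx; elim: j => [|j IH]; first by rewrite !expr0 mul1mx scale1r.
by rewrite exprSr -mulmxE -mulmxA Mx -scalemxAr IH scalerA -exprS.
Qed.

Lemma det_exp1 M j : \det M = 1 -> \det (M ^+ j) = 1.
Proof. by move=> d; elim: j => [|j IH]; rewrite ?expr0 ?det1 // exprS det_mulmx d IH mulr1. Qed.

(** When B x = 0, the rows of B, turned into columns by J and conjugation, are integral vectors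
    orthogonal to x. *)
Lemma mx0_of_herm_row B x : B *m x = 0 -> Omx B -> (forall w, Omx w -> herm w x = 0 -> w = 0) -> B = 0.
Proof.
move=> Bx BO h; have e w : Omx w -> Jmx R *m B^t* *m w = 0.
  move=> wO; apply: h; first by apply: Omx_mul => //; apply: Omx_mul; [exact: Omx_J|exact: Omx_tr].
  by rewrite hermCC herm_row -mulmxA Bx mulmx0 mxE conjC0.
apply/matrixP => i j; rewrite [RHS]mxE.
have := congr1 (mulmx (Jmx R)) (e (delta_mx i 0) (Omx_delta _ _ _)).
rewrite mulmx0 !mulmxA Jmx_sq mul1mx -colE => /matrixP/(_ j 0); rewrite !mxE => /eqP.
by rewrite conjC_eq0 => /eqP.
Qed.

Section Seven.
Variables (x : 'cV[C]_3) (k : C).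
Hypotheses (xneg : herm x x < 0) (Mx : eM zM7 *m x = k *: x) (pk : p7 k = 0).
Local Notation M := (eM zM7).

Lemma uni_M7 : uni M. Proof. apply: uZ_uni; vm_compute; reflexivity. Qed.
Lemma det_M7 : \det M = 1. Proof. by rewrite eM_det (_ : mdet zM7 = zi 1) ?zc1 //; vm_compute. Qed.
Lemma tr_M7 : \tr M = - t. Proof. by rewrite eM_tr (_ : ztr zM7 = zopp ztau) ?zcN ?zc_tau //; vm_compute. Qed.

(** Such a u would be an eigenvector for 1 or -1, which is not a root of [p7]. *)
Lemma int_perp7 u : Omx u -> herm u x = 0 -> u = 0.
Proof.
move=> uO ux; apply/eqP/negPn/negP => u0.
have irr := irrational_line (Omx_eM R zM7) Mx (root7_prim pk) (isT : ~~ (7 %| 2)%N).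
have ev (e : C) : M *m u = e *: u -> e ^+ 2 = 1 -> False.
  move=> Mu e2; have := eig_char uni_M7 det_M7 Mu u0; rewrite (char_p7 tr_M7) => /root7_prim pe.
  by have := prim_expr_neq1 pe (isT : ~~ (7 %| 2)%N); rewrite e2 eqxx.
case: (int_perp uni_M7 (Omx_eM R zM7) xneg Mx irr uO u0 ux) => h.
  by apply: (ev 1); rewrite ?expr1n // scale1r.
by apply: (ev (-1)); rewrite ?sqrrN ?expr1n // scaleN1r.
Qed.

(** If c^12 = 1, then A M has at x the eigenvalue k c with (k c)^12 = k^12 different from 1, so
    [elliptic_eig] leaves (k c)^7 = 1. Hence c^7 = 1 in every case, c is a power of k, and A minus
    the corresponding power of M kills x. *)
Lemma isotropy7 A (c : C) : uni A -> Omx A -> \det A = 1 -> A *m x = c *: x -> exists2 j, (j < 7)%N & A = M ^+ j.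
Proof.
move=> Au AO Ad Ax; have pr := root7_prim pk; have k7 := prim_expr_order pr.
have c7 : c ^+ 7 = 1.
  have AMx : (A *m M) *m x = (k * c) *: x by rewrite -mulmxA Mx -scalemxAr Ax scalerA.
  have AMd : \det (A *m M) = 1 by rewrite det_mulmx Ad det_M7 mulr1.
  have main : c ^+ 12 = 1 -> c ^+ 7 = 1.
    move=> c12; have e : (k * c) ^+ 12 = k ^+ 12 by rewrite exprMn c12 mulr1.
    have n12 : k ^+ 12 != 1 by exact: (prim_expr_neq1 pr).
    case: (elliptic_eig (uni_mul Au uni_M7) (Omx_mul AO (Omx_eM R zM7)) AMd xneg AMx) => h.
    - by move/eqP: n12; rewrite -e (exprM _ 6 2) h expr1n.
    - by move/eqP: n12; rewrite -e (exprM _ 2 6) h (exprM _ 2 3) sqrrN !expr1n.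
    by move: h; rewrite exprMn k7 mul1r.
  case: (elliptic_eig Au AO Ad xneg Ax) => // h; apply: main.
    by rewrite (exprM _ 6 2) h expr1n.
  by rewrite (exprM _ 2 6) h (exprM _ 2 3) sqrrN !expr1n.
have [j cj] := prim_rootP pr c7.
exists j => //; apply/eqP; rewrite -subr_eq0; apply/eqP.
apply: (@mx0_of_herm_row _ x) => [| |w wO wx]; last exact: int_perp7.
  by rewrite mulmxBl Ax (expmx_eig _ Mx) cj subrr.
by apply: Omx_add => //; apply/Omx_opp/Omx_exp/Omx_eM.
Qed.
End Seven.

Section Six.
Variables (x : 'cV[C]_3) (k : C).
Hypotheses (xneg : herm x x < 0) (Mx : eM zM6 *m x = k *: x) (pk : k ^+ 2 - k + 1 = 0).
Local Notation M := (eM zM6).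
Local Notation w6 := (eV zw6).

Lemma uni_M6 : uni M. Proof. apply: uZ_uni; vm_compute; reflexivity. Qed.
Lemma det_M6 : \det M = 1. Proof. by rewrite eM_det (_ : mdet zM6 = zi 1) ?zc1 //; vm_compute. Qed.
Lemma tr_M6 : \tr M = 2. Proof. by rewrite eM_tr (_ : ztr zM6 = zi 2) ?zc_int //; vm_compute. Qed.
Lemma M6_w6 : M *m w6 = w6. Proof. by rewrite -eM_vec; apply/veqP; vm_compute. Qed.
Lemma herm_w6 : herm w6 w6 = 1. Proof. by rewrite herm_eV (_ : zherm zw6 zw6 = zi 1) ?zc1 //; vm_compute. Qed.

Lemma k6_neq1 : k != 1.
Proof. by apply/eqP => x1; move/eqP: pk; rewrite x1 expr1n subrr add0r; exact/negP/oner_neq0. Qed.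

Lemma w6_perp : herm w6 x = 0.
Proof.
have k1 := nsq_root (isT : (0 < 6)%N) (prim_expr_order (root6_prim pk)).
by apply: (eig_orth uni_M6 (_ : M *m w6 = 1 *: w6) Mx k1); rewrite ?scale1r ?M6_w6 // eq_sym k6_neq1.
Qed.

Lemma char6 (y : C) : y ^+ 3 - \tr M * y ^+ 2 + (\tr M)^*%R * y - 1 = (y - 1) * (y ^+ 2 - y + 1).
Proof. by rewrite tr_M6 rmorph_nat; ring. Qed.

Lemma reg6 : regular_at M x k.
Proof.
split; [exact: uni_M6|exact: Omx_eM|exact: det_M6|exact: Mx|].
rewrite /disc_char tr_M6 rmorph_nat.
rewrite (_ : _ + 2 = 3%:R * (k ^+ 2 - k + 1) - (k + 1)); last by ring.
rewrite pk mulr0 sub0r oppr_eq0 addr_eq0; apply/eqP => kN; move/eqP: pk.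
by rewrite kN sqrrN expr1n opprK (_ : _ + 1 = 3%:R) ?pnatr_eq0 //; ring.
Qed.

(** A fixed vector independent of [w6] would give M the determinant k instead of 1, and -1 is not an
    eigenvalue of M. *)
Lemma int_perp6 u : Omx u -> herm u x = 0 -> exists b : C, u = b *: w6.
Proof.
move=> uO ux; have [->|u0] := eqVneq u 0; first by exists 0; rewrite scale0r.
have irr := irrational_line (Omx_eM R zM6) Mx (root6_prim pk) (isT : ~~ (6 %| 2)%N).
case: (int_perp uni_M6 (Omx_eM R zM6) xneg Mx irr uO u0 ux) => h.
  have w60 : w6 != 0 by apply/eqP => z; move/eqP: herm_w6; rewrite z herm0l eq_sym oner_eq0.
  have [d|d] := eqVneq (\det (cols x w6 u)) 0; first exact: perp_dep xneg w6_perp ux w60 d.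
  case/eqP: k6_neq1; apply: (mulIf d); rewrite mul1r.
  have := congr1 determinant (mul_cols M x w6 u).
  have -> : cols (M *m x) (M *m w6) (M *m u) = cols (k *: x) (1 *: w6) (1 *: u) by rewrite Mx M6_w6 h !scale1r.
  by rewrite det_mulmx det_M6 mul1r det_cols_scale !mulr1.
have /(eig_char uni_M6 det_M6)/(_ u0) : M *m u = (-1) *: u by rewrite scaleN1r.
rewrite char6 => /eqP; rewrite mulf_eq0 (_ : -1 - 1 = - 2%:R) ?oppr_eq0 ?pnatr_eq0 /=; last by ring.
by rewrite (_ : _ + 1 = 3%:R) ?pnatr_eq0 //; ring.
Qed.

(** Applied to A and to A M, [elliptic_eig] leaves c^6 = 1, so A agrees at x with a power of M. By
    [int_perp6] the rows of the difference are multiples of one vector, and A is that power times a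
    map altering only [w6]. *)
Lemma isotropy6 A (c : C) : uni A -> Omx A -> \det A = 1 -> A *m x = c *: x -> exists2 j, (j < 6)%N & A = M ^+ j.
Proof.
move=> Au AO Ad Ax; have pr := root6_prim pk; have k6 := prim_expr_order pr.
have k1 : k ^+ 7 != 1 by rewrite exprS k6 mulr1 k6_neq1.
have c6 : c ^+ 6 = 1.
  have AMx : (A *m M) *m x = (k * c) *: x by rewrite -mulmxA Mx -scalemxAr Ax scalerA.
  have AMd : \det (A *m M) = 1 by rewrite det_mulmx Ad det_M6 mulr1.
  have two : (1 : C) != -1 by rewrite -subr_eq0 opprK -[1 + 1]/(2%:R) pnatr_eq0.
  have eA := elliptic_eig (uni_mul Au uni_M6) (Omx_mul AO (Omx_eM R zM6)) AMd xneg AMx.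
  case: (elliptic_eig Au AO Ad xneg Ax) => // c2; rewrite !exprMn k6 ?mul1r in eA.
    have c42 : c ^+ 42 = -1 by rewrite (exprM _ 2 21) c2 exprS (exprM _ 2 10) sqrrN !expr1n mulr1.
    have c6 : c ^+ 6 = -1 by rewrite (exprM _ 2 3) c2 exprS sqrrN expr1n mulr1.
    case: eA => h.
    - exact: h.
    - have : k ^+ 2 == 1 by rewrite c2 mulrN1 in h; rewrite -[k ^+ 2]opprK h opprK.
      by rewrite (negPf (prim_expr_neq1 pr (isT : ~~ (6 %| 2)%N))).
    have := congr1 (fun z : C => z ^+ 6) h; rewrite exprMn -!exprM (exprM _ 6 7 : k ^+ 42 = _) k6 !expr1n mul1r c42.
    by move/eqP; rewrite eq_sym (negPf two).
  case: eA => h //.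
  - have : (k * c) ^+ 12 = 1 by rewrite exprMn (exprM _ 2 6) (exprM c 2 6) -exprMn h (exprM _ 2 3) sqrrN !expr1n.
    rewrite exprMn (exprM _ 6 2) k6 expr1n mul1r => c12.
    have c14 : c ^+ 14 = 1 by rewrite (exprM _ 7 2) c2 expr1n.
    have cc : c ^+ 2 = 1 by move: c14; rewrite -[14%N]/(12 + 2)%N exprD c12 mul1r.
    by rewrite (exprM _ 2 3) cc expr1n.
  by move: h; rewrite c2 mulr1 => /eqP; rewrite (negPf k1).
have [j cj] := prim_rootP pr c6.
exists j => //; pose B := A - M ^+ j.
have Bx : B *m x = 0 by rewrite mulmxBl Ax (expmx_eig _ Mx) cj subrr.
have BO : Omx B by apply: Omx_add => //; apply/Omx_opp/Omx_exp/Omx_eM.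
have Bperp z : herm z w6 = 0 -> B *m z = 0.
  move=> zw; apply/matrixP => i i'; rewrite ord1 [RHS]mxE.
  pose w : 'cV[C]_3 := delta_mx i 0.
  have rO : Omx (Jmx R *m B^t* *m w) by apply: Omx_mul (Omx_delta _ _ _); apply: Omx_mul; [exact: Omx_J|exact: Omx_tr].
  have rx : herm (Jmx R *m B^t* *m w) x = 0 by rewrite hermCC herm_row -mulmxA Bx mulmx0 mxE conjC0.
  have [b e] := int_perp6 rO rx.
  have : herm z (Jmx R *m B^t* *m w) = 0 by rewrite e hermZr zw mulr0.
  rewrite herm_row -mulmxA.
  have -> : w^t* = delta_mx 0 i by apply/matrixP => a b'; rewrite !mxE !ord1 /= andbT rmorph_nat.
  by rewrite -rowE mxE.
have Mj6 : M ^+ j *m w6 = w6 by rewrite (@expmx_eig M w6 1) ?scale1r ?M6_w6 // expr1n scale1r.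
have Aw : herm (A *m w6) x = 0 by rewrite (eig_perp Au xneg Ax) w6_perp mulr0.
have [b bE] := int_perp6 (Omx_mul AO (eV_O R zw6 : Omx w6)) Aw.
have AE : A = M ^+ j + ((b - 1) *: w6) *m (w6^t* *m Jmx R).
  apply/eqP; rewrite addrC -subr_eq; apply/eqP; rewrite -/B.
  apply/matrixP => i i'.
  have := Bperp (delta_mx i' 0 - herm (delta_mx i' 0) w6 *: w6).
  rewrite hermBl hermZl herm_w6 mulr1 subrr => /(_ erefl).
  rewrite mulmxBr -scalemxAr -colE {2}/B mulmxBl bE Mj6 => /eqP; rewrite subr_eq0 => /eqP/matrixP/(_ i 0).
  rewrite !mxE => ->; rewrite herm_def -colE big_ord1 !mxE; ring.
have {}AE : A = M ^+ j *m (1%:M + ((b - 1) *: w6) *m (w6^t* *m Jmx R)).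
  by rewrite mulmxDr mulmx1 {1}AE mulmxA -scalemxAr Mj6.
(* The determinant of 1 + (b - 1) w w^* J is b, because w has norm 1. *)
have b1 : b = 1.
  have := congr1 determinant AE; rewrite det_mulmx Ad (det_exp1 _ det_M6) mul1r det_rank1_update.
  have -> : (1%:M : 'M[C]_3) *m 1%:M - \tr (1%:M : 'M[C]_3) *: 1%:M + (minor_sum (1%:M : 'M[C]_3))%:M = 1%:M.
    rewrite mulmx1 mxtrace1 /minor_sum !mxE /=; apply/matrixP => i i'; rewrite !mxE; case: eqP => _ /=; ring.
  rewrite det1 mulmx1 -scalemxAr mxE -herm_def herm_w6 mulr1 => e.
  by rewrite e addrC subrK.
by rewrite AE b1 subrr scale0r mul0mx addr0 mulmx1.
Qed.

End Six.
End Isotropy67.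

(** * Mirrors and reflections *)

Section Mirrors.
Variable R : realType.
Local Notation C := R[i].
Local Notation O := (isO R).
Local Notation Re := complex.Re.
Local Notation eV := (eV R).
Local Notation eM := (eM R).
Local Notation zc := (zc R).
Implicit Types (A B M : 'M[C]_3) (u v w z : 'cV[C]_3).

Lemma herm_nondeg z : (forall u, herm u z = 0) -> z = 0.
Proof.
move=> h; have e i : (Jmx R *m z) i 0 = 0.
  have := h (delta_mx i 0); rewrite hermCC herm_def => /eqP.
  rewrite conjC_eq0 => /eqP e; rewrite -[RHS]e -mulmxA.
  have -> : (delta_mx i 0 : 'cV[C]_3)^t* = delta_mx 0 i by apply/matrixP => a b; rewrite !mxE !ord1 /= andbT rmorph_nat.
  by rewrite -rowE [RHS]mxE.
have e0 : Jmx R *m z = 0 by apply/matrixP => i j; rewrite ord1 e mxE.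
by rewrite -[z]mul1mx -Jmx_sq -mulmxA e0 mulmx0.
Qed.

Lemma perp_split u w : herm w w != 0 -> exists (c : C) z, u = c *: w + z /\ herm z w = 0.
Proof. by move=> w0; exists (herm u w / herm w w), (u - (herm u w / herm w w) *: w); split; [rewrite addrC subrK|exact: perp_decomp]. Qed.

Lemma perp_split_neg p w z (c : C) : herm p p < 0 -> 0 < herm w w -> p = c *: w + z -> herm z w = 0 -> herm z z < 0.
Proof.
move=> pneg wpos pE zw; have wz : herm w z = 0 by rewrite hermCC zw conjC0.
apply: le_lt_trans pneg; rewrite pE !(hermDl, hermDr, hermZl, hermZr) zw wz !mulr0 addr0 add0r mulrA -nsqE lerDr.
by rewrite mulr_ge0 ?(ltW wpos) // lecR nsq_ge0.
Qed.

Lemma pos_perp_neg w : 0 < herm w w -> exists2 v, herm v v < 0 & herm v w = 0.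
Proof.
move=> wpos; have w0 : herm w w != 0 by rewrite gt_eqF.
have pneg : herm (eV vp1) (eV vp1) < 0 by rewrite herm_eV (_ : zherm vp1 vp1 = zi (-2)) // zc_int ltrz0.
have [c [z [pE zw]]] := perp_split (eV vp1) w0.
by exists z => //; exact: perp_split_neg pneg wpos pE zw.
Qed.

Lemma neg_perturb v u : herm v v < 0 -> herm u v = 0 -> exists2 N : C, N != 0 & herm (N *: v + u) (N *: v + u) < 0.
Proof.
move=> vneg uv; have vu : herm v u = 0 by rewrite hermCC uv conjC0.
have v1 : 0 < - Re (herm v v) by rewrite oppr_gt0 -herm_lt0.
have [n nE] := nat_above (Re (herm u u) / - Re (herm v v)).
exists n.+1%:R; first by rewrite pnatr_eq0.
rewrite !(hermDl, hermDr, hermZl, hermZr) uv vu !mulr0 addr0 add0r rmorph_nat mulrA -natrM.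
rewrite [herm v v]herm_real [herm u u]herm_real -(rmorph_nat (real_complex R)) -rmorphM -rmorphD /= (@ltcR _ _ 0).
rewrite ltr_pdivrMr // in nE.
have h : n%:R * - Re (herm v v) <= (n.+1 * n.+1)%:R * - Re (herm v v).
  by apply: ler_wpM2r; [exact: ltW|rewrite ler_nat; nia].
by rewrite -ltrBrDl sub0r -mulrN; exact: lt_le_trans nE h.
Qed.

Lemma mirrorP x v w : is_line_of x v -> mirror w x <-> herm v w = 0.
Proof.
move=> xv; split=> [[u /= uw e]|vw].
  have [c c0 cE] := (line_eq xv (ex_intro2 _ _ u erefl (esym e) : is_line_of x (val u))).1 erefl.
  by rewrite cE hermZl uw mulr0.
have [u uE ->] := xv; exists u => //=; by rewrite uE.
Qed.

Lemma mirror_scale w (c : C) : c != 0 -> mirror (c *: w) = mirror w.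
Proof.
move=> c0; have cc : c^*%R != 0 by rewrite conjC_eq0.
apply/seteqP; split=> x; have [v xv] := line_of x => /(mirrorP _ xv) h; apply/(mirrorP _ xv).
  by move/eqP: h; rewrite hermZr mulf_eq0 (negPf cc) => /eqP.
by rewrite hermZr h mulr0.
Qed.

(** The negative vectors orthogonal to w span the orthogonal of w, by [neg_perturb]; so this plane
    is orthogonal to w' as well, and the form is nondegenerate. *)
Lemma mirror_subset w w' : 0 < herm w w -> mirror w `<=` mirror w' -> exists c : C, w' = c *: w.
Proof.
move=> wpos sub; have [v vneg vw] := pos_perp_neg wpos.
have tst u : herm u u < 0 -> herm u w = 0 -> herm u w' = 0.
  by move=> uneg uw; have [x xu] := line_exists uneg; apply/(mirrorP _ xu)/sub/(mirrorP _ xu).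
have vv : herm v v != 0 by rewrite ltr0_neq0.
have perp u : herm u w = 0 -> herm u w' = 0.
  move=> uw; have [c [z [uE zv]]] := perp_split u vv.
  have zw : herm z w = 0 by move: uw; rewrite uE hermDl hermZl vw mulr0 add0r.
  have [N N0 neg] := neg_perturb vneg zv.
  have := tst _ neg; rewrite !hermDl !hermZl vw zw mulr0 addr0 (tst _ vneg vw) mulr0 add0r => /(_ erefl) zw'.
  by rewrite uE hermDl hermZl (tst _ vneg vw) mulr0 add0r.
have w0 : herm w w != 0 by rewrite gt_eqF.
have [c [z [w'E zw]]] := perp_split w' w0; exists c.
suff z0 : z = 0 by rewrite w'E z0 addr0.
apply: herm_nondeg => u; have [d [u1 [uE u1w]]] := perp_split u w0.
have wz : herm w z = 0 by rewrite hermCC zw conjC0.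
have := perp _ u1w; rewrite w'E hermDr hermZr u1w mulr0 add0r => u1z.
by rewrite uE hermDl hermZl wz u1z mulr0 add0r.
Qed.

Lemma act_mirror A w : uni A -> act (piU A) @` mirror w = mirror (A *m w).
Proof.
move=> Au; apply/seteqP; split=> [y [x xm <-]|y].
  have [v xv] := line_of x; move/(mirrorP _ xv): xm => vw.
  by apply/(mirrorP _ (act_line xv Au)); rewrite uni_herm.
have [v yv] := line_of y => /(mirrorP _ yv) vw.
exists (act (piU (uinv A)) y).
  by apply/(mirrorP _ (act_line yv (uni_inv Au))); rewrite -vw -{2}[v]mul1mx -(uinvKr Au) -mulmxA uni_herm.
by rewrite -actM -(piU_mul Au (uni_inv Au)) uinvKr // piU_one act1.
Qed.

(** Every negative vector of the orthogonal of w is an eigenvector. Those of the form N v + z are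
    not orthogonal to v, so they share the eigenvalue of v, and then z does too. The eigenvalues l
    and m differ since the class of A is not 1. *)
Lemma reflects_scalar A w : uni A -> 0 < herm w w -> reflects_in (piU A) (mirror w) ->
  exists l m : C, [/\ l != m, forall u, herm u w = 0 -> A *m u = l *: u & A *m w = m *: w].
Proof.
move=> Au wpos [A1 _ fixA]; have [v vneg vw] := pos_perp_neg wpos.
have eig u : herm u u < 0 -> herm u w = 0 -> exists c : C, A *m u = c *: u.
  move=> uneg uw; have [x xu] := line_exists uneg.
  by apply/(act_fix xu Au)/fixA/(mirrorP _ xu).
have vv : herm v v != 0 by rewrite ltr0_neq0.
have [l Av] := eig v vneg vw.
have perp u : herm u w = 0 -> A *m u = l *: u.
  move=> uw; have [c [z [uE zv]]] := perp_split u vv.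
  have zw : herm z w = 0 by move: uw; rewrite uE hermDl hermZl vw mulr0 add0r.
  have [N N0 neg] := neg_perturb vneg zv.
  have [k kE] : exists k : C, A *m (N *: v + z) = k *: (N *: v + z).
    by apply: eig => //; rewrite hermDl hermZl vw zw mulr0 addr0.
  have kl : k = l.
    have := eig_perp Au vneg Av (N *: v + z); rewrite kE !(hermDl, hermZl) zv addr0 => h.
    exact: (mulIf (mulf_neq0 N0 vv)).
  have Az : A *m z = l *: z.
    by move: kE; rewrite kl mulmxDr -scalemxAr Av scalerDr !scalerA mulrC => /addrI.
  by rewrite uE mulmxDr -scalemxAr Av Az scalerDr !scalerA mulrC.
have w0 : herm w w != 0 by rewrite gt_eqF.
have ln : l != 0 by have [] := nsq_unit_inv (eig_neg_unit Au vneg Av).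
have [m [z [AwE zw]]] := perp_split (A *m w) w0.
have Aw : A *m w = m *: w.
  suff z0 : z = 0 by rewrite AwE z0 addr0.
  apply: herm_nondeg => u; have [d [u1 [uE u1w]]] := perp_split u w0.
  have wz : herm w z = 0 by rewrite hermCC zw conjC0.
  have u1A : herm u1 (A *m w) = 0.
    have := uni_herm u1 w Au; rewrite (perp _ u1w) hermZl u1w => /eqP.
    by rewrite mulf_eq0 (negPf ln) => /eqP.
  rewrite AwE hermDr hermZr u1w mulr0 add0r in u1A.
  by rewrite uE hermDl hermZl wz u1A mulr0 add0r.
exists l, m; split=> //; apply/eqP => lm; case: A1; rewrite -piU_one; apply/(piU_eq Au (uni_one R)).
exists l => //; rewrite scalemx1 -[A]mulmx1; apply/matrixP => i j.
have [d [z' [eE zw']]] := perp_split (col j 1%:M) w0.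
have : A *m col j 1%:M = l *: col j 1%:M by rewrite eE mulmxDr -scalemxAr Aw perp // -lm scalerDr !scalerA mulrC.
rewrite colE mulmxA -colE => /matrixP/(_ i 0); rewrite mxE => ->; rewrite mxE mul1mx !mxE eqxx andbT.
by case: eqP => _; rewrite ?mulr1n ?mulr0n ?mulr1 ?mulr0.
Qed.

Lemma refl_mx_uni w : uni (refl_mx w).
Proof. by have /andP[_ /eqP] := refl_isUJ w. Qed.

Lemma refl_piU w : refl w = piU (refl_mx w).
Proof. by rewrite -[refl_mx w]/(val (MkUJ (refl_isUJ w))) piU_val. Qed.

Lemma refl_mx_self w : herm w w != 0 -> refl_mx w *m w = - w.
Proof. by move=> w0; rewrite refl_mxE mulfK // scaler_nat mulr2n opprD addrA subrr add0r. Qed.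

Lemma refl_mx_perp w u : herm u w = 0 -> refl_mx w *m u = u.
Proof. by move=> uw; rewrite refl_mxE uw mulr0 mul0r scale0r subr0. Qed.

Lemma mx_perp_ext A B w : herm w w != 0 -> (forall u, herm u w = 0 -> A *m u = B *m u) -> A *m w = B *m w -> A = B.
Proof.
move=> w0 h hw; rewrite -[A]mulmx1 -[B]mulmx1; apply/matrixP => i j.
have [d [z' [eE zw']]] := perp_split (col j 1%:M) w0.
have : A *m col j 1%:M = B *m col j 1%:M by rewrite eE !mulmxDr -!scalemxAr hw h.
by rewrite !colE !mulmxA -!colE => /matrixP/(_ i 0); rewrite !mxE.
Qed.

Lemma refl_reflects w : 0 < herm w w -> reflects_in (refl w) (mirror w).
Proof.
move=> wpos; have w0 : herm w w != 0 by rewrite gt_eqF.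
have ru := refl_mx_uni w; split.
- rewrite refl_piU -piU_one => /(piU_eq ru (uni_one R))[c _ e].
  have [v vneg vw] := pos_perp_neg wpos.
  have c1 : c = 1.
    have v0 := herm_neg_neq0 vneg; have := refl_mx_perp vw; rewrite e -scalemxAl mul1mx => /eqP.
    by rewrite -subr_eq0 -[X in _ - X]scale1r -scalerBl scaler_eq0 (negPf v0) orbF subr_eq0 => /eqP.
  have := refl_mx_self w0; rewrite e c1 scale1r mul1mx => /eqP; rewrite -addr_eq0 -mulr2n -scaler_nat scaler_eq0 pnatr_eq0 /=.
  by apply/negP; apply: contraNneq w0 => ->; rewrite herm0l.
- by exists 2%N => //; rewrite refl_piU -piU_exp // expr2 -mulmxE refl_mxK piU_one.
move=> x; have [v xv] := line_of x => /(mirrorP _ xv) vw.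
by rewrite refl_piU; apply/(act_fix xv ru); exists 1; rewrite refl_mx_perp // scale1r.
Qed.

(* The eigenvalue m <> 1 of A on w is \tr A - 2, hence a unit of Z[tau]. *)
Lemma reflects_refl_mx A p w : uni A -> Omx A -> herm p p < 0 -> A *m p = p -> 0 < herm w w ->
  reflects_in (piU A) (mirror w) -> A = refl_mx w.
Proof.
move=> Au AO pneg Ap wpos /(reflects_scalar Au wpos)[l [m [lm perp Aw]]].
have w0 : herm w w != 0 by rewrite gt_eqF.
have [c [z [pE zw]]] := perp_split p w0.
have zneg := perp_split_neg pneg wpos pE zw; have zz : herm z z != 0 by rewrite ltr0_neq0.
have wz : herm w z = 0 by rewrite hermCC zw conjC0.
have l1 : l = 1.
  apply: (mulIf zz); rewrite mul1r.
  transitivity (herm (A *m p) z); last by rewrite Ap pE hermDl hermZl wz mulr0 add0r.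
  by rewrite pE mulmxDr -scalemxAr Aw perp // hermDl !hermZl wz !mulr0 add0r.
have AE : A = 1%:M + ((m - 1) / herm w w) *: (w *m (w^t* *m Jmx R)).
  have Bu u : (1%:M + ((m - 1) / herm w w) *: (w *m (w^t* *m Jmx R))) *m u = u + ((m - 1) / herm w w * herm u w) *: w.
    by rewrite mulmxDl mul1mx -scalemxAl -mulmxA (mx11_scalar (_ *m u)) mul_mx_scalar scalerA -herm_def.
  apply: (mx_perp_ext w0) => [u uw|]; rewrite Bu.
    by rewrite perp // uw mulr0 scale0r addr0 l1 scale1r.
  by rewrite Aw divfK // scalerBl scale1r addrC subrK.
have m1 : nsq m = 1.
  have := uni_herm w w Au; rewrite Aw hermZl hermZr mulrA -nsqE => e.
  by apply: complexI; apply: (mulIf w0); rewrite e mul1r.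
have mO : m \in O.
  have -> : m = \tr A - 2%:R.
    rewrite AE mxtraceD mxtraceZ mxtrace1 mxtrace_mulC (mx11_scalar (_ *m w)) mxtrace_scalar -herm_def mulr1n divfK //; ring.
  by rewrite rpredB ?rpred_nat // /mxtrace rpred_sum.
have mN : m = -1 by case: (unit_O mO m1) => // m1'; case/eqP: lm; rewrite l1 m1'.
apply: (mx_perp_ext w0) => [u uw|]; first by rewrite perp // l1 scale1r refl_mx_perp.
by rewrite refl_mx_self // Aw mN scaleN1r.
Qed.
End Mirrors.

(** * Isotropy groups of the rational points *)

(** Divisibility in Z[tau], tested by multiplying by the conjugate of [d] and dividing both
    coordinates by its norm. *)
Definition zdvd (d z : ZO) : bool :=
  let w := zmul (zconj d) z in
  BinInt.Z.eqb (BinInt.Z.modulo w.1 (znorm d)) BinNums.Z0 && BinInt.Z.eqb (BinInt.Z.modulo w.2 (znorm d)) BinNums.Z0.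

Lemma zdvd_mull d q : zdvd d (zmul d q).
Proof.
rewrite /zdvd; have -> : zmul (zconj d) (zmul d q) = (BinInt.Z.mul q.1 (znorm d), BinInt.Z.mul q.2 (znorm d)).
  by case: d q => [a b] [c e]; rewrite /zmul /zconj /znorm; cbn [fst snd]; congr (_, _); lia.
cbn [fst snd]; move: (znorm d) => n.
have h x : BinInt.Z.eqb (BinInt.Z.modulo (BinInt.Z.mul x n) n) BinNums.Z0.
  apply/BinInt.Z.eqb_eq; have [n0|/eqP n0] := eqVneq n BinNums.Z0; first by rewrite n0 BinInt.Z.mul_0_r.
  exact: BinInt.Z.mod_mul.
by rewrite !h.
Qed.

Definition zlin (a b : ZO) (r1 r2 : zvec) : zvec := vadd (vscale a r1) (vscale b r2).

(* Some entry of X M^-1 is not in O. *)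
Definition nonintegral_ratio (M X : zmat) : bool :=
  let Y := mmul X (madjg M) in
  has (fun i => has (fun j => ~~ zdvd (mdet M) (mget Y i j)) [:: 0; 1; 2]%N) [:: 0; 1; 2]%N.

Definition zlt (x y : BinNums.Z) := BinInt.Z.ltb x y.

(* Every integral isometry mapping p to q is in G; r1, r2 and s1, s2 are bases of the
   lattices orthogonal to p and q, and the bounds confine the coordinates of the images
   of r1, r2 on s1, s2 to small_norms. *)
Definition transporter_check (p r1 r2 q y s1 s2 : zvec) (G : seq zmat) : bool :=
  let m := (zherm s1 s1).1 in let n := (zherm s2 s2).1 in
  let m' := (zherm r1 r1).1 in let n' := (zherm r2 r2).1 in
  let D := BinInt.Z.sub (BinInt.Z.mul m n) (znorm (zherm s2 s1)) in
  let M := mcols p r1 r2 in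
  [&& [&& ref_basis y s1 s2 q, zeq (zherm r1 p) z0 & zeq (zherm r2 p) z0],
      [&& zeq (zherm s1 s1) (zi m) && zeq (zherm s2 s2) (zi n), zeq (zherm r1 r1) (zi m') && zeq (zherm r2 r2) (zi n'),
          zlt (BinInt.Z.mul m' m) (BinInt.Z.mul 3 D) && zlt (BinInt.Z.mul m' n) (BinInt.Z.mul 3 D),
          zlt (BinInt.Z.mul n' m) (BinInt.Z.mul 3 D) && zlt (BinInt.Z.mul n' n) (BinInt.Z.mul 3 D) & zlt BinNums.Z0 D],
      meq (mmul M (madjg M)) (mscale (mdet M) mone) && ~~ zeq (mdet M) z0, all (fun X => veq (mvec X p) q) G &
      all (fun a => all (fun b => all (fun c => all (fun d =>
        let u := zlin a b s1 s2 in let v := zlin c d s1 s2 in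
        [&& zeq (zherm u u) (zherm r1 r1), zeq (zherm v v) (zherm r2 r2) & zeq (zherm v u) (zherm r2 r1)] ==>
        has (fun X => veq (mvec X r1) u && veq (mvec X r2) v) G || nonintegral_ratio M (mcols q u v))
      small_norms) small_norms) small_norms) small_norms].

Lemma int_of_Z_det (m n k : BinNums.Z) :
  int_of_Z (BinInt.Z.sub (BinInt.Z.mul m n) k) = int_of_Z m * int_of_Z n - int_of_Z k.
Proof. lia. Qed.

Section Stabilizer.
Variable R : realType.
Local Notation C := R[i].
Local Notation O := (isO R).
Local Notation Re := complex.Re.
Local Notation eV := (eV R).
Local Notation eM := (eM R).
Local Notation zc := (zc R).
Implicit Types (A B M : 'M[C]_3) (u v w z : 'cV[C]_3).

Lemma ref_basis_coord y r1 r2 p u : ref_basis y r1 r2 p -> Omx u -> herm u (eV p) = 0 ->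
  exists a b : C, [/\ a \in O, b \in O & u = a *: eV r1 + b *: eV r2].
Proof.
move=> /and4P[inv /zeqP k1 /zeqP k2 /zeqP k3] uO up.
have I := zinvertibleP R inv; set B' := eM _ in I.
pose x := B' *m u; have xO : Omx x by apply: Omx_mul => //; exact: Omx_eM.
have uE : u = x 0 0 *: eV y + (x 1 0 *: eV r1 + x 2%:R 0 *: eV r2).
  by rewrite -cols_mul mulmxA I mul1mx.
have x0 : x 0 0 = 0.
  by move: up; rewrite uE !hermDl !hermZl !herm_eV k1 k2 k3 zc1 zc0 !mulr0 !addr0 mulr1.
exists (x 1 0), (x 2%:R 0); split; rewrite ?xO //.
by rewrite {1}uE x0 scale0r add0r.
Qed.

(** The Gram determinants of (u, r1) and (u, r2) are |b|^2 D and |a|^2 D. *)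
Lemma coord_bound (r1 r2 : 'cV[C]_3) (a b : C) : let u := a *: r1 + b *: r2 in
  let D := Re (herm r1 r1) * Re (herm r2 r2) - nsq (herm r2 r1) in
  nsq b * D <= Re (herm u u) * Re (herm r1 r1) /\ nsq a * D <= Re (herm u u) * Re (herm r2 r2).
Proof.
move=> u D.
have g1 := form_gram (@hermDl R) (@hermZl R) (@hermCC R) r1 r2 a b 1 0.
have g2 := form_gram (@hermDl R) (@hermZl R) (@hermCC R) r1 r2 a b 0 1.
rewrite /= !(scale0r, scale1r, add0r, addr0, mulr0, mulr1, sub0r, subr0) -/u nsqN in g1 g2.
by split; rewrite -?g1 -?g2 gerBl nsq_ge0.
Qed.

Lemma nsq_lt3 (z : C) : z \in O -> nsq z < 3 -> exists2 p, p \in small_norms & z = zc p.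
Proof.
move=> zO; have [n nE] := nsqO_nat zO; rewrite nE => lt; apply: nsq_le2 => //.
by rewrite nE ler_nat; rewrite ltr_nat in lt.
Qed.

Lemma small_coef (z : C) (D x y : BinNums.Z) : z \in O -> zlt BinNums.Z0 D ->
  nsq z * (int_of_Z D)%:~R <= (int_of_Z x)%:~R * (int_of_Z y)%:~R -> zlt (BinInt.Z.mul x y) (BinInt.Z.mul 3 D) ->
  exists2 q, q \in small_norms & z = zc q.
Proof.
move=> zO D0 le lt; apply: nsq_lt3 => //.
have DR0 : 0 < ((int_of_Z D)%:~R : R) by rewrite ltr0z; move: D0; rewrite /zlt => /BinInt.Z.ltb_lt; lia.
rewrite -(ltr_pM2r DR0); apply: le_lt_trans le _.
have -> : 3 = 3%:~R :> R by [].
rewrite -!intrM ltr_int; move: lt; rewrite /zlt => /BinInt.Z.ltb_lt; clear; lia.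
Qed.

Lemma transporter_complete p r1 r2 q y s1 s2 G A : transporter_check p r1 r2 q y s1 s2 G -> uni A -> Omx A ->
  A *m eV p = eV q -> exists2 X, X \in G & A = eM X.
Proof.
case/and5P => /and3P[rb /zeqP o1 /zeqP o2] /and5P[/andP[/zeqP m1 /zeqP n1] /andP[/zeqP m1' /zeqP n1'] /andP[mm mn] /andP[nm nn] D0].
move=> /andP[/meqP adj det0] /allP fixp chk Au AO Ap.
set m := (zherm s1 s1).1 in m1 mm mn D0 nn nm; set n := (zherm s2 s2).1 in n1 mn nn D0 mm nm.
set m' := (zherm r1 r1).1 in m1' mm mn D0 nn nm; set n' := (zherm r2 r2).1 in n1' mn nn D0 mm nm.
set D := BinInt.Z.sub _ _ in mm mn nn nm D0.
have perpA r : herm (eV r) (eV p) = 0 -> herm (A *m eV r) (eV q) = 0 by move=> h; rewrite -Ap uni_herm.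
have p1 : herm (eV r1) (eV p) = 0 by rewrite herm_eV o1 zc0.
have p2 : herm (eV r2) (eV p) = 0 by rewrite herm_eV o2 zc0.
have rO (r : zvec) : Omx (eV r) by exact: eV_O.
have [a [b [aO bO uE]]] := ref_basis_coord rb (Omx_mul AO (rO r1)) (perpA _ p1).
have [c [d [cO dO vE]]] := ref_basis_coord rb (Omx_mul AO (rO r2)) (perpA _ p2).
have ReE (r : zvec) (e : BinNums.Z) : zherm r r = zi e -> Re (herm (eV r) (eV r)) = (int_of_Z e)%:~R.
  by move=> h; rewrite herm_eV h zc_int intC_Re.
have DR : Re (herm (eV s1) (eV s1)) * Re (herm (eV s2) (eV s2)) - nsq (herm (eV s2) (eV s1)) = (int_of_Z D)%:~R.
  rewrite (ReE _ _ m1) (ReE _ _ n1) herm_eV nsq_zc -intrM -intrB; by rewrite -int_of_Z_det.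
have [ub1 ub2] := coord_bound (eV s1) (eV s2) a b; rewrite /= DR -uE uni_herm // (ReE _ _ m1) (ReE _ _ n1) (ReE _ _ m1') in ub1 ub2.
have [vb1 vb2] := coord_bound (eV s1) (eV s2) c d; rewrite /= DR -vE uni_herm // (ReE _ _ m1) (ReE _ _ n1) (ReE _ _ n1') in vb1 vb2.
have [a' a'S aE] := small_coef aO D0 ub2 mn.
have [b' b'S bE] := small_coef bO D0 ub1 mm.
have [c' c'S cE] := small_coef cO D0 vb2 nn.
have [d' d'S dE] := small_coef dO D0 vb1 nm.
have {}uE : A *m eV r1 = eV (zlin a' b' s1 s2) by rewrite uE aE bE eV_add !eV_scale.
have {}vE : A *m eV r2 = eV (zlin c' d' s1 s2) by rewrite vE cE dE eV_add !eV_scale.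
have := allP (allP (allP (allP chk _ a'S) _ b'S) _ c'S) _ d'S => /=.
set u := zlin a' b' s1 s2 in uE *; set v := zlin c' d' s1 s2 in vE *.
have g1 : zeq (zherm u u) (zherm r1 r1) by apply/zeqP/(@zc_inj R); rewrite -!herm_eV -uE uni_herm.
have g2 : zeq (zherm v v) (zherm r2 r2) by apply/zeqP/(@zc_inj R); rewrite -!herm_eV -vE uni_herm.
have g3 : zeq (zherm v u) (zherm r2 r1) by apply/zeqP/(@zc_inj R); rewrite -!herm_eV -uE -vE uni_herm.
rewrite g1 g2 g3 /= => /orP[/hasP[X XG /andP[/veqP X1 /veqP X2]]|].
  exists X => //; have inv : \det (eM (mcols p r1 r2)) != 0 by apply: contra det0; rewrite eM_det => /eqP e; apply/zeqP/(@zc_inj R); rewrite e zc0.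
  have /veqP fX := fixp _ XG.
  have e : A *m eM (mcols p r1 r2) = eM X *m eM (mcols p r1 r2).
    by rewrite -cols_eM !mul_cols Ap uE vE -!eM_vec X1 X2 fX.
  by rewrite -[A](mulmxK (_ : eM (mcols p r1 r2) \in unitmx)) ?e ?mulmxK // unitmxE unitfE.
(* Here A is the matrix of images times the inverse of M, so the product of the images with the
   adjugate is det(M) A, and each of its entries is divisible by det(M). *)
move=> /hasP[i iI /hasP[j jJ /negP]]; case.
have i3 : (i < 3)%N by move: iI; rewrite !inE => /or3P[] /eqP ->.
have j3 : (j < 3)%N by move: jJ; rewrite !inE => /or3P[] /eqP ->.
have [e eE] := isO_zc (AO (Ordinal i3) (Ordinal j3)).
rewrite (_ : mget _ i j = zmul (mdet (mcols p r1 r2)) e) ?zdvd_mull //.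
have h : eM (mmul (mcols q u v) (madjg (mcols p r1 r2))) = zc (mdet (mcols p r1 r2)) *: A.
  rewrite eM_mul -(_ : A *m eM (mcols p r1 r2) = eM (mcols q u v)); last by rewrite -!cols_eM mul_cols Ap uE vE.
  by rewrite -mulmxA -eM_mul adj eM_scale eM_one -scalemxAr mulmx1.
have := congr1 (fun N : 'M[C]_3 => N (Ordinal i3) (Ordinal j3)) h; rewrite [LHS]mxE [RHS]mxE eE -zcM.
exact: zc_inj.
Qed.
End Stabilizer.

Local Opaque piU eM eV act.

(** [c] stands for 2 / <w,w>, an integer for the norms 1 and 2; the conjugated entry is the j-th one
    of w^* J. *)
Definition zrefl (c : BinNums.Z) (w : zvec) : zmat :=
  mmk (fun i j => zsub (if i == j then zi 1 else z0) (zmul (zi c) (zmul (vget w i) (zconj (vget w (2 - j)%N))))).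

Fixpoint zalt (k : nat) (S T : zmat) : zmat := if k is k'.+1 then mmul S (zalt k' T S) else mone.

(** The 2 n alternating words; those of length n in either order are equal by the braid relation, so
    only one is listed. *)
Definition dihedral (n : nat) (S T : zmat) : seq zmat :=
  [seq zalt k S T | k <- iota 0 n.+1] ++ [seq zalt k T S | k <- iota 1 n.-1].

(* A polar vector w of norm 1 (b = true) or 2 (b = false) with g mapping (0,1,0),
   resp. (1,0,1), to w. *)
Record polar := Polar { pvec : zvec; pnorm1 : bool; pgam : zmat }.

Definition base_polar (b : bool) : zvec := if b then [:: z0; zi 1; z0] else [:: zi 1; z0; zi 1].
Definition polar_norm (b : bool) : BinNums.Z := if b then 1 else 2.
Definition polar_coef (b : bool) : BinNums.Z := if b then 2 else 1.
Definition prefl (W : polar) : zmat := zrefl (polar_coef (pnorm1 W)) (pvec W).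

Definition polar_check (W : polar) : bool :=
  [&& zeq (zherm (pvec W) (pvec W)) (zi (polar_norm (pnorm1 W))), uZ (pgam W) &
      veq (mvec (pgam W) (base_polar (pnorm1 W))) (pvec W)].

(** The last block certifies the list of mirrors: the matrix fixing p of a reflection has trace 1
    and square 1, so testing the elements of [G] with these two properties misses none. *)
Definition dihedral_check (p y r1 r2 w1 w2 : zvec) (b1 b2 : bool) (n : nat) (Ws : seq polar) : bool :=
  let S := zrefl (polar_coef b1) w1 in let T := zrefl (polar_coef b2) w2 in let G := dihedral n S T in
  [&& transporter_check p r1 r2 p y r1 r2 G, all uZ G && pairwise (fun X Y => ~~ meq X Y) G,
      [&& zeq (zherm w1 w1) (zi (polar_norm b1)), zeq (zherm w2 w2) (zi (polar_norm b2)), uZ S, uZ T, veq (mvec S p) p & veq (mvec T p) p],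
      meq (zalt n S T) (zalt n T S) && all (fun k => ~~ meq (zalt k S T) (zalt k T S)) (iota 2 (n - 2)) &
      [&& all (fun X => zeq (ztr X) (zi 1) && meq (mmul X X) mone ==> has (fun W => meq X (prefl W)) Ws) G,
          all (fun W => polar_check W && has (fun X => meq X (prefl W)) G) Ws &
          pairwise (fun W W' => ~~ meq (prefl W) (prefl W')) Ws]].

Section Dihedral.
Variable R : realType.
Local Notation C := R[i].
Local Notation O := (isO R).
Local Notation Re := complex.Re.
Local Notation eV := (eV R).
Local Notation eM := (eM R).
Local Notation zc := (zc R).
Implicit Types (A B M : 'M[C]_3) (u v w z : 'cV[C]_3).

Lemma refl_mx_eM (b : bool) (w : zvec) : zherm w w = zi (polar_norm b) -> refl_mx (eV w) = eM (zrefl (polar_coef b) w).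
Proof.
move=> h; have cE : 2 / herm (eV w) (eV w) = zc (zi (polar_coef b)).
  rewrite herm_eV h !zc_int; case: b {h} => /=; rewrite ?divr1 //.
  by rewrite divff // pnatr_eq0.
have rE (j : 'I_3) : ((eV w)^t* *m Jmx R) 0 j = zc (zconj (vget w (2 - j)%N)).
  move: j; apply: ord3P; rewrite mxE sum3 !mxE /= ?(mulr0, mulr1, add0r, addr0) zc_conj //.
apply/matrixP => i j; rewrite /refl_mx !mxE mget_mk zcB !zcM -cE big_ord1 rE mxE (fun_if zc) zc1 zc0.
have -> : (nat_of_ord i == j) = (i == j) by [].
by case: eqP.
Qed.

Lemma alternating_eM (k : nat) (S T : zmat) : uni (eM S) -> uni (eM T) ->
  uni (eM (zalt k S T)) /\ alternating k (piU (eM S)) (piU (eM T)) = piU (eM (zalt k S T)).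
Proof.
elim: k S T => [|k IH] S T Su Tu /=; first by rewrite eM_one piU_one; split=> //; exact: uni_one.
have [u e] := IH T S Tu Su; rewrite eM_mul; split; first exact: uni_mul.
by rewrite piU_mul // e.
Qed.

(** The scalar relating two representatives is 1 as soon as both fix the same nonzero vector;
    classes are therefore compared through their matrices. *)
Lemma piU_fix_inj A B (p : 'cV[C]_3) : uni A -> uni B -> p != 0 -> A *m p = p -> B *m p = p -> piU A = piU B -> A = B.
Proof.
move=> Au Bu p0 Ap Bp /(piU_eq Au Bu)[c _ e].
have /eqP : (c - 1) *: p = 0 by rewrite scalerBl scale1r -{2}Ap e -scalemxAl Bp subrr.
by rewrite scaler_eq0 (negPf p0) orbF subr_eq0 => /eqP c1; rewrite e c1 scale1r.
Qed.

Lemma isotropy_subgroup x : is_subgroup (isotropy 7 x : set (PU R)).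
Proof.
split; first by split; [apply/GammaP; exists 1%:M; split; rewrite ?piU_one //; [exact: uni_one|exact: Omx_one]|exact: act1].
move=> g h [/GammaP[A [Au AO gE]] gx] [/GammaP[B [Bu BO hE]] hx]; split.
  apply/GammaP; exists (A *m uinv B); split; [exact/uni_mul/uni_inv|exact/Omx_mul/Omx_uinv|].
  by rewrite (piU_mul Au (uni_inv Bu)) (piU_inv Bu) gE hE.
by rewrite -{1}hx -actM mulgVK gx.
Qed.

Lemma generated_sub (S H : set (PU R)) : is_subgroup H -> S `<=` H -> generated S `<=` H.
Proof. by move=> Hs SH g; apply; split. Qed.

Lemma generated_subgroup (S : set (PU R)) : is_subgroup (generated S).
Proof.
split=> [H [[H1 _] _] //|g h gS hS H [HS SH]].
by apply: HS.2; [apply: gS|apply: hS].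
Qed.

Lemma sub_generated (S : set (PU R)) : S `<=` generated S.
Proof. by move=> g Sg H [_]; apply. Qed.

Lemma subgroup_mul (H : set (PU R)) g h : is_subgroup H -> H g -> H h -> H (g * h)%g.
Proof.
move=> [H1 HV] Hg Hh; have Hi : H h^-1%g by have := HV _ _ H1 Hh; rewrite mul1g.
by have := HV _ _ Hg Hi; rewrite invgK.
Qed.

Lemma alternating_generated k (a b : PU R) (H : set (PU R)) : is_subgroup H -> H a -> H b -> H (alternating k a b).
Proof.
elim: k a b => [|k IH] a b Hs Ha Hb /=; first exact: Hs.1.
by apply: subgroup_mul => //; apply: IH.
Qed.

Lemma polar_pos (b : bool) (w : zvec) : zherm w w = zi (polar_norm b) -> 0 < herm (eV w) (eV w).
Proof. by move=> h; rewrite herm_eV h zc_int ltr0z; case: b h. Qed.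

Lemma zalt_fix l (A B : zmat) (v : 'cV[C]_3) : eM A *m v = v -> eM B *m v = v -> eM (zalt l A B) *m v = v.
Proof. by elim: l A B => [|l IH] A B hA hB /=; rewrite ?eM_one ?mul1mx // eM_mul -mulmxA IH. Qed.

Local Opaque alternating zalt.
Section FromFacts.
Variables (p : zvec) (S T : zmat) (G : seq zmat) (n : nat) (x : H2 R).
Hypotheses (GE : G = dihedral n S T) (n2 : (2 <= n)%N) (xp : is_line_of x (eV p)).
Hypothesis Guni : forall X : zmat, X \in G -> uni (eM X).
Hypothesis Gp : forall X : zmat, X \in G -> eM X *m eV p = eV p.
Hypothesis complete : forall A, uni A -> Omx A -> A *m eV p = eV p -> exists2 X : zmat, X \in G & A = eM X.
Hypothesis distinct : pairwise (fun X Y => ~~ meq X Y) G.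
Hypotheses (Su : uni (eM S)) (Tu : uni (eM T)) (Sp : eM S *m eV p = eV p) (Tp : eM T *m eV p = eV p).
Local Notation s1 := (piU (eM S)).
Local Notation s2 := (piU (eM T)).

Let pneg : herm (eV p) (eV p) < 0. Proof. exact: line_neg xp. Qed.
Let p0 : eV p != 0. Proof. exact: herm_neg_neq0 pneg. Qed.

Lemma isotropy_fix A : uni A -> Omx A -> A *m eV p = eV p -> isotropy 7 x (piU A).
Proof.
move=> Au AO Ap; split; first by apply/GammaP; exists A.
by apply/(act_fix xp Au); exists 1; rewrite scale1r.
Qed.

(** The eigenvalue at the integral vector p is a unit of Z[tau], so after a change of sign the
    representative fixes p itself. *)
Lemma isotropy_dihedral g : isotropy 7 x g <-> exists2 X : zmat, X \in G & g = piU (eM X).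
Proof.
split=> [/(isotropyP _ xp)[A [c [Au AO Ad Ap ->]]]|[X XG ->]]; last first.
  by apply: isotropy_fix; [exact: Guni|exact: Omx_eM|exact: Gp].
have cO := int_eig AO (@eV_O R p : Omx (eV p)) p0 Ap.
case: (unit_O cO (eig_neg_unit Au pneg Ap)) => c1; rewrite c1 in Ap.
  have [X XG ->] := complete Au AO (etrans Ap (scale1r _)).
  by exists X.
have NAp : - A *m eV p = eV p by rewrite mulNmx Ap scaleN1r opprK.
have [X XG e] := complete (uni_opp Au) (Omx_opp AO) NAp.
by exists X => //; rewrite -e uniN.
Qed.

Lemma size_dihedral : size G = n.*2.
Proof. by rewrite GE size_cat !size_map !size_iota; move: n2; lia. Qed.

Lemma dihedral_inj i j : (i < size G)%N -> (j < size G)%N -> piU (eM (nth mone G i)) = piU (eM (nth mone G j)) -> i = j.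
Proof.
move=> iG jG e; have iI := mem_nth mone iG; have jI := mem_nth mone jG.
have {}e := piU_fix_inj (Guni iI) (Guni jI) p0 (Gp iI) (Gp jI) e.
move/(pairwiseP mone): distinct => pw.
case: (ltngtP i j) => // lt; exfalso.
  by have /negP := pw i j iG jG lt; apply; apply/(@meqP R).
by have /negP := pw j i jG iG lt; apply; apply/(@meqP R).
Qed.

Lemma isotropy_card : (isotropy 7 x #= `I_(n.*2))%card.
Proof.
rewrite -size_dihedral; have -> : isotropy 7 x = (fun i => piU (eM (nth mone G i))) @` `I_(size G).
  apply/seteqP; split=> [g /isotropy_dihedral[X XG ->]|g [i /= iG <-]].
    by have [i iG <-] := nthP mone XG; exists i.
  by apply/isotropy_dihedral; exists (nth mone G i) => //; exact: mem_nth.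
by apply: inj_card_eq => i j; rewrite !inE /= => iG jG; apply: dihedral_inj.
Qed.

Let isoS : isotropy 7 x s1.
Proof. exact: (isotropy_fix Su (@Omx_eM R S) Sp). Qed.
Let isoT : isotropy 7 x s2.
Proof. exact: (isotropy_fix Tu (@Omx_eM R T) Tp). Qed.

Lemma isotropy_generated : isotropy 7 x = generated [set s1; s2].
Proof.
apply/seteqP; split=> [g /isotropy_dihedral[X XG ->]|]; last first.
  by apply: generated_sub; [exact: isotropy_subgroup|move=> g [->|->]].
have g1 : generated [set s1; s2] s1 by apply: sub_generated; left.
have g2 : generated [set s1; s2] s2 by apply: sub_generated; right.
move: XG; rewrite GE mem_cat => /orP[] /mapP[k _ ->].
  by rewrite -(alternating_eM k Su Tu).2; exact: (alternating_generated k (generated_subgroup _) g1 g2).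
by rewrite -(alternating_eM k Tu Su).2; exact: (alternating_generated k (generated_subgroup _) g2 g1).
Qed.

Lemma isotropy_reflection_subgroup : creflection s1 -> creflection s2 -> isotropy 7 x = reflection_subgroup (isotropy 7 x).
Proof.
move=> c1 c2; apply/seteqP; split; last by apply: generated_sub; [exact: isotropy_subgroup|move=> g []].
rewrite {1}isotropy_generated; apply: generated_sub; first exact: generated_subgroup.
by move=> g [->|->]; apply: sub_generated; split.
Qed.

Lemma braid_dihedral : meq (zalt n S T) (zalt n T S) -> all (fun k => ~~ meq (zalt k S T) (zalt k T S)) (iota 2 (n - 2)) ->
  braid_length s1 s2 n.
Proof.
move=> /(@meqP R) e /allP ne.
have altE k (A B : zmat) : uni (eM A) -> uni (eM B) -> alternating k (piU (eM A)) (piU (eM B)) = piU (eM (zalt k A B)).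
  by move=> Au Bu; have [_ ->] := alternating_eM k Au Bu.
split; [exact: n2|apply: (etrans (altE n S T Su Tu)); rewrite e; apply: esym; exact: altE|].
move=> k /andP[k2 kn]; move=> /(fun h => etrans (esym (altE k S T Su Tu)) (etrans h (altE k T S Tu Su))) h.
have fixp l (A B : zmat) : eM A *m eV p = eV p -> eM B *m eV p = eV p -> eM (zalt l A B) *m eV p = eV p.
  by apply: zalt_fix.
have /ne/negP : k \in iota 2 (n - 2) by rewrite mem_iota k2 (subnKC n2).
apply; apply/(@meqP R).
exact: (piU_fix_inj (alternating_eM k Su Tu).1 (alternating_eM k Tu Su).1 p0 (fixp k _ _ Sp Tp) (fixp k _ _ Tp Sp) h).
Qed.

End FromFacts.

End Dihedral.

Local Opaque refl refl_mx alternating zalt.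

(** * Mirrors counted by orbit *)

Section MirrorCount.
Variable R : realType.
Local Notation C := R[i].
Local Notation O := (isO R).
Local Notation Re := complex.Re.
Local Notation eV := (eV R).
Local Notation eM := (eM R).
Local Notation zc := (zc R).
Implicit Types (A B M : 'M[C]_3) (u v w z : 'cV[C]_3).

Lemma nth_eM_inj (T : Type) (f : T -> zmat) (x0 : T) (s : seq T) i j :
  pairwise (fun x y => ~~ meq (f x) (f y)) s -> (i < size s)%N -> (j < size s)%N ->
  eM (f (nth x0 s i)) = eM (f (nth x0 s j)) -> i = j.
Proof.
move=> /(pairwiseP x0) pw il jl /(@meqP R) e; case: (ltngtP i j) => [lt|lt|->]; last exact: erefl.
  by have := pw i j il jl lt; rewrite e.
by have := pw j i jl il lt; move: e => /(@meqP R)/esym/(@meqP R) ->.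
Qed.

Lemma refl_mx_def w : refl_mx w = 1%:M - (2 / herm w w) *: (w *m (w^t* *m Jmx R)).
Proof. by []. Qed.

Lemma refl_mx_tr w : herm w w != 0 -> \tr (refl_mx w) = 1.
Proof.
move=> w0; have e : \tr (w *m (w^t* *m Jmx R)) = herm w w by rewrite mxtrace_mulC herm_def /mxtrace big_ord1.
rewrite refl_mx_def linearB linearZ /= e mxtrace1 divfK //; ring.
Qed.

Lemma refl_mx_scale (c : C) w : c != 0 -> herm w w != 0 -> refl_mx (c *: w) = refl_mx w.
Proof.
move=> c0 w0; apply: (mx_perp_ext w0) => [u uw|].
  have cuw : herm u (c *: w) = 0 by rewrite hermZr uw mulr0.
  exact: (etrans (refl_mx_perp cuw) (esym (refl_mx_perp uw))).
have cw0 : herm (c *: w) (c *: w) != 0 by rewrite hermZl hermZr !mulf_neq0 // conjC_eq0.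
apply: (scalerI c0); apply: (etrans (scalemxAr c _ w)); apply: (etrans (refl_mx_self cw0)); apply: esym.
exact: (etrans (congr1 ( *:%R c) (refl_mx_self w0)) (scalerN c w)).
Qed.

Lemma refl_mx_mirror v w : 0 < herm v v -> refl_mx v = refl_mx w -> mirror v = mirror w.
Proof.
move=> vpos vwE; have v0 : herm v v != 0 by rewrite gt_eqF.
have := refl_mx_self v0; rewrite vwE refl_mxE => /eqP; rewrite subr_eq addrC -subr_eq opprK -mulr2n -scaler_nat => /eqP h2.
have vw : v = (herm v w / herm w w) *: w.
  apply: (@scalerI _ _ (2 : C)); first by rewrite pnatr_eq0.
  by rewrite h2 scalerA mulrA.
have c0 : herm v w / herm w w != 0 by apply/eqP => c0; move: vpos; rewrite vw c0 scale0r herm0l ltxx.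
by rewrite [in LHS]vw (mirror_scale _ c0).
Qed.

(** Each base vector pairs to 1 with an integral vector, so c and its inverse lie in Z[tau] and c
    has modulus 1; the norms 1 and 2 are then preserved. *)
Lemma base_polar_neq (b b' : bool) A (c : C) : uni A -> Omx A ->
  A *m eV (base_polar b) = c *: eV (base_polar b') -> b = b'.
Proof.
move=> Au AO Ab.
have dual (d : bool) : exists e : zvec, herm (eV (base_polar d)) (eV e) = 1.
  by exists (if d then [:: z0; zi 1; z0] else [:: z0; z0; zi 1]); rewrite herm_eV -zc1; congr zc; case: d.
have n (d : bool) : herm (eV (base_polar d)) (eV (base_polar d)) = (int_of_Z (polar_norm d))%:~R.
  by rewrite herm_eV -zc_int; congr zc; case: d.
have [e' e'1] := dual b'; have [e e1] := dual b.
have cO : c \in O.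
  have := herm_O (Omx_mul AO (@eV_O R (base_polar b) : Omx _)) (@eV_O R e' : Omx _).
  by rewrite Ab hermZl e'1 mulr1.
have := uni_herm (eV (base_polar b)) (eV (base_polar b)) Au.
rewrite Ab hermZl hermZr mulrA -nsqE !n => E.
have c0 : c != 0 by apply/eqP => c0; move: E; rewrite c0 nsq0 mul0r; case: (b) => /eqP; rewrite eq_sym intr_eq0.
have ciO : c^-1 \in O.
  have h : uinv A *m eV (base_polar b') = c^-1 *: eV (base_polar b).
    by apply: (scalerI c0); rewrite scalemxAr -Ab mulmxA uinvK // mul1mx scalerA divff // scale1r.
  have := herm_O (Omx_mul (Omx_uinv AO) (@eV_O R (base_polar b') : Omx _)) (@eV_O R e : Omx _).
  by rewrite h hermZl e1 mulr1.
have n1 : nsq c = 1.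
  have h : nsq c * nsq c^-1 = 1 by rewrite -nsqM divff // nsq1.
  have := nsqO_ge1 cO c0; have := nsqO_ge1 ciO; rewrite invr_eq0 => /(_ c0) g1 g2.
  apply/eqP; rewrite eq_le g2 andbT -h; apply: ler_peMr => //; exact: nsq_ge0.
by move: E; rewrite n1 mul1r => /intr_inj; case: (b); case: (b').
Qed.

Lemma polar_checkP (W : polar) : polar_check W ->
  [/\ 0 < herm (eV (pvec W)) (eV (pvec W)), refl_mx (eV (pvec W)) = eM (prefl W), uni (eM (pgam W)) &
      eV (pvec W) = eM (pgam W) *m eV (base_polar (pnorm1 W))].
Proof.
move=> /and3P[/zeqP n g /veqP e]; split; [exact: polar_pos n|exact: refl_mx_eM|exact: uZ_uni|].
by rewrite -e eM_vec.
Qed.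

Lemma polar_mirror_orbit (W : polar) (b : bool) : polar_check W ->
  mirror_orbit 7 (mirror (eV (base_polar b))) (mirror (eV (pvec W))) <-> pnorm1 W = b.
Proof.
move=> /polar_checkP[wpos _ gu wE]; split=> [[g /GammaP[A [Au AO ->]]]|<-]; last first.
  exists (piU (eM (pgam W))); first by apply/GammaP; exists (eM (pgam W)); split; [exact: gu|exact: Omx_eM|].
  by rewrite wE (act_mirror _ gu).
rewrite (act_mirror _ Au) => me.
have sub : mirror (eV (pvec W)) `<=` mirror (A *m eV (base_polar b)) by rewrite me.
have [c cE] := mirror_subset wpos sub.
apply/esym/(base_polar_neq (A := uinv (eM (pgam W)) *m A) (c := c)).
- exact: (uni_mul (uni_inv gu) Au).
- exact: (Omx_mul (Omx_uinv (@Omx_eM R _)) AO).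
by rewrite -mulmxA cE wE -scalemxAr mulmxA (uinvK gu) mul1mx.
Qed.

Lemma vec3_eV (a b c : C) (v : zvec) : a = zc (vget v 0) -> b = zc (vget v 1) -> c = zc (vget v 2) -> vec3 a b c = eV v.
Proof. by move=> -> -> ->; apply/matrixP => i j; rewrite ord1 !mxE; move: i; apply: ord3P. Qed.

Lemma vec3_base1 : vec3 0 1 0 = eV (base_polar true).
Proof. by apply: vec3_eV; rewrite /= ?zc0 ?zc1. Qed.

Lemma vec3_base2 : vec3 1 0 1 = eV (base_polar false).
Proof. by apply: vec3_eV; rewrite /= ?zc0 ?zc1. Qed.

Lemma mirror_numbers_count (G : set (PU R)) (Ws : seq polar) :
  all polar_check Ws -> pairwise (fun W W' => ~~ meq (prefl W) (prefl W')) Ws ->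
  (forall m, mirrors_of G m <-> exists i, (i < size Ws)%N /\ m = mirror (eV (pvec (nth (Polar [::] true [::]) Ws i)))) ->
  mirror_numbers G (count pnorm1 Ws) (count (predC pnorm1) Ws).
Proof.
move=> chk dist mG.
suff h (b : bool) : (mirrors_of G `&` mirror_orbit 7 (mirror (eV (base_polar b))) #=
    `I_(count (fun W => pnorm1 W == b) Ws))%card.
  split.
    rewrite vec3_base1.
    have -> : count pnorm1 Ws = count (fun W => pnorm1 W == true) Ws by apply: eq_count => W; case: pnorm1.
    exact: h.
  rewrite vec3_base2.
  have -> : count (predC pnorm1) Ws = count (fun W => pnorm1 W == false) Ws by apply: eq_count => W /=; case: pnorm1.
  exact: h.
set W0 := Polar _ _ _ in mG; rewrite -size_filter; set Wb := [seq _ <- _ | _].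
have WbP : forall i, (i < size Wb)%N -> polar_check (nth W0 Wb i) /\ pnorm1 (nth W0 Wb i) = b /\
    exists j, (j < size Ws)%N /\ nth W0 Wb i = nth W0 Ws j.
  move: chk; rewrite /Wb; elim: (Ws) => [|W s IH] //= /andP[cW cs] i.
  case: eqP => [Wb1|_].
    case: i => [|i] /= lt; first by split=> //; split=> //; exists 0%N.
    have [a1 [a2 [j [jl a3]]]] := IH cs i lt; split=> //; split=> //; by exists j.+1.
  move=> lt; have [a1 [a2 [j [jl a3]]]] := IH cs i lt; split=> //; split=> //; by exists j.+1.
have WbS : forall j, (j < size Ws)%N -> pnorm1 (nth W0 Ws j) = b -> exists i, (i < size Wb)%N /\ nth W0 Wb i = nth W0 Ws j.
  rewrite /Wb; elim: (Ws) => [|W s IH] //= [|j] /= lt e.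
    by rewrite e eqxx; exists 0%N.
  have [i [il ie]] := IH j lt e; case: eqP => _; [by exists i.+1|by exists i].
have chkj j : (j < size Ws)%N -> polar_check (nth W0 Ws j) by move=> lt; exact: (all_nthP W0 chk).
have -> : mirrors_of G `&` mirror_orbit 7 (mirror (eV (base_polar b))) =
    (fun i => mirror (eV (pvec (nth W0 Wb i)))) @` `I_(size Wb).
  apply/seteqP; split=> [m [/mG[j [jl ->]] /(polar_mirror_orbit b (chkj j jl))jb]|m [i /= il <-]].
    by have [i [il ie]] := WbS j jl jb; exists i; [exact: il|rewrite ie].
  have [c [ib [j [jl je]]]] := WbP i il; split; first by apply/mG; exists j; rewrite je.
  exact/(polar_mirror_orbit b c).
apply: inj_card_eq => i j; rewrite !inE /= => il jl e.
have [/polar_checkP[ipos iE _ _] _] := WbP i il; have [/polar_checkP[jpos jE _ _] _] := WbP j jl.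
have sub : mirror (eV (pvec (nth W0 Wb i))) `<=` mirror (eV (pvec (nth W0 Wb j))) by rewrite e.
have [c cE] := mirror_subset ipos sub.
have c0 : c != 0 by apply/eqP => c0; move: jpos; rewrite cE c0 scale0r herm0l ltxx.
have rE : eM (prefl (nth W0 Wb i)) = eM (prefl (nth W0 Wb j)).
  rewrite -iE -jE cE; apply: esym; apply: (refl_mx_scale c0); by rewrite gt_eqF.
have {}dist : pairwise (fun W W' => ~~ meq (prefl W) (prefl W')) Wb by exact: pairwise_filter.
exact: (nth_eM_inj dist il jl rE).
Qed.

Lemma two_reflection_dihedral (x : H2 R) p y r1 r2 (w1 w2 : zvec) (b1 b2 : bool) (n : nat) (Ws : seq polar) :
  is_line_of x (eV p) -> (2 <= n)%N -> dihedral_check p y r1 r2 w1 w2 b1 b2 n Ws ->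
  two_reflection_isotropy x (eV w1) (eV w2) n.*2 n (count pnorm1 Ws) (count (predC pnorm1) Ws).
Proof.
move=> xp n2; rewrite /dihedral_check; set S := zrefl _ w1; set T := zrefl _ w2; set G := dihedral n S T.
case/and5P=> stab /andP[/allP GuZ distinct] /and5P[/zeqP nw1 /zeqP nw2 Suz Tuz /andP[/veqP Sp /veqP Tp]] /andP[br1 br2].
case/and3P=> /allP refls chk dist.
have Su := uZ_uni R Suz; have Tu := uZ_uni R Tuz.
have complete := fun A => @transporter_complete R p r1 r2 p y r1 r2 G A stab.
have Gp X : X \in G -> eM X *m eV p = eV p.
  move=> XG; have /and5P[_ _ _ /allP h _] := stab; have /(@veqP R) := h X XG; by rewrite eM_vec.
have {}Sp : eM S *m eV p = eV p by rewrite -eM_vec; exact: Sp.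
have {}Tp : eM T *m eV p = eV p by rewrite -eM_vec; exact: Tp.
have Gu X : X \in G -> uni (eM X) by move=> XG; exact: uZ_uni (GuZ X XG).
have pneg := line_neg xp.
have w1pos := polar_pos R nw1; have w2pos := polar_pos R nw2.
have sE b (w : zvec) : zherm w w = zi (polar_norm b) -> refl (eV w) = piU (eM (zrefl (polar_coef b) w)).
  by move=> /(refl_mx_eM R) <-; exact: refl_piU.
have s1 := sE _ _ nw1 : refl (eV w1) = piU (eM S).
have s2 := sE _ _ nw2 : refl (eV w2) = piU (eM T).
have c1 : creflection (piU (eM S)).
  by rewrite -s1; exists (mirror (eV w1)); [exists (eV w1)|exact: refl_reflects].
have c2 : creflection (piU (eM T)).
  by rewrite -s2; exists (mirror (eV w2)); [exists (eV w2)|exact: refl_reflects].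
have isoG := isotropy_dihedral xp Gu Gp complete.
rewrite /two_reflection_isotropy s1 s2; split.
- exact: (isotropy_reflection_subgroup (erefl G) xp Gu Gp complete Su Tu Sp Tp c1 c2).
- exact: (isotropy_card (erefl G) n2 xp Gu Gp complete distinct).
- exact: (isotropy_generated (erefl G) xp Gu Gp complete Su Tu Sp Tp).
- exact: (braid_dihedral n2 xp Su Tu Sp Tp br1 br2).
have chk1 : all polar_check Ws by apply: sub_all chk => W /andP[].
apply: mirror_numbers_count => // m; split=> [[[w [wpos ->]] [g /isoG[X XG ->] rX]]|[i [il ->]]].
  have e := reflects_refl_mx (Gu X XG) (@Omx_eM R X) pneg (Gp X XG) wpos rX.
  have w0 : herm w w != 0 by rewrite gt_eqF.
  have t1 : zeq (ztr X) (zi 1) by apply/zeqP/(@zc_inj R); rewrite -eM_tr e refl_mx_tr // zc1.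
  have t2 : meq (mmul X X) mone by apply/(@meqP R); rewrite eM_mul e refl_mxK eM_one.
  have := refls X XG; rewrite t1 t2 /= => /(has_nthP (Polar [::] true [::]))[i il /(@meqP R) h].
  exists i; split; first exact: il.
  have [ipos iE _ _] := polar_checkP (all_nthP (Polar [::] true [::]) chk1 i il).
  move: ipos iE; set v := eV _ => ipos iE; rewrite -h e in iE.
  exact: esym (refl_mx_mirror ipos iE).
have /andP[ci /hasP[X XG /(@meqP R) XE]] := all_nthP (Polar [::] true [::]) chk i il.
have [ipos iE _ _] := polar_checkP ci; split; first by exists (eV (pvec (nth (Polar [::] true [::]) Ws i))).
exists (piU (eM X)); first exact: ((isoG _).2 (ex_intro2 _ _ X XG (erefl _))).
by rewrite XE -iE -refl_piU; exact: refl_reflects.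
Qed.
End MirrorCount.

(** * Certificates for the five rational points *)

Local Open Scope Z_scope.
Definition polars1 : seq polar :=
  [:: Polar [:: z0; zi 1; z0] true mone; Polar [:: zi 1; z0; zi 1] false mone].
Definition gam_b : zmat := [:: [:: (1,0); (-1,0); (-1,1)]; [:: (0,0); (1,0); (1,0)]; [:: (0,0); (0,0); (1,0)]].
Definition gam_c : zmat := [:: [:: (1,-1); (-1,0); (-1,0)]; [:: (-1,0); (-1,1); (0,1)]; [:: (-1,0); (0,1); (1,0)]].
Definition gam_d : zmat := [:: [:: (1,0); (0,0); (-1,2)]; [:: (0,0); (1,0); (0,0)]; [:: (0,0); (0,0); (1,0)]].
Definition polars2 : seq polar :=
  [:: Polar [:: (1,0); (0,-1); (0,0)] false [:: [:: (1,0); (0,0); (0,0)]; [:: (0,-1); (-1,0); (0,0)]; [:: (-1,0); (-1,1); (1,0)]];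
      Polar [:: (-1,2); (0,1); (1,0)] false [:: [:: (1,0); (-1,1); (-2,2)]; [:: (0,0); (1,0); (0,1)]; [:: (0,0); (0,0); (1,0)]];
      Polar [:: (0,2); (0,0); (1,0)] false gam_d].
Definition polars3 : seq polar :=
  [:: Polar [:: (0,0); (0,1); (1,0)] false [:: [:: (1,0); (1,-1); (-1,0)]; [:: (0,0); (-1,0); (0,1)]; [:: (0,0); (0,0); (1,0)]];
      Polar [:: (0,1); (1,0); (1,0)] false gam_b;
      Polar [:: (0,-1); (-1,1); (0,0)] false gam_c].
Definition polars4 : seq polar :=
  [:: Polar [:: z0; zi 1; z0] true mone;
      Polar [:: (0,1); (-1,0); (1,0)] false [:: [:: (1,0); (1,0); (-1,1)]; [:: (0,0); (1,0); (-1,0)]; [:: (0,0); (0,0); (1,0)]];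
      Polar [:: (0,1); (1,0); (1,0)] false gam_b;
      Polar [:: (0,-1); (0,0); (-1,0)] true [:: [:: (1,-1); (0,-1); (-2,0)]; [:: (-1,0); (0,0); (-1,1)]; [:: (-1,0); (-1,0); (0,1)]]].
Definition polars5 : seq polar :=
  [:: Polar [:: (0,2); (0,0); (1,0)] false gam_d;
      Polar [:: (-4,1); (-1,1); (0,1)] false [:: [:: (-2,-1); (-1,1); (-2,2)]; [:: (-1,0); (-1,1); (0,1)]; [:: (-1,1); (1,0); (1,0)]];
      Polar [:: (0,-1); (-1,1); (0,0)] false gam_c;
      Polar [:: (2,-2); (-1,-1); (-1,0)] false [:: [:: (-1,2); (2,3); (3,-4)]; [:: (0,0); (1,0); (-1,-1)]; [:: (1,0); (2,-1); (-2,0)]]].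
Lemma dihedral_check1 : dihedral_check vp1 ref1.1.1 ref1.1.2 ref1.2 [:: z0; zi 1; z0] [:: zi 1; z0; zi 1] true false 2 polars1.
Proof. by vm_compute. Qed.
Lemma dihedral_check2 : dihedral_check vp2 ref2.1.1 ref2.1.2 ref2.2 [:: (1,0); (0,-1); (0,0)] [:: (0,2); (0,0); (1,0)] false false 3 polars2.
Proof. by vm_compute. Qed.
Lemma dihedral_check3 : dihedral_check vp3 ref3.1.1 ref3.1.2 ref3.2 [:: (0,0); (0,1); (1,0)] [:: (0,1); (1,-1); (0,0)] false false 3 polars3.
Proof. by vm_compute. Qed.
Lemma dihedral_check4 : dihedral_check vp4 [:: (-1,-2); (-2,-2); (-2,0)] [:: z0; zi 1; z0] [:: (0,1); (0,0); (1,0)]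
  [:: z0; zi 1; z0] [:: (0,1); (1,0); (1,0)] true false 4 polars4.
Proof. by vm_compute. Qed.
Lemma dihedral_check5 : dihedral_check vp5 ref5.1.1 ref5.1.2 ref5.2 [:: (0,2); (0,0); (1,0)] [:: (0,1); (1,-1); (0,0)] false false 4 polars5.
Proof. by vm_compute. Qed.
Local Close Scope Z_scope.

Local Open Scope Z_scope.
Definition polar6 : polar := Polar zw6 true
  [:: [:: (1,0); (-1,1); (-3,4)]; [:: (1,-1); (0,1); (5,2)]; [:: (-1,0); (1,0); (2,-3)]].
Local Close Scope Z_scope.

Lemma all_iota0 (P : pred nat) n j : all P (iota 0 n) -> (j < n)%N -> P j.
Proof. by move=> /allP h jn; apply: h; rewrite mem_iota. Qed.

(** * Isotropy groups of the irrational points *)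

Section CyclicIsotropy.
Variable R : realType.
Local Notation C := R[i].
Local Notation O := (isO R).
Local Notation Re := complex.Re.
Local Notation t := (tau R).
Local Notation eV := (eV R).
Local Notation eM := (eM R).
Local Notation zc := (zc R).
Implicit Types (A B M : 'M[C]_3) (u v w z : 'cV[C]_3).

Lemma reg7 x (k : C) : herm x x < 0 -> eM zM7 *m x = k *: x -> p7 k = 0 -> regular_at (eM zM7) x k.
Proof.
move=> xneg Mx pk; split; [exact: uni_M7|exact: Omx_eM|exact: det_M7|exact: Mx|].
rewrite /disc_char tr_M7 rmorphN /= -[(tau R)^*%R]/((tau R)^*%R) conj_tau.
apply: p7_simple => //; exact: (eig_neg_unit (uni_M7 R) xneg Mx).
Qed.

Lemma regular_fixed_point (x y : H2 R) M v (k : C) : is_line_of x v -> regular_at M v k -> act (piU M) y = y <-> y = x.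
Proof.
move=> xv reg; have [Mu MO Md Mv _] := reg; have vneg := line_neg xv.
split=> [|->]; last by apply/(act_fix xv Mu); exists k.
have [u yu] := line_of y; move/(act_fix yu Mu) => [c Mc].
have [d d0 uE] := reg_line vneg reg (line_neg yu) Mc.
by apply/(line_eq yu xv); exists d.
Qed.

Lemma scalar_unit_det A B : uni A -> uni B -> Omx A -> Omx B -> \det A = 1 -> \det B = 1 -> piU A = piU B -> A = B.
Proof.
move=> Au Bu AO BO Ad Bd /(piU_eqO Au Bu AO BO)[//|AB].
move: Ad; rewrite AB -scaleN1r detZ Bd mulr1 => /eqP.
by rewrite -signr_odd expr1 eq_sym -subr_eq0 opprK -[1 + 1]/(2%:R) pnatr_eq0.
Qed.

Section Cyclic.
Variables (x : H2 R) (v : 'cV[C]_3) (k : C) (n : nat) (M : 'M[C]_3).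
Hypotheses (xv : is_line_of x v) (Mv : M *m v = k *: v) (pk : n.-primitive_root k).
Hypotheses (Mu : uni M) (MO : Omx M) (Md : \det M = 1).
Hypothesis iso : forall A (c : C), uni A -> Omx A -> \det A = 1 -> A *m v = c *: v -> exists2 j, (j < n)%N & A = M ^+ j.

Lemma isotropy_power j : isotropy 7 x (piU (M ^+ j)).
Proof.
split; first by apply/GammaP; exists (M ^+ j); split; [exact: uni_exp|exact: Omx_exp|].
by apply/(act_fix xv (uni_exp j Mu)); exists (k ^+ j); exact: expmx_eig.
Qed.

Lemma isotropy_cyclic g : isotropy 7 x g <-> exists2 j, (j < n)%N & g = piU (M ^+ j).
Proof.
split=> [/(isotropyP _ xv)[A [c [Au AO Ad Av ->]]]|[j _ ->]]; last exact: isotropy_power.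
by have [j jn ->] := iso Au AO Ad Av; exists j.
Qed.

(** Representatives of determinant 1 are unique, and distinct powers have distinct eigenvalues at
    v. *)
Lemma cyclic_card : (isotropy 7 x #= `I_n)%card.
Proof.
have -> : isotropy 7 x = (fun j => piU (M ^+ j)) @` `I_n.
  apply/seteqP; split=> [g /isotropy_cyclic[j jn ->]|g [j /= jn <-]]; first by exists j.
  exact: isotropy_power.
apply: inj_card_eq => i j; rewrite !inE /= => lt_i lt_j e.
have {}e := scalar_unit_det (uni_exp i Mu) (uni_exp j Mu) (Omx_exp i MO) (Omx_exp j MO) (det_exp1 i Md) (det_exp1 j Md) e.
have : k ^+ i == k ^+ j.
  have v0 := herm_neg_neq0 (line_neg xv).
  have := expmx_eig j Mv; rewrite -e (expmx_eig i Mv) => /eqP.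
  by rewrite -subr_eq0 -scalerBl scaler_eq0 (negPf v0) orbF subr_eq0.
by rewrite (eq_prim_root_expr pk) !modn_small // => /eqP.
Qed.

Lemma cyclic_generated : isotropy 7 x = generated [set piU M].
Proof.
apply/seteqP; split=> [g /isotropy_cyclic[j _ ->]|]; last first.
  apply: generated_sub; first exact: isotropy_subgroup.
  by move=> g ->; have := isotropy_power 1; rewrite expr1.
have gM : generated [set piU M] (piU M) by apply: sub_generated.
have gs := @generated_subgroup R [set piU M].
rewrite (piU_exp _ Mu); elim: j => [|j IH]; first by rewrite expg0; exact: gs.1.
by rewrite expgS; exact: (subgroup_mul gs gM IH).
Qed.

End Cyclic.

(* A reflection has only two eigenvalues, hence a quadratic minimal polynomial. *)
Lemma reflects_det0 A w : uni A -> 0 < herm w w -> reflects_in (piU A) (mirror w) ->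
  forall e, \det (cols e (A *m e) (A *m (A *m e))) = 0.
Proof.
move=> Au wpos /(reflects_scalar Au wpos)[l [m [_ perp Aw]]] e.
have w0 : herm w w != 0 by rewrite gt_eqF.
have [c [z [eE zw]]] := perp_split e w0.
have Az := perp _ zw.
have Ae : A *m e = (c * m) *: w + l *: z by rewrite eE mulmxDr -scalemxAr Aw scalerA Az.
have -> : A *m (A *m e) = (l + m) *: (A *m e) - (l * m) *: e.
  rewrite Ae mulmxDr -!scalemxAr Aw Az eE; apply/matrixP => i j; rewrite !mxE; ring.
rewrite det3E !mxE /=; ring.
Qed.

Lemma refl_mx_neq1 w : 0 < herm w w -> refl w <> 1%g.
Proof. by move=> /refl_reflects[]. Qed.

End CyclicIsotropy.

Section SixSeven.
Variable R : realType.
Local Notation C := R[i].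
Local Notation eV := (eV R).
Local Notation eM := (eM R).
Local Notation zc := (zc R).

(** A test vector that is cyclic for all nontrivial powers of [zM7] and for the powers of [zM6]
    other than 0 and 3; a reflection has no cyclic vector. *)
Definition ze1 : zvec := [:: z0; zi 1; zi 1].
Definition krylov (X : zmat) : ZO := mdet (mcols ze1 (mvec X ze1) (mvec X (mvec X ze1))).

Lemma krylov_det X : \det (cols (eV ze1) (eM X *m eV ze1) (eM X *m (eM X *m eV ze1))) = zc (krylov X).
Proof. by rewrite -!eM_vec cols_eM eM_det. Qed.

Lemma krylov_reflects X (w : 'cV[C]_3) : uni (eM X) -> 0 < herm w w -> reflects_in (piU (eM X)) (mirror w) -> krylov X = z0.
Proof.
move=> Xu wpos /(reflects_det0 Xu wpos)/(_ (eV ze1)); rewrite krylov_det -(zc0 R); exact: zc_inj.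
Qed.

Lemma krylov_pow7 : all (fun j => zeq (krylov (mpow zM7 j)) z0 ==> (j == 0%N)) (iota 0 7).
Proof. by vm_compute. Qed.

Lemma krylov_pow6 : all (fun j => zeq (krylov (mpow zM6 j)) z0 ==> (j == 0%N) || (j == 3%N)) (iota 0 6).
Proof. by vm_compute. Qed.

Local Opaque krylov mpow.

Lemma generated_set0 : generated (set0 : set (PU R)) = [set 1%g].
Proof.
apply/seteqP; split=> [|g ->]; last exact: (generated_subgroup _).1.
apply: generated_sub; last by move=> g [].
by split=> // g h -> ->; rewrite invg1 mulg1.
Qed.

Lemma generated_involution (s : PU R) : (s * s)%g = 1%g -> generated [set s] = [set 1%g; s].
Proof.
move=> s2; have sV : s^-1%g = s by rewrite -[RHS](mulKg s) s2 mulg1.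
apply/seteqP; split=> [|g [->|->]]; [|exact: (generated_subgroup _).1|exact: sub_generated].
apply: generated_sub; last by move=> g ->; right.
split=> [|g h [->|->] [->|->]]; first by left.
- by rewrite invg1 mulg1; left.
- by rewrite mul1g sV; right.
- by rewrite invg1 mulg1; right.
- by rewrite mulgV; left.
Qed.

Lemma isotropy_group7 (x : H2 R) v (k : C) : is_line_of x v -> eM zM7 *m v = k *: v -> p7 k = 0 ->
  [/\ (isotropy 7 x #= `I_7)%card, isotropy 7 x = generated [set piU (eM zM7)] &
      reflection_subgroup (isotropy 7 x) = [set 1%g]].
Proof.
move=> xv Mv pk; have xneg := line_neg xv; have prim := root7_prim pk.
have Mu := uni_M7 R; have MO := @Omx_eM R zM7; have Md := det_M7 R.
have iso := isotropy7 xneg Mv pk.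
split; [exact: (cyclic_card xv Mv prim Mu MO Md iso)|exact: (cyclic_generated xv Mv Mu MO iso)|].
rewrite -generated_set0 /reflection_subgroup; congr generated; apply/seteqP; split=> // g [].
move=> /(isotropy_cyclic xv Mv Mu MO iso)[j j7 ->]; rewrite -eM_pow => -[m [w [wpos ->]] rw].
have ju : uni (eM (mpow zM7 j)) by rewrite eM_pow; exact: uni_exp.
have /implyP h := all_iota0 krylov_pow7 j7; have /eqP j0 := h (introT (zeqP _ _) (krylov_reflects ju wpos rw)).
by case: rw; rewrite j0 eM_one piU_one => /(_ erefl).
Qed.

(** As matrices the two sides are opposite; the sign disappears in PU(J). *)
Lemma M6_cube : piU (eM zM6 ^+ 3) = refl (eV zw6).
Proof.
have nw : zherm zw6 zw6 = zi (polar_norm true) by vm_compute.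
rewrite refl_piU (refl_mx_eM R nw) -eM_pow.
have -> : eM (mpow zM6 3) = - eM (zrefl (polar_coef true) zw6).
  rewrite -scaleN1r (_ : -1 = zc (zi (-1))) -?eM_scale; last by rewrite zc_int.
  by apply/(@meqP R); vm_compute.
by apply: uniN; rewrite -(refl_mx_eM R nw); exact: refl_mx_uni.
Qed.

Lemma isotropy_group6 (x : H2 R) v (k : C) : is_line_of x v -> eM zM6 *m v = k *: v -> k ^+ 2 - k + 1 = 0 ->
  [/\ (isotropy 7 x #= `I_6)%card, isotropy 7 x = generated [set piU (eM zM6)],
      (reflection_subgroup (isotropy 7 x) #= `I_2)%card,
      reflection_subgroup (isotropy 7 x) = generated [set refl (eV zw6)] &
      mirror_numbers (isotropy 7 x) 1 0].
Proof.
move=> xv Mv pk; have xneg := line_neg xv; have prim := root6_prim pk.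
have Mu := uni_M6 R; have MO := @Omx_eM R zM6; have Md := det_M6 R.
have iso := isotropy6 xneg Mv pk.
have wpos : 0 < herm (eV zw6) (eV zw6) by rewrite herm_w6 ltr01.
have wx := w6_perp Mv pk.
have refl_only w j : (j < 6)%N -> 0 < herm w w -> reflects_in (piU (eM zM6 ^+ j)) (mirror w) -> j = 3%N.
  move=> j6 wp rw; have ju : uni (eM (mpow zM6 j)) by rewrite eM_pow; exact: uni_exp.
  rewrite -eM_pow in rw; have /implyP h := all_iota0 krylov_pow6 j6.
  case/orP: (h (introT (zeqP _ _) (krylov_reflects ju wp rw))) => /eqP j0; last exact: j0.
  by case: rw; rewrite j0 eM_one piU_one => /(_ erefl).
have isoR : isotropy 7 x (refl (eV zw6)) by rewrite -M6_cube; exact: (isotropy_power xv Mv Mu MO).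
have cR : creflection (refl (eV zw6)) by exists (mirror (eV zw6)); [exists (eV zw6)|exact: refl_reflects].
have RG : reflection_subgroup (isotropy 7 x) = generated [set refl (eV zw6)].
  rewrite /reflection_subgroup; congr generated; apply/seteqP; split=> [g []|g ->]; last by split.
  move=> /(isotropy_cyclic xv Mv Mu MO iso)[j j6 ->] [m [w [wp ->]] rw].
  by rewrite (refl_only w j j6 wp rw) M6_cube.
split; [exact: (cyclic_card xv Mv prim Mu MO Md iso)|exact: (cyclic_generated xv Mv Mu MO iso)| |exact: RG|].
- have s2 : (refl (eV zw6) * refl (eV zw6))%g = 1%g.
    by rewrite refl_piU -(piU_mul (refl_mx_uni _) (refl_mx_uni _)) refl_mxK piU_one.
  rewrite RG (generated_involution s2).
  have -> : [set 1%g; refl (eV zw6)] = (fun i => if i == 0%N then 1%g else refl (eV zw6)) @` `I_2.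
    apply/seteqP; split=> [g [->|->]|g [[|[|i]] //= _ <-]]; by [exists 0%N|exists 1%N|left|right].
  have ne := refl_mx_neq1 wpos.
  apply: inj_card_eq => -[|[|i]] [|[|j]]; rewrite !inE //= => _ _ e; by case: ne.
apply: (@mirror_numbers_count R _ [:: polar6]) => // m; split=> [[[w [wp ->]] [g gG rw]]|[[|i] [//= _ ->]]].
  exists 0%N; split; first exact: isT.
  move: gG rw => /(isotropy_cyclic xv Mv Mu MO iso)[j j6 ->] rw.
  have j3 := refl_only w j j6 wp rw; rewrite j3 M6_cube refl_piU in rw.
  have e : refl_mx (eV zw6) = refl_mx w.
    apply: (reflects_refl_mx (refl_mx_uni _) _ xneg _ wp rw).
      have nw : zherm zw6 zw6 = zi (polar_norm true) by vm_compute.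
      by rewrite (refl_mx_eM R nw); exact: Omx_eM.
    by apply: refl_mx_perp; rewrite hermCC wx conjC0.
  exact: esym (refl_mx_mirror wpos e).
split; first by exists (eV zw6).
by exists (refl (eV zw6)); [exact: isoR|exact: refl_reflects].
Qed.
End SixSeven.

(** * Distinct orbits *)

Section Orbits.
Variable R : realType.
Local Notation C := R[i].
Local Notation O := (isO R).
Local Notation Re := complex.Re.
Local Notation t := (tau R).
Local Notation eV := (eV R).
Local Notation eM := (eM R).
Local Notation zc := (zc R).
Implicit Types (A B M : 'M[C]_3) (u v w z : 'cV[C]_3).

Lemma in_orbit_sym v w : in_orbit v w -> in_orbit w v.
Proof.
move=> [P [c [Pu PO c0 ->]]]; exists (uinv P), c^-1; split.
- exact: uni_inv.
- exact: Omx_uinv.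
- by rewrite invr_eq0.
by rewrite -scalemxAr scalerA mulVf // scale1r mulmxA uinvK // mul1mx.
Qed.

Lemma in_orbit_trans u v w : in_orbit u v -> in_orbit v w -> in_orbit u w.
Proof.
move=> [P [c [Pu PO c0 vE]]] [Q [d [Qu QO d0 ->]]]; exists (Q *m P), (d * c); split.
- exact: uni_mul.
- exact: Omx_mul.
- by rewrite mulf_neq0.
by rewrite vE -scalemxAr scalerA mulmxA.
Qed.

Lemma Gorbit_in_orbit (x y : H2 R) v w : is_line_of x v -> is_line_of y w -> Gorbit 7 x y <-> in_orbit v w.
Proof.
move=> xv yw; split=> [[g /GammaP[A [Au AO ->]] e]|[P [c [Pu PO c0 e]]]].
  by have [c c0 cE] := (line_eq yw (act_line xv Au)).1 e; exists A, c.
exists (piU P); first by apply/GammaP; exists P.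
by apply/(line_eq yw (act_line xv Pu)); exists c.
Qed.

(* y and y' witness that p and p' are primitive vectors *)
Lemma primitive_orbit p y p' y' : zherm y p = zi 1 -> zherm y' p' = zi 1 -> in_orbit (eV p) (eV p') ->
  exists P, [/\ uni P, Omx P & P *m eV p = eV p'].
Proof.
move=> yp yp' orb.
have coef (q z q' : zvec) : zherm z q' = zi 1 -> forall P (c : C), Omx P -> eV q' = c *: (P *m eV q) -> exists2 b : C, b \in O & c * b = 1.
  move=> zq P c PO e; exists (herm (P *m eV q) (eV z)).
    exact: (herm_O (Omx_mul PO (@eV_O R q : Omx _)) (@eV_O R z : Omx _)).
  by rewrite -hermZl -e hermCC herm_eV zq zc1 conjC1.
have [P [c [Pu PO c0 e]]] := orb; have [b bO cb] := coef p y' p' yp' P c PO e.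
have e' : eV p = c^-1 *: (uinv P *m eV p').
  by rewrite e -scalemxAr mulmxA uinvK // mul1mx scalerA mulVf // scale1r.
have [b' b'O cb'] := coef p' y p yp (uinv P) c^-1 (Omx_uinv PO) e'.
have cE : c = b' by rewrite -[LHS]mulr1 -cb' mulrA divff // mul1r.
have b0 : b != 0 by apply/eqP => b0; move/eqP: cb; rewrite b0 mulr0 eq_sym oner_eq0.
have n1 : nsq c = 1.
  have h : nsq c * nsq b = 1 by rewrite -nsqM cb nsq1.
  have g1 := nsqO_ge1 bO b0; have g2 : 1 <= nsq c by apply: nsqO_ge1 => //; rewrite cE.
  apply/eqP; rewrite eq_le g2 andbT -h; apply: ler_peMr => //; exact: nsq_ge0.
have cO : c \in O by rewrite cE.
case: (unit_O cO n1) => c1.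
  by exists P; split=> //; rewrite e c1 scale1r.
by exists (- P); split; [exact: uni_opp|exact: Omx_opp|rewrite e c1 scaleN1r mulNmx].
Qed.

Lemma primitive_norm p y p' y' : zherm y p = zi 1 -> zherm y' p' = zi 1 -> in_orbit (eV p) (eV p') ->
  zherm p p = zherm p' p'.
Proof.
move=> yp yp' /(primitive_orbit yp yp')[P [Pu _ e]]; apply: (@zc_inj R).
by rewrite -!herm_eV -e uni_herm.
Qed.

Lemma rational_irrational n (k : C) M x p : Omx M -> M *m x = k *: x -> n.-primitive_root k -> ~~ (n %| 2)%N ->
  eV p != 0 -> ~ in_orbit x (eV p).
Proof.
move=> MO Mx pk n2 p0 [P [c [Pu PO c0 e]]].
apply: (irrational_line MO Mx pk n2 (Omx_mul (Omx_uinv PO) (@eV_O R p : Omx (eV p))) _ (c := c)).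
  apply/eqP => h; move/eqP: p0; apply; rewrite -[eV p]mul1mx -(uinvKr Pu) -mulmxA h mulmx0 //.
by rewrite e -scalemxAr mulmxA uinvK // mul1mx.
Qed.

(** An isometry carrying one line to the other would turn the integral vector [zw6], orthogonal to
    x6, into a nonzero integral vector orthogonal to x7. *)
Lemma orbit6_7 x6 x7 (k6 k7 : C) : herm x6 x6 < 0 -> herm x7 x7 < 0 -> eM zM6 *m x6 = k6 *: x6 -> k6 ^+ 2 - k6 + 1 = 0 ->
  eM zM7 *m x7 = k7 *: x7 -> p7 k7 = 0 -> ~ in_orbit x7 x6.
Proof.
move=> n6 n7 M6x p6 M7x pk [P [c [Pu PO c0 e]]].
have w6x := w6_perp M6x p6.
have := int_perp7 n7 M7x pk (Omx_mul (Omx_uinv PO) (@eV_O R zw6 : Omx _)).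
have -> : herm (uinv P *m eV zw6) x7 = 0.
  have : herm (eV zw6) (c *: (P *m x7)) = 0 by rewrite -e.
  rewrite hermZr => /eqP; rewrite mulf_eq0 conjC_eq0 (negPf c0) /= => /eqP h.
  by rewrite -(uni_herm (uinv P *m eV zw6) x7 Pu) mulmxA uinvKr // mul1mx.
move=> /(_ erefl) h; have : herm (eV zw6) (eV zw6) = 0 by rewrite -(uni_herm (eV zw6) (eV zw6) (uni_inv Pu)) h herm0l.
by rewrite herm_w6 => /eqP; rewrite oner_eq0.
Qed.

Definition rat_points : seq zvec := [:: vp1; vp2; vp3; vp4; vp5].
Definition rat_duals : seq zvec := [:: ref1.1.1; ref2.1.1; ref3.1.1; ref4.1.1; ref5.1.1].

Lemma rat_duals_check : all (fun i => zeq (zherm (nth [::] rat_duals i) (nth [::] rat_points i)) (zi 1)) (iota 0 5).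
Proof. by vm_compute. Qed.

(* The norms leave only two pairs of points to distinguish. *)
Lemma rat_norms_check : all (fun i => all (fun j =>
  zeq (zherm (nth [::] rat_points i) (nth [::] rat_points i)) (zherm (nth [::] rat_points j) (nth [::] rat_points j))
  ==> (i == j) || ((i, j) \in [:: (0, 4); (1, 2)]%N) || ((j, i) \in [:: (0, 4); (1, 2)]%N)) (iota 0 5)) (iota 0 5).
Proof. by vm_compute. Qed.

(** With an empty list of candidates, the check certifies that no integral isometry maps one vector
    to the other. *)
Lemma transporter_check15 : transporter_check vp1 ref1.1.2 ref1.2 vp5 ref5.1.1 ref5.1.2 ref5.2 [::].
Proof. by vm_compute. Qed.

Lemma transporter_check23 : transporter_check vp2 ref2.1.2 ref2.2 vp3 ref3.1.1 ref3.1.2 ref3.2 [::].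
Proof. by vm_compute. Qed.

(** Orbit equivalence of primitive vectors is realised by an isometry between the vectors
    themselves. The norm therefore separates all but two pairs, which are settled by the empty
    transporters. *)
Lemma rational_orbits_distinct i j : (i < 5)%N -> (j < 5)%N ->
  in_orbit (eV (nth [::] rat_points i)) (eV (nth [::] rat_points j)) -> i = j.
Proof.
move=> i5 j5 orb.
have dual l : (l < 5)%N -> zherm (nth [::] rat_duals l) (nth [::] rat_points l) = zi 1.
  by move=> l5; apply/zeqP; exact: (all_iota0 rat_duals_check l5).
have di := dual i i5; have dj := dual j j5.
have excl : forall a b, (a < 5)%N -> (b < 5)%N -> (a, b) \in [:: (0, 4); (1, 2)]%N ->
    ~ in_orbit (eV (nth [::] rat_points a)) (eV (nth [::] rat_points b)).
  move=> a b a5 b5 ab /(primitive_orbit (dual a a5) (dual b b5))[P [Pu PO]].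
  move: ab; rewrite !inE => /orP[] /eqP[-> ->] e.
    by have [X] := transporter_complete transporter_check15 Pu PO e.
  by have [X] := transporter_complete transporter_check23 Pu PO e.
have /implyP h := all_iota0 (all_iota0 rat_norms_check i5) j5.
have /orP[/orP[/eqP //|ij]|ji] := h (introT (zeqP _ _) (primitive_norm di dj orb)).
  by case: (excl i j i5 j5 ij orb).
by case: (excl j i j5 i5 ji (in_orbit_sym orb)).
Qed.

End Orbits.

(** * Assembly of the classification *)

Section Classification.
Variable R : realType.
Local Notation C := R[i].
Local Notation t := (tau R).
Local Notation eV := (eV R).
Local Notation eM := (eM R).
Local Notation zc := (zc R).

Section Points.
Variables (x6 x7 : 'cV[C]_3) (k6 k7 : C).
Hypotheses (n6 : herm x6 x6 < 0) (n7 : herm x7 x7 < 0).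
Hypotheses (Mx6 : eM zM6 *m x6 = k6 *: x6) (pk6 : k6 ^+ 2 - k6 + 1 = 0).
Hypotheses (Mx7 : eM zM7 *m x7 = k7 *: x7) (pk7 : p7 k7 = 0).

Definition point_vectors : seq 'cV[C]_3 := [seq eV p | p <- rat_points] ++ [:: x6; x7].
Local Notation pv := (nth 0 point_vectors).

Lemma point_rat i : (i < 5)%N -> pv i = eV (nth [::] rat_points i).
Proof. by move=> i5; rewrite nth_cat size_map i5 (nth_map [::]). Qed.

Lemma point_cases i : (i < 7)%N -> [\/ (i < 5)%N, i = 5%N | i = 6%N].
Proof. by move=> i7; have [lt|] := ltnP i 5; [constructor 1|case: i i7 => [|[|[|[|[|[|[|i]]]]]]] //; [constructor 2|constructor 3]]. Qed.

Lemma rat_points_neg i : (i < 5)%N -> herm (eV (nth [::] rat_points i)) (eV (nth [::] rat_points i)) < 0.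
Proof.
have h : all (fun i => let z := zherm (nth [::] rat_points i) (nth [::] rat_points i) in zeq z (zi z.1) && zlt z.1 BinNums.Z0) (iota 0 5).
  by vm_compute.
move=> i5; have /andP[/zeqP e /BinInt.Z.ltb_lt lt] := all_iota0 h i5.
rewrite herm_eV e zc_int ltrz0; move: lt; set z := (zherm _ _).1; lia.
Qed.

Lemma point_neg i : (i < 7)%N -> herm (pv i) (pv i) < 0.
Proof.
case/point_cases => [i5|->|->]; [|exact: n6|exact: n7].
by rewrite point_rat //; exact: rat_points_neg.
Qed.

Lemma point_orbits_distinct i j : (i < 7)%N -> (j < 7)%N -> in_orbit (pv i) (pv j) -> i = j.
Proof.
have no6 a : (a < 5)%N -> ~ in_orbit x6 (eV (nth [::] rat_points a)).
  move=> a5; apply: (rational_irrational (@Omx_eM R zM6) Mx6 (root6_prim pk6) (isT : ~~ (6 %| 2)%N)).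
  exact: herm_neg_neq0 (rat_points_neg a5).
have no7 a : (a < 5)%N -> ~ in_orbit x7 (eV (nth [::] rat_points a)).
  move=> a5; apply: (rational_irrational (@Omx_eM R zM7) Mx7 (root7_prim pk7) (isT : ~~ (7 %| 2)%N)).
  exact: herm_neg_neq0 (rat_points_neg a5).
have no67 : ~ in_orbit x7 x6 := orbit6_7 n6 n7 Mx6 pk6 Mx7 pk7.
have e5 : pv 5 = x6 by []. have e6 : pv 6 = x7 by [].
case/point_cases => [i5|->|->]; case/point_cases => [j5|->|->]; rewrite ?e5 ?e6 ?(point_rat i5) ?(point_rat j5).
- exact: rational_orbits_distinct.
- by move/in_orbit_sym/(no6 i i5).
- by move/in_orbit_sym/(no7 i i5).
- by move/(no6 j j5).
- by [].
- by move/in_orbit_sym/no67.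
- by move/(no7 j j5).
- by move/no67.
- by [].
Qed.

Lemma isolated_point_orbit (x : H2 R) v : is_line_of x v -> isolated (fixed_points (isotropy 7 x)) x ->
  exists2 i, (i < 7)%N & in_orbit (pv i) v.
Proof.
move=> xv /(isolated_regular xv)[A [l reg]]; have vneg := line_neg xv.
have g6 : eM (mmul zM6 zM6) *m x6 = (k6 * k6) *: x6 by rewrite eM_mul -mulmxA Mx6 -scalemxAr Mx6 scalerA.
have g7 : eM zM7_4 *m x7 = (k7 ^+ 4) *: x7 by rewrite eM_pow; exact: expmx_eig.
case: (regular_cases n6 g6 vneg reg) => [[p pI orb]|orb|[B [k [regB trB]]]].
- have [i i5 pE] := nthP [::] pI; exists i; first exact: ltn_trans i5 _.
  by rewrite point_rat // pE.
- by exists 5%N.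
by exists 6%N => //; exact: order7_orbit vneg regB trB n7 g7.
Qed.

End Points.

Lemma isqrt7_tau : isqrt R 7 = 2 * t - 1.
Proof. by rewrite /tau mulrC divfK ?pnatr_eq0 // addrC addKr. Qed.

Ltac solve_zc := rewrite ?isqrt7_tau ?conj_tau zcE /= /BinPos.Pos.to_nat /=; ring.

Lemma mat3_M6 : mat3 [:: [:: -2; t - 2; 1 + 2 * isqrt R 7]; [:: t - 1; t + 1; 3]; [:: t; 1; 3 - t]] = eM zM6.
Proof.
apply/matrixP => i j; rewrite !mxE.
by move: i j; apply: ord3P; apply: ord3P; solve_zc.
Qed.

Lemma mat3_M7 : mat3 [:: [:: -2 - t; t - 3; 3 * t - 2]; [:: -1; 0; - t^*%R]; [:: - t^*%R; t; 2]] = eM zM7.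
Proof.
apply/matrixP => i j; rewrite !mxE.
by move: i j; apply: ord3P; apply: ord3P; solve_zc.
Qed.

Lemma vec3_p1 : vec3 1 0 (-1) = eV vp1. Proof. by apply: vec3_eV; solve_zc. Qed.
Lemma vec3_p2 : vec3 (3 + isqrt R 7) 1 t^*%R = eV vp2. Proof. by apply: vec3_eV; solve_zc. Qed.
Lemma vec3_p3 : vec3 (-1 - t) (- t^*%R) t = eV vp3. Proof. by apply: vec3_eV; solve_zc. Qed.
Lemma vec3_p4 : vec3 t^*%R 0 (-1) = eV vp4. Proof. by apply: vec3_eV; solve_zc. Qed.
Lemma vec3_p5 : vec3 4 t^*%R (- t) = eV vp5. Proof. by apply: vec3_eV; solve_zc. Qed.
Lemma vec3_w2 : vec3 1 (- t) 0 = eV [:: zi 1; zopp ztau; z0]. Proof. by apply: vec3_eV; solve_zc. Qed.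
Lemma vec3_w25 : vec3 (1 + isqrt R 7) 0 1 = eV [:: zadd ztau ztau; z0; zi 1]. Proof. by apply: vec3_eV; solve_zc. Qed.
Lemma vec3_w3 : vec3 0 t 1 = eV [:: z0; ztau; zi 1]. Proof. by apply: vec3_eV; solve_zc. Qed.
Lemma vec3_w35 : vec3 t t^*%R 0 = eV [:: ztau; ztaub; z0]. Proof. by apply: vec3_eV; solve_zc. Qed.
Lemma vec3_w4 : vec3 t 1 1 = eV [:: ztau; zi 1; zi 1]. Proof. by apply: vec3_eV; solve_zc. Qed.
Lemma vec3_w6 : vec3 (- t^*%R) t 1 = eV zw6. Proof. by apply: vec3_eV; solve_zc. Qed.

End Classification.

Theorem mainTheorem12 (R : realType) :
  let s := isqrt R 7 in
  let t := tau R in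
  let tb := (tau R)^*%R in
  exists (p : nat -> H2 R) (M6 M7 : UJ R),
  [/\ val M6 = mat3 [:: [:: -2; t - 2; 1 + 2 * s];
                        [:: t - 1; t + 1; 3];
                        [:: t; 1; 3 - t]],
      val M7 = mat3 [:: [:: -2 - t; t - 3; 3 * t - 2];
                        [:: -1; 0; - tb];
                        [:: - tb; t; 2]],
      [/\ is_line_of (p 1%N) (vec3 1 0 (-1)),
          is_line_of (p 2%N) (vec3 (3 + s) 1 tb),
          is_line_of (p 3%N) (vec3 (-1 - t) (- tb) t),
          is_line_of (p 4%N) (vec3 tb 0 (-1)) &
          is_line_of (p 5%N) (vec3 4 tb (- t))] /\
      [/\ forall x, act (\pi_(PU R) M6) x = x <-> x = p 6%N &
          forall x, act (\pi_(PU R) M7) x = x <-> x = p 7%N],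
      forall x : H2 R, isolated (fixed_points (isotropy 7 x)) x ->
        exists! k : nat, (1 <= k <= 7)%N /\ Gorbit 7 (p k) x &
      [/\ two_reflection_isotropy (p 1%N)
            (vec3 0 1 0) (vec3 1 0 1) 4 2 1 1,
          two_reflection_isotropy (p 2%N)
            (vec3 1 (- t) 0) (vec3 (1 + s) 0 1) 6 3 0 3,
          two_reflection_isotropy (p 3%N)
            (vec3 0 t 1) (vec3 t tb 0) 6 3 0 3,
          two_reflection_isotropy (p 4%N)
            (vec3 0 1 0) (vec3 t 1 1) 8 4 2 2 &
          two_reflection_isotropy (p 5%N)
            (vec3 (1 + s) 0 1) (vec3 t tb 0) 8 4 0 4] /\
      [/\ let G := isotropy 7 (p 6%N) in
          [/\ (G #= `I_6)%card, G = generated [set \pi_(PU R) M6],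
              (reflection_subgroup G #= `I_2)%card,
              reflection_subgroup G = generated [set refl (vec3 (- tb) t 1)] &
              mirror_numbers G 1 0],
          let G := isotropy 7 (p 7%N) in
          [/\ (G #= `I_7)%card, G = generated [set \pi_(PU R) M7] &
              reflection_subgroup G = [set 1%g]],
          forall v, is_line_of (p 6%N) v -> ~ forall i, Qisqrt 7 (v i 0) &
          forall v, is_line_of (p 7%N) v -> ~ forall i, Qisqrt 7 (v i 0)]].
Proof.
move=> s t tb.
have [x6 [k6 [n6 Mx6 pk6]]] := exists_neg6 R; have [x7 [k7 [n7 Mx7 pk7]]] := exists_neg7 R.
pose pv := point_vectors x6 x7.
have [q0 _] : exists q : H2 R, True by have [q _] := line_exists n6; exists q.
have [q qE] : exists q : seq (H2 R), forall i, (i < 7)%N -> is_line_of (nth q0 q i) (nth 0 pv i).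
  suff h : forall vs : seq 'cV[R[i]]_3, (forall i, (i < size vs)%N -> herm (nth 0 vs i) (nth 0 vs i) < 0) ->
      exists q : seq (H2 R), forall i, (i < size vs)%N -> is_line_of (nth q0 q i) (nth 0 vs i).
    by apply: (h pv) => i i7; exact: point_neg n6 n7 i i7.
  elim=> [|v vs IH] vsneg; first by exists [::].
  have [q vq] := line_exists (vsneg 0%N isT).
  have [qs qsE] := IH (fun i => vsneg i.+1).
  by exists (q :: qs) => -[|i] //= lt; exact: qsE.
(* The points are numbered from 1, the list from 0; the value at 0 is irrelevant to the range
   1..7. *)
pose p k := nth q0 q k.-1.
have l1 : is_line_of (p 1%N) (eV R vp1) := qE 0%N isT.
have l2 : is_line_of (p 2%N) (eV R vp2) := qE 1%N isT.
have l3 : is_line_of (p 3%N) (eV R vp3) := qE 2%N isT.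
have l4 : is_line_of (p 4%N) (eV R vp4) := qE 3%N isT.
have l5 : is_line_of (p 5%N) (eV R vp5) := qE 4%N isT.
have l6 : is_line_of (p 6%N) x6 := qE 5%N isT.
have l7 : is_line_of (p 7%N) x7 := qE 6%N isT.
have u6 : uZ zM6 by vm_compute. have u7 : uZ zM7 by vm_compute.
have pi6 : \pi_(PU R) (MkUJ (uZ_isUJ R u6)) = piU (eM R zM6) := esym (piU_val _).
have pi7 : \pi_(PU R) (MkUJ (uZ_isUJ R u7)) = piU (eM R zM7) := esym (piU_val _).
exists p, (MkUJ (uZ_isUJ R u6)), (MkUJ (uZ_isUJ R u7)).
rewrite pi6 pi7; split.
- exact: esym (mat3_M6 R).
- exact: esym (mat3_M7 R).
- split; first by split; rewrite ?vec3_p1 ?vec3_p2 ?vec3_p3 ?vec3_p4 ?vec3_p5.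
  by split=> x; [exact: (regular_fixed_point x l6 (reg6 Mx6 pk6))|exact: (regular_fixed_point x l7 (reg7 n7 Mx7 pk7))].
- move=> x iso; have [v xv] := line_of x.
  have [i i7 orb] := isolated_point_orbit n6 n7 Mx6 Mx7 xv iso.
  exists i.+1; split; first by split=> //; apply/(Gorbit_in_orbit (qE i i7) xv).
  move=> [|k] [//= k7' /(Gorbit_in_orbit (qE k k7') xv) orb']; congr S.
  apply: (point_orbits_distinct n6 n7 Mx6 pk6 Mx7 pk7 i7 k7').
  exact: in_orbit_trans orb (in_orbit_sym orb').
split.
  rewrite vec3_base1 vec3_base2 vec3_w2 vec3_w25 vec3_w3 vec3_w35 vec3_w4; split.
  - exact: (two_reflection_dihedral (n := 2) l1 isT dihedral_check1).
  - exact: (two_reflection_dihedral (n := 3) l2 isT dihedral_check2).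
  - exact: (two_reflection_dihedral (n := 3) l3 isT dihedral_check3).
  - exact: (two_reflection_dihedral (n := 4) l4 isT dihedral_check4).
  - exact: (two_reflection_dihedral (n := 4) l5 isT dihedral_check5).
split.
- rewrite vec3_w6; exact: (isotropy_group6 l6 Mx6 pk6).
- exact: (isotropy_group7 l7 Mx7 pk7).
- move=> v lv; have v0 := herm_neg_neq0 (line_neg lv).
  have [c _ vE] := (line_eq lv l6).1 erefl.
  exact: (irrational_coord (@Omx_eM R zM6) Mx6 (root6_prim pk6) isT v0 vE).
move=> v lv; have v0 := herm_neg_neq0 (line_neg lv).
have [c _ vE] := (line_eq lv l7).1 erefl.
exact: (irrational_coord (@Omx_eM R zM7) Mx7 (root7_prim pk7) isT v0 vE).
Qed.
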